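(* Consider one of the following two settings. (Minimization) $\mathcal{M}$ is a uniquely geodesic Riemannian manifold with sectional curvature in $[\kappa_{\min},\kappa_{\max}]$, $f$ has a minimizer $z^*$, $z_0$ is an initial point, $R=\mathrm{dist}(z_0,z^* )$, and $f\in\Gamma(\mathcal{X})$ with $\mathcal{X}=\bar B(z^*,5R)\subset\mathcal{M}$. (Min-max) $\mathcal{M},\mathcal{N}$ are two such manifolds, $f$ has a saddle point $z^*$, $z_0$ is an initial point, $R=\mathrm{dist}(z_0,z^* )$, and $f\in\Gamma_{\mathrm{sp}}(\mathcal{X})$ with $\mathcal{X}=\bar B(z^*,5R)\subset\mathcal{M}\times\mathcal{N}$. Let $\eta>0$ and let $(z_t)_{t\ge0}$ be the iterates of the Riemannian inexact proximal point algorithm (RIPPA, defined in the context). Then: 1. (Case $\mu=0$.) $z_t\in\bar B(z^*,\sqrt2R)$ for every $t\ge0$, and for every $\epsilon>0$ the output of RIPPA after $T=O\big(\frac{R^2}{\eta\epsilon}\big)$ iterations, i.e. the uniform geodesic average of $z_1,\dots,z_T$, is an $\epsilon$-minimizer of $f$ (minimization) or an $\epsilon$-saddle point of $f$ (min-max). 2. (Case $\mu>0$.) If $f$ is $\mu$-strongly g-convex (minimization) or $\mu$-strongly g-convex-concave (min-max) in $\bar B(z^*,\sqrt2R)$, then $z_t\in\bar B(z^*,\sqrt2R)$ and $\mathrm{dist}(z_{t+1},z^* )^2\le\frac{1}{1+\eta\mu/2}\mathrm{dist}(z_t,z^* )^2$ for every $t\ge 0$; in particular, for every $\varepsilon_d>0$,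 $\mathrm{dist}(z_T,z^* )^2\le\varepsilon_d$ after $T=O\big((1+\frac1{\mu\eta})\log(\frac{R^2}{\varepsilon_d})\big)$ iterations.
   Context: A space is uniquely geodesic if every two points are connected by one and only one geodesic. $\mathrm{Exp}_z$ is the exponential map, $\mathrm{Exp}_z^{-1}$ its inverse, $\bar B(z,r)$ the closed ball; on $\mathcal{M}\times\mathcal{N}$ the product metric is used, $\mathrm{dist}((x_1,y_1),(x_2,y_2))^2=\mathrm{dist}(x_1,x_2)^2+\mathrm{dist}(y_1,y_2)^2$. A set is g-convex if every two of its points are joined by a geodesic contained in it. For a g-convex $\mathcal{X}\subset\mathcal{M}$, $\Gamma(\mathcal{X})$ is the class of $f:\mathcal{M}\to\mathbb{R}\cup\{+\infty\}$ that are proper, lower semicontinuous and g-convex in $\mathcal{X}$ (convex along every geodesic in $\mathcal{X}$). For a g-convex $\mathcal{X}\subset\mathcal{M}\times\mathcal{N}$, $\Gamma_{\mathrm{sp}}(\mathcal{X})$ is the class of $f:\mathcal{M}\times\mathcal{N}\to\mathbb{R}\cup\{\pm\infty\}$ such that $f(\cdot,y)$ and $-f(x,\cdot)$ are g-convex in $\mathcal{X}$, proper and lower semicontinuous for all $(x,y)\in\mathcal{X}$. $h$ is $\mu$-strongly g-convex in a set $S$ if $h(y)\ge h(x)+\langle v,\mathrm{Exp}_x^{-1}(y)\rangle+\frac\mu2\mathrm{dist}(x,y)^2$ for all $x,y\in S$, $v\in\partial h(x)$; $f$ is $\mu$-strongly g-convex-concave if $f(\cdot,y)$ and $-f(x,\cdot)$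 are $\mu$-strongly g-convex. A saddle point $(x^*,y^* )$ satisfies $f(x^*,y)\le f(x^*,y^* )\le f(x,y^* )$ for all $x\in\mathcal{M},y\in\mathcal{N}$. A point $x$ is an $\epsilon$-minimizer if $f(x)-f(z^* )\le\epsilon$; a point $(x,y)$ is an $\epsilon$-saddle point if $f(x,\tilde y)-f(\tilde x,y)\le\epsilon$ for all $(\tilde x,\tilde y)\in\mathcal{X}$. For $r>0$, $\delta_r=r\sqrt{\kappa_{\max}}\cot(r\sqrt{\kappa_{\max}})$ if $\kappa_{\max}>0$ and $\delta_r=1$ otherwise. Prox: for minimization, $\mathrm{prox}_{\eta f}(\bar z)=\arg\min_{z\in\mathcal{M}}\{f(z)+\frac1{2\eta}\mathrm{dist}(z,\bar z)^2\}$; for min-max with $\bar z=(\bar x,\bar y)$ it is the solution $(x,y)$ of $\min_{x\in\mathcal{M}}\max_{y\in\mathcal{N}}\{f(x,y)+\frac1{2\eta}\mathrm{dist}(x,\bar x)^2-\frac1{2\eta}\mathrm{dist}(y,\bar y)^2\}$ (existence is a standing assumption). RIPPA: given $z_0$, $\eta>0$ and $\mu\ge0$, for $t=0,\dots,T-1$ let $z_{t+1}^*=\mathrm{prox}_{\eta f}(z_t)$ and choose any $z_{t+1}$ such that $$\mathrm{dist}(z_{t+1},z_{t+1}^* )^2\le\tfrac14\mathrm{dist}(z_t,z_{t+1}^* )^2\quad\text{and}\quad\|r_{t+1}\|^2\le\Delta_{t+1}\,\delta_{5R}\,\mathrm{dist}(z_{t+1},z_t)^2,$$ where $r_{t+1}=\eta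 v_{t+1}-\mathrm{Exp}_{z_{t+1}}^{-1}(z_t)$ for some $v_{t+1}\in F(z_{t+1})$, with $F(z)=\partial f(z)$ for minimization and $F(z)=(\partial_xf(x,y),-\partial_yf(x,y))$ for min-max (i.e. subdifferentials of $f(\cdot,y)$ and of $-f(x,\cdot)$), and $\Delta_t=(t+1)^{-2}$ if $\mu=0$, $\Delta_t=\eta\mu/2$ if $\mu>0$. The output is $z_T$ if $\mu>0$, and if $\mu=0$ the uniform geodesic average $\bar z_T$ given by $\bar z_1=z_1$, $\bar z_{t+1}=\mathrm{Exp}_{\bar z_t}\big(\frac1{t+1}\mathrm{Exp}_{\bar z_t}^{-1}(z_{t+1})\big)$. $O(\cdot)$ hides universal constants only.
   Formalization: If κ_max>0, 5R√κ_max<π is assumed (past it δ_{5R} can be huge and the claim fails); in min-max the ε-saddle bound over all of X needs f g-convex-concave on the product of X's projections, otherwise it covers only (x̃,ỹ) with (x,ỹ),(x̃,y) in X. *)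

(* Defs.v *)
From HB Require Import structures.
From mathcomp Require Import all_boot all_order all_algebra.
From mathcomp Require Import all_classical all_reals all_analysis.

Set Implicit Arguments.
Unset Strict Implicit.
Unset Printing Implicit Defensive.

Import Order.TTheory GRing.Theory Num.Theory.
Import numFieldNormedType.Exports.

Local Open Scope classical_set_scope.
Local Open Scope ring_scope.

Section smooth.
Context {R : realType} {n : nat}.

Definition partial (j : 'I_n) (f : 'rV[R]_n -> R) (p : 'rV[R]_n) : R :=
  'D_(delta_mx 0 j) f p.

Fixpoint Ck (k : nat) (U : set 'rV[R]_n) (f : 'rV[R]_n -> R) : Prop :=
  if k is k'.+1 then
    (forall p, U p -> differentiable f p) /\ forall j, Ck k' U (partial j f)
  else forall p, U p -> {for p, continuous f}.

Definition smooth_on (U : set 'rV[R]_n) (f : 'rV[R]_n -> R) : Prop :=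
  forall k, Ck k U f.

End smooth.

(* A chart i identifies the open set [chart_dom i] with the open set
   [chart_img] of R^n, through [coord i] and its inverse [param i]; both are
   unconstrained outside these sets.  Tangent vectors are row vectors: the
   tangent space at x is 'rV_(mdim M), read in the distinguished chart
   [chart_at x] around x. *)
Record riemannian_manifold (R : realType) := RiemannianManifold {
  carrier :> topologicalType ;
  mdim : nat ;
  chart : Type ;
  chart_dom : chart -> set carrier ;
  coord : chart -> carrier -> 'rV[R]_mdim ;
  param : chart -> 'rV[R]_mdim -> carrier ;
  chart_at : carrier -> chart ;
  metric : chart -> 'rV[R]_mdim -> 'M[R]_mdim ;
  _ : hausdorff_space carrier ;
  _ : @second_countable carrier ;
  _ : forall x, chart_dom (chart_at x) x ;
  _ : forall i, open (chart_dom i) ;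
  _ : forall i, open (coord i @` chart_dom i) ;
  _ : forall i x, chart_dom i x -> param i (coord i x) = x ;
  _ : forall i x, chart_dom i x -> {for x, continuous (coord i)} ;
  _ : forall i p, (coord i @` chart_dom i) p -> {for p, continuous (param i)} ;
  _ : forall i j k,
      smooth_on (coord i @` (chart_dom i `&` chart_dom j))
                (fun p => coord j (param i p) 0 k) ;
  _ : forall i a b,
      smooth_on (coord i @` chart_dom i) (fun p => metric i p a b) ;
  _ : forall i p, (coord i @` chart_dom i) p -> (metric i p)^T = metric i p ;
  _ : forall i p, (coord i @` chart_dom i) p ->
      forall v : 'rV[R]_mdim, v != 0 -> 0 < (v *m metric i p *m v^T) 0 0 ;
  _ : forall i j x, chart_dom i x -> chart_dom j x ->
      let J := 'J (fun p => coord j (param i p)) (coord i x) in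
      metric i (coord i x) = J *m metric j (coord j x) *m J^T
}.

Section riemannian.
Context {R : realType} (M : riemannian_manifold R).
Local Notation n := (mdim M).

Definition chart_img (i : chart M) : set 'rV[R]_n := coord i @` chart_dom i.

Definition ginner (x : M) (u v : 'rV[R]_n) : R :=
  (u *m metric (chart_at x) (coord (chart_at x) x) *m v^T) 0 0.

Definition christoffel (i : chart M) (a b k : 'I_n) (p : 'rV[R]_n) : R :=
  2^-1 * \sum_l invmx (metric i p) k l *
    (partial a (fun q => metric i q b l) p
     + partial b (fun q => metric i q a l) p
     - partial l (fun q => metric i q a b) p).

(* R(d_a, d_b) d_c = \sum_l riemann i a b c l d_l,
   with R(X, Y) Z = D_X D_Y Z - D_Y D_X Z - D_[X,Y] Z. *)
Definition riemann (i : chart M) (a b c l : 'I_n) (p : 'rV[R]_n) : R :=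
  partial a (christoffel i b c l) p - partial b (christoffel i a c l) p
  + \sum_m (christoffel i a m l p * christoffel i b c m p
            - christoffel i b m l p * christoffel i a c m p).

(* g(R(u, w) w, u) *)
Definition curv4 (i : chart M) (p u w : 'rV[R]_n) : R :=
  \sum_a \sum_b \sum_c \sum_l \sum_m
    u 0 a * w 0 b * w 0 c * riemann i a b c l p * metric i p l m * u 0 m.

(* Squared area of the parallelogram spanned by u and w: it is non zero if and
   only if u and w are linearly independent. *)
Definition area2 (i : chart M) (p u w : 'rV[R]_n) : R :=
  let g (s t : 'rV[R]_n) := (s *m metric i p *m t^T) 0 0 in
  g u u * g w w - g u w ^+ 2.

Definition sectional (i : chart M) (p u w : 'rV[R]_n) : R :=
  curv4 i p u w / area2 i p u w.

Definition sectional_in (kmin kmax : R) : Prop :=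
  forall (i : chart M) p u w, chart_img i p -> area2 i p u w != 0 ->
    kmin <= sectional i p u w <= kmax.

(* P holds on an open interval containing [0, 1]. *)
Definition around01 (P : R -> Prop) : Prop :=
  forall t : R, 0 <= t <= 1 -> \forall s \near t, P s.

Definition C1_at (c : R -> M) (t : R) : Prop :=
  {for t, continuous c} /\
  forall i, chart_dom i (c t) ->
    (\forall s \near t, derivable (coord i \o c) s 1) /\
    {for t, continuous (derive1 (coord i \o c))}.

Definition geodesic_at (c : R -> M) (t : R) : Prop :=
  {for t, continuous c} /\
  forall i, chart_dom i (c t) ->
    let q := coord i \o c in
    [/\ \forall s \near t, derivable q s 1,
        derivable (derive1 q) t 1 &
        forall k, derive1n 2 q t 0 k
          + \sum_a \sum_b christoffel i a b k (q t) * derive1 q t 0 a * derive1 q t 0 b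
          = 0].

Definition velocity (c : R -> M) (t : R) : 'rV[R]_n :=
  derive1 (coord (chart_at (c t)) \o c) t.

(* Geodesics are affinely parametrized on [0, 1] (constant ones included).  A
   solution of the geodesic equation on [0, 1] always extends a little beyond
   the endpoints, so that asking for the equation on a neighbourhood of [0, 1]
   is no restriction and avoids one-sided derivatives. *)
Definition geodesic (x y : M) (c : R -> M) : Prop :=
  [/\ c 0 = x, c 1 = y & around01 (geodesic_at c)].

Definition uniquely_geodesic : Prop :=
  forall x y : M, (exists c, geodesic x y c) /\
    forall c1 c2, geodesic x y c1 -> geodesic x y c2 ->
      forall t, 0 <= t <= 1 -> c1 t = c2 t.

Definition curve_length (c : R -> M) : R :=
  \int[lebesgue_measure]_(t in `[0%R, 1%R])
    Num.sqrt (ginner (c t) (velocity c t) (velocity c t)).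

(* C^1 curves are allowed to have zero velocity, hence to turn corners: the
   infimum is the same as over piecewise C^1 curves. *)
Definition dist (x y : M) : R :=
  inf [set curve_length c | c in
        [set c | [/\ c 0 = x, c 1 = y & around01 (C1_at c)]]].

Definition exp_graph (x : M) (v : 'rV[R]_n) (y : M) : Prop :=
  exists c, geodesic x y c /\ velocity c 0 = v.

(* Both are total functions, with a dummy value when v is not in the domain of
   the exponential map at x, or y not in its range. *)
Definition Exp (x : M) (v : 'rV[R]_n) : M := xget x [set y | exp_graph x v y].
Definition Exp_inv (x y : M) : 'rV[R]_n := xget 0 [set v | exp_graph x v y].

Definition cball (z : M) (r : R) : set M := [set x | dist x z <= r].

Definition gconvex_set (S : set M) : Prop :=
  forall x y, S x -> S y -> exists2 c, geodesic x y c &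
    forall t, 0 <= t <= 1 -> S (c t).

Definition gconvex_fun (S : set M) (h : M -> \bar R) : Prop :=
  forall x y c, geodesic x y c -> (forall t, 0 <= t <= 1 -> S (c t)) ->
    forall t, 0 <= t <= 1 ->
      (h (c t) <= (1 - t)%:E * h x + t%:E * h y)%E.

Definition proper_in (S : set M) (h : M -> \bar R) : Prop :=
  (forall x, S x -> h x != -oo%E) /\ exists2 x, S x & h x != +oo%E.

Definition closed_gconvex_in (S : set M) (h : M -> \bar R) : Prop :=
  [/\ proper_in S h, lower_semicontinuous (h : subspace S -> \bar R)
    & gconvex_fun S h].

Definition Gamma (X : set M) (f : M -> \bar R) : Prop :=
  [/\ gconvex_set X, forall x, f x != -oo%E & closed_gconvex_in X f].

(* v is a subgradient at x of the restriction of h to X. *)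
Definition subdiff (X : set M) (h : M -> \bar R) (x : M) : set 'rV[R]_n :=
  [set v | forall y, X y -> (h x + (ginner x v (Exp_inv x y))%:E <= h y)%E].

(* Strong g-convexity in S of a function that is g-convex in X. *)
Definition strongly_gconvex (mu : R) (X S : set M) (h : M -> \bar R) : Prop :=
  forall x y v, S x -> S y -> subdiff X h x v ->
    (h x + (ginner x v (Exp_inv x y) + mu / 2 * dist x y ^+ 2)%:E <= h y)%E.

Definition minimizer (f : M -> \bar R) (zs : M) : Prop :=
  forall x, (f zs <= f x)%E.

Definition eps_minimizer (f : M -> \bar R) (zs : M) (eps : R) (x : M) : Prop :=
  (f x - f zs <= eps%:E)%E.

Definition is_prox (eta : R) (f : M -> \bar R) (zbar z : M) : Prop :=
  minimizer (fun w => f w + ((2 * eta)^-1 * dist w zbar ^+ 2)%:E)%E z.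

End riemannian.

(* This comparison constant (of Hessians of squared distances) is meaningful for
   r * sqrt kmax < pi, the first branch of cot. *)
Definition delta {R : realType} (kmax r : R) : R :=
  if 0 < kmax then
    let s := r * Num.sqrt kmax in s * (cos s / sin s)
  else 1.

Definition Delta {R : realType} (eta mu : R) (t : nat) : R :=
  if mu == 0 then (t.+1%:R ^+ 2)^-1 else eta * mu / 2.

Section rippa_min.
Context {R : realType} (M : riemannian_manifold R).

(* z 0, ..., z T are iterates of the algorithm; rad stands for dist(z_0, z^* ). *)
Definition rippa (X : set M) (f : M -> \bar R) (kmax rad eta mu : R)
    (T : nat) (z : nat -> M) : Prop :=
  forall t, (t < T)%N -> exists zs v,
    let r := eta *: v - Exp_inv (z t.+1) (z t) in
    [/\ is_prox eta f (z t) zs,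
        dist (z t.+1) zs ^+ 2 <= 4^-1 * dist (z t) zs ^+ 2,
        subdiff X f (z t.+1) v &
        ginner (z t.+1) r r
          <= Delta eta mu t.+1 * delta kmax (5 * rad) * dist (z t.+1) (z t) ^+ 2].

(* The average of z 1, ..., z T, for T > 0. *)
Fixpoint gavg (z : nat -> M) (T : nat) : M :=
  match T with
  | 0%N => z 0%N
  | 1%N => z 1%N
  | T'.+1 => Exp (gavg z T') (T'.+1%:R^-1 *: Exp_inv (gavg z T') (z T'.+1))
  end.

End rippa_min.

(* Geodesics of the Riemannian product M x N are the pairs of geodesics, its
   tangent spaces are the orthogonal sums of those of M and N, and its
   exponential map acts componentwise. *)
Section minmax.
Context {R : realType} (M N : riemannian_manifold R).
Implicit Types (X S : set (M * N)) (f : M -> N -> \bar R) (z : M * N).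

Definition dist2 (z w : M * N) : R :=
  Num.sqrt (dist z.1 w.1 ^+ 2 + dist z.2 w.2 ^+ 2).

Definition cball2 (z : M * N) (r : R) : set (M * N) :=
  [set w | dist2 w z <= r].

Definition gconvex_set2 X : Prop :=
  forall z w, X z -> X w -> exists c d,
    [/\ geodesic z.1 w.1 c, geodesic z.2 w.2 d &
        forall t, 0 <= t <= 1 -> X (c t, d t)].

(* "In X" means, for f(., y), in the section of X at y, and likewise
   for f(x, .). *)
Definition Gamma_sp X f : Prop :=
  gconvex_set2 X /\
  forall x y, X (x, y) ->
    closed_gconvex_in (ysection X y) (f ^~ y) /\
    closed_gconvex_in (xsection X x) (fun w => - f x w)%E.

(* The product of the projections of X on M and N. *)
Definition box X : set (M * N) := (fst @` X) `*` (snd @` X).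

Definition strongly_gconvex_concave (mu : R) X S f : Prop :=
  forall x y, S (x, y) ->
    strongly_gconvex mu (ysection X y) (ysection S y) (f ^~ y) /\
    strongly_gconvex mu (xsection X x) (xsection S x) (fun w => - f x w)%E.

Definition saddle_point f z : Prop :=
  forall x y, (f z.1 y <= f z.1 z.2)%E /\ (f z.1 z.2 <= f x z.2)%E.

Definition eps_saddle X f (eps : R) z : Prop :=
  forall x y, X (x, y) -> (f z.1 y - f x z.2 <= eps%:E)%E.

(* The same, except that f is only evaluated at points of X: when X is a ball of
   the product, (x, y) and z in X do not force (z.1, y) and (x, z.2) in X. *)
Definition eps_saddle_within X f (eps : R) z : Prop :=
  forall x y, X (x, y) -> X (z.1, y) -> X (x, z.2) ->
    (f z.1 y - f x z.2 <= eps%:E)%E.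

Definition is_prox_sp (eta : R) f (zbar z : M * N) : Prop :=
  saddle_point (fun x y =>
    f x y + ((2 * eta)^-1 * dist x zbar.1 ^+ 2
             - (2 * eta)^-1 * dist y zbar.2 ^+ 2)%:E)%E z.

Definition rippa_sp X f (kmax rad eta mu : R) (T : nat) (z : nat -> M * N) :
    Prop :=
  forall t, (t < T)%N -> exists zs v w,
    let x' := (z t.+1).1 in let y' := (z t.+1).2 in
    let rx := eta *: v - Exp_inv x' (z t).1 in
    let ry := eta *: w - Exp_inv y' (z t).2 in
    [/\ is_prox_sp eta f (z t) zs,
        dist2 (z t.+1) zs ^+ 2 <= 4^-1 * dist2 (z t) zs ^+ 2,
        subdiff (ysection X y') (f ^~ y') x' v,
        subdiff (xsection X x') (fun q => - f x' q)%E y' w &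
        ginner x' rx rx + ginner y' ry ry
          <= Delta eta mu t.+1 * delta kmax (5 * rad)
             * dist2 (z t.+1) (z t) ^+ 2].

Definition gavg2 (z : nat -> M * N) (T : nat) : M * N :=
  (gavg (fst \o z) T, gavg (snd \o z) T).

End minmax.

(* Main.v *)
(* One step from z to z' satisfies, for every reference point u in the ball of radius 5R,
     2 eta (f z' - f u) <= d(u, z)^2 - (1 - Delta) d(u, z')^2   (- eta mu d(u, z')^2).
   This follows from the subgradient inequality at z', Young's inequality for the inexactness r, and
   the hinge inequality
     d(x, u)^2 - 2 <log_x u, log_x z> + delta_{5R} d(x, z)^2 <= d(u, z)^2.
   With u = z^*, and Delta summable, the iterates stay in the ball of radius sqrt 2 R; summing and
   applying Jensen's inequality to the geodesic average gives the rate R^2 / (eta T). In the min-max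
   case the step inequality is summed with u = (x^*, y) for y within R of y^*, and the gap at an
   arbitrary y follows from concavity on the geodesic from y^* to y. If mu > 0 and eta mu > 1, the
   exact proximal point is analysed first, to see that z' is in the ball of strong convexity.

   The hinge inequality is Hessian comparison: the second derivative of d(p, .)^2 / 2 along a geodesic
   is <DJ, J> for a Jacobi field J, and the Riccati equation bounds it below by s cot s as long as
   s = r sqrt kmax < pi, where moreover exp_p is not degenerate. The manifold is not assumed complete,
   so the continuity of log_p, the inverse of an injective smooth map between spaces of the same
   dimension, comes from invariance of domain, itself a consequence of the Poincare-Miranda theorem,
   which is proved by counting mod 2 on a grid. *)

Require Import Defs.
From HB Require Import structures.
From mathcomp Require Import all_boot all_order all_algebra.
From mathcomp Require Import all_classical all_reals all_analysis.
From mathcomp Require Import ring lra.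
Import Order.TTheory GRing.Theory Num.Theory.
Import numFieldNormedType.Exports.
Local Open Scope classical_set_scope.
Local Open Scope ring_scope.
Import Defs.

Set Implicit Arguments.
Unset Strict Implicit.
Unset Printing Implicit Defensive.

(** * Strict differentiability and ordinary differential equations *)

(** The manifold is not complete and [dist] is an infimum over curves, so nothing says a priori that
    the geodesic from x to y realises [dist x y]. The proof works with the length [rr x y] of that
    geodesic, computed from [Exp_inv], and shows [rr = dist] below the conjugate radius of the model
    space, where exp has an invertible differential. Strict differentiability is used throughout:
    Gronwall estimates produce it for flows, and it passes to a continuous inverse at a single
    point.

    Radii are counted in multiples of R. An iterate within sqrt 2 <= 3/2 of z^* has its proximal
    point within 3/2 of itself, and the next iterate within 3/4 of the latter, hence within 15/4 of
    z^*. A hinge triangle whose reference point is within 1 of z^* has two sides adding up to at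
    most 1 + 3/2 + 9/4 = 19/4. Both fit in 5. This is why min-max reference points are restricted to
    distance R; reaching the rest of the ball costs each player a factor 5, and with 5 R^2 / (eta T)
    per player the total is 50 = 2 * 5 * 5. *)

Section basics.
Context {R : realType}.

(** Division-free form of the derivative, which covers s = t as well and suits estimates on sums and
    compositions. *)
Lemma is_derive_epsP (f : R -> R) (t a : R) :
  is_derive t 1 f a <->
  forall e, 0 < e -> exists2 d, 0 < d &
    forall s, `|s - t| < d -> `|f s - f t - a * (s - t)| <= e * `|s - t|.
Proof.
split.
- move=> [df <-] e e0; move/cvgrPdist_le : df => /(_ e e0)[d /= d0 H].
  exists d => // s std; have [->|nst] := eqVneq s t.
    by rewrite !subrr mulr0 subr0 !normr0 mulr0.
  have h0 : s - t != 0 by rewrite subr_eq0.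
  have /= := H (s - t).
  rewrite sub0r normrN => /(_ std h0).
  rewrite /derive [_%:A]mulr1 subrK => H1.
  have E x : f s - f t - x * (s - t) = - (x - (s - t)^-1 * (f s - f t)) * (s - t).
    by field.
  rewrite E normrM normrN ler_wpM2r//.
- move=> H.
  have C : (fun h => h^-1 *: (f (h *: 1 + t) - f t)) @ 0^' --> a.
    apply/cvgrPdist_le => e e0; have [d d0 Hd] := H e e0.
    exists d => // h /=; rewrite sub0r normrN => hd h0.
    have := Hd (h + t); rewrite addrK => /(_ hd) H1.
    rewrite [_%:A]mulr1 -[_ *: _]/(_ * _).
    have -> : a - h^-1 * (f (h + t) - f t) = - (f (h + t) - f t - a * h) / h by field.
    by rewrite normrM normrN normfV ler_pdivrMr ?normr_gt0.
  by split; [apply/cvg_ex; exists a|exact/cvg_lim].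
Qed.

Lemma normv_coord n (v : 'rV[R]_n) k : `|v 0 k| <= `|v|.
Proof.
rewrite [leRHS]/Num.Def.normr/= mx_normrE.
exact: (le_bigmax _ (fun i : 'I_1 * 'I_n => `|v i.1 i.2|) (0, k)).
Qed.

Lemma normv_le n (v : 'rV[R]_n) e : 0 <= e ->
  (forall k, `|v 0 k| <= e) -> `|v| <= e.
Proof.
move=> e0 H; rewrite [leLHS]/Num.Def.normr/= mx_normrE.
by apply: bigmax_le => //= -[i j] _ /=; rewrite (ord1 i).
Qed.

(** A crude upper bound for the operator norm in the sup norm; [normv_mul] is the property that
    matters. *)
Definition opn m k (A : 'M[R]_(m, k)) : R := \sum_j \sum_l `|A j l|.

Lemma opn_ge0 m k (A : 'M[R]_(m, k)) : 0 <= opn A.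
Proof. by apply: sumr_ge0 => j _; exact: sumr_ge0. Qed.

Lemma normv_mul m k (v : 'rV[R]_m) (A : 'M[R]_(m, k)) : `|v *m A| <= opn A * `|v|.
Proof.
apply: normv_le => [|l]; first by rewrite mulr_ge0 ?opn_ge0.
rewrite mxE (le_trans (ler_norm_sum _ _ _))// mulr_suml ler_sum// => j _.
rewrite normrM mulrC ler_pM// ?normv_coord//.
by rewrite (bigD1 l)//= lerDl sumr_ge0.
Qed.

Lemma rV_sum m (v : 'rV[R]_m) : v = \sum_j v 0 j *: delta_mx 0 j.
Proof. exact: row_sum_delta. Qed.

Lemma linear_mx m k (E : 'rV[R]_m -> 'rV[R]_k) :
  (forall a u v, E (a *: u + v) = a *: E u + E v) -> exists A, forall b, b *m A = E b.
Proof.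
move=> lin.
have E0 : E 0 = 0.
  by have := lin (-1) 0 0; rewrite scaler0 addr0 scaleN1r addNr.
exists (\matrix_(j, l) E (delta_mx 0 j) 0 l) => b.
rewrite [in RHS](rV_sum b).
apply/rowP => l; rewrite mxE.
have -> : E (\sum_j b 0 j *: delta_mx 0 j) = \sum_j b 0 j *: E (delta_mx 0 j).
  rewrite (big_morph E (_ : {morph E : u1 u2 / u1 + u2}) E0) => [|u1 u2].
    by apply: eq_bigr => j _; rewrite -[b 0 j *: _]addr0 lin E0 addr0.
  by have := lin 1 u1 u2; rewrite !scale1r.
by rewrite summxE; apply: eq_bigr => j _; rewrite !mxE.
Qed.

(* Strict differentiability; derivatives are matrices acting on row vectors from the right. *)
Definition sdiff m k (f : 'rV[R]_m -> 'rV[R]_k) x (A : 'M[R]_(m, k)) :=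
  forall e, 0 < e -> exists2 d, 0 < d & forall y z, `|y - x| < d -> `|z - x| < d ->
    `|f y - f z - (y - z) *m A| <= e * `|y - z|.

(** The derivative is a bare function [l], which spares the calculus rules any matrix bookkeeping;
    its boundedness, automatic for a matrix, has to be carried along. *)
Definition sdR m (f : 'rV[R]_m -> R) x (l : 'rV[R]_m -> R) :=
  (exists2 C, 0 < C & forall b, `|l b| <= C * `|b|) /\
  forall e, 0 < e -> exists2 d, 0 < d & forall y z, `|y - x| < d -> `|z - x| < d ->
    `|f y - f z - l (y - z)| <= e * `|y - z|.

(** Turns coordinatewise estimates, each with its own radius, into one estimate in the sup norm. *)
Lemma fin_radius (T : finType) (P : T -> R -> Prop) :
  (forall l d d', P l d -> d' <= d -> P l d') ->
  (forall l, exists2 d, 0 < d & P l d) -> exists2 d, 0 < d & forall l, P l d.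
Proof.
move=> mono H.
have /choice[d Hd] : forall l, exists d, 0 < d /\ P l d.
  by move=> l; have [d d0 Pd] := H l; exists d.
exists (\big[Num.min/1]_l d l).
  by elim/big_ind : _ => // [x y x0 y0|l _]; [rewrite lt_min x0|have [] := Hd l].
move=> l; have [_ Pl] := Hd l; apply: (mono _ _ _ Pl).
exact: bigmin_le_cond.
Qed.

Lemma sdiffP m k (f : 'rV[R]_m -> 'rV[R]_k) x A :
  sdiff f x A <-> forall l, sdR (fun y => f y 0 l) x (fun b => (b *m A) 0 l).
Proof.
split=> H.
- move=> l; split.
    exists (opn A + 1) => [|b]; first by rewrite ltr_wpDl ?opn_ge0.
    rewrite (le_trans (normv_coord _ _))// (le_trans (normv_mul _ _))//.
    by rewrite ler_wpM2r// lerDl.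
  move=> e /H[d d0 Hd]; exists d => // y z yd zd.
  by have := Hd y z yd zd; apply: le_trans; rewrite (le_trans _ (normv_coord _ l))// !mxE.
- move=> e e0.
  have [|l|d d0 Hd] := fin_radius (P := fun l d => forall y z, `|y - x| < d -> `|z - x| < d ->
    `|f y 0 l - f z 0 l - ((y - z) *m A) 0 l| <= e * `|y - z|).
  + by move=> l d d' Hd d'd y z yd zd; apply: Hd; exact: lt_le_trans d'd.
  + by have [_ /(_ e e0)] := H l.
  exists d => // y z yd zd.
  apply: normv_le => [|l]; first by rewrite mulr_ge0 ?(ltW e0).
  by have := Hd l y z yd zd; rewrite !mxE.
Qed.

Lemma continuous_epsP (V W : normedModType R) (f : V -> W) x :
  {for x, continuous f} <->
  forall e, 0 < e -> exists2 d, 0 < d & forall y, `|y - x| < d -> `|f y - f x| <= e.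
Proof.
split.
- move=> /cvgrPdist_le H e /H /nbhs_ballP[d /= d0 Hd]; exists d => // y yd.
  by rewrite distrC; apply: Hd; rewrite -ball_normE /= distrC.
- move=> H; apply/cvgrPdist_le => e /H[d d0 Hd]; apply/nbhs_ballP; exists d => // y.
  by rewrite -ball_normE /= distrC => /Hd; rewrite distrC.
Qed.

Definition vder n (c : R -> 'rV[R]_n) (t : R) (a : 'rV[R]_n) :=
  forall k, is_derive t 1 (fun s => c s 0 k) (a 0 k).

Lemma vderP n (c : R -> 'rV[R]_n) t a : vder c t a <-> is_derive t 1 c a.
Proof.
split=> [H|[d dE] k].
- have D : derivable c t 1.
    by apply/derivable_mxP => i j; rewrite (ord1 i); have [] := H j.
  split=> //; rewrite derive_mx//; apply/rowP => k; rewrite mxE.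
  by have [_ ->] := H k.
- split; first by have /derivable_mxP := d; exact.
  by rewrite -dE derive_mx// mxE.
Qed.

Lemma vder_epsP n (c : R -> 'rV[R]_n) t a : vder c t a <->
  forall e, 0 < e -> exists2 d, 0 < d &
    forall s, `|s - t| < d -> `|c s - c t - (s - t) *: a| <= e * `|s - t|.
Proof.
split=> H.
- move=> e e0.
  have [|l|d d0 Hd] := fin_radius (P := fun k d => forall s, `|s - t| < d ->
    `|c s 0 k - c t 0 k - a 0 k * (s - t)| <= e * `|s - t|).
  + by move=> l d d' Hd d'd s sd; apply: Hd; exact: lt_le_trans d'd.
  + by have /is_derive_epsP/(_ e e0) := H l.
  exists d => // s sd; apply: normv_le => [|l]; first by rewrite mulr_ge0 ?(ltW e0).
  by rewrite !mxE [_ * a _ _]mulrC; exact: Hd.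
- move=> k; apply/is_derive_epsP => e /H[d d0 Hd]; exists d => // s /Hd.
  by apply: le_trans; rewrite (le_trans _ (normv_coord _ k))// !mxE mulrC.
Qed.

Lemma vder_continuous n (c : R -> 'rV[R]_n) t a : vder c t a -> {for t, continuous c}.
Proof.
by move=> /vderP[/derivable1_diffP d _]; exact: differentiable_continuous.
Qed.

Lemma is_derive_continuous (f : R -> R) (t a : R) : is_derive t 1 f a -> {for t, continuous f}.
Proof. by move=> [/derivable1_diffP d _]; exact: differentiable_continuous. Qed.

(** With the sup norm, the scalar mean value theorem in each coordinate gives the vector inequality
    without loss in the constant. *)
Lemma vmvt n (c c' : R -> 'rV[R]_n) a b K : a <= b ->
  (forall s, a <= s <= b -> vder c s (c' s)) ->
  (forall s, a <= s <= b -> `|c' s| <= K) -> `|c b - c a| <= K * (b - a).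
Proof.
move=> ab H HK.
have K0 : 0 <= K by apply: le_trans (HK a _); rewrite ?lexx.
apply: normv_le => [|k]; first by rewrite mulr_ge0// subr_ge0.
have [x xab|x|s] := @MVT_segment _ (fun s => c s 0 k) (fun s => c' s 0 k) a b ab.
- by move: xab; rewrite in_itv/= => /andP[ax xb]; apply: H; rewrite !ltW.
- apply: derivable_within_continuous => s; rewrite in_itv/= => sab.
  by have [] := H s sab k.
- rewrite in_itv/= => sab E; rewrite !mxE E normrM [`|b - a|]ger0_norm ?subr_ge0//.
  by rewrite ler_wpM2r ?subr_ge0// (le_trans (normv_coord _ _))// HK.
Qed.

Lemma vder_sub n (c d : R -> 'rV[R]_n) t a b :
  vder c t a -> vder d t b -> vder (fun s => c s - d s) t (a - b).
Proof.
move=> cd dd k; rewrite (_ : (fun s => _) = (fun s => c s 0 k) - (fun s => d s 0 k)).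
  by rewrite !mxE; exact: is_deriveB.
by apply/funext => s; rewrite !mxE.
Qed.

Lemma vderN n (c : R -> 'rV[R]_n) t a :
  vder c t a -> vder (fun s => c (- s)) (- t) (- a).
Proof.
move=> /vder_epsP H; apply/vder_epsP => e /H[d d0 Hd]; exists d => // s sd.
have E : - s - t = - (s - - t) by ring.
have := Hd (- s); rewrite opprK E normrN => /(_ sd).
by rewrite scalerN scaleNr !opprK.
Qed.

Lemma vmvt0 n (c c' : R -> 'rV[R]_n) h K :
  (forall s, `|s| <= `|h| -> vder c s (c' s)) ->
  (forall s, `|s| <= `|h| -> `|c' s| <= K) -> `|c h - c 0| <= K * `|h|.
Proof.
move=> H HK; have [h0|h0] := leP 0 h.
  rewrite [`|h|]ger0_norm// -{2}[h]subr0; apply: (vmvt (c' := c')) => // s /andP[s0 sh].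
    by apply: H; rewrite !ger0_norm.
  by apply: HK; rewrite !ger0_norm.
have {}h0 := ltW h0.
have := @vmvt _ (fun s => c (- s)) (fun s => - c' (- s)) 0 (- h) K.
rewrite oppr0 opprK oppr_ge0 addr0 ler0_norm//; apply=> // s /andP[s0 sh].
  rewrite -[s in vder _ s]opprK; apply: vderN; apply: H.
  by rewrite normrN (ger0_norm s0) (ler0_norm h0).
rewrite normrN; apply: HK.
by rewrite normrN (ger0_norm s0) (ler0_norm h0).
Qed.

(** On an interval so short that [K * h <= 2^-1] the exponential can be avoided: at a point where
    the norm of c is maximal, the mean value inequality bounds the maximum by its initial value plus
    [h * eps] plus half of itself. *)
Lemma gronwall n (c c' : R -> 'rV[R]_n) h K eps : 0 <= h -> 0 <= K -> 0 <= eps ->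
  K * h <= 2^-1 ->
  (forall s, `|s| <= h -> vder c s (c' s)) ->
  (forall s, `|s| <= h -> `|c' s| <= K * `|c s| + eps) ->
  forall s, `|s| <= h -> `|c s| <= 2 * `|c 0| + 2 * h * eps.
Proof.
move=> h0 K0 e0 Kh H HK s sh.
have hh : - h <= h by rewrite (le_trans _ h0)// oppr_le0.
have [|m + mmax] := @EVT_max R (fun s => `|c s|) (- h) h hh.
  apply/continuous_in_subspaceT => x; rewrite inE/= in_itv/= -ler_norml => /H /vder_continuous cx.
  by apply: continuous_comp => //; exact: norm_continuous.
rewrite in_itv/= -ler_norml => mh.
have M : `|c m - c 0| <= (K * `|c m| + eps) * `|m|.
  apply: (vmvt0 (c' := c')) => x xm; first by apply: H; exact: le_trans mh.
  have xh : `|x| <= h by exact: le_trans mh.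
  rewrite (le_trans (HK _ xh))// lerD2r ler_wpM2l// mmax//.
  by rewrite in_itv/= -ler_norml.
have : `|c m| <= `|c 0| + (K * `|c m| + eps) * h.
  rewrite -[c m in leLHS](subrK (c 0)) addrC (le_trans (ler_normD _ _))// lerD2l.
  rewrite (le_trans M)// ler_wpM2l//; rewrite addr_ge0// mulr_ge0//.
have : K * `|c m| * h <= 2^-1 * `|c m| by rewrite mulrAC ler_wpM2r.
have : `|c s| <= `|c m| by apply: mmax; rewrite in_itv/= -ler_norml.
set x := `|c s|; set y := `|c m|; set z := `|c 0|.
by move=> ? ? ?; nra.
Qed.

End basics.

(** * Existence for ordinary differential equations by Picard iteration *)

Section picard.
Context {R : realType}.

Lemma continuous_primitive (f : R -> R) : continuous f ->
  exists F : R -> R, forall t : R, `|t| < 1 -> is_derive t 1 F (f t).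
Proof.
move=> cf.
exists (fun x => (\int[lebesgue_measure]_(t in `[-1, x]) f t)%R) => t.
rewrite ltr_norml => /andP[t1 t2].
have := @continuous_FTC1_closed R f (-1) t 1 t2 _ t1 (cf t).
case=> [|d E].
  apply: continuous_compact_integrable; first exact: segment_compact.
  exact: continuous_subspaceT.
by apply: DeriveDef; [exact: d|rewrite -derive1E; exact: E].
Qed.

(** For h >= 0, the retraction of the line onto [-h, h]: it extends data known on an interval to the
    whole line, where global continuity and Lipschitz hypotheses make sense. *)
Definition clamp (h x : R) : R := Num.max (- h) (Num.min h x).

Lemma clamp_id h x : `|x| <= h -> clamp h x = x.
Proof. by rewrite ler_norml /clamp => /andP[a b]; rewrite min_r// max_r. Qed.

Lemma clamp_le h x : 0 <= h -> `|clamp h x| <= h.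
Proof.
move=> h0; rewrite ler_norml /clamp le_max lexx/= ge_max ge_min lexx/= andbT.
by rewrite (le_trans _ h0)// oppr_le0.
Qed.

Lemma clamp_lip h x y : `|clamp h x - clamp h y| <= `|x - y|.
Proof.
rewrite /clamp /Num.max /Num.min.
have h1 := ler_norm (x - y); have := ler_norm (y - x); rewrite distrC => h2.
by repeat case: ifPn; rewrite -?leNgt => *; rewrite ler_norml; apply/andP; split; lra.
Qed.

Lemma lip_continuous (V W : normedModType R) (f : V -> W) K :
  (forall x y, `|f x - f y| <= K * `|x - y|) -> continuous f.
Proof.
move=> H x; apply/continuous_epsP => e e0.
have K0 : 0 < `|K| + 1 by rewrite ltr_wpDl.
exists (e / (`|K| + 1)) => [|y]; first by rewrite divr_gt0.
rewrite ltr_pdivlMr// => /ltW; apply: le_trans; rewrite (le_trans (H _ _))//.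
by rewrite mulrC ler_wpM2l// (le_trans (ler_norm K))// lerDl.
Qed.

Lemma clamp_continuous h : continuous (clamp h).
Proof. by apply: (@lip_continuous _ _ _ 1) => x y; rewrite mul1r clamp_lip. Qed.

Lemma rowv_continuous n (V : normedModType R) (f : V -> 'rV[R]_n) x :
  (forall k, {for x, continuous (fun y => f y 0 k)}) -> {for x, continuous f}.
Proof.
move=> H; apply/continuous_epsP => e e0.
have [|l|d d0 Hd] := fin_radius (P := fun k d => forall y, `|y - x| < d -> `|f y 0 k - f x 0 k| <= e).
- by move=> l d d' Hd d'd s sd; apply: Hd; exact: lt_le_trans d'd.
- by have /continuous_epsP/(_ e e0) := H l.
- exists d => // y /Hd{}Hd; apply: normv_le => [|k]; first exact: ltW.
  by have := Hd k; rewrite !mxE.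
Qed.

Lemma coordv_continuous n (k : 'I_n) : continuous (fun v : 'rV[R]_n => v 0 k).
Proof.
apply: (@lip_continuous _ _ _ 1) => x y; rewrite mul1r.
by rewrite (le_trans _ (normv_coord _ k))// !mxE.
Qed.

(** The intervals of centre [u k] and radius [2 * D / 2 ^+ k] are nested, and the supremum of their
    left endpoints lies in all of them. *)
Lemma nested_limit (u : nat -> R) D : (forall k, `|u k.+1 - u k| <= D / 2 ^+ k) ->
  exists l, forall k, `|u k - l| <= 2 * D / 2 ^+ k.
Proof.
move=> H.
have p2 k : 0 < 2 ^+ k :> R by rewrite exprn_gt0.
have D0 : 0 <= D by have := H 0%N; rewrite expr0 divr1; exact: le_trans.
have E k : 2 * D / 2 ^+ k = D / 2 ^+ k + 2 * D / 2 ^+ k.+1.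
  by rewrite exprS; field; rewrite gt_eqF.
have step k j : u k - 2 * D / 2 ^+ k <= u (j + k)%N - 2 * D / 2 ^+ (j + k) /\
    u (j + k)%N + 2 * D / 2 ^+ (j + k) <= u k + 2 * D / 2 ^+ k.
  elim: j => [|j [i1 i2]]; first by rewrite add0n.
  rewrite addSn; move: (H (j + k)%N) (E (j + k)%N); rewrite ler_norml => /andP[h1 h2] h3.
  by split; lra.
have q k : 0 <= 2 * D / 2 ^+ k by rewrite divr_ge0 ?mulr_ge0// ltW.
have ab k j : u k - 2 * D / 2 ^+ k <= u j + 2 * D / 2 ^+ j.
  have [/subnK <-|/ltnW/subnK <-] := leqP k j.
    by have [i1 _] := step k (j - k)%N; have := q (j - k + k)%N; lra.
  by have [_ i1] := step j (k - j)%N; have := q (k - j + j)%N; lra.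
pose A := [set u k - 2 * D / 2 ^+ k | k in [set: nat]].
have supA : has_sup A.
  split; first by exists (u 0%N - 2 * D / 2 ^+ 0), 0%N.
  by exists (u 0%N + 2 * D / 2 ^+ 0) => _ [k _ <-].
exists (sup A) => k.
have h1 : u k - 2 * D / 2 ^+ k <= sup A by apply: sup_upper_bound => //; exists k.
have h2 : sup A <= u k + 2 * D / 2 ^+ k by apply: ge_sup; [by case: supA|by move=> _ [j _ <-]].
by rewrite ler_norml; apply/andP; split; lra.
Qed.

Lemma vder_shift n (c : R -> 'rV[R]_n) t r a :
  vder c (t + r) a -> vder (fun s => c (t + s)) r a.
Proof.
move=> /vder_epsP H; apply/vder_epsP => e /H[d d0 Hd]; exists d => // s sr.
by have := Hd (t + s); rewrite (_ : t + s - (t + r) = s - r); [exact|ring].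
Qed.

Lemma vder_scale n (v : 'rV[R]_n) t : vder (fun s => s *: v) t v.
Proof.
apply/vder_epsP => e e0; exists 1 => // s _.
by rewrite -scalerBl subrr normr0 mulr_ge0// ltW.
Qed.

Lemma half_pow_small (D : R) : 0 <= D -> forall e, 0 < e ->
  exists k0, forall k, (k0 <= k)%N -> 2 * D / 2 ^+ k <= e.
Proof.
move=> D0 e e0; exists (Num.truncn (2 * D / e)).+1 => k kk.
rewrite ler_pdivrMr ?exprn_gt0// -ler_pdivrMl// [leLHS]mulrC.
have h : 2 * D / e < (Num.truncn (2 * D / e)).+1%:R by exact: truncnS_gt.
apply: le_trans (ltW h) _; rewrite -natrX ler_nat (leq_trans kk)//.
by rewrite ltnW// ltn_expl.
Qed.

(** The limit is differentiated through the iterates: G along [Y k] is uniformly close to G along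
    the limit, and G along the limit is close to its value at t because G along one fixed iterate
    [Y k0] is continuous. *)
Lemma picard_limit n (G : R -> 'rV[R]_n -> 'rV[R]_n) (K tau D : R) (Y : nat -> R -> 'rV[R]_n) :
  0 <= K -> 0 <= D ->
  (forall t y z, `|G t y - G t z| <= K * `|y - z|) ->
  (forall k, continuous (fun t => G t (Y k t))) ->
  (forall k t, `|t| < tau -> vder (Y k.+1) t (G t (Y k t))) ->
  (forall k t, `|t| < tau -> `|Y k.+1 t - Y k t| <= D / 2 ^+ k) ->
  exists y : R -> 'rV[R]_n, (forall t k, `|t| < tau -> `|Y k t - y t| <= 2 * D / 2 ^+ k) /\
    forall t, `|t| < tau -> vder y t (G t (y t)).
Proof.
move=> K0 D0 lipG contG dY bnd.
have /choice[y Hy] : forall t, exists l : 'rV[R]_n, `|t| < tau -> forall k, `|Y k t - l| <= 2 * D / 2 ^+ k.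
  move=> t; have [tt|] := boolP (`|t| < tau); last by exists 0.
  have /choice[l Hl] : forall j, exists l, forall k, `|Y k t 0 j - l| <= 2 * D / 2 ^+ k.
    move=> j; apply: nested_limit => k; apply: le_trans (bnd k t tt).
    by apply: le_trans (normv_coord _ j); rewrite !mxE.
  exists (\row_j l j) => _ k; apply: normv_le => [|j]; last by rewrite !mxE Hl.
  by rewrite divr_ge0 ?exprn_ge0// mulr_ge0.
have small := half_pow_small D0.
exists y; split; first by move=> t k tt; exact: Hy.
move=> t tt; apply/vder_epsP => e e0.
have e' : 0 < e / (4 * (K + 1)) by rewrite divr_gt0// mulr_gt0// ltr_wpDl.
have [k0 Hk0] := small _ e'.
have bKe : K * (e / (4 * (K + 1))) <= e / 4.
  by rewrite -{2}[e](divfK (_ : K + 1 != 0)) ?gt_eqF ?ltr_wpDl//; nra.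
have close k s : (k0 <= k)%N -> `|s| < tau -> `|G s (Y k s) - G s (y s)| <= e / 4.
  move=> kk ss; apply: le_trans bKe; rewrite (le_trans (lipG _ _ _))// ler_wpM2l//.
  by apply: le_trans (Hy _ ss k) _; exact: Hk0.
have /continuous_epsP := contG k0 t.
move=> /(_ (e / 4)); case=> [|d d0 Hd]; first by rewrite divr_gt0.
exists (Num.min d (tau - `|t|)) => [|s]; first by rewrite lt_min d0 subr_gt0.
rewrite lt_min => /andP[sd st].
have bt r : `|r - t| <= `|s - t| -> `|r| < tau.
  move=> h; rewrite -[r](subrK t) (le_lt_trans (ler_normD _ _))//; lra.
have ss : `|s| < tau by exact: bt.
have key k : (k0 <= k)%N -> `|Y k.+1 s - Y k.+1 t - (s - t) *: G t (y t)| <= e * `|s - t|.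
  move=> kk.
  have := @vmvt0 _ _ (fun r => Y k.+1 (t + r) - r *: G t (y t)) (fun r => G (t + r) (Y k (t + r)) - G t (y t)) (s - t) e.
  have Es : t + (s - t) = s by ring.
  rewrite addr0 scale0r subr0 Es (addrAC (Y k.+1 s)) => -> //.
  - move=> r rs; apply: vder_sub.
      by apply: vder_shift; apply: dY; apply: bt; rewrite addrC addKr.
    exact: vder_scale.
  - move=> r rs.
    have tr : `|t + r| < tau by apply: bt; rewrite addrC addKr.
    have a1 := close k (t + r) kk tr.
    have a2 := close k0 (t + r) (leqnn _) tr.
    have a3 := close k0 t (leqnn _) tt.
    have a4 : `|G (t + r) (Y k0 (t + r)) - G t (Y k0 t)| <= e / 4.
      by apply: Hd; rewrite addrC addKr; exact: le_lt_trans sd.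
    rewrite (_ : _ - _ = (G (t + r) (Y k (t + r)) - G (t + r) (y (t + r))) +
      - (G (t + r) (Y k0 (t + r)) - G (t + r) (y (t + r))) +
      (G (t + r) (Y k0 (t + r)) - G t (Y k0 t)) + (G t (Y k0 t) - G t (y t))).
      apply: le_trans (ler_normD _ _) _; apply: le_trans (lerD (ler_normD _ _) (lexx _)) _.
      apply: le_trans (lerD (lerD (ler_normD _ _) (lexx _)) (lexx _)) _.
      rewrite normrN; lra.
    by apply/rowP => j; rewrite !mxE; ring.
(* [key] is uniform in k >= k0, so the index can now go to infinity with s fixed; e1 absorbs the
   distance between iterate and limit. *)
apply/ler_addgt0Pl => e1 e10.
have [k1 Hk1] := small (e1 / 2) (divr_gt0 e10 (ltr0Sn _ _)).
pose k := maxn k0 k1.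
have a1 := key k (leq_maxl _ _).
have a2 := le_trans (Hy s ss k.+1) (Hk1 _ (leq_trans (leq_maxr _ _) (leqnSn k))).
have a3 := le_trans (Hy t tt k.+1) (Hk1 _ (leq_trans (leq_maxr _ _) (leqnSn k))).
rewrite (_ : y s - y t - _ = - (Y k.+1 s - y s) + (Y k.+1 t - y t) + (Y k.+1 s - Y k.+1 t - (s - t) *: G t (y t))); last first.
  set g := _ *: _; move: (Y _ s) (Y _ t) (y s) (y t) => p q r v.
  by apply/rowP => j; rewrite !mxE; ring.
apply: le_trans (ler_normD _ _) _; rewrite lerD//.
by apply: le_trans (ler_normD _ _) _; rewrite normrN; lra.
Qed.

Lemma picard n (G : R -> 'rV[R]_n -> 'rV[R]_n) (K tau : R) (xi : 'rV[R]_n) :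
  0 <= K -> 0 < tau -> tau < 1 -> K * tau <= 2^-1 ->
  (forall t y z, `|G t y - G t z| <= K * `|y - z|) ->
  (forall y : R -> 'rV[R]_n, continuous y -> continuous (fun t => G t (y t))) ->
  exists y : R -> 'rV[R]_n, y 0 = xi /\ forall t, `|t| < tau -> vder y t (G t (y t)).
Proof.
move=> K0 tau0 tau1 Ktau lipG contG.
(* Iterates are packed with their continuity, on which the existence of the next primitive rests. *)
pose X := {y : R -> 'rV[R]_n | continuous y}.
have step (y : X) : exists y' : X, sval y' 0 = xi /\
    forall t, `|t| < tau -> vder (sval y') t (G t (sval y t)).
  have cf k : continuous (fun t => G t (sval y t) 0 k).
    move=> t; apply: (@continuous_comp _ _ _ _ (fun v : 'rV[R]_n => v 0 k)); last exact: coordv_continuous.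
    exact: contG (svalP y) _.
  have /choice[F HF] : forall k, exists F : R -> R, forall t : R, `|t| < 1 ->
      is_derive t 1 F (G t (sval y t) 0 k).
    by move=> k; exact: continuous_primitive.
  (* Clamping the time freezes the iterate outside [-tau, tau] and keeps it continuous on the whole
     line; the primitives are controlled only on (-1, 1). *)
  pose y' t := xi + \row_k (F k (clamp tau t) - F k 0).
  have cy' : continuous y'.
    move=> t; apply: rowv_continuous => k.
    rewrite (_ : (fun _ => _) = fun s => (xi 0 k - F k 0) + F k (clamp tau s)); last first.
      by apply/funext => s; rewrite !mxE; ring.
    apply: continuousD; first exact: cst_continuous.
    apply: continuous_comp; first exact: clamp_continuous.
    by apply: is_derive_continuous; apply: HF; apply: le_lt_trans tau1; apply: clamp_le; exact: ltW.
  exists (exist _ y' cy') => /=; split.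
    rewrite /y' clamp_id ?normr0 ?ltW//; apply/rowP => k.
    by rewrite !mxE subrr addr0.
  move=> t tt k.
  have t1 : `|t| < 1 by exact: lt_trans tau1.
  have [_ [d d0 Hd]] : True /\ exists2 d, 0 < d & forall s, `|s - t| < d -> clamp tau s = s.
    split=> //; exists (tau - `|t|) => [|s sd]; first by rewrite subr_gt0.
    rewrite clamp_id// -[s](subrK t) (le_trans (ler_normD _ _))//; lra.
  apply/is_derive_epsP => e e0.
  have /is_derive_epsP/(_ e e0)[d' d'0 Hd'] := HF k t t1.
  exists (Num.min d d') => [|s]; first by rewrite lt_min d0.
  rewrite lt_min => /andP[sd sd']; rewrite /y' !mxE (Hd s)// (Hd t); last by rewrite subrr normr0.
  apply: le_trans (Hd' s sd'); rewrite le_eqVlt; apply/orP; left; apply/eqP; congr `|_|; ring.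
have [nxt Hnxt] := choice step.
have c0 : continuous (fun _ : R => xi) by move=> t; exact: cst_continuous.
pose Y k : R -> 'rV[R]_n := sval (iter k nxt (exist _ (fun _ : R => xi) c0)).
have Y0 k : Y k 0 = xi by case: k => [//|k]; have [] := Hnxt (iter k nxt (exist _ (fun _ : R => xi) c0)).
have dY k t : `|t| < tau -> vder (Y k.+1) t (G t (Y k t)).
  by have [_] := Hnxt (iter k nxt (exist _ (fun _ : R => xi) c0)); apply.
have [D HD] : exists D, forall t, `|t| < tau -> `|Y 1%N t - Y 0%N t| <= D.
  have [||m _ mmax] := @EVT_max R (fun s => `|Y 1%N s - xi|) (- tau) tau.
  - by rewrite (le_trans _ (ltW tau0))// oppr_le0 ltW.
  - apply: continuous_subspaceT => x.
    apply: (@continuous_comp _ _ _ (fun s => Y 1%N s - xi) (@Num.norm _ _)); last exact: norm_continuous.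
    by apply: continuousB; [exact: (svalP (nxt _))|exact: cst_continuous].
  - exists `|Y 1%N m - xi| => t tt; apply: mmax.
    by rewrite in_itv/= -ler_norml ltW.
(* Contraction: [K * tau <= 2^-1] halves the gap between consecutive iterates. *)
have bnd k t : `|t| < tau -> `|Y k.+1 t - Y k t| <= D / 2 ^+ k.
  elim: k t => [|k IH] t tt; first by rewrite expr0 divr1 HD.
  have D0 : 0 <= D / 2 ^+ k by apply: le_trans (IH 0 _); rewrite ?normr0.
  have := @vmvt0 _ _ (fun s => Y k.+2 s - Y k.+1 s) (fun s => G s (Y k.+1 s) - G s (Y k s)) t (K * (D / 2 ^+ k)).
  rewrite !Y0 subrr subr0 => H; apply: le_trans (H _ _) _.
  - by move=> s st; apply: vder_sub; apply: dY; exact: le_lt_trans st tt.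
  - move=> s st; rewrite (le_trans (lipG _ _ _))// ler_wpM2l// IH//; exact: le_lt_trans st tt.
  - rewrite exprS invfM; have : K * `|t| <= 2^-1.
      by apply: le_trans Ktau; rewrite ler_wpM2l// ltW.
    by move=> ?; rewrite mulrAC [leRHS]mulrCA ler_wpM2r.
have D0 : 0 <= D by apply: le_trans (HD 0 _); rewrite ?normr0.
have [|y [Hy dy]] := @picard_limit n G K tau D Y K0 D0 lipG _ dY bnd.
  by move=> k; apply: contG; exact: (svalP (iter k nxt (exist _ (fun _ : R => xi) c0))).
exists y; split=> //.
apply/eqP; rewrite -subr_eq0 -normr_le0; apply/ler_addgt0Pl => e e0.
have [k0 /(_ _ (leqnn _)) Hk] := half_pow_small D0 e0.
have := Hy 0 k0; rewrite normr0 => /(_ tau0); rewrite Y0 distrC addr0 => h.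
exact: le_trans h Hk.
Qed.

End picard.

(** * Local flows and their derivatives in the initial point *)

Section flow.
Context {R : realType}.

Lemma sdiff_lip m k (f : 'rV[R]_m -> 'rV[R]_k) x A : sdiff f x A ->
  exists2 d, 0 < d & forall y z, `|y - x| < d -> `|z - x| < d ->
    `|f y - f z| <= (opn A + 1) * `|y - z|.
Proof.
move=> /(_ 1 ltr01)[d d0 Hd]; exists d => // y z yd zd.
rewrite -[f y - f z](subrK ((y - z) *m A)) (le_trans (ler_normD _ _))// addrC mulrDl.
by rewrite lerD ?Hd// normv_mul.
Qed.

(** Evaluate both approximations at [y + h *: b] and divide by h: a homogeneous estimate valid near
    0 is valid everywhere. *)
Lemma sdiff_cmp m k (f : 'rV[R]_m -> 'rV[R]_k) (y : 'rV[R]_m) A B d e : sdiff f y B -> 0 < d -> 0 <= e ->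
  (forall z : 'rV[R]_m, `|z - y| < d -> `|f z - f y - (z - y) *m A| <= e * `|z - y|) ->
  forall b : 'rV[R]_m, `|b *m B - b *m A| <= e * `|b|.
Proof.
move=> H d0 e0 HA b; apply/ler_addgt0Pl => e1 e10.
have b1 : 0 < `|b| + 1 by rewrite ltr_wpDl.
have [d' d'0 HB] := H _ (divr_gt0 e10 b1).
pose h := Num.min d d' / (`|b| + 1) / 2.
have dd : 0 < Num.min d d' by rewrite lt_min d0.
have h0 : 0 < h by rewrite !divr_gt0.
have hb : `|h *: b| < Num.min d d'.
  rewrite normrZ gtr0_norm// /h mulrAC ltr_pdivrMr// mulrAC ltr_pdivrMr//.
  have : `|b| < (`|b| + 1) * 2 by have := normr_ge0 b; lra.
  by move=> hh; rewrite -mulrA ltr_pM2l// mulrC.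
have := HA (y + h *: b); have := HB (y + h *: b) y.
rewrite (addrC y) addrK; move: hb; rewrite lt_min => /andP[h1 h2].
rewrite subrr normr0 => /(_ h2 d'0); move=> H2 /(_ h1) H1.
rewrite -(ler_pM2l h0).
have E : h * `|b *m B - b *m A| = `|(f (h *: b + y) - f y - (h *: b) *m A) - (f (h *: b + y) - f y - (h *: b) *m B)|.
  rewrite -{1}(gtr0_norm h0) -normrZ scalerBr -!scalemxAl; congr `|_|.
  by move: (h *: (b *m B)) (h *: (b *m A)) => ? ?; apply/rowP => j; rewrite !mxE; ring.
rewrite E (le_trans (ler_normB _ _))//.
have H3 : e1 / (`|b| + 1) * `|h *: b| <= h * e1.
  rewrite normrZ gtr0_norm// mulrAC ler_pdivrMr//.
  have := normr_ge0 b; move: (`|b|) => x x0; have : 0 <= h * e1 by rewrite mulr_ge0// ltW.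
  by move=> ?; nra.
have H4 : e * `|h *: b| = h * (e * `|b|) by rewrite normrZ gtr0_norm// mulrCA.
rewrite mulrDr -H4 addrC lerD//; exact: le_trans H3.
Qed.

(** A strict derivative at x is an approximate derivative at all nearby points, so the derivatives
    that exist near x are automatically close to A. *)
Lemma sdiff_close m k (f : 'rV[R]_m -> 'rV[R]_k) x A : sdiff f x A ->
  forall e, 0 < e -> exists2 d, 0 < d & forall (y : 'rV[R]_m) B, `|y - x| < d -> sdiff f y B ->
    forall b : 'rV[R]_m, `|b *m B - b *m A| <= e * `|b|.
Proof.
move=> H e e0; have [d d0 Hd] := H e e0; exists d => // y B yd sB.
apply: (@sdiff_cmp _ _ f y A B (d - `|y - x|)) => //; [by rewrite subr_gt0|exact: ltW|].
move=> z zd; apply: Hd => //; rewrite -[z](subrK y) -addrA (le_lt_trans (ler_normD _ _))//.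
by rewrite -ltrBrDr.
Qed.

(** Lebesgue number principle: local radii on a compact interval can be replaced by a single one. *)
Lemma compact_radius (a b : R) (P : R -> R -> Prop) :
  (forall s d d', P s d -> d' <= d -> P s d') ->
  (forall s, a <= s <= b -> exists2 d, 0 < d & forall s', a <= s' <= b -> `|s' - s| < d -> P s' d) ->
  exists2 d, 0 < d & forall s, a <= s <= b -> P s d.
Proof.
move=> mono H.
have /compact_near_coveringP/near_covering_withinP/= C := @segment_compact R a b.
have := C R (0^'+) (fun d s => P s d) _ => /(_ _)[].
  move=> s /=; rewrite in_itv/= => sab; have [d d0 Hd] := H s sab.
  exists ([set s' | `|s' - s| < d], [set d' | 0 < d' <= d]) => /=.
    split; first by apply/nbhs_ballP; exists d => // y; rewrite -ball_normE/= distrC.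
    by near=> d'; apply/andP; split; near: d'; [exact: nbhs_right_gt|exact: nbhs_right_le].
  move=> [s' d'] /= [s's /andP[d'0 d'd]]; rewrite in_itv/= => s'ab.
  exact: mono (Hd s' s'ab s's) d'd.
move=> d /= d0 Hd; exists (d / 2) => [|s sab]; first by rewrite divr_gt0.
apply: Hd => /=; rewrite ?in_itv//= ?divr_gt0//.
by rewrite sub0r normrN gtr0_norm ?divr_gt0// ltr_pdivrMr// ltr_pMr// ltr1n.
Unshelve. all: by end_near.
Qed.

Definition vclamp m rho (v : 'rV[R]_m) : 'rV[R]_m := \row_k clamp rho (v 0 k).

Lemma vclamp_id m rho (v : 'rV[R]_m) : `|v| <= rho -> vclamp rho v = v.
Proof.
by move=> h; apply/rowP => k; rewrite mxE clamp_id// (le_trans (normv_coord _ _)).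
Qed.

Lemma vclamp_le m rho (v : 'rV[R]_m) : 0 <= rho -> `|vclamp rho v| <= rho.
Proof. by move=> h; apply: normv_le => // k; rewrite mxE clamp_le. Qed.

Lemma vclamp_lip m rho (v w : 'rV[R]_m) : `|vclamp rho v - vclamp rho w| <= `|v - w|.
Proof.
apply: normv_le => // k; rewrite !mxE (le_trans (clamp_lip _ _ _))//.
by rewrite (le_trans _ (normv_coord _ k))// !mxE.
Qed.

Lemma mulmx_cont m (b : R -> 'rV[R]_m) (A : R -> 'M[R]_m) t :
  {for t, continuous b} ->
  (forall e, 0 < e -> exists2 d, 0 < d & forall s, `|s - t| < d ->
     forall v : 'rV[R]_m, `|v *m A s - v *m A t| <= e * `|v|) ->
  {for t, continuous (fun s => b s *m A s)}.
Proof.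
move=> /continuous_epsP cb cA; apply/continuous_epsP => e e0.
have b1 : 0 < `|b t| + 1 by rewrite ltr_wpDl.
have [d d0 Hd] := cA (e / 2 / (`|b t| + 1)) (divr_gt0 (divr_gt0 e0 (ltr0Sn _ _)) b1).
have K0 : 0 < opn (A t) + 1 by rewrite ltr_wpDl// opn_ge0.
have m0 : 0 < Num.min 1 (e / 2 / (opn (A t) + 1)) by rewrite lt_min ltr01/= !divr_gt0.
have [d' d'0 Hd'] := cb _ m0.
exists (Num.min d d') => [|s]; first by rewrite lt_min d0.
rewrite lt_min => /andP[/Hd h1 /Hd'].
rewrite le_min => /andP[h2 h3].
rewrite (_ : _ - _ = (b s *m A s - b s *m A t) + (b s - b t) *m A t); last first.
  by rewrite mulmxBl addrA subrK.
have h4 : `|b s| <= `|b t| + 1.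
  by rewrite -[b s](subrK (b t)) (le_trans (ler_normD _ _))// addrC lerD2l.
rewrite (le_trans (ler_normD _ _))// [e in leRHS](splitr e) lerD//.
  rewrite (le_trans (h1 _))// mulrAC ler_pdivrMr// ler_wpM2l// divr_ge0// ltW//.
rewrite (le_trans (normv_mul _ _))//.
apply: (@le_trans _ _ ((opn (A t) + 1) * `|b s - b t|)); first by rewrite ler_wpM2r// lerDl.
by rewrite mulrC -ler_pdivlMr.
Qed.

(** A flow box with the derivative [Y] of the flow in the initial point, which solves the linearised
    equation along the orbit. Time and radius are uniform over the box, and differentiability comes
    from a Gronwall estimate of the linearisation error. *)
Lemma local_flow m (F : 'rV[R]_m -> 'rV[R]_m) (DF : 'rV[R]_m -> 'M[R]_m)
    (Om : set 'rV[R]_m) xi0 :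
  open Om -> (forall xi, Om xi -> sdiff F xi (DF xi)) -> Om xi0 ->
  exists tau d (phi : 'rV[R]_m -> R -> 'rV[R]_m) (Y : 'rV[R]_m -> R -> 'M[R]_m),
    [/\ 0 < tau, 0 < d & forall xi, `|xi - xi0| < d ->
    [/\ phi xi 0 = xi, Y xi 0 = 1%:M &
      forall h, `|h| < tau ->
      [/\ Om (phi xi h), vder (phi xi) h (F (phi xi h)),
          sdiff (phi ^~ h) xi (Y xi h) &
          forall b : 'rV[R]_m, vder (fun h => b *m Y xi h) h (b *m Y xi h *m DF (phi xi h))]]].
Proof.
move=> oO sF O0.
have [rO rO0 HO] : exists2 r, 0 < r & forall x, `|x - xi0| < r -> Om x.
  have /nbhs_ballP[r /= r0 Hr] := open_nbhs_nbhs (conj oO O0).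
  by exists r => // x xr; apply: Hr; rewrite -ball_normE/= distrC.
have [rL rL0 HL] := sdiff_lip (sF _ O0).
set K := opn (DF xi0) + 1 in HL.
have K0 : 0 < K by rewrite ltr_wpDl// opn_ge0.
pose rho := Num.min rO rL / 2.
have mr0 : 0 < Num.min rO rL by rewrite lt_min rO0.
have rho0 : 0 < rho by rewrite divr_gt0.
have rhoB x : `|x - xi0| <= rho -> `|x - xi0| < rO /\ `|x - xi0| < rL.
  move=> h; have : `|x - xi0| < Num.min rO rL.
    by apply: le_lt_trans h _; rewrite /rho ltr_pdivrMr// ltr_pMr// ltr1n.
  by rewrite lt_min => /andP[].
(* Composing with the projection onto a small cube makes F globally Lipschitz; [Mb * tau <= rho / 2]
   keeps the orbits inside the cube, where [P] is the identity. *)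
pose P x := xi0 + vclamp rho (x - xi0).
have PB x : `|P x - xi0| <= rho by rewrite /P addrC addKr vclamp_le// ltW.
have Pid x : `|x - xi0| <= rho -> P x = x by move=> h; rewrite /P vclamp_id// addrC subrK.
have Plip x y : `|P x - P y| <= `|x - y|.
  by rewrite /P opprD addrACA subrr add0r (le_trans (vclamp_lip _ _ _))// opprB addrA subrK.
have lipG (t : R) y z : `|F (P y) - F (P z)| <= K * `|y - z|.
  have [_ h1] := rhoB _ (PB y); have [_ h2] := rhoB _ (PB z).
  by rewrite (le_trans (HL _ _ h1 h2))// ler_wpM2l// ltW.
have DFb x : `|x - xi0| <= rho -> forall b : 'rV[R]_m, `|b *m DF x| <= K * `|b|.
  move=> xr b; have [h1 h2] := rhoB _ xr.
  have := @sdiff_cmp _ _ F x 0 (DF x) (rL - `|x - xi0|) K (sF _ (HO _ h1)) _ (ltW K0) _ b.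
  rewrite mulmx0 subr0; apply; first by rewrite subr_gt0.
  move=> z zx; rewrite mulmx0 subr0; apply: HL => //.
  by rewrite -[z](subrK x) -addrA (le_lt_trans (ler_normD _ _))// -ltrBrDr.
pose Mb := `|F xi0| + K * rho + 1.
have Mb0 : 0 < Mb by rewrite ltr_wpDl// addr_ge0// mulr_ge0// ltW.
have FB x : `|F (P x)| <= Mb.
  have := lipG 0 (P x) xi0; rewrite [P xi0]Pid ?subrr ?normr0 ?(ltW rho0)// Pid ?PB// => h.
  rewrite -[F (P x)](subrK (F xi0)) (le_trans (ler_normD _ _))// /Mb.
  have : K * `|P x - xi0| <= K * rho by rewrite ler_wpM2l// ltW.
  lra.
pose tau := Num.min 2^-1 (Num.min (K^-1 / 2) (rho / Mb / 2)).
have tau0 : 0 < tau by rewrite !lt_min !divr_gt0// ?invr_gt0// ltr0n.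
have tau1 : tau < 1.
  by apply: (@le_lt_trans _ _ 2^-1); [rewrite ge_min lexx|rewrite invf_lt1// ltr1n].
have Ktau : K * tau <= 2^-1.
  apply: (@le_trans _ _ (K * (K^-1 / 2))); last by rewrite mulVKf ?gt_eqF.
  by rewrite ler_wpM2l ?(ltW K0)// /tau !ge_min lexx orbT.
have Mtau : Mb * tau <= rho / 2.
  apply: (@le_trans _ _ (Mb * (rho / Mb / 2))).
    by rewrite ler_wpM2l ?(ltW Mb0)// /tau !ge_min lexx !orbT.
  by rewrite le_eqVlt; apply/orP; left; apply/eqP; field; rewrite gt_eqF.
have /choice[phi Hphi] : forall xi, exists y : R -> 'rV[R]_m,
    y 0 = xi /\ forall t, `|t| < tau -> vder y t (F (P (y t))).
  move=> xi; apply: (@picard _ _ (fun _ y => F (P y)) K tau xi (ltW K0)) => //.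
  move=> y cy t; apply: (@continuous_comp _ _ _ y (fun v => F (P v))); first exact: cy.
  exact: (@lip_continuous _ _ _ _ K) (lipG 0) _.
have inB xi h : `|xi - xi0| < rho / 2 -> `|h| < tau -> `|phi xi h - xi0| <= rho.
  move=> xr hh; have [p0 dp] := Hphi xi.
  have := @vmvt0 _ _ (phi xi) (fun s => F (P (phi xi s))) h Mb.
  rewrite p0 => H.
  rewrite -[phi xi h](subrK xi) -addrA (le_trans (ler_normD _ _))// [rho]splitr lerD ?ltW//.
  apply: le_lt_trans (H _ _) _; [|by move=> s _; exact: FB|].
    by move=> s sh; apply: dp; exact: le_lt_trans hh.
  by apply: lt_le_trans Mtau; rewrite ltr_pM2l.
have dphi xi h : `|xi - xi0| < rho / 2 -> `|h| < tau -> vder (phi xi) h (F (phi xi h)).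
  by move=> xr hh; have [_ /(_ h hh)] := Hphi xi; rewrite Pid// inB.
have Ophi xi h : `|xi - xi0| < rho / 2 -> `|h| < tau -> Om (phi xi h).
  by move=> xr hh; apply: HO; have [] := rhoB _ (inB _ _ xr hh).
have lphi x y h : `|h| < tau -> `|phi x h - phi y h| <= 2 * `|x - y|.
  move=> hh; have [x0 dx] := Hphi x; have [y0 dy] := Hphi y.
  have := @gronwall _ _ (fun s => phi x s - phi y s) (fun s => F (P (phi x s)) - F (P (phi y s))) `|h| K 0.
  rewrite x0 y0 mulr0 addr0; apply=> //; rewrite ?(ltW K0)//.
  - by apply: le_trans Ktau; rewrite ler_wpM2l ?ltW.
  - by move=> s sh; apply: vder_sub; [apply: dx|apply: dy]; exact: le_lt_trans hh.
  - by move=> s _; rewrite addr0 lipG.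
(* Times clamped to [-tau', tau'] stay strictly inside the interval on which the orbit is
   controlled. *)
pose tau' := tau / 2.
have tau'0 : 0 < tau' by rewrite divr_gt0.
have tau'l : tau' < tau by rewrite ltr_pdivrMr// ltr_pMr// ltr1n.
have DFc xi t : `|xi - xi0| < rho / 2 -> `|t| < tau -> forall e, 0 < e ->
    exists2 d, 0 < d & forall s, `|s - t| < d -> `|s| < tau ->
      forall v : 'rV[R]_m, `|v *m DF (phi xi s) - v *m DF (phi xi t)| <= e * `|v|.
  move=> xr tt e e0; have [d d0 Hd] := sdiff_close (sF _ (Ophi _ _ xr tt)) e0.
  have /continuous_epsP/(_ (d / 2) (divr_gt0 d0 (ltr0Sn _ _)))[d' d'0 Hd'] := vder_continuous (dphi _ _ xr tt).
  exists d' => // s sd ss v; apply: Hd; last by apply: sF; exact: Ophi.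
  by apply: le_lt_trans (Hd' s sd) _; rewrite ltr_pdivrMr// ltr_pMr// ltr1n.
have /choice[Y HY] : forall xi, exists Y : R -> 'M[R]_m, `|xi - xi0| < rho / 2 ->
    Y 0 = 1%:M /\ forall h, `|h| < tau' -> forall b : 'rV[R]_m, vder (fun h => b *m Y h) h (b *m Y h *m DF (phi xi h)).
  move=> xi; have [xr|] := boolP (`|xi - xi0| < rho / 2); last by exists (fun=> 0).
  have ct s : `|clamp tau' s| < tau by apply: le_lt_trans tau'l; rewrite clamp_le// ltW.
  (* Row j of [Y] is the solution of the linear equation starting from the j-th basis vector. *)
  have /choice[y Hy] : forall j : 'I_m, exists y : R -> 'rV[R]_m, y 0 = delta_mx 0 j /\
      forall t, `|t| < tau' -> vder y t (y t *m DF (phi xi (clamp tau' t))).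
    move=> j; apply: (@picard _ _ (fun t y => y *m DF (phi xi (clamp tau' t))) K tau' _ (ltW K0)) => //.
    - exact: lt_trans tau1.
    - by apply: le_trans Ktau; rewrite ler_wpM2l ?ltW.
    - by move=> t a b; rewrite -mulmxBl DFb// inB.
    - move=> c cc t; apply: mulmx_cont; first exact: cc.
      move=> e e0; have [d d0 Hd] := DFc xi _ xr (ct t) e e0.
      exists d => // s sd v; apply: Hd => //.
      by apply: le_lt_trans sd; exact: clamp_lip.
  exists (fun h => \matrix_(j, k) y j h 0 k) => _; split.
    by apply/matrixP => j k; have [y0 _] := Hy j; rewrite !mxE y0 mxE eqxx/= eq_sym.
  move=> h hh b k.
  rewrite [X in is_derive _ _ X](_ : _ = \sum_j (fun s : R => b 0 j * y j s 0 k)); last first.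
    by apply/funext => s; rewrite fct_sumE mxE; apply: eq_bigr => j _; rewrite mxE.
  rewrite -mulmxA mxE.
  apply: is_derive_sum => j; rewrite !mxE.
  have [_ /(_ h hh k)] := Hy j; rewrite clamp_id ?(ltW hh)// => dj.
  rewrite (_ : \sum_j0 _ = (y j h *m DF (phi xi h)) 0 k); last first.
    by rewrite !mxE; apply: eq_bigr => l _; rewrite !mxE.
  exact: is_deriveZ.
exists tau', (rho / 2), phi, Y; split=> //; first by rewrite divr_gt0.
move=> xi xr; have [p0 _] := Hphi xi; have [Y0 dY] := HY xi xr; split=> // h hh.
have hht : `|h| < tau by exact: lt_trans hh tau'l.
split; [exact: Ophi|exact: dphi| |exact: dY].
move=> e e0.
(* Strict differentiability of F made uniform along the orbit, with a radius that does not depend on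
   the time s. *)
have [|s|d d0 Hd] := @compact_radius (- `|h|) `|h| (fun s d => forall y z : 'rV[R]_m,
    `|y - phi xi s| < d -> `|z - phi xi s| < d ->
    `|F y - F z - (y - z) *m DF (phi xi s)| <= e / 4 * `|y - z|).
- by move=> s d d' H d'd y z yd zd; apply: H; exact: lt_le_trans d'd.
- rewrite -ler_norml => sh.
  have ss : `|s| < tau by exact: le_lt_trans hht.
  have e8 : 0 < e / 8 by rewrite divr_gt0.
  have [d d0 Hd] := sF _ (Ophi _ _ xr ss) _ e8.
  have [d1 d10 Hd1] := DFc _ _ xr ss _ e8.
  have /continuous_epsP/(_ (d / 2) (divr_gt0 d0 (ltr0Sn _ _)))[d2 d20 Hd2] := vder_continuous (dphi _ _ xr ss).
  exists (Num.min (d / 2) (Num.min d1 d2)) => [|s']; first by rewrite !lt_min d10 d20 divr_gt0.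
  rewrite -ler_norml => s'h; rewrite !lt_min => /andP[_ /andP[sd1 sd2]] y z.
  rewrite !lt_min => /andP[yd _] /andP[zd _].
  have tr v : `|v - phi xi s'| < d / 2 -> `|v - phi xi s| < d.
    move=> h1; rewrite -[v](subrK (phi xi s')) -addrA (le_lt_trans (ler_normD _ _))//.
    by rewrite [d]splitr ltr_leD// Hd2.
  have h1 := Hd _ _ (tr _ yd) (tr _ zd).
  have h2 := Hd1 s' sd1 (le_lt_trans s'h hht) (y - z).
  rewrite (_ : _ - _ = (F y - F z - (y - z) *m DF (phi xi s)) -
     ((y - z) *m DF (phi xi s') - (y - z) *m DF (phi xi s))); last first.
    by move: (_ *m _) (_ *m _) => ? ?; apply/rowP => j; rewrite !mxE; ring.
  rewrite (le_trans (ler_normB _ _))//; move: h1 h2; lra.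
pose d' := Num.min (d / 2) (rho / 2 - `|xi - xi0|).
exists d' => [|x y]; first by rewrite lt_min divr_gt0// subr_gt0.
rewrite !lt_min => /andP[xd xr'] /andP[yd yr'].
have near x' : `|x' - xi| < rho / 2 - `|xi - xi0| -> `|x' - xi0| < rho / 2.
  by move=> h1; rewrite -[x'](subrK xi) -addrA (le_lt_trans (ler_normD _ _))// -ltrBrDr.
have {}xr' := near _ xr'; have {}yr' := near _ yr'.
(* E solves the linearised equation up to the error of linearising F, at most e / 4 times the
   distance of the two orbits, itself at most twice that of x and y. Since E vanishes at 0, Gronwall
   concludes. *)
pose E s := phi x s - phi y s - (x - y) *m Y xi s.
pose E' s := F (phi x s) - F (phi y s) - (x - y) *m Y xi s *m DF (phi xi s).
have lt_h (s : R) : `|s| <= `|h| -> `|s| < tau /\ `|s| < tau'.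
  by move=> sh; split; [exact: le_lt_trans hht|exact: le_lt_trans hh].
have := @gronwall _ _ E E' `|h| K (e / 4 * (2 * `|x - y|)).
have -> : E 0 = 0 by rewrite /E Y0 mulmx1; have [-> _] := Hphi x; have [-> _] := Hphi y; rewrite subrr.
rewrite normr0 mulr0 add0r => G.
apply: le_trans (G _ _ _ _ _ _ h _) _ => //.
- exact: ltW.
- by rewrite !mulr_ge0// ltW// divr_gt0.
- by apply: le_trans Ktau; rewrite ler_wpM2l ?ltW.
- move=> s /lt_h[s1 s2]; apply: vder_sub; last exact: dY.
  by apply: vder_sub; exact: dphi.
- move=> s sh; have [s1 s2] := lt_h s sh.
  have cl x' : `|x' - xi| < d / 2 -> `|phi x' s - phi xi s| < d.
    move=> h1; rewrite (le_lt_trans (lphi _ _ _ s1))//; lra.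
  have h1 := Hd s _ (phi x s) (phi y s) (cl _ xd) (cl _ yd).
  rewrite (_ : E' s = E s *m DF (phi xi s) +
     (F (phi x s) - F (phi y s) - (phi x s - phi y s) *m DF (phi xi s))); last first.
    rewrite /E' /E (mulmxBl _ ((x - y) *m _)).
    move: ((phi x s - phi y s) *m _) ((x - y) *m _ *m _) => ? ?.
    by apply/rowP => j; rewrite !mxE; ring.
  rewrite (le_trans (ler_normD _ _))// lerD//; first by rewrite DFb// inB.
  apply: le_trans (h1 _) _; first by rewrite -ler_norml.
  by rewrite ler_wpM2l ?lphi// divr_ge0// ltW.
- have : `|h| <= 1 by rewrite ltW// (lt_trans hht).
  rewrite (_ : 2 * `|h| * _ = `|h| * (e * `|x - y|)); last by field.
  by move=> h1; rewrite ler_piMl// mulr_ge0// ltW.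
Qed.

End flow.

(** * Poincare-Miranda theorem and invariance of domain *)

Section grid.
Variables (n N : nat) (lab : 'I_n -> ('I_n -> nat) -> bool).
Local Notation pt := ('I_n -> nat).
Implicit Types (v w : pt) (d : 'I_n) (D : {set 'I_n}) (ts s : seq 'I_n).

Definition upd v d x : pt := fun i => if i == d then x else v i.
Definition step v d : pt := upd v d (v d).+1.

Lemma upd_comm v d d' x y : d != d' -> upd (upd v d x) d' y = upd (upd v d' y) d x.
Proof.
move=> dd; apply/funext => i; rewrite /upd.
by case: eqP => // ->; rewrite eq_sym (negbTE dd).
Qed.

Lemma step_comm v d d' : d != d' -> step (step v d) d' = step (step v d') d.
Proof.
move=> dd; rewrite /step upd_comm//; congr upd; rewrite /upd.
  by rewrite eq_sym (negbTE dd).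
by rewrite (negbTE dd).
Qed.

Lemma step_upd v d d' x : d != d' -> upd (step v d) d' x = step (upd v d' x) d.
Proof. by move=> dd; rewrite /step upd_comm//; congr upd; rewrite /upd (negbTE dd). Qed.

Lemma step_updxx v d x : step (upd v d x) d = upd v d x.+1.
Proof. by apply/funext => i; rewrite /step /upd eqxx; case: eqP. Qed.

(* The value on the cube at v of the mod 2 cup product of the coboundaries of
   the labels ts, restricted to the directions D. *)
Fixpoint cup ts D v : bool :=
  if ts is t :: ts' then
    \big[addb/false]_(d in D) ((lab t (step v d) (+) lab t v) && cup ts' (D :\ d) (step v d))
  else true.

(** Modulo 2, each unordered pair of directions is counted twice. *)
Lemma big_sym D (S : 'I_n -> 'I_n -> bool) : (forall d d', S d d' = S d' d) ->
  \big[addb/false]_(d in D) \big[addb/false]_(d' in D :\ d) S d d' = false.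
Proof.
move=> sym.
have E d : \big[addb/false]_(d' in D :\ d) S d d' =
  \big[addb/false]_(d' in D | (d' < d)%N) S d d' (+) \big[addb/false]_(d' in D | (d < d')%N) S d d'.
  rewrite (bigID (fun d' : 'I_n => (d' < d)%N))/=; congr addb; apply: eq_bigl => d'; rewrite !inE.
    by rewrite andbAC; case: (ltngtP d' d) => //=; rewrite ?andbF ?andbT// -val_eqE/=; case: ltngtP.
  by rewrite -val_eqE/=; case: (ltngtP d' d); rewrite ?andbF ?andbT.
under eq_bigr do rewrite E.
rewrite big_split/= [X in _ (+) X](exchange_big_dep (mem D))//=; last by move=> d d' _ /andP[].
rewrite [X in _ (+) X](eq_bigr (fun i : 'I_n => \big[addb/false]_(d' in D | (d' < i)%N) S i d')).
  by rewrite addbb.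
by move=> d dD; apply: eq_big => d'; rewrite ?dD// sym.
Qed.

Lemma addb_false_eq (a b : bool) : a (+) b = false -> a = b.
Proof. by case: a; case: b. Qed.

(** A cup product of coboundaries is a cocycle: its sum over the facets of a cube is even. Induction
    on the labels, through the Leibniz rule. *)
Lemma cup_closed ts D v :
  \big[addb/false]_(d in D) (cup ts (D :\ d) (step v d) (+) cup ts (D :\ d) v) = false.
Proof.
elim: ts D v => [|t ts IH] D v; first by apply: big1.
have DC d d' : D :\ d :\ d' = D :\ d' :\ d by apply/setP => i; rewrite !inE andbCA.
(* The sums of a and e' are symmetric in d and d', hence vanish by [big_sym]; e and e' on one hand,
   b and c on the other, differ by a coboundary killed by the induction hypothesis. *)
pose a d d' := lab t (step (step v d) d') && cup ts (D :\ d :\ d') (step (step v d) d').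
pose b d d' := lab t (step v d) && cup ts (D :\ d :\ d') (step (step v d) d').
pose c d d' := lab t (step v d) && cup ts (D :\ d :\ d') (step v d).
pose e d d' := lab t v && cup ts (D :\ d :\ d') (step v d').
pose e' d d' := lab t v && cup ts (D :\ d :\ d') v.
have -> : \big[addb/false]_(d in D) (cup (t :: ts) (D :\ d) (step v d) (+) cup (t :: ts) (D :\ d) v) =
  \big[addb/false]_(d in D) \big[addb/false]_(d' in D :\ d) a d d' (+)
  \big[addb/false]_(d in D) \big[addb/false]_(d' in D :\ d) b d d' (+)
  (\big[addb/false]_(d in D) \big[addb/false]_(d' in D :\ d) c d' d (+)
  \big[addb/false]_(d in D) \big[addb/false]_(d' in D :\ d) e d d').
  rewrite -!big_split/=; apply: eq_bigr => d _; rewrite -!big_split/=; apply: eq_bigr => d' _.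
  rewrite /a /b /c /e (DC d' d).
  by rewrite !andb_addl.
have -> : \big[addb/false]_(d in D) \big[addb/false]_(d' in D :\ d) a d d' = false.
  rewrite (eq_bigr (fun d => \big[addb/false]_(d' in D :\ d) (if d == d' then false else a d d'))).
    apply: big_sym => d d'; rewrite eq_sym; case: eqP => // /eqP dd.
    by rewrite /a DC step_comm// eq_sym.
  by move=> d _; apply: eq_bigr => d'; rewrite !inE eq_sym => /andP[/negbTE ->].
have -> : \big[addb/false]_(d in D) \big[addb/false]_(d' in D :\ d) c d' d =
   \big[addb/false]_(d in D) \big[addb/false]_(d' in D :\ d) c d d'.
  rewrite (exchange_big_dep (mem D))/=; last by move=> d d' _; rewrite !inE => /andP[].
  apply: eq_bigr => d dD; apply: eq_bigl => d'; rewrite !inE eq_sym.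
  by rewrite [d \in D]dD andbT andbC.
have -> : \big[addb/false]_(d in D) \big[addb/false]_(d' in D :\ d) e d d' =
   \big[addb/false]_(d in D) \big[addb/false]_(d' in D :\ d) e' d d'.
  apply: eq_bigr => d _; apply: addb_false_eq; rewrite -big_split/=.
  rewrite (eq_bigr (fun d' => lab t v && (cup ts (D :\ d :\ d') (step v d') (+) cup ts (D :\ d :\ d') v))).
    by rewrite -big_distrr/= IH andbF.
  by move=> d' _; rewrite andb_addr.
have -> : \big[addb/false]_(d in D) \big[addb/false]_(d' in D :\ d) e' d d' = false.
  by apply: big_sym => d d'; rewrite /e' DC.
rewrite addbF addFb -big_split/=; apply: big1 => d _; rewrite -big_split/=.
rewrite (eq_bigr (fun d' => lab t (step v d) && (cup ts (D :\ d :\ d') (step (step v d) d') (+)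
  cup ts (D :\ d :\ d') (step v d)))); last by move=> d' _; rewrite andb_addr.
by rewrite -big_distrr/= IH andbF.
Qed.

Fixpoint bsum s (g : pt -> bool) v : bool :=
  if s is d :: s' then \big[addb/false]_(x < N) bsum s' g (upd v d x) else g v.

Lemma eq_bsum s g h v : g =1 h -> bsum s g v = bsum s h v.
Proof.
by move=> gh; elim: s v => [|d s IH] v /=; [exact: gh|apply: eq_bigr => x _; exact: IH].
Qed.

Lemma bsum_add s g h v : bsum s (fun w => g w (+) h w) v = bsum s g v (+) bsum s h v.
Proof.
elim: s v => [//|d s IH] v /=; rewrite -big_split/=; apply: eq_bigr => x _; exact: IH.
Qed.

Lemma bsum_false s v : bsum s (fun=> false) v = false.
Proof. by elim: s v => [//|d s IH] v /=; apply: big1. Qed.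

Lemma bsum_big s D (g : 'I_n -> pt -> bool) v :
  bsum s (fun w => \big[addb/false]_(d in D) g d w) v = \big[addb/false]_(d in D) bsum s (g d) v.
Proof.
elim: s v => [//|d s IH] v /=; rewrite exchange_big/=; apply: eq_bigr => x _; exact: IH.
Qed.

Lemma bsum_step s g v d : d \notin s -> bsum s g (step v d) = bsum s (fun w => g (step w d)) v.
Proof.
elim: s v => [//|d' s IH] v /=; rewrite inE negb_or => /andP[dd ds].
by apply: eq_bigr => x _; rewrite step_upd// IH.
Qed.

Lemma bsum_upd s g v d x : d \notin s -> bsum s g (upd v d x) = bsum s (fun w => g (upd w d x)) v.
Proof.
elim: s v => [//|d' s IH] v /=; rewrite inE negb_or => /andP[dd ds].
by apply: eq_bigr => y _; rewrite upd_comm// IH.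
Qed.

(** Stokes formula in one direction: the sum of a difference along d leaves only the two faces
    orthogonal to d. *)
Lemma bsum_telescope s g v d : uniq s -> d \in s ->
  bsum s (fun w => g (step w d) (+) g w) v =
  bsum (rem d s) (fun w => g (upd w d N) (+) g (upd w d 0%N)) v.
Proof.
elim: s v => [//|d' s IH] v /= /andP[d's us]; rewrite inE.
have [->|dd /= ds] := eqVneq d d'; last first.
  by apply: eq_bigr => x _; exact: IH.
move=> _; rewrite bsum_add -!bsum_upd//.
under eq_bigr do rewrite bsum_add -bsum_step// step_updxx.
elim: N => [|k IHk]; first by rewrite big_ord0 addbb.
rewrite big_ord_recr/= IHk; case: (bsum _ _ _); case: (bsum _ _ _); by case: (bsum _ _ _).
Qed.

(** Label d is constant on the face [v d = c], and the cubes considered do not extend in direction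
    d, so the coboundary of label d vanishes on them and the product with it. *)
Lemma cup_face ts D v d c b : d \notin D -> d \in ts -> v d = c ->
  (forall w, w d = c -> lab d w = b) -> cup ts D v = false.
Proof.
elim: ts D v => [//|t ts IH] D v dD; rewrite inE => dts vd H /=.
have sd d' : d' \in D -> step v d' d = c.
  by rewrite /step /upd; case: eqP => // <-; rewrite (negbTE dD).
case/orP: dts => [/eqP <-|dts]; apply: big1 => d' d'D.
  by rewrite (H v)// (H (step v d')) ?addbb// sd.
by rewrite IH ?andbF// ?sd// inE negb_and dD orbT.
Qed.

Hypothesis lab0 : forall d v, v d = 0%N -> lab d v = false.
Hypothesis labN : forall d v, v d = N -> lab d v = true.

(** Modulo 2 Stokes formula: the cup product is the coboundary of label t times the remaining
    product, so the total is carried by the boundary. Faces orthogonal to the other directions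
    vanish by [cup_face]; the near face of t has label 0; the far one has label 1 and gives the same
    total in one dimension less. *)
Lemma bsum_cup s v : uniq s -> bsum s (cup s [set d in s]) v = true.
Proof.
elim: s v => [//|t s IH] v us.
set D := [set d in t :: s].
pose G d w := lab t w && cup s (D :\ d) w.
rewrite (eq_bsum _ _ (h := fun w => \big[addb/false]_(d in D) (G d (step w d) (+) G d w))); last first.
  move=> w /=; apply: addb_false_eq; rewrite -big_split/=.
  rewrite (eq_bigr (fun d => lab t w && (cup s (D :\ d) (step w d) (+) cup s (D :\ d) w))).
    by rewrite -big_distrr/= cup_closed andbF.
  by move=> d _; rewrite /G; do 2!case: (lab t _); do 2!case: (cup _ _ _).
rewrite bsum_big.
have tD : t \in D by rewrite !inE eqxx.
rewrite (bigD1 t tD) big1 ?Monoid.mulm1; last first.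
  move=> d /andP[dD dt].
  have ds : d \in s by move: dD; rewrite -[is_true _]/(is_true (d \in D)) !inE (negbTE dt).
  rewrite (bsum_telescope (G d))//; last by rewrite inE ds orbT.
  rewrite (eq_bsum _ _ (h := fun=> false)) ?bsum_false// => w.
  rewrite /G (@cup_face _ _ _ d N true) ?(@cup_face _ _ _ d 0%N false) ?andbF//.
  - by rewrite !inE eqxx.
  - by rewrite /upd eqxx.
  - exact: lab0.
  - by rewrite !inE eqxx.
  - by rewrite /upd eqxx.
  - exact: labN.
rewrite (bsum_telescope (G t)) ?inE ?eqxx//=.
have DE : D :\ t = [set d in s].
  apply/setP => i; rewrite !inE; case: eqP => //= ->.
  by move: us => /= /andP[/negbTE ->].
rewrite (eq_bsum _ _ (h := fun w => cup s [set d in s] (upd w t N))).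
  by rewrite eqxx -bsum_upd ?IH//; case/andP: us.
by move=> w; rewrite /G labN ?lab0 ?DE ?addbF// /upd eqxx.
Qed.

Lemma bsum_true s g v : bsum s g v = true ->
  exists2 w, (forall d, d \in s -> w d < N)%N & g w = true.
Proof.
move=> h.
have H : forall s v, bsum s g v = true ->
    exists2 w, (forall d, (w d < N)%N || ((d \notin s) && (w d == v d))) & g w = true.
  move=> {h v s} s; elim: s => [|d s IH] v /= h.
    by exists v => // d; rewrite eqxx orbT.
  have [x hx] : exists x : 'I_N, bsum s g (upd v d x) = true.
    apply/existsP; apply: contraT => /existsPn/= H; move: h; rewrite big1// => x _.
    exact/negbTE/H.
  have [w Hw gw] := IH _ hx; exists w => // i; have := Hw i.
  rewrite inE negb_or /upd; case: (i =P d) => [->|_] //=.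
  by case/orP => [h1|/andP[_ /eqP ->]]; rewrite ?h1 ?ltn_ord.
have [w Hw gw] := H s v h; exists w => // i ids; have := Hw i.
by rewrite ids/= orbF.
Qed.

(** A true product singles out a monotone path of edges of the cube, and each label of [ts] changes
    along one of these edges. *)
Lemma cup_true ts D v t : cup ts D v = true -> t \in ts ->
  exists a b, [/\ forall i, (v i <= a i <= v i + (i \in D))%N,
    forall i, (v i <= b i <= v i + (i \in D))%N, lab t a = true & lab t b = false].
Proof.
elim: ts D v => [//|t' ts IH] D v /= h.
have [d /andP[dD /andP[h1 h2]]] : exists d, (d \in D) && ((lab t' (step v d) (+) lab t' v) && cup ts (D :\ d) (step v d)).
  apply/existsP; apply: contraT => /existsPn/= H; move: h; rewrite big1// => d dD.
  by apply/negbTE; have := H d; rewrite dD.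
have sv i : (v i <= step v d i <= v i + (i \in D))%N.
  by rewrite /step /upd; case: eqP => [->|_]; rewrite ?dD ?addn1 ?leqnn ?leqnSn//= leq_addr.
rewrite inE => /orP[/eqP ->|tts]; last first.
  have [a [b [ha hb la lb]]] := IH _ _ h2 tts.
  have tr (p : pt) : (forall i, step v d i <= p i <= step v d i + (i \in D :\ d))%N ->
     forall i, (v i <= p i <= v i + (i \in D))%N.
    move=> H i; have := H i; rewrite !inE /step /upd; case: eqP => [->|_] //=.
    by rewrite dD addn0 addn1 => /andP[/ltnW -> ->].
  by exists a, b; split=> //; exact: tr.
have vv i : (v i <= v i <= v i + (i \in D))%N by rewrite leqnn leq_addr.
case E : (lab t' v); case E' : (lab t' (step v d)); move: h1; rewrite ?E ?E' => //= _.
  by exists v, (step v d).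
by exists (step v d), v.
Qed.

Lemma grid_PM : exists2 w : pt, (forall d, w d < N)%N & forall t,
  exists a b, [/\ forall i, (w i <= a i <= (w i).+1)%N,
    forall i, (w i <= b i <= (w i).+1)%N, lab t a = true & lab t b = false].
Proof.
have [w Hw gw] := bsum_true (@bsum_cup (enum 'I_n) (fun=> 0%N) (enum_uniq _)).
exists w => [d|t]; first by apply: Hw; rewrite mem_enum.
have [|a [b [ha hb la lb]]] := cup_true gw (t := t); first by rewrite mem_enum.
exists a, b; split=> // i; [have := ha i|have := hb i]; by rewrite inE mem_enum addn1.
Qed.

End grid.

(** * From the grid to continuous maps *)

Section invariance.
Context {R : realType}.

Lemma compact_radius_rV n (K : set 'rV[R]_n) (P : 'rV[R]_n -> R -> Prop) : compact K ->
  (forall s d d', P s d -> d' <= d -> P s d') ->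
  (forall s, K s -> exists2 d, 0 < d & forall s', K s' -> `|s' - s| < d -> P s' d) ->
  exists2 d, 0 < d & forall s, K s -> P s d.
Proof.
move=> cK mono H.
have /compact_near_coveringP/near_covering_withinP/= C := cK.
have := C R (0^'+) (fun d s => P s d) _ => /(_ _)[].
  move=> s /= Ks; have [d d0 Hd] := H s Ks.
  exists ([set s' | `|s' - s| < d], [set d' | 0 < d' <= d]) => /=.
    split; first by apply/nbhs_ballP; exists d => // y; rewrite -ball_normE/= distrC.
    by near=> d'; apply/andP; split; near: d'; [exact: nbhs_right_gt|exact: nbhs_right_le].
  move=> [s' d'] /= [s's /andP[d'0 d'd]] Ks'.
  exact: mono (Hd s' Ks' s's) d'd.
move=> d /= d0 Hd; exists (d / 2) => [|s sab]; first by rewrite divr_gt0.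
apply: Hd => //=; rewrite ?divr_gt0//.
by rewrite sub0r normrN gtr0_norm ?divr_gt0// ltr_pdivrMr// ltr_pMr// ltr1n.
Unshelve. all: by end_near.
Qed.

Lemma cube_compact n (r : R) : compact [set x : 'rV[R]_n | `|x| <= r].
Proof.
apply: bounded_closed_compact.
  by exists r; split=> [|M rM x /= xr]; rewrite ?num_real// (le_trans xr)// ltW.
apply: (@closed_comp _ _ (fun x : 'rV[R]_n => `|x|) [set y | y <= r]); last exact: closed_le.
by move=> x _; exact: norm_continuous.
Qed.

(** Without a zero, compactness gives a scale at which, near each point, some component of G does
    not change sign; a grid of that mesh has a cube on which all of them do. *)
Theorem poincare_miranda n (G : 'rV[R]_n -> 'rV[R]_n) (r : R) : 0 < r ->
  (forall x : 'rV[R]_n, `|x| <= r -> {for x, continuous G}) ->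
  (forall (x : 'rV[R]_n) i, `|x| <= r -> x 0 i = - r -> G x 0 i < 0) ->
  (forall (x : 'rV[R]_n) i, `|x| <= r -> x 0 i = r -> 0 < G x 0 i) ->
  exists2 x, `|x| <= r & G x = 0.
Proof.
move=> r0 cG Gn Gp; apply: contrapT => noz.
have [|x xr|d d0 Hd] := @compact_radius_rV n [set x | `|x| <= r] (fun x d =>
    forall a b : 'I_n -> 'rV[R]_n, (forall i, `|a i - x| < d) -> (forall i, `|b i - x| < d) ->
    exists i, ~ (0 < G (a i) 0 i /\ G (b i) 0 i <= 0)) (@cube_compact n r).
- by move=> x d d' H d'd a b ha hb; apply: H => i; exact: lt_le_trans d'd.
- have [i Gi] : exists i, G x 0 i != 0.
    apply: contrapT => H; apply: noz; exists x => //; apply/rowP => i; rewrite mxE.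
    by apply/eqP; apply: contrapT => /negP h; apply: H; exists i.
  have e0 : 0 < `|G x 0 i| / 2 by rewrite divr_gt0// normr_gt0.
  have /continuous_epsP/(_ _ e0)[d d0 Hd] := cG x xr.
  exists (d / 2) => [|x' _ x'x a b ha hb]; first by rewrite divr_gt0.
  have near y : `|y - x'| < d / 2 -> `|G y 0 i - G x 0 i| <= `|G x 0 i| / 2.
    move=> yx; apply: le_trans (Hd y _).
      by rewrite (le_trans _ (normv_coord _ i))// !mxE.
    rewrite -[y](subrK x') -addrA (le_lt_trans (ler_normD _ _))//; lra.
  exists i => -[Ga Gb]; have := near _ (ha i); have := near _ (hb i).
  have [Gx|Gx] := ltrP 0 (G x 0 i).
    by rewrite (gtr0_norm Gx) !ler_norml => /andP[? ?] /andP[? ?]; lra.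
  have {}Gx : G x 0 i < 0 by rewrite lt_neqAle Gi.
  by rewrite (ltr0_norm Gx) !ler_norml => /andP[? ?] /andP[? ?]; lra.
pose N := (Num.truncn (2 * r / d)).+1.
have N0 : 0 < N%:R :> R by rewrite ltr0n.
have Nd : 2 * r / N%:R < d by rewrite ltr_pdivrMr// [ltRHS]mulrC -ltr_pdivrMr// truncnS_gt.
pose P (w : 'I_n -> nat) : 'rV[R]_n := \row_i (- r + 2 * r * (w i)%:R / N%:R).
have PB w : (forall i, w i <= N)%N -> `|P w| <= r.
  move=> wN; apply: normv_le => [|i]; first exact: ltW.
  have h1 : 0 <= 2 * r * (w i)%:R / N%:R by rewrite divr_ge0// !mulr_ge0// ltW.
  have h2 : 2 * r * (w i)%:R / N%:R <= 2 * r.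
    by rewrite ler_pdivrMr// ler_wpM2l ?ler_nat// mulr_ge0// ltW.
  by rewrite mxE ler_norml; apply/andP; split; lra.
(* The labels are prescribed on the faces because [grid_PM] asks for them at all integer points,
   including those outside the grid, where [P w] leaves the cube. *)
pose lab i (w : 'I_n -> nat) := if w i == 0%N then false else if w i == N then true
  else 0 < G (P w) 0 i.
have labP i w : (forall j, w j <= N)%N -> lab i w = (0 < G (P w) 0 i).
  move=> wN; rewrite /lab; case: eqP => [w0|_].
    apply/esym/negbTE; rewrite -leNgt ltW// Gn ?PB//.
    by rewrite mxE w0 mulr0 mul0r addr0.
  case: eqP => [wN'|//]; apply/esym; rewrite Gp ?PB// mxE wN'.
  by rewrite mulfK ?gt_eqF//; ring.
have [i v|i v|w wN Hw] := @grid_PM n N lab.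
- by rewrite /lab => ->.
- by rewrite /lab => ->; rewrite eqxx.
have /choice[a /choice[b Hab]] := Hw.
have wNle i : (w i <= N)%N by exact: ltnW.
have aN u : (forall i, w i <= u i <= (w i).+1)%N -> (forall i, u i <= N)%N.
  by move=> H i; have /andP[_ h] := H i; exact: leq_trans h (wN i).
have close u : (forall i, w i <= u i <= (w i).+1)%N -> `|P u - P w| < d.
  move=> H; apply: le_lt_trans Nd; apply: normv_le => [|i].
    by rewrite divr_ge0// mulr_ge0// ltW.
  rewrite !mxE (_ : _ - _ = 2 * r / N%:R * ((u i)%:R - (w i)%:R)); last by field; rewrite gt_eqF.
  have := H i; rewrite -natrB; last by case/andP: (H i).
  rewrite normrM.
  move=> /andP[h1 h2]; rewrite (ger0_norm (_ : 0 <= 2 * r / N%:R)) ?divr_ge0 ?mulr_ge0 ?(ltW r0)//.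
  rewrite ger0_norm ?ler0n// -[leRHS]mulr1 ler_wpM2l ?divr_ge0 ?mulr_ge0 ?(ltW r0)//.
  by rewrite -[1]/(1%:R) ler_nat leq_subLR addn1.
have [i|i|i []] := Hd (P w) (PB _ wNle) (fun i => P (a i)) (fun i => P (b i)).
- by have [h _ _ _] := Hab i; exact: close.
- by have [_ h _ _] := Hab i; exact: close.
have [ha hb la lb] := Hab i.
rewrite -(labP i) ?la; last exact: aN.
by rewrite leNgt -(labP i) ?lb//; exact: aN.
Qed.

Definition unit_clamp (x : R) : R := Num.max 0 (Num.min 1 x).

Lemma unit_clamp_le0 x : x <= 0 -> unit_clamp x = 0.
Proof.
by move=> x0; rewrite /unit_clamp min_r ?(le_trans x0)// max_l.
Qed.

Lemma unit_clamp_ge1 x : 1 <= x -> unit_clamp x = 1.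
Proof. by move=> x0; rewrite /unit_clamp min_l// max_r. Qed.

Lemma unit_clamp01 x : 0 <= unit_clamp x <= 1.
Proof. by rewrite /unit_clamp le_max lexx/= ge_max ler01/= ge_min lexx. Qed.

Lemma unit_clamp_continuous : continuous unit_clamp.
Proof.
apply: (@lip_continuous _ _ _ _ 1) => x y; rewrite mul1r.
have h1 := ler_norm (x - y); have := ler_norm (y - x); rewrite distrC => h2.
rewrite /unit_clamp /Num.max /Num.min.
by repeat case: ifPn; rewrite -?leNgt => *; rewrite ler_norml; apply/andP; split; lra.
Qed.

(* Extending f past the ball of radius r, first by sliding the value y to
   f w1 and then to f 0 along the images of a segment, and finally by shrinking
   the argument until f is close to the identity, yields a map which satisfies the
   boundary conditions of Poincare-Miranda but vanishes nowhere if y is not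
   in the image of the ball. *)
Lemma open_of_regular0 n (f : 'rV[R]_n -> 'rV[R]_n) (w1 : 'rV[R]_n) r : 0 < r ->
  (forall x : 'rV[R]_n, `|x| <= r -> {for x, continuous f}) ->
  (forall x y : 'rV[R]_n, `|x| <= r -> `|y| <= r -> f x = f y -> x = y) ->
  f 0 = 0 -> sdiff f 0 1%:M -> `|w1| < r ->
  exists2 e, 0 < e & forall y : 'rV[R]_n, `|y - f w1| < e -> exists2 x, `|x| <= r & f x = y.
Proof.
move=> r0 cf injf f0 sf w1r.
have [eta eta0 Heta] : exists2 eta, 0 < eta & forall x : 'rV[R]_n, `|x| = r -> eta <= `|f x - f w1|.
  pose S := [set x : 'rV[R]_n | `|x| = r].
  have [[x0 Sx0]|S0] := pselect (S !=set0); last first.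
    by exists 1 => // x xr; exfalso; apply: S0; exists x.
  have cS : compact S.
    apply: bounded_closed_compact.
      by exists r; split=> [|M rM x /= xr]; rewrite ?num_real// xr ltW.
    apply: (@closed_comp _ _ (fun x : 'rV[R]_n => `|x|) [set y | y = r]); last exact: closed_eq.
    by move=> x _; exact: norm_continuous.
  have [|c cS' cmin] := @EVT_min_rV R n (fun x => `|f x - f w1|) S (ex_intro _ x0 Sx0) cS.
    apply: continuous_in_subspaceT => x; rewrite inE => xS.
    apply: (@continuous_comp _ _ _ (fun x => f x - f w1) (@Num.norm _ _)); last exact: norm_continuous.
    by apply: continuousB; [apply: cf; rewrite xS|exact: cst_continuous].
  exists `|f c - f w1| => [|x xr]; last by apply: cmin; rewrite inE.
  rewrite normr_gt0 subr_eq0; apply/eqP => /injf; rewrite inE in cS'; rewrite cS' => /(_ (lexx _) (ltW w1r)) E.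
  by move: w1r; rewrite -E cS' ltxx.
exists eta => // y yeta; apply: contrapT => noy.
have [d d0 Hd] := sf _ (divr_gt0 ltr01 (ltr0Sn R 1)).
pose e0 := Num.min 1 (d / 2 / r).
have e00 : 0 < e0 by rewrite lt_min ltr01/= !divr_gt0.
have e01 : e0 <= 1 by rewrite ge_min lexx.
have e0d : r * e0 < d.
  have : r * e0 <= d / 2 by rewrite mulrC -ler_pdivlMr// ge_min lexx orbT.
  by move/le_lt_trans; apply; rewrite ltr_pdivrMr// ltr_pMr// ltr1n.
(* [l k] rises from 0 to 1 as the norm of z goes from k to k + 1. Up to norm 1 the argument of f
   sweeps the ball of radius r; from 1 to 2 the target y slides to f w1, from 2 to 3 it moves to f
   0, and from 3 to 4 the argument shrinks to norm [r * e0], where f is close to the identity. *)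
pose l k (z : 'rV[R]_n) := unit_clamp (`|z| - k).
pose th z := r * (1 - l 3 z * (1 - e0)) / Num.max 1 `|z|.
pose b z := (1 - l 1 z) *: y + l 1 z *: f ((1 - l 2 z) *: w1).
have lc k z : {for z, continuous (l k)}.
  apply: (@continuous_comp _ _ _ (fun z : 'rV[R]_n => `|z| - k) unit_clamp); last exact: unit_clamp_continuous.
  by apply: continuousB; [exact: norm_continuous|exact: cst_continuous].
have m0 (z : 'rV[R]_n) : 0 < Num.max 1 `|z| by rewrite lt_max ltr01.
have l01 k z : 0 <= l k z <= 1 by exact: unit_clamp01.
have thz z : `|th z *: z| <= r * (1 - l 3 z * (1 - e0)).
  have /andP[h1 h2] := l01 3 z.
  have h3 : 0 <= r * (1 - l 3 z * (1 - e0)).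
    rewrite mulr_ge0 ?(ltW r0)// subr_ge0 mulr_ile1 ?subr_ge0//.
    by rewrite lerBlDr lerDl ltW.
  rewrite normrZ ger0_norm; last by rewrite divr_ge0// ltW.
  by rewrite mulrAC ler_pdivrMr// ler_wpM2l// le_max lexx orbT.
have thr z : `|th z *: z| <= r.
  have /andP[h1 h2] := l01 3 z.
  apply: le_trans (thz z) _; rewrite ger_pMr// lerBlDr lerDl mulr_ge0// subr_ge0//.
have thz1 (z : 'rV[R]_n) : 1 <= `|z| -> `|th z *: z| = r * (1 - l 3 z * (1 - e0)).
  move=> z1; have /andP[h1 h2] := l01 3 z.
  have h3 : 0 <= r * (1 - l 3 z * (1 - e0)).
    rewrite mulr_ge0 ?(ltW r0)// subr_ge0 mulr_ile1 ?subr_ge0//.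
    by rewrite lerBlDr lerDl ltW.
  rewrite normrZ ger0_norm; last by rewrite divr_ge0// ltW.
  by rewrite /th max_r// divfK// gt_eqF// (lt_le_trans ltr01).
have w1b z : `|(1 - l 2 z) *: w1| <= `|w1|.
  have /andP[h1 h2] := l01 2 z.
  by rewrite normrZ ger0_norm ?subr_ge0// ler_piMl// lerBlDr lerDl.
pose G z := f (th z *: z) - b z.
have cth z : {for z, continuous th}.
  apply: continuousM; last first.
    apply: (@continuous_comp _ _ _ (fun z : 'rV[R]_n => Num.max 1 `|z|) (fun x => x^-1)); last exact: inv_continuous (lt0r_neq0 (m0 z)).
    by apply: continuous_max; [exact: cst_continuous|exact: norm_continuous].
  apply: continuousM; first exact: cst_continuous.
  apply: continuousB; first exact: cst_continuous.
  by apply: continuousM; [exact: lc|exact: cst_continuous].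
have onel k z : {for z, continuous (fun z => 1 - l k z)}.
  by apply: continuousB; [exact: cst_continuous|exact: lc].
have [|z i zr zi|z i zr zi|z zr Gz] := @poincare_miranda n G 4 (ltr0Sn _ _).
- move=> z _; apply: continuousB.
    apply: (@continuous_comp _ _ _ (fun z => th z *: z) f); last exact/cf/thr.
    by apply: continuousZ; [exact: cth|].
  apply: continuousD; apply: continuousZ => //; first exact: cst_continuous.
  apply: (@continuous_comp _ _ _ (fun z => (1 - l 2 z) *: w1) f).
    by apply: continuousZ => //; exact: cst_continuous.
  by apply: cf; rewrite (le_trans (w1b z))// ltW.
- have z4 : `|z| = 4.
    by apply/eqP; rewrite eq_le zr/= (le_trans _ (normv_coord _ i))// zi normrN ger0_norm.
  have [l1 l2 l3] : [/\ l 1 z = 1, l 2 z = 1 & l 3 z = 1].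
    by rewrite /l z4; split; apply: unit_clamp_ge1; lra.
  have nx := thz1 z; rewrite z4 l3 mul1r opprB addrCA subrr addr0 in nx.
  have {}nx := nx (ler1n _ 4).
  have xi : (th z *: z) 0 i = - (r * e0).
    rewrite mxE zi /th z4 l3 max_r ?ler1n//; by field.
  rewrite /G /b l1 l2 !subrr !scale0r scale1r add0r f0 subr0.
  have := Hd (th z *: z) 0; rewrite !subr0 normr0 f0 subr0 mulmx1 nx => /(_ e0d d0) H.
  have := le_trans (normv_coord _ i) H; rewrite mxE [X in _ + X]mxE xi opprK ler_norml => /andP[_ h].
  have re0 : 0 < r * e0 by rewrite mulr_gt0.
  lra.
- have z4 : `|z| = 4.
    by apply/eqP; rewrite eq_le zr/= (le_trans _ (normv_coord _ i))// zi ger0_norm.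
  have [l1 l2 l3] : [/\ l 1 z = 1, l 2 z = 1 & l 3 z = 1].
    by rewrite /l z4; split; apply: unit_clamp_ge1; lra.
  have nx := thz1 z; rewrite z4 l3 mul1r opprB addrCA subrr addr0 in nx.
  have {}nx := nx (ler1n _ 4).
  have xi : (th z *: z) 0 i = r * e0.
    rewrite mxE zi /th z4 l3 max_r ?ler1n//; by field.
  rewrite /G /b l1 l2 !subrr !scale0r scale1r add0r f0 subr0.
  have := Hd (th z *: z) 0; rewrite !subr0 normr0 f0 subr0 mulmx1 nx => /(_ e0d d0) H.
  have := le_trans (normv_coord _ i) H; rewrite mxE [X in _ + X]mxE xi ler_norml => /andP[h _].
  have re0 : 0 < r * e0 by rewrite mulr_gt0.
  lra.
(* Each shell excludes a zero: up to norm 1 it would be a preimage of y; from 1 to 2 it would bring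
   the image of the sphere within eta of f w1; beyond 2, injectivity would equate two vectors of
   different norms. *)
move/eqP: Gz; rewrite subr_eq0 => /eqP fb.
have [z1|z1] := leP `|z| 1.
  apply: noy; exists (th z *: z); first exact: thr.
  rewrite fb /b (_ : l 1 z = 0) ?subr0 ?scale1r ?scale0r ?addr0//.
  by apply: unit_clamp_le0; rewrite subr_le0.
have nx := thz1 z (ltW z1).
have [z2|z2] := leP `|z| 2.
  have [l2 l3] : l 2 z = 0 /\ l 3 z = 0.
    by split; apply: unit_clamp_le0; lra.
  rewrite l3 mul0r subr0 mulr1 in nx.
  have := Heta _ nx; rewrite fb /b l2 subr0 scale1r leNgt => /negP; apply.
  rewrite (_ : _ - f w1 = (1 - l 1 z) *: (y - f w1)); last first.
    by apply/rowP => j; rewrite !mxE; ring.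
  have /andP[h1 h2] := l01 1 z.
  rewrite normrZ ger0_norm ?subr_ge0//; apply: le_lt_trans yeta.
  by rewrite ler_piMl// lerBlDr lerDl.
have l1 : l 1 z = 1 by apply: unit_clamp_ge1; lra.
rewrite /b l1 subrr scale0r add0r scale1r in fb.
have w1b' := le_lt_trans (w1b z) w1r.
have E := injf _ _ (thr z) (ltW w1b') fb.
have [z3|z3] := leP `|z| 3.
  have l3 : l 3 z = 0 by apply: unit_clamp_le0; lra.
  rewrite l3 mul0r subr0 mulr1 E in nx.
  by move: w1b'; rewrite nx ltxx.
have l2 : l 2 z = 1 by apply: unit_clamp_ge1; lra.
rewrite l2 subrr scale0r in E; rewrite E normr0 in nx.
have /andP[h1 h2] := l01 3 z.
have : 0 < r * (1 - l 3 z * (1 - e0)) by rewrite mulr_gt0//; nra.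
by rewrite -nx ltxx.
Qed.

End invariance.

Lemma leq_add_subl (a b c : nat) : (c <= b)%N -> (b <= a + (b - c))%N -> (c <= a)%N.
Proof.
by move=> cb; rewrite -{1}(subnKC cb) leq_add2r.
Qed.

(** * Regular points and invariance of domain *)

Section domain.
Context {R : realType}.

(** Linear algebra for [regular_dense]: E will be the projector [pid_mx k], dx a displacement along
    the curve and o its first-order remainder. *)
Lemma kernel_elim n (o dx : 'rV[R]_n) (B P Q E : 'M[R]_n) : Q *m E = 0 -> P *m E = P ->
  ((o + dx *m B) *m P + dx *m Q) *m E = 0 -> dx *m B *m P = - (o *m P).
Proof.
move=> QE PE; rewrite mulmxDl -[_ *m Q *m _]mulmxA QE mulmx0 addr0 !mulmxDl.
rewrite -(mulmxA o) -(mulmxA (dx *m B)) PE => /eqP.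
by rewrite addrC addr_eq0 => /eqP.
Qed.

Lemma kernel_elim2 n (o dx : 'rV[R]_n) (B P W : 'M[R]_n) : B = B *m P *m W ->
  dx *m B *m P = - (o *m P) -> dx *m B = - (o *m P *m W).
Proof. by move=> ES E0; rewrite {1}ES -mulNmx -E0 !mulmxA. Qed.

Lemma sdiff_continuous m k (f : 'rV[R]_m -> 'rV[R]_k) x A : sdiff f x A -> {for x, continuous f}.
Proof.
move=> /sdiff_lip[d d0 Hd]; apply/continuous_epsP => e e0.
have K0 : 0 < opn A + 1 by rewrite ltr_wpDl// opn_ge0.
exists (Num.min d (e / (opn A + 1))) => [|y]; first by rewrite lt_min d0 divr_gt0.
rewrite lt_min ltr_pdivlMr// => /andP[yd ye].
by rewrite (le_trans (Hd _ _ yd _)) ?subrr ?normr0// mulrC ltW.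
Qed.

Lemma sdiff_affine n (f : 'rV[R]_n -> 'rV[R]_n) c A (P Q : 'M[R]_n) (b : 'rV[R]_n) :
  sdiff f c A -> sdiff (fun x => f x *m P + x *m Q + b) c (A *m P + Q).
Proof.
move=> sf e e0; have K0 : 0 < opn P + 1 by rewrite ltr_wpDl// opn_ge0.
have [d d0 Hd] := sf _ (divr_gt0 e0 K0); exists d => // y z yd zd.
rewrite (_ : _ - _ = (f y - f z - (y - z) *m A) *m P).
  apply: le_trans (normv_mul _ _) _; rewrite mulrC.
  have := Hd y z yd zd; rewrite mulrAC -ler_pdivrMr ?invr_gt0// invrK => h.
  by apply: le_trans h; rewrite ler_wpM2l// lerDl.
rewrite !mulmxDr !mulmxBl ?mulmxA.
move: (y *m A *m P) (z *m A *m P) (f y *m P) (f z *m P) (y *m Q) (z *m Q) => ? ? ? ? ? ?.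
by apply/rowP => j; rewrite !mxE; ring.
Qed.

Lemma sdiff_unit_lb n (f : 'rV[R]_n -> 'rV[R]_n) c A : sdiff f c A -> A \in unitmx ->
  exists2 C, 0 < C & exists2 d, 0 < d & forall y z : 'rV[R]_n, `|y - c| < d -> `|z - c| < d ->
    `|y - z| <= C * `|f y - f z|.
Proof.
move=> sf uA; pose C := opn (invmx A) + 1.
have C0 : 0 < C by rewrite ltr_wpDl// opn_ge0.
have c20 : 0 < C^-1 / 2 by rewrite divr_gt0// invr_gt0.
have [d d0 Hd] := sf _ c20.
exists (2 * C); first by rewrite mulr_gt0.
exists d => // y z yd zd.
have h1 : `|y - z| <= C * `|(y - z) *m A|.
  rewrite -{1}[y - z](mulmxK uA) (le_trans (normv_mul _ _))// ler_wpM2r// lerDl//.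
have h2 : `|(y - z) *m A| <= `|f y - f z| + C^-1 / 2 * `|y - z|.
  have := Hd y z yd zd; move: (_ *m _) (f y - f z) => u v h.
  by rewrite -[u](subKr v) (le_trans (ler_normB _ _))// lerD2l.
have h3 : C * (C^-1 / 2 * `|y - z|) = `|y - z| / 2 by field; rewrite gt_eqF.
have h4 : C * `|(y - z) *m A| <= C * (`|f y - f z| + C^-1 / 2 * `|y - z|) by rewrite ler_wpM2l// ltW.
move: h4; rewrite mulrDr h3 => h4; rewrite -mulrA; lra.
Qed.

Lemma open_of_regular n (f : 'rV[R]_n -> 'rV[R]_n) (c w : 'rV[R]_n) A r : 0 < r ->
  (forall x : 'rV[R]_n, `|x - c| <= r -> {for x, continuous f}) ->
  (forall x y : 'rV[R]_n, `|x - c| <= r -> `|y - c| <= r -> f x = f y -> x = y) ->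
  sdiff f c A -> A \in unitmx -> `|w - c| < r ->
  exists2 e, 0 < e & forall y : 'rV[R]_n, `|y - f w| < e -> exists2 x, `|x - c| <= r & f x = y.
Proof.
move=> r0 cf injf sf uA wc.
pose g (x : 'rV[R]_n) : 'rV[R]_n := (f (x + c) - f c) *m invmx A.
have gK x : f (x + c) = g x *m A + f c by rewrite /g mulmxKV// subrK.
have [|||||e e0 He] := @open_of_regular0 R n g (w - c) r r0.
- move=> x xr.
  apply: (@continuous_comp _ _ _ (fun x : 'rV[R]_n => f (x + c) - f c) (fun v : 'rV[R]_n => v *m invmx A)).
    apply: continuousB; last exact: cst_continuous.
    apply: (@continuous_comp _ _ _ (fun x : 'rV[R]_n => x + c) f).
      by apply: continuousD; [|exact: cst_continuous].
    by apply: cf; rewrite addrK.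
  by apply: (@lip_continuous _ _ _ _ (opn (invmx A))) => u v; rewrite -mulmxBl normv_mul.
- move=> x y xr yr gxy; apply: (addIr c); apply: injf; rewrite ?addrK//.
  by rewrite !gK gxy.
- by rewrite /g add0r subrr mul0mx.
- have := sdiff_affine (invmx A) 0 (- f c *m invmx A) sf; rewrite addr0 mulmxV// => h e /h[d d0 Hd].
  exists d => // y z; rewrite !subr0 => yd zd; have := Hd (y + c) (z + c).
  rewrite !addrK => /(_ yd zd).
  rewrite (_ : y + c - (z + c) = y - z); last by apply/rowP => j; rewrite !mxE; ring.
  by rewrite !mulmx0 !addr0 -!mulmxDl.
- exact: wc.
- exists (e / (opn (invmx A) + 1)) => [|y yw].
    by rewrite divr_gt0// ltr_wpDl// opn_ge0.
  have [|x xr gx] := He ((y - f c) *m invmx A).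
    rewrite /g subrK -mulmxBl opprB addrA subrK.
    apply: le_lt_trans (normv_mul _ _) _.
    move: yw; rewrite ltr_pdivlMr ?ltr_wpDl ?opn_ge0// mulrC; apply: le_lt_trans.
    by rewrite ler_wpM2r// lerDl.
  exists (x + c); first by rewrite addrK.
  by rewrite gK gx mulmxKV// subrK.
Qed.

Lemma unitmx_near n (A : 'M[R]_n) : A \in unitmx -> exists2 e, 0 < e &
  forall B : 'M[R]_n, (forall v : 'rV[R]_n, `|v *m B - v *m A| <= e * `|v|) -> B \in unitmx.
Proof.
move=> uA; pose C := opn (invmx A) + 1.
have C0 : 0 < C by rewrite ltr_wpDl// opn_ge0.
exists (C^-1 / 2) => [|B HB]; first by rewrite divr_gt0// invr_gt0.
rewrite -row_free_unit -kermx_eq0; apply/eqP/row_matrixP => i; rewrite row0.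
set v := row i _.
have vB : v *m B = 0 by apply/eqP; rewrite -sub_kermx row_sub.
have := HB v; rewrite vB sub0r normrN => h.
have h1 : `|v| <= C * `|v *m A|.
  by rewrite -{1}[v](mulmxK uA) (le_trans (normv_mul _ _))// ler_wpM2r// lerDl.
have h2 : C * `|v *m A| <= C * (C^-1 / 2 * `|v|) by rewrite ler_wpM2l// ltW.
have h3 : C * (C^-1 / 2 * `|v|) = `|v| / 2 by field; rewrite gt_eqF.
apply/eqP; rewrite -normr_le0; lra.
Qed.

(* Where the rank of the derivative is locally maximal but not full, f is constant along
   some nontrivial curve. *)
Lemma regular_dense n (f : 'rV[R]_n -> 'rV[R]_n) (Df : 'rV[R]_n -> 'M[R]_n) w r : 0 < r ->
  (forall x : 'rV[R]_n, `|x - w| < r -> sdiff f x (Df x)) ->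
  (forall x y : 'rV[R]_n, `|x - w| < r -> `|y - w| < r -> f x = f y -> x = y) ->
  exists2 x : 'rV[R]_n, `|x - w| < r & Df x \in unitmx.
Proof.
move=> r0 sf injf.
pose S (k : nat) := exists2 x : 'rV[R]_n, `|x - w| < r & \rank (Df x) = k.
have [k [x0 x0w rk] kmax] : exists2 k, S k & forall j, S j -> (j <= k)%N.
  have exS : exists k, `[< S k >].
    by exists (\rank (Df w)); apply/asboolP; exists w; rewrite ?subrr ?normr0.
  have bnd j : `[< S j >] -> (j <= n)%N by move=> /asboolP[x _ <-]; exact: rank_leq_row.
  case: (ex_maxnP exS bnd) => k /asboolP Sk kmax.
  by exists k => // j Sj; apply: kmax; apply/asboolP.
have rk_le x : `|x - w| < r -> (\rank (Df x) <= k)%N by move=> xw; apply: kmax; exists x.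
have [kn|kn] := leqP n k.
  by exists x0 => //; rewrite -row_free_unit /row_free rk eqn_leq kn -rk rank_leq_row.
exfalso.
set A := Df x0 in rk.
pose L := col_ebase A; pose U := row_ebase A.
have AE : A = L *m pid_mx k *m U by rewrite -rk mulmx_ebase.
have uL : L \in unitmx by exact: col_ebase_unit.
have uU : U \in unitmx by exact: row_ebase_unit.
(* In bases adapted to the derivative A at x0, G keeps the first k coordinates of f and completes
   them with linear ones, so that its derivative at x0 is the invertible matrix L. *)
pose P : 'M[R]_n := invmx U *m pid_mx k; pose Q : 'M[R]_n := L *m copid_mx k.
pose G (x : 'rV[R]_n) : 'rV[R]_n := f x *m P + x *m Q + 0.
have pp : (pid_mx k : 'M[R]_n) *m (pid_mx k : 'M[R]_n) = pid_mx k by rewrite pid_mx_id// ltnW.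
have LE : A *m P + Q = L.
  rewrite AE /P /Q mulmxA mulmxK// -!mulmxA pp -mulmxDr.
  by rewrite /copid_mx addrC subrK mulmx1.
have sG x : `|x - w| < r -> sdiff G x (Df x *m P + Q) by move=> /sf h; exact: sdiff_affine.
have uG : Df x0 *m P + Q \in unitmx by rewrite LE.
have [C C0 [d d0 Hd]] := sdiff_unit_lb (sG _ x0w) uG.
have [eu eu0 Heu] := unitmx_near uL.
have := sdiff_close (sG _ x0w) eu0; rewrite LE => -[d1 d10 Hd1].
pose rho := Num.min (Num.min d d1) (r - `|x0 - w|) / 2.
have rho20 : 0 < Num.min (Num.min d d1) (r - `|x0 - w|) by rewrite !lt_min d0 d10 subr_gt0.
have rho0 : 0 < rho by rewrite divr_gt0.
have nearx x : `|x - x0| <= rho -> [/\ `|x - x0| < d, `|x - x0| < d1 & `|x - w| < r].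
  move=> h; have : `|x - x0| < Num.min (Num.min d d1) (r - `|x0 - w|).
    by apply: le_lt_trans h _; rewrite /rho ltr_pdivrMr// ltr_pMr// ltr1n.
  rewrite !lt_min => /andP[/andP[-> ->] h2]; split=> //.
  by rewrite -[x](subrK x0) -addrA (le_lt_trans (ler_normD _ _))// -ltrBrDr.
have [|||||e e0 He] := @open_of_regular n G x0 x0 L rho rho0.
- by move=> x /nearx[_ _ xw]; exact: sdiff_continuous (sG _ xw).
- move=> x y /nearx[xd _ _] /nearx[yd _ _] Gxy; apply/eqP; rewrite -subr_eq0 -normr_le0.
  by have := Hd _ _ xd yd; rewrite Gxy subrr normr0 mulr0.
- by rewrite -LE; exact: sG.
- by [].
- by rewrite subrr normr0.
(* A direction killed by [pid_mx k]: along the preimage by G of the segment [G x0 + t *: u], the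
   first k coordinates of f are constant. *)
pose u : 'rV[R]_n := delta_mx 0 (Ordinal kn).
have u_pid : u *m (pid_mx k : 'M[R]_n) = 0.
  apply/rowP => j; rewrite !mxE big1// => i _; rewrite !mxE /=.
  by case: (i =P Ordinal kn) => [->|_]; rewrite ?mul0r//= ltnn andbF mulr0.
have Nu : `|u| <= 1 by apply: normv_le => // j; rewrite mxE; case: andP; rewrite ?normr0 ?normr1.
have /choice[x Hx] : forall t : R, exists y : 'rV[R]_n, `|t| < e -> `|y - x0| <= rho /\ G y = G x0 + t *: u.
  move=> t; have [te|] := boolP (`|t| < e); last by exists 0.
  have [|y yr Gy] := He (G x0 + t *: u); last by exists y.
  by rewrite addrC addKr normrZ (le_lt_trans _ te)// ler_piMr.
have xlip t s : `|t| < e -> `|s| < e -> `|x t - x s| <= C * `|t - s|.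
  move=> te se; have [/nearx[h1 _ _] E1] := Hx t te; have [/nearx[h2 _ _] E2] := Hx s se.
  apply: le_trans (Hd _ _ h1 h2) _; rewrite ler_wpM2l ?(ltW C0)// E1 E2.
  rewrite opprD addrACA subrr add0r -scalerBl normrZ ler_piMr//.
have dh t : `|t| < e -> vder (fun s => f (x s)) t 0.
  move=> te; have [xr Gt] := Hx t te; have [_ h2 xw] := nearx _ xr.
  set B := Df (x t).
  have uM : B *m P + Q \in unitmx.
    by apply: Heu => v; apply: (Hd1 (x t)) => //; exact: sG.
  have rQ : (\rank Q <= n - k)%N.
    by rewrite /Q -(rank_copid_mx R (ltnW kn)) mxrankM_maxr.
  have rBP : (k <= \rank (B *m P))%N.
    have := mxrank_add (B *m P) Q; rewrite mxrank_unit// => h.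
    have := leq_trans h (leq_add (leqnn _) rQ).
    exact: leq_add_subl (ltnW kn).
  have [W ES] : exists W : 'M[R]_n, B = B *m P *m W.
    have : ((B^T) <= (B *m P)^T)%MS.
      have h : ((B *m P)^T <= B^T)%MS by rewrite trmx_mul submxMl.
      rewrite -(mxrank_leqif_sup h) !mxrank_tr eqn_leq mxrankM_maxl/=.
      by rewrite (leq_trans _ rBP)// rk_le.
    move=> /submxP[D ED]; exists D^T.
    by rewrite -[LHS]trmxK ED trmx_mul trmxK.
  apply/vder_epsP => e1 e10.
  pose K := (opn W + 1) * (opn P + 1) + 1.
  have K0 : 0 < K by rewrite ltr_wpDl// mulr_ge0// addr_ge0// opn_ge0.
  have e2 : 0 < e1 / K / C by rewrite !divr_gt0.
  have [d2 d20 Hd2] := sf _ xw _ e2.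
  exists (Num.min (e - `|t|) (d2 / C)) => [|s]; first by rewrite lt_min subr_gt0 te divr_gt0.
  rewrite lt_min => /andP[st1 st2].
  have se : `|s| < e.
    by rewrite -[s](subrK t) (le_lt_trans (ler_normD _ _))// -ltrBrDr.
  have [_ Gs] := Hx s se.
  have xst := xlip _ _ se te.
  have xd2 : `|x s - x t| < d2 by apply: le_lt_trans xst _; rewrite mulrC -ltr_pdivlMr.
  have := Hd2 (x s) (x t) xd2; rewrite subrr normr0 => /(_ d20).
  set o := f (x s) - f (x t) - _ => ho.
  have E0 : (x s - x t) *m B *m P = - (o *m P).
    have : (G (x s) - G (x t)) *m (pid_mx k : 'M[R]_n) = 0.
      by rewrite Gs Gt opprD addrACA subrr add0r -scalerBl -scalemxAl u_pid scaler0.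
    have -> : G (x s) - G (x t) = (f (x s) - f (x t)) *m P + (x s - x t) *m Q.
      rewrite /G !mulmxBl; move: (f (x s) *m P) (f (x t) *m P) (x s *m Q) (x t *m Q) => ? ? ? ?.
      by apply/rowP => j; rewrite !mxE; ring.
    have -> : f (x s) - f (x t) = o + (x s - x t) *m B by rewrite /o subrK.
    have Qp : Q *m (pid_mx k : 'M[R]_n) = 0.
      by rewrite /Q /copid_mx -mulmxA mulmxBl mul1mx pp subrr mulmx0.
    have Pp : P *m (pid_mx k : 'M[R]_n) = P by rewrite /P -mulmxA pp.
    exact: kernel_elim.
  have E1 : (x s - x t) *m B = - (o *m P *m W).
    exact: kernel_elim2.
  rewrite scaler0 subr0 (_ : f (x s) - f (x t) = o - o *m P *m W); last first.
    by rewrite -E1 /o subrK.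
  apply: (@le_trans _ _ (K * `|o|)).
    rewrite (le_trans (ler_normB _ _))// /K mulrDl mul1r addrC lerD//.
    rewrite (le_trans (normv_mul _ _))// -mulrA ler_pM ?opn_ge0 ?lerDl//.
    by rewrite (le_trans (normv_mul _ _))// ler_wpM2r// lerDl.
  apply: (@le_trans _ _ (K * (e1 / K / C * (C * `|s - t|)))).
    rewrite ler_wpM2l ?(ltW K0)// (le_trans ho)// ler_wpM2l//; exact: ltW.
  by rewrite le_eqVlt; apply/orP; left; apply/eqP; field; rewrite !gt_eqF.
have e2 : `|e / 2| < e by rewrite gtr0_norm ?divr_gt0// ltr_pdivrMr// ltr_pMr// ltr1n.
have z0 : `|0 : R| < e by rewrite normr0.
have := @vmvt0 R n (fun s => f (x s)) (fun=> 0) (e / 2) 0.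
rewrite mul0r => Hmvt.
have ff : f (x (e / 2)) = f (x 0).
  apply/eqP; rewrite -subr_eq0 -normr_le0; apply: Hmvt => s se; last by rewrite normr0.
  by apply: dh; exact: le_lt_trans e2.
have [/nearx[_ _ h1] G1] := Hx _ e2; have [/nearx[_ _ h2] G2] := Hx _ z0.
have E := injf _ _ h1 h2 ff.
have : (e / 2) *: u = 0.
  by apply: (addrI (G x0)); rewrite -G1 E G2 scale0r.
move=> /rowP/(_ (Ordinal kn)); rewrite !mxE !eqxx mulr1 => /eqP.
by rewrite gt_eqF// divr_gt0.
Qed.

(** The derivative may be singular at w, so the topological argument is centred at a regular point c
    close to w; it reaches the value f w because w lies in the ball of radius r / 2 around c. *)
Theorem invariance_of_domain n (f : 'rV[R]_n -> 'rV[R]_n) (Df : 'rV[R]_n -> 'M[R]_n) w r : 0 < r ->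
  (forall x : 'rV[R]_n, `|x - w| < r -> sdiff f x (Df x)) ->
  (forall x y : 'rV[R]_n, `|x - w| < r -> `|y - w| < r -> f x = f y -> x = y) ->
  exists2 e, 0 < e & forall y : 'rV[R]_n, `|y - f w| < e -> exists2 x, `|x - w| < r & f x = y.
Proof.
move=> r0 sf injf.
have r4 : r / 4 < r by rewrite ltr_pdivrMr// ltr_pMr// ltr1n.
have [x|x y|c cw uc] := @regular_dense n f Df w (r / 4) (divr_gt0 r0 (ltr0Sn _ _)).
- by move=> h; apply: sf; exact: lt_trans r4.
- by move=> h1 h2; apply: injf; exact: lt_trans r4.
have nw x : `|x - c| <= r / 2 -> `|x - w| < r.
  move=> h; rewrite -[x](subrK c) -addrA (le_lt_trans (ler_normD _ _))//; lra.
have [|x /nw xw|x y /nw xw /nw yw||||e e0 He] := @open_of_regular n f c w (Df c) (r / 2).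
- by rewrite divr_gt0.
- exact: sdiff_continuous (sf _ xw).
- exact: injf.
- by apply: sf; exact: lt_trans r4.
- by [].
- by rewrite distrC (lt_trans cw)// ltr_pM2l// ltf_pV2 ?posrE// ltr_nat.
by exists e => // y /He[x /nw xw fx]; exists x.
Qed.

(** Continuity of the inverse is a hypothesis here; for the inverse of exp it will come from
    invariance of domain. *)
Lemma sdiff_inverse n (f g : 'rV[R]_n -> 'rV[R]_n) y0 A d : sdiff f (g y0) A -> A \in unitmx ->
  0 < d -> (forall y, `|y - y0| < d -> f (g y) = y) -> {for y0, continuous g} ->
  sdiff g y0 (invmx A).
Proof.
move=> sf uA d0 fg /continuous_epsP cg.
have [C C0 [d1 d10 Hd1]] := sdiff_unit_lb sf uA.
move=> e e0; pose K := opn (invmx A) + 1.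
have K0 : 0 < K by rewrite ltr_wpDl// opn_ge0.
have [d2 d20 Hd2] := sf (e / C / K) (divr_gt0 (divr_gt0 e0 C0) K0).
have m0 : 0 < Num.min d1 d2 by rewrite lt_min d10.
have [d3 d30 Hd3] := cg (Num.min d1 d2 / 2) (divr_gt0 m0 (ltr0Sn _ _)).
have gd y : `|y - y0| < d3 -> `|g y - g y0| < Num.min d1 d2.
  by move=> /Hd3/le_lt_trans; apply; rewrite ltr_pdivrMr// ltr_pMr// ltr1n.
exists (Num.min d d3) => [|y z]; first by rewrite lt_min d0.
rewrite !lt_min => /andP[yd /gd + ] /andP[zd /gd]; rewrite !lt_min => /andP[y1 y2] /andP[z1 z2].
have h1 := Hd1 _ _ y1 z1; have h2 := Hd2 _ _ y2 z2.
rewrite (fg _ yd) (fg _ zd) in h1 h2.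
rewrite (_ : _ - _ = - ((y - z - (g y - g z) *m A) *m invmx A)); last first.
  by rewrite [in RHS]mulmxBl mulmxK// opprB.
rewrite normrN (le_trans (normv_mul _ _))//.
apply: (@le_trans _ _ (K * (e / C / K * (C * `|y - z|)))).
  apply: ler_pM; rewrite ?opn_ge0// ?lerDl// (le_trans h2)// ler_wpM2l// divr_ge0 ?(ltW K0)// divr_ge0// ltW//.
by rewrite le_eqVlt; apply/orP; left; apply/eqP; field; rewrite !gt_eqF.
Qed.

End domain.

(** * Smooth functions and bilinear forms *)

Section gradients.
Context {R : realType}.

Lemma sdR_near m (f g : 'rV[R]_m -> R) x l d : 0 < d -> (forall y : 'rV[R]_m, `|y - x| < d -> f y = g y) ->
  sdR f x l -> sdR g x l.
Proof.
move=> d0 fg [C H]; split=> // e /H[d' d'0 Hd]; exists (Num.min d d') => [|y z].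
  by rewrite lt_min d0.
by rewrite !lt_min => /andP[y1 y2] /andP[z1 z2]; rewrite -!fg//; exact: Hd.
Qed.

Lemma sdR_eq m (f : 'rV[R]_m -> R) x l l' : l =1 l' -> sdR f x l -> sdR f x l'.
Proof. by move=> /funext ->. Qed.

Lemma sdR_cst m (c : R) x : sdR (fun _ : 'rV[R]_m => c) x (fun=> 0).
Proof.
split; first by exists 1 => // b; rewrite normr0 mul1r.
by move=> e e0; exists 1 => // y z _ _; rewrite !subrr normr0 mulr_ge0// ltW.
Qed.

Lemma sdR_lin m (l : 'rV[R]_m -> R) x : (exists2 C, 0 < C & forall b : 'rV[R]_m, `|l b| <= C * `|b|) ->
  (forall y z, l (y - z) = l y - l z) -> sdR l x l.
Proof.
move=> H lB; split => // e e0; exists 1 => // y z _ _.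
by rewrite lB subrr normr0 mulr_ge0// ltW.
Qed.

Lemma sdR_add m (f g : 'rV[R]_m -> R) x lf lg : sdR f x lf -> sdR g x lg ->
  sdR (fun y => f y + g y) x (fun b => lf b + lg b).
Proof.
move=> [[C C0 Cf] Hf] [[D D0 Dg] Hg]; split.
  exists (C + D) => [|b]; first by rewrite addr_gt0.
  by rewrite mulrDl (le_trans (ler_normD _ _))// lerD.
move=> e e0; have e2 : 0 < e / 2 by rewrite divr_gt0.
have [d d0 Hd] := Hf _ e2; have [d' d'0 Hd'] := Hg _ e2.
exists (Num.min d d') => [|y z]; first by rewrite lt_min d0.
rewrite !lt_min => /andP[y1 y2] /andP[z1 z2].
have := Hd _ _ y1 z1; have := Hd' _ _ y2 z2.
move=> h1 h2; rewrite (_ : _ - _ - _ = (f y - f z - lf (y - z)) + (g y - g z - lg (y - z))); last by ring.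
rewrite (le_trans (ler_normD _ _))//; lra.
Qed.

Lemma sdR_lip m (f : 'rV[R]_m -> R) x l : sdR f x l -> exists2 K, 0 < K & exists2 d, 0 < d &
  forall y z, `|y - x| < d -> `|z - x| < d -> `|f y - f z| <= K * `|y - z|.
Proof.
move=> [[C C0 Cf] /(_ 1 ltr01)[d d0 Hd]]; exists (1 + C); first by rewrite addr_gt0.
exists d => // y z yd zd; rewrite -[f y - f z](subrK (l (y - z))) mulrDl.
by rewrite (le_trans (ler_normD _ _))// lerD// Hd.
Qed.

Lemma sdR_continuous m (f : 'rV[R]_m -> R) x l : sdR f x l -> {for x, continuous f}.
Proof.
move=> /sdR_lip[K K0 [d d0 Hd]]; apply/continuous_epsP => e e0.
exists (Num.min d (e / K)) => [|y]; first by rewrite lt_min d0 divr_gt0.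
rewrite lt_min ltr_pdivlMr// => /andP[yd ye].
by rewrite (le_trans (Hd _ _ yd _)) ?subrr ?normr0// mulrC ltW.
Qed.

Lemma sdR_mul m (f g : 'rV[R]_m -> R) x lf lg : sdR f x lf -> sdR g x lg ->
  sdR (fun y => f y * g y) x (fun b => f x * lg b + g x * lf b).
Proof.
move=> sf sg; have [K K0 [r r0 HK]] := sdR_lip sg; have [L L0 [r' r'0 HL]] := sdR_lip sf.
have /continuous_epsP cf := sdR_continuous sf.
have /continuous_epsP cg := sdR_continuous sg.
move: (sf) (sg) => [[C C0 Cf] Hf] [[D D0 Dg] Hg]; split.
  exists (`|f x| * D + `|g x| * C + 1) => [|b].
    by rewrite ltr_wpDl// addr_ge0// mulr_ge0// ltW.
  have h1 := Cf b; have h2 := Dg b; rewrite !mulrDl mul1r.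
  rewrite (le_trans (ler_normD _ _))// !normrM.
  have a1 : `|f x| * `|lg b| <= `|f x| * D * `|b| by rewrite -mulrA ler_wpM2l.
  have a2 : `|g x| * `|lf b| <= `|g x| * C * `|b| by rewrite -mulrA ler_wpM2l.
  have := normr_ge0 b; lra.
move=> e e0.
pose e1 := e / 4 / (`|f x| + 1); pose e2 := e / 4 / (`|g x| + 1).
pose e3 := e / 4 / K; pose e4 := e / 4 / L.
have [p1 p2 p3 p4] : [/\ 0 < e1, 0 < e2, 0 < e3 & 0 < e4].
  by split; rewrite !divr_gt0// ltr_wpDl.
have [d1 d10 H1] := Hg _ p1; have [d2 d20 H2] := Hf _ p2.
have [d3 d30 H3] := cf _ p3; have [d4 d40 H4] := cg _ p4.
exists (Num.min r (Num.min r' (Num.min d1 (Num.min d2 (Num.min d3 d4))))) => [|y z].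
  by rewrite !lt_min r0 r'0 d10 d20 d30.
rewrite !lt_min => /andP[yr /and5P[yr' y1 y2 y3 y4]] /andP[zr /and5P[zr' z1 z2 z3 z4]].
set b := y - z.
have -> : f y * g y - f z * g z - (f x * lg b + g x * lf b) =
  f x * (g y - g z - lg b) + (f y - f x) * (g y - g z) + g x * (f y - f z - lf b) + (g z - g x) * (f y - f z).
  by ring.
have b0 := normr_ge0 b.
have q1 : `|f x * (g y - g z - lg b)| <= e / 4 * `|b|.
  rewrite normrM (le_trans (ler_wpM2l (normr_ge0 _) (H1 _ _ y1 z1)))// -/b mulrA ler_wpM2r//.
  by rewrite /e1 mulrA ler_pdivrMr ?ltr_wpDl// mulrC ler_wpM2l ?lerDl// divr_ge0// ltW.
have q2 : `|(f y - f x) * (g y - g z)| <= e / 4 * `|b|.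
  rewrite normrM (le_trans (ler_pM (normr_ge0 _) (normr_ge0 _) (H3 _ y3) (HK _ _ yr zr)))// -/b mulrA.
  by rewrite /e3 divfK// gt_eqF.
have q3 : `|g x * (f y - f z - lf b)| <= e / 4 * `|b|.
  rewrite normrM (le_trans (ler_wpM2l (normr_ge0 _) (H2 _ _ y2 z2)))// -/b mulrA ler_wpM2r//.
  by rewrite /e2 mulrA ler_pdivrMr ?ltr_wpDl// mulrC ler_wpM2l ?lerDl// divr_ge0// ltW.
have q4 : `|(g z - g x) * (f y - f z)| <= e / 4 * `|b|.
  rewrite normrM (le_trans (ler_pM (normr_ge0 _) (normr_ge0 _) (H4 _ z4) (HL _ _ yr' zr')))// -/b mulrA.
  by rewrite /e4 divfK// gt_eqF.
rewrite (le_trans (ler_normD _ _))// (le_trans (lerD (ler_normD _ _) (lexx _)))//.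
rewrite (le_trans (lerD (lerD (ler_normD _ _) (lexx _)) (lexx _)))//; lra.
Qed.

Lemma sdR_inv m (f : 'rV[R]_m -> R) x l : f x != 0 -> sdR f x l ->
  sdR (fun y => (f y)^-1) x (fun b => - (l b / f x ^+ 2)).
Proof.
move=> fx sf; have [K K0 [r r0 HK]] := sdR_lip sf.
have cf := sdR_continuous sf.
have /continuous_epsP ci : {for x, continuous (fun y => (f y)^-1)}.
  by apply: (@continuous_comp _ _ _ f (fun y => y^-1)) => //; exact: inv_continuous.
have f2 : 0 < f x ^+ 2 by rewrite exprn_even_gt0.
move: (sf) => [[C C0 Cf] Hf]; split.
  exists (C / f x ^+ 2) => [|b]; first by rewrite divr_gt0.
  by rewrite normrN normrM normfV (gtr0_norm f2) mulrAC ler_pM2r ?invr_gt0.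
move=> e e0.
set M := `|(f x)^-1| + 1; have M0 : 0 < M by rewrite ltr_wpDl.
pose e1 := e / 2 * f x ^+ 2; pose e2 := e / 4 / M / K.
have [p1 p2] : 0 < e1 /\ 0 < e2 by rewrite mulr_gt0 ?divr_gt0.
have [d1 d10 H1] := Hf _ p1; have [d2 d20 H2] := ci _ p2; have [d3 d30 H3] := ci _ ltr01.
have [d4 d40 H4] : exists2 d, 0 < d & forall y : 'rV[R]_m, `|y - x| < d -> f y != 0.
  have fx0 : 0 < `|f x| / 2 by rewrite divr_gt0// normr_gt0.
  have /continuous_epsP/(_ _ fx0)[d d0 Hd] := cf; exists d => // y /Hd.
  apply: contraTneq => ->; rewrite sub0r normrN -ltNge ltr_pdivrMr// ltr_pMr ?ltr1n// normr_gt0//.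
exists (Num.min r (Num.min d1 (Num.min d2 (Num.min d3 d4)))) => [|y z].
  by rewrite !lt_min r0 d10 d20 d30.
rewrite !lt_min => /and5P[yr y1 y2 y3 y4] /and5P[zr z1 z2 z3 z4].
have fy := H4 _ y4; have fz := H4 _ z4.
set b := y - z.
have -> : (f y)^-1 - (f z)^-1 - - (l b / f x ^+ 2) = - ((f y - f z - l b) / f x ^+ 2) -
   (f y - f z) * ((f y)^-1 * ((f z)^-1 - (f x)^-1) + (f x)^-1 * ((f y)^-1 - (f x)^-1)).
  by field; rewrite fx fy.
have b0 := normr_ge0 b.
have q1 : `|- ((f y - f z - l b) / f x ^+ 2)| <= e / 2 * `|b|.
  rewrite normrN normrM normfV (gtr0_norm f2) ler_pdivrMr// mulrAC.
  exact: H1.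
have My : `|(f y)^-1| <= M.
  by rewrite -[(f y)^-1](subrK (f x)^-1) (le_trans (ler_normD _ _))// addrC lerD2l H3.
have q2 : `|(f y)^-1 * ((f z)^-1 - (f x)^-1) + (f x)^-1 * ((f y)^-1 - (f x)^-1)| <= M * e2 + M * e2.
  rewrite (le_trans (ler_normD _ _))// !normrM lerD// ler_pM// ?H2//.
  by rewrite lerDl.
have q3 : `|(f y - f z) * ((f y)^-1 * ((f z)^-1 - (f x)^-1) + (f x)^-1 * ((f y)^-1 - (f x)^-1))| <= e / 2 * `|b|.
  rewrite normrM (le_trans (ler_pM (normr_ge0 _) (normr_ge0 _) (HK _ _ yr zr) q2))//.
  by rewrite le_eqVlt; apply/orP; left; apply/eqP; rewrite /e2 -/b; field; rewrite !gt_eqF.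
by rewrite (le_trans (ler_normB _ _))//; lra.
Qed.

Definition dotv m (b a : 'rV[R]_m) : R := \sum_j b 0 j * a 0 j.

Lemma dotvD m (b a a' : 'rV[R]_m) : dotv b (a + a') = dotv b a + dotv b a'.
Proof. by rewrite /dotv -big_split/=; apply: eq_bigr => j _; rewrite mxE mulrDr. Qed.

Lemma dotvZ m c (b a : 'rV[R]_m) : dotv b (c *: a) = c * dotv b a.
Proof. by rewrite /dotv mulr_sumr; apply: eq_bigr => j _; rewrite mxE mulrCA. Qed.

Lemma dotv0 m (b : 'rV[R]_m) : dotv b 0 = 0.
Proof. by rewrite /dotv big1// => j _; rewrite mxE mulr0. Qed.

Lemma dotvDl m (b b' a : 'rV[R]_m) : dotv (b + b') a = dotv b a + dotv b' a.
Proof. by rewrite /dotv -big_split/=; apply: eq_bigr => j _; rewrite mxE mulrDl. Qed.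

Lemma dotvZl m c (b a : 'rV[R]_m) : dotv (c *: b) a = c * dotv b a.
Proof. by rewrite /dotv mulr_sumr; apply: eq_bigr => j _; rewrite mxE mulrA. Qed.

Lemma dotv_delta m (a : 'rV[R]_m) j : dotv (delta_mx 0 j) a = a 0 j.
Proof.
rewrite /dotv (bigD1 j)//= mxE !eqxx mul1r big1 ?addr0// => k kj.
by rewrite mxE (negbTE kj) andbF mul0r.
Qed.

Lemma dotv_lip m (a : 'rV[R]_m) : exists2 C, 0 < C & forall b : 'rV[R]_m, `|dotv b a| <= C * `|b|.
Proof.
exists (\sum_j `|a 0 j| + 1) => [|b]; first by rewrite ltr_wpDl// sumr_ge0.
rewrite mulrDl mul1r ler_wpDr// mulr_suml (le_trans (ler_norm_sum _ _ _))// ler_sum// => j _.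
by rewrite normrM mulrC ler_wpM2l// normv_coord.
Qed.

Definition sg m (f : 'rV[R]_m -> R) x (a : 'rV[R]_m) := sdR f x (fun b => dotv b a).

(** The existential form is closed under algebraic operations without tracking derivatives; [sdP]
    recovers the derivative as the gradient. *)
Definition sd m (f : 'rV[R]_m -> R) x := exists a, sg f x a.

Lemma sd_cst m c (x : 'rV[R]_m) : sd (fun=> c) x.
Proof.
exists 0; apply: sdR_eq (sdR_cst c x) => b; by rewrite dotv0.
Qed.

Lemma sd_add m (f g : 'rV[R]_m -> R) x : sd f x -> sd g x -> sd (fun y => f y + g y) x.
Proof.
move=> [a sa] [b sb]; exists (a + b); apply: sdR_eq (sdR_add sa sb) => v.
by rewrite dotvD.
Qed.

Lemma sd_mul m (f g : 'rV[R]_m -> R) x : sd f x -> sd g x -> sd (fun y => f y * g y) x.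
Proof.
move=> [a sa] [b sb]; exists (f x *: b + g x *: a); apply: sdR_eq (sdR_mul sa sb) => v.
by rewrite dotvD !dotvZ.
Qed.

Lemma sd_inv m (f : 'rV[R]_m -> R) x : f x != 0 -> sd f x -> sd (fun y => (f y)^-1) x.
Proof.
move=> fx [a sa]; exists (- (f x ^+ 2)^-1 *: a); apply: sdR_eq (sdR_inv fx sa) => v.
by rewrite dotvZ mulNr mulrC.
Qed.

Lemma sd_near m (f g : 'rV[R]_m -> R) x d : 0 < d -> (forall y : 'rV[R]_m, `|y - x| < d -> f y = g y) ->
  sd f x -> sd g x.
Proof. by move=> d0 fg [a sa]; exists a; exact: (sdR_near d0 fg sa). Qed.

Lemma sd_sum m (I : Type) (r : seq I) (P : pred I) (f : I -> 'rV[R]_m -> R) x :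
  (forall i, sd (f i) x) -> sd (fun y => \sum_(i <- r | P i) f i y) x.
Proof.
move=> H; elim: r => [|i r IH].
  by rewrite (_ : (fun _ => _) = fun=> 0); [exact: sd_cst|apply/funext => y; rewrite big_nil].
rewrite (_ : (fun _ => _) = fun y => (if P i then f i y else 0) + \sum_(i <- r | P i) f i y).
  apply: sd_add => //; case: (P i); [exact: H|exact: sd_cst].
by apply/funext => y; rewrite big_cons; case: (P i); rewrite ?add0r.
Qed.

Lemma sd_prod m (I : Type) (r : seq I) (P : pred I) (f : I -> 'rV[R]_m -> R) x :
  (forall i, sd (f i) x) -> sd (fun y => \prod_(i <- r | P i) f i y) x.
Proof.
move=> H; elim: r => [|i r IH].
  by rewrite (_ : (fun _ => _) = fun=> 1); [exact: sd_cst|apply/funext => y; rewrite big_nil].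
rewrite (_ : (fun _ => _) = fun y => (if P i then f i y else 1) * \prod_(i <- r | P i) f i y).
  apply: sd_mul => //; case: (P i); [exact: H|exact: sd_cst].
by apply/funext => y; rewrite big_cons; case: (P i); rewrite ?mul1r.
Qed.

Lemma sd_det m n (A : 'rV[R]_m -> 'M[R]_n) x : (forall i j, sd (fun y => A y i j) x) ->
  sd (fun y => \det (A y)) x.
Proof.
move=> H; rewrite /determinant; apply: sd_sum => s.
apply: sd_mul; first exact: sd_cst.
by apply: sd_prod => i.
Qed.

(** Cramer's rule: the entries of the inverse are rational functions of the entries. *)
Lemma sd_invmx m n (A : 'rV[R]_m -> 'M[R]_n) x d : 0 < d ->
  (forall y : 'rV[R]_m, `|y - x| < d -> A y \in unitmx) ->
  (forall i j, sd (fun y => A y i j) x) -> forall i j, sd (fun y => invmx (A y) i j) x.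
Proof.
move=> d0 uA sA i j.
apply: (@sd_near _ (fun y => (\det (A y))^-1 * cofactor (A y) j i) _ _ d d0).
  by move=> y yd; rewrite /invmx uA// !mxE.
apply: sd_mul.
  apply: sd_inv; last exact: sd_det.
  by have := uA x; rewrite subrr normr0 unitmxE unitfE; apply.
apply: sd_mul; first exact: sd_cst.
apply: sd_det => k l; rewrite (_ : (fun _ => _) = fun y => A y (lift j k) (lift i l)) //.
by apply/funext => y; rewrite !mxE.
Qed.

Lemma sg_chain m (f : 'rV[R]_m -> R) a (q : R -> 'rV[R]_m) (t : R) q' :
  sg f (q t) a -> vder q t q' -> is_derive t 1 (fun s => f (q s)) (dotv q' a).
Proof.
move=> [[C C0 HC] sf] dq; apply/is_derive_epsP => e e0.
have cq := vder_continuous dq.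
have q1 : 0 < `|q'| + 1 by rewrite ltr_wpDl.
pose e1 := e / 2 / (`|q'| + 1); pose e2 := Num.min 1 (e / 2 / C).
have p1 : 0 < e1 by rewrite !divr_gt0.
have p2 : 0 < e2 by rewrite lt_min ltr01/= !divr_gt0.
have [d d0 Hd] := sf _ p1.
have /continuous_epsP/(_ (d / 2) (divr_gt0 d0 (ltr0Sn _ _)))[d' d'0 Hd'] := cq.
have /vder_epsP/(_ _ p2)[d2 d20 Hd2] := dq.
exists (Num.min d' d2) => [|s]; first by rewrite lt_min d'0.
rewrite lt_min => /andP[/Hd' s1 /Hd2 s2].
have qs : `|q s - q t| < d by apply: le_lt_trans s1 _; rewrite ltr_pdivrMr// ltr_pMr// ltr1n.
have := Hd _ (q t) qs; rewrite subrr normr0 => /(_ d0) h1.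
rewrite (_ : f (q s) - f (q t) - dotv q' a * _ = (f (q s) - f (q t) - dotv (q s - q t) a) + dotv (q s - q t - (s - t) *: q') a).
  have lq : `|q s - q t| <= (`|q'| + 1) * `|s - t|.
    rewrite -[q s - q t](subrK ((s - t) *: q')) (le_trans (ler_normD _ _))// normrZ.
    rewrite mulrDl mul1r addrC mulrC lerD2l (le_trans s2)// ler_piMl// ge_min lexx//.
  have h2 : e1 * `|q s - q t| <= e / 2 * `|s - t|.
    by rewrite -ler_pdivlMl// (le_trans lq)// /e1 le_eqVlt; apply/orP; left; apply/eqP; field; rewrite !gt_eqF.
  have h3 : C * `|q s - q t - (s - t) *: q'| <= e / 2 * `|s - t|.
    rewrite -ler_pdivlMl// (le_trans s2)// mulrA ler_wpM2r// ge_min mulrC lexx orbT//.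
  rewrite (le_trans (ler_normD _ _))// [e]splitr mulrDl lerD//.
    exact: le_trans h2.
  exact: le_trans (HC _) h3.
rewrite -[q s - q t in X in _ = X + _](subrK ((s - t) *: q')) [dotv (_ + _ *: _) a]dotvDl dotvZl.
by ring.
Qed.

Lemma sg_derive m (f : 'rV[R]_m -> R) x a b : sg f x a -> is_derive x b f (dotv b a).
Proof.
move=> sf.
have := @sg_chain _ f a (fun s => x + s *: b) 0 b; rewrite scale0r addr0 => /(_ sf).
have db : vder (fun s => x + s *: b) 0 b.
  apply/vder_epsP => e e0; exists 1 => // s _.
  by rewrite scale0r addr0 subr0 (addrC x) addrK subrr normr0 mulr_ge0// ltW.
move=> /(_ db)/is_derive_epsP H.
have C : (fun h => h^-1 *: (f (h *: b + x) - f x)) @ 0^' --> dotv b a.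
  apply/cvgrPdist_le => e e0; have [d d0 Hd] := H e e0.
  exists d => // h /=; rewrite sub0r normrN => hd h0.
  have := Hd h; rewrite subr0 scale0r addr0 => /(_ hd) H1.
  rewrite -[_ *: (_ : R)]/(_ * _) (addrC _ x).
  have -> : dotv b a - h^-1 * (f (x + h *: b) - f x) = - (f (x + h *: b) - f x - dotv b a * h) / h by field.
  by rewrite normrM normrN normfV ler_pdivrMr ?normr_gt0.
by split; [apply/cvg_ex; exists (dotv b a)|exact/cvg_lim].
Qed.

Lemma sg_partial m (f : 'rV[R]_m -> R) x a j : sg f x a -> partial j f x = a 0 j.
Proof. by move=> /(sg_derive (delta_mx 0 j))[_]; rewrite /partial => ->; rewrite dotv_delta. Qed.

Definition grad m (f : 'rV[R]_m -> R) x : 'rV[R]_m := \row_j partial j f x.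

Lemma sdP m (f : 'rV[R]_m -> R) x : sd f x -> sg f x (grad f x).
Proof.
move=> [a sa]; rewrite (_ : grad f x = a)//.
by apply/rowP => j; rewrite mxE; exact: sg_partial.
Qed.

Lemma smooth_partial m (U : set 'rV[R]_m) f j : smooth_on U f -> smooth_on U (partial j f).
Proof. by move=> H k; have [_ +] := H k.+1; apply. Qed.

Lemma open_ball m (U : set 'rV[R]_m) x : open U -> U x ->
  exists2 d, 0 < d & forall y : 'rV[R]_m, `|y - x| < d -> U y.
Proof.
move=> oU Ux; have /nbhs_ballP[r /= r0 Hr] := open_nbhs_nbhs (conj oU Ux).
by exists r => // y yr; apply: Hr; rewrite -ball_normE/= distrC.
Qed.

(** The bridge from the classes [Ck] to strict differentiability: mean value theorem on the segment
    from z to y, and continuity of the partial derivatives at x. *)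
Lemma smooth_sd m (U : set 'rV[R]_m) f x : open U -> smooth_on U f -> U x -> sd f x.
Proof.
move=> oU sf Ux; exists (grad f x); split; first exact: dotv_lip.
move=> e e0.
have [r r0 HU] := open_ball oU Ux.
have df y : U y -> differentiable f y by move=> Uy; have [+ _] := sf 1%N; apply.
have m1 : 0 < m%:R + 1 :> R by rewrite ltr_wpDl.
have [|j|d d0 Hd] := fin_radius (P := fun (j : 'I_m) d => forall y : 'rV[R]_m, `|y - x| < d ->
    `|partial j f y - partial j f x| <= e / (m%:R + 1)).
- by move=> l d d' H d'd y yd; apply: H; exact: lt_le_trans d'd.
- have /= cj := smooth_partial j sf 0%N.
  by have /continuous_epsP := cj x Ux; apply; rewrite divr_gt0.
exists (Num.min r d) => [|y z]; first by rewrite lt_min r0.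
rewrite !lt_min => /andP[yr yd] /andP[zr zd].
pose v := y - z; pose q (s : R) := z + s *: v.
have qx s : 0 <= s <= 1 -> `|q s - x| < r /\ `|q s - x| < d.
  move=> /andP[s0 s1].
  have E : q s - x = (1 - s) *: (z - x) + s *: (y - x).
    by rewrite /q /v; apply/rowP => k; rewrite !mxE; ring.
  have B rr : `|y - x| < rr -> `|z - x| < rr -> `|q s - x| < rr.
    move=> h1 h2; rewrite E (le_lt_trans (ler_normD _ _))// !normrZ !ger0_norm ?subr_ge0//.
    have [->|s1'] := eqVneq s 1; first by rewrite subrr mul0r add0r mul1r.
    have : 0 < 1 - s by rewrite subr_gt0 lt_neqAle s1'.
    move=> ?; nra.
  by split; apply: B.
have derq (s : R) : 0 <= s <= 1 -> is_derive s 1 (fun s => f (q s)) (dotv v (grad f (q s))).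
  move=> s01; have [/HU Uq _] := qx s s01.
  have dq : is_derive s 1 q v.
    apply/vderP/vder_epsP => e1 e10; exists 1 => // s' _.
    rewrite /q opprD addrACA subrr add0r -scalerBl subrr normr0 mulr_ge0// ltW//.
  have dfq : differentiable q s by apply/derivable1_diffP; case: dq.
  have Df : differentiable (f \o q) s by apply: differentiable_comp => //; exact: df.
  split; first exact/derivable1_diffP.
  rewrite deriveE// diff_comp//; last exact: df.
  have E1 : 'd q s 1 = v by rewrite -deriveE//; case: dq.
  rewrite /= E1.
  rewrite [v in 'd f _ v]rV_sum linear_sum; apply: eq_bigr => j _.
  by rewrite linearZ/= [X in _ = _ * X]mxE /partial deriveE//; exact: df.
have [||c + ] := @MVT_segment _ (fun s => f (q s)) (fun s => dotv v (grad f (q s))) 0 1 ler01.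
- by move=> s; rewrite in_itv/= => /andP[s0 s1]; apply: derq; rewrite !ltW.
- by apply: derivable_within_continuous => s; rewrite in_itv/= => s01; have [] := derq s s01.
rewrite in_itv/= => c01; rewrite subr0 mulr1.
have -> : q 1 = y by rewrite /q scale1r /v addrC subrK.
have -> : q 0 = z by rewrite /q scale0r addr0.
rewrite -/v => ->.
have [_ cd] := qx c c01.
have -> : dotv v (grad f (q c)) - dotv v (grad f x) = dotv v (grad f (q c) - grad f x).
  by rewrite dotvD; congr (_ + _); rewrite -[- grad f x]scaleN1r dotvZ mulN1r.
rewrite (le_trans (ler_norm_sum _ _ _))//.
apply: (@le_trans _ _ (\sum_(j < m) `|v| * (e / (m%:R + 1)))).
  by apply: ler_sum => j _; rewrite normrM ler_pM ?normv_coord//; have := Hd j _ cd; rewrite !mxE.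
have h : m%:R * (e / (m%:R + 1)) <= e.
  by rewrite mulrCA ler_piMr ?(ltW e0)// ler_pdivrMr// mul1r lerDl.
have := ler_wpM2l (normr_ge0 v) h.
by rewrite sumr_const card_ord -(mulr_natl (`|v| * _)) (mulrCA m%:R `|v|) (mulrC e `|v|).
Qed.

End gradients.

(** * Bilinear forms and symmetry of second derivatives *)

Section bilinear.
Context {R : realType}.

Definition bil n (A : 'M[R]_n) (u v : 'rV[R]_n) : R := (u *m A *m v^T) 0 0.

Lemma bilE n (A : 'M[R]_n) u v : bil A u v = \sum_a \sum_b u 0 a * A a b * v 0 b.
Proof.
rewrite /bil mxE exchange_big/=; apply: eq_bigr => b _.
by rewrite !mxE mulr_suml.
Qed.

Lemma bilDl n (A : 'M[R]_n) u u' v : bil A (u + u') v = bil A u v + bil A u' v.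
Proof. by rewrite /bil !mulmxDl mxE. Qed.

Lemma bilDr n (A : 'M[R]_n) u v v' : bil A u (v + v') = bil A u v + bil A u v'.
Proof. by rewrite /bil linearD/= mulmxDr mxE. Qed.

Lemma bilZl n (A : 'M[R]_n) c u v : bil A (c *: u) v = c * bil A u v.
Proof. by rewrite /bil -!scalemxAl mxE. Qed.

Lemma bilZr n (A : 'M[R]_n) c u v : bil A u (c *: v) = c * bil A u v.
Proof. by rewrite /bil linearZ/= -scalemxAr mxE. Qed.

Lemma bilNl n (A : 'M[R]_n) u v : bil A (- u) v = - bil A u v.
Proof. by rewrite -scaleN1r bilZl mulN1r. Qed.

Lemma bilNr n (A : 'M[R]_n) u v : bil A u (- v) = - bil A u v.
Proof. by rewrite -scaleN1r bilZr mulN1r. Qed.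

Lemma bil0l n (A : 'M[R]_n) v : bil A 0 v = 0.
Proof. by rewrite -(scale0r 0) bilZl mul0r. Qed.

Lemma bil0r n (A : 'M[R]_n) v : bil A v 0 = 0.
Proof. by rewrite -(scale0r 0) bilZr mul0r. Qed.

Lemma bil_sumr n (A : 'M[R]_n) (I : Type) (r : seq I) (P : pred I) (u : I -> 'rV[R]_n) v :
  bil A v (\sum_(i <- r | P i) u i) = \sum_(i <- r | P i) bil A v (u i).
Proof. by elim/big_rec2 : _ => [|i x y _ <-]; rewrite ?bil0r// bilDr. Qed.

Lemma bil_sym n (A : 'M[R]_n) u v : A^T = A -> bil A u v = bil A v u.
Proof.
move=> sA; rewrite !bilE exchange_big/=; apply: eq_bigr => a _; apply: eq_bigr => b _.
have <- : A b a = A a b by rewrite -{1}sA mxE.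
by rewrite mulrC mulrAC mulrA mulrAC.
Qed.

Lemma bil_delta n (A : 'M[R]_n) u j : bil A u (delta_mx 0 j) = (u *m A) 0 j.
Proof.
rewrite /bil mxE (bigD1 j)//= [X in _ * X]mxE [X in _ * X]mxE !eqxx mulr1 big1 ?addr0// => k kj.
by rewrite [X in _ * X]mxE [X in _ * X]mxE (negbTE kj) andbF mulr0.
Qed.

Lemma is_derive_bil n (A : R -> 'M[R]_n) (A' : 'M[R]_n) (u v : R -> 'rV[R]_n) u' v' (t : R) :
  (forall a b, is_derive t 1 (fun s => A s a b) (A' a b)) -> vder u t u' -> vder v t v' ->
  is_derive t 1 (fun s => bil (A s) (u s) (v s))
    (bil A' (u t) (v t) + bil (A t) u' (v t) + bil (A t) (u t) v').
Proof.
move=> dA du dv.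
rewrite (_ : (fun _ => _) = \sum_a \sum_b (fun s => u s 0 a * A s a b * v s 0 b)); last first.
  apply/funext => s; rewrite bilE fct_sumE; apply: eq_bigr => a _; rewrite fct_sumE.
  by apply: eq_bigr => b _.
rewrite !bilE -!big_split/=; apply: is_derive_sum => a.
rewrite -!big_split/=; apply: is_derive_sum => b.
have d1 := is_deriveM (is_deriveM (du a) (dA a b)) (dv b).
apply: (is_derive_eq (f := (fun s => u s 0 a) * (fun s => A s a b) * (fun s => v s 0 b))) d1 _.
by rewrite fctE /GRing.scale/=; ring.
Qed.

Lemma vderD n (c d : R -> 'rV[R]_n) t a b :
  vder c t a -> vder d t b -> vder (fun s => c s + d s) t (a + b).
Proof.
move=> cd dd k; rewrite (_ : (fun s => _) = (fun s => c s 0 k) + (fun s => d s 0 k)).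
  by rewrite !mxE; exact: is_deriveD.
by apply/funext => s; rewrite !mxE.
Qed.

Lemma vder_near n (c d : R -> 'rV[R]_n) t a : (\forall s \near t, c s = d s) -> vder c t a -> vder d t a.
Proof.
move=> /nbhs_ballP[r /= r0 Hr] /vder_epsP H; apply/vder_epsP => e /H[d' d'0 Hd'].
exists (Num.min r d') => [|s]; first by rewrite lt_min r0.
rewrite lt_min => /andP[sr sd]; rewrite -(Hr s) -?(Hr t); [exact: Hd'|..].
  exact: ballxx.
by rewrite /ball/= distrC.
Qed.

Lemma is_derive_near (f g : R -> R) (t a : R) : (\forall s \near t, f s = g s) ->
  is_derive t 1 f a -> is_derive t 1 g a.
Proof.
move=> /nbhs_ballP[r /= r0 Hr] /is_derive_epsP H; apply/is_derive_epsP => e /H[d' d'0 Hd'].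
exists (Num.min r d') => [|s]; first by rewrite lt_min r0.
rewrite lt_min => /andP[sr sd]; rewrite -(Hr s) -?(Hr t); [exact: Hd'|..].
  exact: ballxx.
by rewrite /ball/= distrC.
Qed.

Lemma is_derive_unique (f : R -> R) (t a b : R) : is_derive t 1 f a -> is_derive t 1 f b -> a = b.
Proof. by move=> [_ <-] [_ <-]. Qed.

(** The second difference is symmetric in i and j, so this estimate, used in both orders, yields
    [schwarz]. It comes from the mean value theorem in direction i and strict differentiability of
    the i-th partial derivative. *)
Lemma second_difference m (f : 'rV[R]_m -> R) (U : set 'rV[R]_m) x (i j : 'I_m) :
  open U -> smooth_on U f -> U x -> forall e, 0 < e -> exists2 d, 0 < d & forall h, 0 < h < d ->
  `|f (x + h *: delta_mx 0 i + h *: delta_mx 0 j) - f (x + h *: delta_mx 0 i) - f (x + h *: delta_mx 0 j) + f x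
    - h ^+ 2 * partial j (partial i f) x| <= e * h ^+ 2.
Proof.
move=> oU sf Ux e e0.
have [r r0 HU] := open_ball oU Ux.
have si := smooth_partial i sf.
have [_ /(_ (e / 3))] := sdP (smooth_sd oU si Ux).
case=> [|d d0 Hd]; first by rewrite divr_gt0.
pose ei : 'rV[R]_m := delta_mx 0 i; pose ej : 'rV[R]_m := delta_mx 0 j.
have nei : `|ei| <= 1 by apply: normv_le => // k; rewrite mxE; case: andP; rewrite ?normr0 ?normr1.
have nej : `|ej| <= 1 by apply: normv_le => // k; rewrite mxE; case: andP; rewrite ?normr0 ?normr1.
exists (Num.min r d / 2) => [|h /andP[h0]]; first by rewrite divr_gt0// lt_min r0.
rewrite ltr_pdivlMr// lt_min => /andP[hr hd].
have nrm s t : 0 <= s <= h -> 0 <= t <= h -> `|s *: ei + t *: ej| <= h * 2.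
  move=> /andP[s0 sh] /andP[t0 th]; rewrite (le_trans (ler_normD _ _))// !normrZ !ger0_norm//.
  have : s * `|ei| <= h by rewrite (le_trans _ sh)// ler_piMr.
  have : t * `|ej| <= h by rewrite (le_trans _ th)// ler_piMr.
  lra.
have h0h : 0 <= h <= h by rewrite lexx ltW.
have z0h : 0 <= (0 : R) <= h by rewrite lexx ltW.
have E3 (a b : 'rV[R]_m) : x + a + b - x = a + b by rewrite (addrC x) (addrAC _ x) addrK.
have E2 (a : 'rV[R]_m) : x + a - x = a by rewrite addrC addKr.
pose F s := f (x + s *: ei + h *: ej) - f (x + s *: ei).
pose dF s := partial i f (x + s *: ei + h *: ej) - partial i f (x + s *: ei).
have inU s t : 0 <= s <= h -> 0 <= t <= h -> U (x + s *: ei + t *: ej).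
  by move=> sh th; apply: HU; rewrite E3 (le_lt_trans (nrm _ _ sh th)).
have inU0 s : 0 <= s <= h -> U (x + s *: ei).
  by move=> sh; have := inU s 0 sh z0h; rewrite scale0r addr0.
have lder (c : 'rV[R]_m) (s : R) : vder (fun s => x + s *: ei + c) s ei.
  apply/vder_epsP => e1 e10; exists 1 => // s' _.
  rewrite (_ : x + s' *: ei + c - (x + s *: ei + c) - (s' - s) *: ei = 0) ?normr0 ?mulr_ge0 ?(ltW e10)//.
  by apply/rowP => k; rewrite !mxE; ring.
have dFE (s : R) : 0 <= s <= h -> is_derive s 1 F (dF s).
  move=> sh; apply: is_deriveB.
    rewrite /partial; have := sg_chain (sdP (smooth_sd oU sf (inU s h sh h0h))) (lder (h *: ej) s).
    by rewrite dotv_delta mxE.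
  have := lder 0 s; rewrite (_ : (fun _ => _) = fun s => x + s *: ei); last by apply/funext => ?; rewrite addr0.
  move=> l0; have := sg_chain (sdP (smooth_sd oU sf (inU0 s sh))) l0.
  by rewrite dotv_delta mxE.
have [||s + ] := @MVT_segment _ F dF 0 h (ltW h0).
- by move=> s; rewrite in_itv/= => /andP[s0 sh]; apply: dFE; rewrite !ltW.
- by apply: derivable_within_continuous => s; rewrite in_itv/= => s01; have [] := dFE s s01.
rewrite in_itv/= => sh; rewrite subr0 => E.
rewrite (_ : f _ - _ - _ + _ = F h - F 0); last first.
  by rewrite /F scale0r addr0 /ei /ej; ring.
rewrite E /dF.
have n1 : `|x + s *: ei + h *: ej - x| < d.
  by rewrite E3 (le_lt_trans (nrm _ _ sh h0h)).
have n2 : `|x + s *: ei - x| < d.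
  by have := nrm s 0 sh z0h; rewrite scale0r addr0 E2 => /le_lt_trans; exact.
have := Hd _ _ n1 n2.
rewrite (_ : x + s *: ei + h *: ej - (x + s *: ei) = h *: ej); last by rewrite addrC addKr.
rewrite dotvZl dotv_delta mxE => H.
rewrite (_ : _ - _ = h * (partial i f (x + s *: ei + h *: ej) - partial i f (x + s *: ei) - h * partial j (partial i f) x)); last by ring.
rewrite normrM (gtr0_norm h0) expr2 mulrCA ler_pM2l//.
rewrite (le_trans H)// normrZ (gtr0_norm h0).
rewrite (_ : e / 3 * (h * `|ej|) = e * h * (`|ej| / 3)); last by field.
rewrite ler_piMr ?mulr_ge0 ?ltW// ltr_pdivrMr// mul1r (le_lt_trans nej)// ltr1n//.
Qed.

Lemma schwarz m (f : 'rV[R]_m -> R) (U : set 'rV[R]_m) x i j :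
  open U -> smooth_on U f -> U x -> partial i (partial j f) x = partial j (partial i f) x.
Proof.
move=> oU sf Ux; apply/eqP; rewrite -subr_eq0 -normr_le0; apply/ler_addgt0Pl => e e0.
have e2 : 0 < e / 2 by rewrite divr_gt0.
have [d d0 H1] := second_difference i j oU sf Ux e2.
have [d' d'0 H2] := second_difference j i oU sf Ux e2.
pose h := Num.min d d' / 2.
have m0 : 0 < Num.min d d' by rewrite lt_min d0.
have h0 : 0 < h by rewrite divr_gt0.
have : h < Num.min d d' by rewrite ltr_pdivrMr// ltr_pMr// ltr1n.
rewrite lt_min => /andP[hd hd'].
have h1 := H1 h (introT andP (conj h0 hd)); have h2 := H2 h (introT andP (conj h0 hd')).
rewrite (addrAC x (h *: delta_mx 0 j)) in h2.
move: h1 h2; rewrite addr0.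
move: (f (x + _ + _)) (f (x + h *: delta_mx 0 i)) (f (x + h *: delta_mx 0 j)) (f x) => A B C D.
set p := partial i _ x; set q := partial j _ x => h1 h2.
have hh : 0 < h ^+ 2 by rewrite exprn_gt0.
rewrite -(ler_pM2l hh) -{1}(gtr0_norm hh) -normrM.
have -> : h ^+ 2 * (p - q) = (A - B - C + D - h ^+ 2 * q) - (A - C - B + D - h ^+ 2 * p) by ring.
have -> : h ^+ 2 * e = e / 2 * h ^+ 2 + e / 2 * h ^+ 2 by field.
exact: le_trans (ler_normB _ _) (lerD h1 h2).
Qed.

End bilinear.

(** * Metric, Christoffel symbols and geodesics in charts *)

Section charts.
Context {R : realType} (M : riemannian_manifold R).
Local Notation n := (mdim M).
Local Notation V := 'rV[R]_n.
Implicit Types (i j : chart M) (x : M) (y u v w : V).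

Lemma chart_atP x : chart_dom (chart_at x) x.
Proof. by case: M x. Qed.

Lemma chart_dom_open i : open (chart_dom i).
Proof. by case: M i. Qed.

Lemma chart_img_open i : open (chart_img i).
Proof. by rewrite /chart_img; case: M i. Qed.

Lemma coordK i x : chart_dom i x -> param i (coord i x) = x.
Proof. by case: M i x. Qed.

Lemma coord_img i x : chart_dom i x -> chart_img i (coord i x).
Proof. by move=> ix; exists x. Qed.

Lemma paramK i y : chart_img i y -> coord i (param i y) = y.
Proof. by move=> [x ix <-]; rewrite coordK. Qed.

Lemma param_dom i y : chart_img i y -> chart_dom i (param i y).
Proof. by move=> [x ix <-]; rewrite coordK. Qed.

Lemma chart_continuous i x : chart_dom i x -> {for x, continuous (coord i)}.
Proof. by case: M i x. Qed.

Lemma param_continuous i y : chart_img i y -> {for y, continuous (param i)}.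
Proof. by rewrite /chart_img; case: M i y. Qed.

Lemma hausdorffM : hausdorff_space M.
Proof. by case: M. Qed.

Definition overlap i j : set V := coord i @` (chart_dom i `&` chart_dom j).

Definition trans i j y : V := coord j (param i y).

Lemma transition_smooth i j k : smooth_on (overlap i j) (fun p => trans i j p 0 k).
Proof. by rewrite /overlap /trans; case: M i j k. Qed.

Lemma metric_smooth i a b : smooth_on (chart_img i) (fun p => metric i p a b).
Proof. by rewrite /chart_img; case: M i a b. Qed.

Lemma metric_sym i y : chart_img i y -> (metric i y)^T = metric i y.
Proof. by rewrite /chart_img; case: M i y. Qed.

Definition gm i y u v : R := bil (metric i y) u v.

Lemma gm_gt0 i y v : chart_img i y -> v != 0 -> 0 < gm i y v v.
Proof.
have H : forall i y, chart_img i y -> forall v, v != 0 -> 0 < gm i y v v.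
  by rewrite /chart_img /gm /bil; case: M.
by move=> /H; apply.
Qed.

Lemma metric_trans i j x : chart_dom i x -> chart_dom j x ->
  let J := 'J (trans i j) (coord i x) in
  metric i (coord i x) = J *m metric j (coord j x) *m J^T.
Proof. by rewrite /trans; case: M i j x. Qed.

Lemma overlapP i j y : overlap i j y <-> chart_img i y /\ chart_dom j (param i y).
Proof.
split; first by move=> [x [ix jx] <-]; rewrite coordK//; split=> //; exact: coord_img.
by move=> [[x ix <-]]; rewrite coordK// => jx; exists x.
Qed.

Lemma overlap_open i j : open (overlap i j).
Proof.
rewrite openE => y /overlapP[iy jy].
have h1 : \forall z \near y, chart_img i z.
  by apply: open_nbhs_nbhs; split=> //; exact: chart_img_open.
have h2 : \forall z \near y, chart_dom j (param i z).
  by apply: (param_continuous iy); apply: open_nbhs_nbhs; split=> //; exact: chart_dom_open.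
by near=> z; apply/overlapP; split; near: z.
Unshelve. all: by end_near. Qed.

Lemma overlap_coord i j x : chart_dom i x -> chart_dom j x -> overlap i j (coord i x).
Proof. by move=> ix jx; exists x. Qed.

Lemma trans_coord i j x : chart_dom i x -> trans i j (coord i x) = coord j x.
Proof. by move=> ix; rewrite /trans coordK. Qed.

Definition Tm i j y : 'M[R]_n := \matrix_(a, b) partial a (fun p => trans i j p 0 b) y.

Lemma trans_sdiff i j y : overlap i j y -> sdiff (trans i j) y (Tm i j y).
Proof.
move=> Oy; apply/sdiffP => l.
have := sdP (smooth_sd (@overlap_open i j) (@transition_smooth i j l) Oy).
apply: sdR_eq => b; rewrite mxE /dotv; apply: eq_bigr => a _.
by rewrite !mxE.
Qed.

Lemma sdiff_differentiable m k (f : 'rV[R]_m -> 'rV[R]_k) (z : 'rV[R]_m) A : sdiff f z A ->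
  differentiable f z /\ forall b : 'rV[R]_m, 'd f z b = b *m A.
Proof.
move=> sf.
have lA : {linear 'rV[R]_m -> 'rV[R]_k} := mulmxr A.
have cA : continuous (mulmxr A : 'rV[R]_m -> 'rV[R]_k).
  by apply: (@lip_continuous _ _ _ _ (opn A)) => u v; rewrite /= -mulmxBl normv_mul.
have E : f \o shift z = cst (f z) + (mulmxr A : 'rV[R]_m -> 'rV[R]_k) +o_ (0 : 'rV[R]_m) id.
  apply/eqaddoP => e e0; have [d d0 Hd] := sf _ e0.
  near=> h; have := Hd (h + z) z; rewrite addrK subrr normr0 => H.
  rewrite /= /shift /= [in leLHS]opprD addrA.
  by apply: H => //; near: h; apply/nbhs_normP; exists d => // u; rewrite /= sub0r normrN.
have D := diff_unique cA E.
split; last by move=> b; rewrite D.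
by apply/diff_locallyP; split; rewrite D.
Unshelve. all: by end_near. Qed.

Lemma trans_jacobian i j y : overlap i j y -> 'J (trans i j) y = Tm i j y.
Proof.
move=> /trans_sdiff/sdiff_differentiable[_ H].
apply/row_matrixP => a; rewrite rowE mul_rV_lin1 /= H.
by rewrite -rowE.
Qed.

Lemma gm_trans i j y u v : overlap i j y ->
  gm i y u v = gm j (trans i j y) (u *m Tm i j y) (v *m Tm i j y).
Proof.
move=> Oy; have [x [ix jx] yE] := Oy.
have := metric_trans ix jx; rewrite yE trans_jacobian// /gm /bil => /= ->.
by rewrite -yE trans_coord// trmx_mul !mulmxA.
Qed.

Lemma gm_sym i y u v : chart_img i y -> gm i y u v = gm i y v u.
Proof. by move=> iy; apply: bil_sym; exact: metric_sym. Qed.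

Lemma gm_ge0 i y v : chart_img i y -> 0 <= gm i y v v.
Proof.
move=> iy; have [->|v0] := eqVneq v 0; first by rewrite /gm bil0l.
by rewrite ltW// gm_gt0.
Qed.

Lemma gm_nondeg i y u : chart_img i y -> (forall w, gm i y u w = 0) -> u = 0.
Proof.
move=> iy H; apply/eqP; apply: contraT => u0.
by have := gm_gt0 iy u0; rewrite H ltxx.
Qed.

Lemma metric_unit i y : chart_img i y -> metric i y \in unitmx.
Proof.
move=> iy; rewrite -row_free_unit -kermx_eq0; apply/eqP/row_matrixP => k; rewrite row0.
set v := row k _; have vB : v *m metric i y = 0 by apply/eqP; rewrite -sub_kermx row_sub.
by apply: (gm_nondeg iy) => w; rewrite /gm /bil vB mul0mx mxE.
Qed.

Lemma Tm_unit i j y : overlap i j y -> Tm i j y \in unitmx.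
Proof.
move=> Oy; have [iy _] := (overlapP i j y).1 Oy.
rewrite -row_free_unit -kermx_eq0; apply/eqP/row_matrixP => k; rewrite row0.
set v := row k _; have vB : v *m Tm i j y = 0 by apply/eqP; rewrite -sub_kermx row_sub.
by apply: (gm_nondeg iy) => w; rewrite (gm_trans _ _ Oy) vB /gm bil0l.
Qed.

(* [DG i y m u v] is the derivative of [gm i y u v] in [y] along [m]. *)
Definition dmet i y m : 'M[R]_n := \matrix_(a, b) dotv m (grad (fun p => metric i p a b) y).
Definition DG i y m u v : R := bil (dmet i y m) u v.

Lemma metric_sg i y a b : chart_img i y ->
  sg (fun p => metric i p a b) y (grad (fun p => metric i p a b) y).
Proof. move=> iy; apply: sdP; exact: (smooth_sd (@chart_img_open i) (@metric_smooth i a b) iy). Qed.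

Lemma DG_sym i y m u v : chart_img i y -> DG i y m u v = DG i y m v u.
Proof.
move=> iy; apply: bil_sym; apply/matrixP => a b; rewrite !mxE; congr dotv.
apply/rowP => k; rewrite !mxE /partial; apply: near_eq_derive.
apply: filterS (open_nbhs_nbhs (conj (@chart_img_open i) iy)) => z iz.
by rewrite -{1}(metric_sym iz) mxE.
Qed.

Lemma DGDm i y m m' u v : DG i y (m + m') u v = DG i y m u v + DG i y m' u v.
Proof.
rewrite /DG (_ : dmet i y (m + m') = dmet i y m + dmet i y m').
  by rewrite /bil mulmxDr mulmxDl mxE.
by apply/matrixP => a b; rewrite !mxE dotvDl.
Qed.

Lemma DGZm i y c m u v : DG i y (c *: m) u v = c * DG i y m u v.
Proof.
rewrite /DG (_ : dmet i y (c *: m) = c *: dmet i y m).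
  by rewrite /bil -scalemxAr -scalemxAl mxE.
by apply/matrixP => a b; rewrite !mxE dotvZl.
Qed.

Lemma is_derive_gm i (q u v : R -> V) (q' u' v' : V) (t : R) : chart_img i (q t) ->
  vder q t q' -> vder u t u' -> vder v t v' ->
  is_derive t 1 (fun s => gm i (q s) (u s) (v s))
    (DG i (q t) q' (u t) (v t) + gm i (q t) u' (v t) + gm i (q t) (u t) v').
Proof.
move=> iq dq du dv; apply: is_derive_bil => // a b; rewrite mxE.
exact: sg_chain (metric_sg _ _ iq) dq.
Qed.

Definition Gam i y u v : V := \row_k \sum_a \sum_b christoffel i a b k y * u 0 a * v 0 b.

(** The coordinates of the covector 2 g(Gam u v, .), by the Koszul formula. *)
Definition Koszul i y u v : V := \row_l (DG i y u v (delta_mx 0 l) + DG i y v u (delta_mx 0 l) - DG i y (delta_mx 0 l) u v).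

Lemma GamE i y u v : Gam i y u v = (2^-1 *: Koszul i y u v) *m (invmx (metric i y))^T.
Proof.
apply/rowP => k; rewrite !mxE.
under eq_bigr do under eq_bigr do rewrite /christoffel mulrAC -!mulrA mulr_suml.
under [RHS]eq_bigr do rewrite !mxE.
rewrite (eq_bigr (fun a => \sum_b \sum_l 2^-1 * (invmx (metric i y) k l * (u 0 a * v 0 b *
  (partial a (fun q => metric i q b l) y + partial b (fun q => metric i q a l) y
   - partial l (fun q => metric i q a b) y))))); last first.
  move=> a _; apply: eq_bigr => b _; rewrite mulr_sumr; apply: eq_bigr => l _.
  by ring.
rewrite exchange_big/=.
under eq_bigr do rewrite exchange_big/=.
rewrite exchange_big/=; apply: eq_bigr => l _.
rewrite /DG [in RHS]bil_delta mxE.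
have -> : (\sum_j v 0 j * dmet i y u j l) = \sum_a \sum_b u 0 a * v 0 b * partial a (fun q => metric i q b l) y.
  rewrite exchange_big/=; apply: eq_bigr => b _; rewrite mxE /dotv mulr_sumr.
  by apply: eq_bigr => a _; rewrite !mxE mulrA (mulrC (v 0 b)).
rewrite bil_delta mxE.
have -> : (\sum_j u 0 j * dmet i y v j l) = \sum_a \sum_b u 0 a * v 0 b * partial b (fun q => metric i q a l) y.
  apply: eq_bigr => a _; rewrite mxE /dotv mulr_sumr.
  by apply: eq_bigr => b _; rewrite !mxE mulrA.
rewrite bilE.
have -> : (\sum_a \sum_b u 0 a * dmet i y (delta_mx 0 l) a b * v 0 b) = \sum_a \sum_b u 0 a * v 0 b * partial l (fun q => metric i q a b) y.
  by apply: eq_bigr => a _; apply: eq_bigr => b _; rewrite mxE dotv_delta mxE mulrAC.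
rewrite -big_split/= -sumrB mulr_sumr mulr_suml exchange_big/=; apply: eq_bigr => a _.
rewrite -big_split/= -sumrB mulr_sumr mulr_suml; apply: eq_bigr => b _.
by ring.
Qed.

(** Pairing with the metric removes its inverse, so later identities between Christoffel symbols are
    proved by testing against an arbitrary w and using [gm_nondeg]. *)
Lemma koszul i y u v w : chart_img i y ->
  gm i y (Gam i y u v) w = 2^-1 * (DG i y u v w + DG i y v u w - DG i y w u v).
Proof.
move=> iy; rewrite /gm /bil GamE trmx_inv metric_sym// mulmxKV ?metric_unit//.
rewrite -scalemxAl mxE; congr (_ * _).
rewrite mxE [in RHS](rV_sum w).
rewrite {1 2}/DG !bil_sumr.
have -> : DG i y (\sum_j w 0 j *: delta_mx 0 j) u v = \sum_j w 0 j * DG i y (delta_mx 0 j) u v.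
  have D0 : DG i y 0 u v = 0 by rewrite -(scale0r 0) DGZm mul0r.
  by elim/big_rec2 : _ => [|k a b _ <-]; rewrite ?D0// DGDm DGZm.
rewrite -big_split/= -sumrB; apply: eq_bigr => l _.
by rewrite !mxE !bilZr -/(DG _ _ _ _ _) -/(DG i y v u _); ring.
Qed.

Lemma GamDl i y u u' v : Gam i y (u + u') v = Gam i y u v + Gam i y u' v.
Proof.
apply/rowP => k; rewrite !mxE -big_split/=; apply: eq_bigr => a _.
by rewrite -big_split/=; apply: eq_bigr => b _; rewrite mxE; ring.
Qed.

Lemma GamDr i y u v v' : Gam i y u (v + v') = Gam i y u v + Gam i y u v'.
Proof.
apply/rowP => k; rewrite !mxE -big_split/=; apply: eq_bigr => a _.
by rewrite -big_split/=; apply: eq_bigr => b _; rewrite mxE; ring.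
Qed.

Lemma GamZl i y c u v : Gam i y (c *: u) v = c *: Gam i y u v.
Proof.
apply/rowP => k; rewrite !mxE mulr_sumr; apply: eq_bigr => a _.
by rewrite mulr_sumr; apply: eq_bigr => b _; rewrite mxE; ring.
Qed.

Lemma GamZr i y c u v : Gam i y u (c *: v) = c *: Gam i y u v.
Proof.
apply/rowP => k; rewrite !mxE mulr_sumr; apply: eq_bigr => a _.
by rewrite mulr_sumr; apply: eq_bigr => b _; rewrite mxE; ring.
Qed.

Lemma Gam_sym i y u v : chart_img i y -> Gam i y u v = Gam i y v u.
Proof.
move=> iy; apply/eqP; rewrite -subr_eq0; apply/eqP/(gm_nondeg iy) => w.
rewrite /gm bilDl bilNl -!/(gm _ _ _ _) !koszul// (DG_sym w u v)//; ring.
Qed.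

(* The Euler-Lagrange form of the geodesic equation; it involves only the first
   derivatives of the metric and transforms easily under changes of charts. *)
Lemma euler_lagrange i y u a : chart_img i y ->
  a = - Gam i y u u <->
  forall w, gm i y a w + DG i y u u w - 2^-1 * DG i y w u u = 0.
Proof.
move=> iy; split=> [-> w|H].
  by rewrite /gm bilNl -/(gm _ _ _ _) koszul//; field.
apply/eqP; rewrite -subr_eq0 opprK; apply/eqP/(gm_nondeg iy) => w.
rewrite /gm bilDl -!/(gm _ _ _ _) koszul//; have := H w; lra.
Qed.

End charts.

Section chain.
Context {R : realType}.

Lemma sdiff_chain m k (f : 'rV[R]_m -> 'rV[R]_k) A (q : R -> 'rV[R]_m) (q' : 'rV[R]_m) (t : R) :
  sdiff f (q t) A -> vder q t q' -> vder (fun s => f (q s)) t (q' *m A).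
Proof.
move=> /sdiffP sf dq l; rewrite (_ : (q' *m A) 0 l = dotv q' (\row_j A j l)); last first.
  by rewrite mxE /dotv; apply: eq_bigr => j _; rewrite mxE.
apply: (sg_chain (f := fun y => f y 0 l)) dq; apply: sdR_eq (sf l) => b.
by rewrite mxE /dotv; apply: eq_bigr => j _; rewrite mxE.
Qed.

Lemma vder_unique n (c : R -> 'rV[R]_n) (t : R) (a b : 'rV[R]_n) : vder c t a -> vder c t b -> a = b.
Proof. by move=> da db; apply/rowP => k; exact: is_derive_unique (da k) (db k). Qed.

Lemma vder_derivable n (c : R -> 'rV[R]_n) (t : R) (a : 'rV[R]_n) : vder c t a -> derivable c t 1.
Proof. by move=> /vderP[]. Qed.

Lemma vder_derive1 n (c : R -> 'rV[R]_n) (t : R) (a : 'rV[R]_n) : vder c t a -> derive1 c t = a.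
Proof. by move=> /vderP[_ <-]; rewrite derive1E. Qed.

Lemma derivable_vder n (c : R -> 'rV[R]_n) (t : R) : derivable c t 1 -> vder c t (derive1 c t).
Proof. by move=> d; apply/vderP; rewrite derive1E; exact: derivableP. Qed.

Lemma vder_cst n (a : 'rV[R]_n) (t : R) : vder (fun=> a) t 0.
Proof.
apply/vder_epsP => e e0; exists 1 => // s _.
by rewrite subrr scaler0 subrr normr0 mulr_ge0// ltW.
Qed.

Lemma vder_line n (y m : 'rV[R]_n) (t : R) : vder (fun s => y + s *: m) t m.
Proof. by rewrite -[X in vder _ _ X]add0r; apply: vderD; [exact: vder_cst|exact: vder_scale]. Qed.

End chain.

(** * Invariance of the geodesic equation under changes of charts *)

Section transition.
Context {R : realType} (M : riemannian_manifold R).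
Local Notation n := (mdim M).
Local Notation V := 'rV[R]_n.
Implicit Types (i j : chart M) (x : M) (y u v w m : V) (c : R -> M) (t : R).

Definition cv i c (t : R) : V := derive1 (coord i \o c) t.

Lemma near_chart i c t : {for t, continuous c} -> chart_dom i (c t) ->
  \forall s \near t, chart_dom i (c s).
Proof.
by move=> cc it; apply: cc; apply: open_nbhs_nbhs; split=> //; exact: chart_dom_open.
Qed.

Lemma trans_vder i j c t a : {for t, continuous c} -> chart_dom i (c t) -> chart_dom j (c t) ->
  vder (coord i \o c) t a -> vder (coord j \o c) t (a *m Tm i j (coord i (c t))).
Proof.
move=> cc it jt da.
have := sdiff_chain (trans_sdiff (overlap_coord it jt)) da.
apply: vder_near; apply: filterS (near_chart cc it) => s si /=.
by rewrite trans_coord.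
Qed.

Lemma cv_trans i j c t : {for t, continuous c} -> chart_dom i (c t) -> chart_dom j (c t) ->
  derivable (coord i \o c) t 1 -> cv j c t = cv i c t *m Tm i j (coord i (c t)).
Proof.
by move=> cc it jt /derivable_vder/(trans_vder cc it jt)/vder_derive1.
Qed.

Lemma near_fun_continuous i c t : (\forall s \near t, chart_dom i (c s)) ->
  {for t, continuous (coord i \o c)} -> {for t, continuous c}.
Proof.
move=> Ni cc; have it := nbhs_singleton Ni.
have C : {for t, continuous (param i \o (coord i \o c))}.
  by apply: continuous_comp => //; exact/param_continuous/coord_img.
have C' : param i (coord i (c s)) @[s --> t] --> c t.
  by rewrite -[in X in _ --> X](coordK it); exact: C.
apply: cvg_trans C'; apply: near_eq_cvg; apply: filterS Ni => s si /=.
by rewrite coordK.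
Qed.

Definition dTm i j y m : 'M[R]_n := \matrix_(a, b) dotv m (grad (fun p => Tm i j p a b) y).

Lemma TmE i j a b : (fun y => Tm i j y a b) = partial a (fun p => trans i j p 0 b).
Proof. by apply/funext => y; rewrite mxE. Qed.

Lemma dTm_sym i j y m u : overlap i j y -> u *m dTm i j y m = m *m dTm i j y u.
Proof.
move=> Oy; apply/rowP => b; rewrite !mxE.
under eq_bigr do rewrite mxE /dotv mulr_sumr.
under [RHS]eq_bigr do rewrite mxE /dotv mulr_sumr.
rewrite exchange_big/=; apply: eq_bigr => k _; apply: eq_bigr => a _.
rewrite !mxE !TmE (schwarz _ _ (@overlap_open _ _ i j) (@transition_smooth _ _ i j b) Oy).
by rewrite mulrCA.
Qed.

Lemma vder_Tm i j (q u : R -> V) (q' u' : V) t : overlap i j (q t) -> vder q t q' -> vder u t u' ->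
  vder (fun s => u s *m Tm i j (q s)) t (u' *m Tm i j (q t) + u t *m dTm i j (q t) q').
Proof.
move=> Oq dq du k.
have dA a b : is_derive t 1 (fun s => Tm i j (q s) a b) (dTm i j (q t) q' a b).
  rewrite mxE; apply: (sg_chain (f := fun y => Tm i j y a b)) dq; apply: sdP; rewrite TmE.
  apply: (smooth_sd (U := overlap i j)) Oq; first exact: overlap_open.
  exact/smooth_partial/transition_smooth.
have := is_derive_bil dA du (vder_cst (delta_mx 0 k) t).
under eq_fun do rewrite bil_delta.
by rewrite bil0r addr0 !bil_delta addrC => D; rewrite mxE; exact: D.
Qed.

Lemma line_near (U : set V) y m : open U -> U y -> \forall s \near 0, U (y + s *: m).
Proof.
move=> oU Uy; have cl := vder_continuous (vder_line y m 0).
by apply: cl; rewrite /= scale0r addr0; apply: open_nbhs_nbhs.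
Qed.

(** Differentiate [gm_trans] along the line through y in direction m. *)
Lemma DG_trans i j y m u v : overlap i j y ->
  let T := Tm i j y in
  DG i y m u v = DG j (trans i j y) (m *m T) (u *m T) (v *m T)
    + gm j (trans i j y) (u *m dTm i j y m) (v *m T)
    + gm j (trans i j y) (u *m T) (v *m dTm i j y m).
Proof.
move=> Oy T; have [iy jy] := (overlapP i j y).1 Oy.
pose q (s : R) := y + s *: m.
have q0 : q 0 = y by rewrite /q scale0r addr0.
have dq : vder q 0 m := vder_line y m 0.
have iq : chart_img i (q 0) by rewrite q0.
have Oq : overlap i j (q 0) by rewrite q0.
have L := is_derive_gm iq dq (vder_cst u 0) (vder_cst v 0).
have dT : vder (trans i j \o q) 0 (m *m T).
  by rewrite /T -q0; apply: sdiff_chain dq; exact: trans_sdiff.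
have jq : chart_img j ((trans i j \o q) 0) by rewrite /= q0; exact: coord_img.
have E := is_derive_gm jq dT (vder_Tm Oq dq (vder_cst u 0)) (vder_Tm Oq dq (vder_cst v 0)).
move: L; rewrite /gm !bil0l !bil0r !addr0 -!/(gm _ _ _ _) q0 => L.
move: E; rewrite !mul0mx !add0r /= q0 => E.
apply: is_derive_unique L _; apply: is_derive_near E.
apply: filterS (line_near m (@overlap_open _ _ i j) Oy) => s Os /=.
exact/esym/(gm_trans u v Os).
Qed.

(** The Christoffel symbols of the two charts are not compared directly: both accelerations are
    characterised by [euler_lagrange], and the stray second derivatives of the transition map cancel
    by [dTm_sym]. *)
Lemma geodesic_trans i j y u : overlap i j y ->
  - Gam i y u u *m Tm i j y + u *m dTm i j y u =
  - Gam j (trans i j y) (u *m Tm i j y) (u *m Tm i j y).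
Proof.
move=> Oy; have [iy jy] := (overlapP i j y).1 Oy.
have jt : chart_img j (trans i j y) by exact: coord_img.
apply/(euler_lagrange _ _ jt) => w.
set T := Tm i j y.
(* The transition matrix is invertible, so every test vector of chart j comes from chart i. *)
have -> : w = w *m invmx T *m T by rewrite mulmxKV ?Tm_unit.
move: (w *m _) => {}w.
have := (euler_lagrange u (- Gam i y u u) iy).1 erefl w.
rewrite (gm_trans _ _ Oy) (DG_trans u u w Oy) (DG_trans w u u Oy) /=.
rewrite (dTm_sym w u Oy) -/T.
rewrite /gm !bilDl -!/(gm _ _ _ _).
by rewrite (gm_sym (w *m dTm i j y u) _ jt); lra.
Qed.

Lemma GamEsum i y u v k : Gam i y u v 0 k = \sum_a \sum_b christoffel i a b k y * u 0 a * v 0 b.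
Proof. by rewrite mxE. Qed.

Lemma geodesic_at_vder i c t : geodesic_at c t -> chart_dom i (c t) ->
  (\forall s \near t, derivable (coord i \o c) s 1) /\
  vder (cv i c) t (- Gam i (coord i (c t)) (cv i c t) (cv i c t)).
Proof.
move=> [cc H] it; have [D1 D2 E] := H i it; split=> //.
rewrite (_ : - _ = derive1 (cv i c) t); first exact: derivable_vder.
apply/rowP => k; rewrite mxE GamEsum; apply/esym/eqP; rewrite -addr_eq0.
by have := E k; rewrite /derive1n/= => /eqP.
Qed.

(** [geodesic_at] asks for the equation in every chart around the point; by [geodesic_trans] one
    chart is enough. *)
Lemma geodesic_at_of_chart i c t : {for t, continuous c} -> chart_dom i (c t) ->
  (\forall s \near t, derivable (coord i \o c) s 1) ->
  vder (cv i c) t (- Gam i (coord i (c t)) (cv i c t) (cv i c t)) -> geodesic_at c t.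
Proof.
move=> cc it D1 D2; split; first exact: cc.
move=> j jt q.
have N1 : \forall s \near t, [/\ {for s, continuous c}, chart_dom i (c s), chart_dom j (c s) & derivable (coord i \o c) s 1].
  have Ni := near_chart cc it; have Nj := near_chart cc jt.
  have Nii := near_join Ni.
  near=> s; have D : derivable (coord i \o c) s 1 by near: s.
  have Di : \forall s' \near s, chart_dom i (c s') by near: s.
  split; [|by near: s..|exact: D].
  have cs := vder_continuous (derivable_vder D).
  apply: (near_fun_continuous Di cs).
have dq : \forall s \near t, vder q s (cv i c s *m Tm i j (coord i (c s))).
  apply: filterS N1 => s [cs si sj]; move=> /derivable_vder; exact: trans_vder.
have E : \forall s \near t, cv i c s *m Tm i j (coord i (c s)) = derive1 q s.
  by apply: filterS dq => s /vder_derive1 ->.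
have Ot := overlap_coord it jt.
have dt : vder (coord i \o c) t (cv i c t) by apply: derivable_vder; exact: nbhs_singleton D1.
have := vder_Tm Ot dt D2 => /= /(vder_near E).
rewrite (geodesic_trans _ Ot) (trans_coord _ it) => dE.
split; first by apply: filterS dq => s; exact: vder_derivable.
  exact: vder_derivable dE.
move=> k; rewrite /derive1n/= (vder_derive1 dE) mxE GamEsum (nbhs_singleton E).
by rewrite addNr.
Unshelve. all: by end_near. Qed.

End transition.

(** * Real induction and uniqueness for differential equations *)

Section real_line.
Context {R : realType}.

(** The supremum of the initial segments on which P holds satisfies P by the left-limit clause, and
    cannot be below b by the right-extension clause. *)
Lemma real_induction (P : R -> Prop) (b : R) :
  P 0 ->
  (forall s : R, 0 <= s <= b -> P s -> exists2 d, 0 < d & forall s' : R, s <= s' < s + d -> s' <= b -> P s') ->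
  (forall s : R, 0 < s <= b -> (forall s' : R, 0 <= s' < s -> P s') -> P s) ->
  forall s : R, 0 <= s <= b -> P s.
Proof.
move=> P0 Pr Pl s /andP[s0 sb].
pose E := [set r : R | 0 <= r <= b /\ forall r' : R, 0 <= r' <= r -> P r'].
have b0 : 0 <= b := le_trans s0 sb.
have E0 : E 0 by split=> [|r' r'0]; [rewrite lexx|rewrite (_ : r' = 0)//; apply/eqP; rewrite eq_le andbC].
have Eub : has_ubound E by exists b => r [/andP[_ ->]].
have Esup : has_sup E by split=> //; exists 0.
have e0 : 0 <= sup E by exact: ub_le_sup.
have eb : sup E <= b by apply: ge_sup; [exists 0|move=> r [/andP[_ ->]]].
have lt_sup (r : R) : 0 <= r < sup E -> P r.
  move=> /andP[r0 rs]; have [r' Er' rr'] := sup_gt (ex_intro _ 0 E0) rs.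
  by case: Er' => _; apply; rewrite r0 ltW.
have Ps : P (sup E).
  have [->//|s_neq0] := eqVneq (sup E) 0.
  by apply: Pl => //; rewrite eb andbT lt_neqAle eq_sym s_neq0.
have EE : E (sup E).
  split=> [|r /andP[r0]]; first by rewrite e0.
  by rewrite le_eqVlt => /orP[/eqP->//|rs]; apply: lt_sup; rewrite r0.
have [d d0 Hd] := Pr _ (introT andP (conj e0 eb)) Ps.
have [ss|ss] := leP s (sup E); first by case: EE => _; apply; rewrite s0.
pose r := Num.min s (sup E + d / 2).
have rE : E r.
  split=> [|r' /andP[r'0]].
    by rewrite le_min s0 ge_min sb andbT/= addr_ge0// divr_ge0// ltW.
  rewrite le_min => /andP[r's r'd].
  have [rs|rs] := ltP r' (sup E); first by apply: lt_sup; rewrite r'0.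
  by apply: Hd; [lra|exact: le_trans sb].
have := ub_le_sup Eub rE; rewrite leNgt => /negP[].
by rewrite lt_min ss ltrDl divr_gt0.
Qed.

Lemma derive_ge0_le (f f' : R -> R) (a b : R) : a <= b ->
  (forall s, a <= s <= b -> is_derive s 1 f (f' s)) -> (forall s, a <= s <= b -> 0 <= f' s) -> f a <= f b.
Proof.
move=> ab df f'0.
have [s||s sab E] := @MVT_segment R f f' a b ab.
- by rewrite in_itv/= => /andP[a_s sb]; apply: df; rewrite !ltW.
- by apply: derivable_within_continuous => s; rewrite in_itv/= => sab; have [] := df s sab.
by rewrite -subr_ge0 E mulr_ge0 ?subr_ge0// f'0//; move: sab; rewrite in_itv.
Qed.

Lemma derive_eq0_cst (f : R -> R) (a b : R) : a <= b ->
  (forall s, a <= s <= b -> is_derive s 1 f 0) -> f b = f a.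
Proof.
move=> ab df; apply/eqP; rewrite eq_le (derive_ge0_le (f' := fun=> 0) ab)// andbT -lerN2.
apply: (derive_ge0_le (f := fun s => - f s) (f' := fun=> 0) ab) => // s /df ds.
by rewrite -[X in is_derive _ _ _ X]oppr0; exact: is_deriveN.
Qed.

Lemma ode_unique m (F : 'rV[R]_m -> 'rV[R]_m) A (p q : R -> 'rV[R]_m) (t : R) :
  sdiff F (p t) A -> p t = q t ->
  (\forall s \near t, vder p s (F (p s))) -> (\forall s \near t, vder q s (F (q s))) ->
  \forall s \near t, p s = q s.
Proof.
move=> sF pq dp dq.
have [d d0 Hd] := sdiff_lip sF.
have K0 : 0 < opn A + 1 by rewrite ltr_wpDl// opn_ge0.
have near_close (r : R -> 'rV[R]_m) : r t = p t -> (\forall s \near t, vder r s (F (r s))) ->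
    \forall s \near t, `|r s - p t| < d.
  move=> <- dr; have /cvgrPdist_lt/(_ _ d0) := vder_continuous (nbhs_singleton dr).
  by apply: filterS => s; rewrite distrC.
have cp := near_close p erefl dp; have cq := near_close q (esym pq) dq.
have /nbhs_ballP[h /= h0 Hh] : \forall s \near t, [/\ vder p s (F (p s)), vder q s (F (q s)),
    `|p s - p t| < d & `|q s - p t| < d].
  by near=> s; split; near: s.
pose k := Num.min (h / 2) (2^-1 / (opn A + 1)).
have k0 : 0 < k by rewrite lt_min !divr_gt0// invr_gt0.
have kh : k < h by rewrite gt_min ltr_pdivrMr// ltr_pMr// ltr1n.
have Hk (s : R) : `|s| <= k -> ball t h (t + s).
  by move=> sk; rewrite /ball/= opprD addNKr normrN (le_lt_trans sk).
have G := @gronwall R m (fun s => p (t + s) - q (t + s)) (fun s => F (p (t + s)) - F (q (t + s))) k (opn A + 1) 0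
  (ltW k0) (ltW K0) (lexx 0).
apply/nbhs_ballP; exists k => // s; rewrite /ball/= distrC => sk.
have {G} := G _ _ _ (s - t) (ltW sk); rewrite addr0 pq subrr normr0 !mulr0 addr0 (addrC t) subrK.
move=> G; apply/eqP; rewrite -subr_eq0 -normr_le0; apply: G.
- by rewrite mulrC -ler_pdivlMr// ge_min lexx orbT.
- move=> r /Hk/Hh[p1 q1 _ _]; apply: vder_sub; exact: vder_shift.
- move=> r /Hk/Hh[_ _ p1 q1]; rewrite addr0; exact: Hd.
Unshelve. all: by end_near. Qed.

Lemma vder_affine n (c : R -> 'rV[R]_n) (k a t : R) v : vder c (k * t + a) v ->
  vder (fun s => c (k * s + a)) t (k *: v).
Proof.
move=> /vder_epsP H; apply/vder_epsP => e e0.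
have k1 : 0 < `|k| + 1 by rewrite ltr_wpDl.
have [d d0 Hd] := H _ (divr_gt0 e0 k1).
exists (d / (`|k| + 1)) => [|s]; first by rewrite divr_gt0.
rewrite ltr_pdivlMr// => sd.
have E : k * s + a - (k * t + a) = k * (s - t) by ring.
have kst : `|k * (s - t)| <= `|s - t| * (`|k| + 1).
  by rewrite normrM mulrC ler_wpM2l// lerDl.
have := Hd (k * s + a); rewrite E scalerA (mulrC (s - t)) => /(_ (le_lt_trans kst sd)) H'.
by rewrite (le_trans H')// mulrAC ler_pdivrMr// -mulrA ler_wpM2l// ltW.
Qed.

End real_line.

Section field.
Context {R : realType}.

Lemma sdR_comp m k (f : 'rV[R]_k -> R) (L : 'rV[R]_m -> 'rV[R]_k) (x : 'rV[R]_m) l :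
  (forall y z, L (y - z) = L y - L z) -> (forall y, `|L y| <= `|y|) ->
  sdR f (L x) l -> sdR (fun y => f (L y)) x (fun b => l (L b)).
Proof.
move=> LB Ll [[C C0 HC] H]; split.
  by exists C => // b; rewrite (le_trans (HC _))// ler_wpM2l// ltW.
move=> e e0; have [d d0 Hd] := H e e0; exists d => // y z yd zd.
rewrite LB (le_trans (Hd _ _ _ _)) -?LB ?(le_lt_trans (Ll _))//.
by rewrite ler_wpM2l// ltW.
Qed.

Lemma sdR_sum m (I : Type) (r : seq I) (f : I -> 'rV[R]_m -> R) (x : 'rV[R]_m) l :
  (forall i, sdR (f i) x (l i)) -> sdR (fun y => \sum_(i <- r) f i y) x (fun b => \sum_(i <- r) l i b).
Proof.
move=> H; elim: r => [|i r IH].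
  rewrite (_ : (fun _ => _) = fun=> 0); last by apply/funext => y; rewrite big_nil.
  by apply: sdR_eq (sdR_cst 0 x) => b; rewrite big_nil.
rewrite (_ : (fun _ => _) = fun y => f i y + \sum_(i <- r) f i y); last by apply/funext => y; rewrite big_cons.
by apply: sdR_eq (sdR_add (H i) IH) => b; rewrite big_cons.
Qed.

Lemma lsub_norm n m (v : 'rV[R]_(n + m)) : `|lsubmx v| <= `|v|.
Proof. by apply: normv_le => // k; rewrite mxE normv_coord. Qed.

Lemma lsubB n m (v w : 'rV[R]_(n + m)) : lsubmx (v - w) = lsubmx v - lsubmx w.
Proof. by apply/rowP => k; rewrite !mxE. Qed.

Lemma vder_row n m (c : R -> 'rV[R]_n) (d : R -> 'rV[R]_m) (t : R) a b : vder c t a -> vder d t b ->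
  vder (fun s => row_mx (c s) (d s)) t (row_mx a b).
Proof.
move=> dc dd l; rewrite -[l]splitK; case: (fintype.split l) => j /=.
  by under eq_fun do rewrite row_mxEl; rewrite row_mxEl; exact: dc.
by under eq_fun do rewrite row_mxEr; rewrite row_mxEr; exact: dd.
Qed.

Lemma vder_lsub n m (c : R -> 'rV[R]_(n + m)) (t : R) a : vder c t a -> vder (fun s => lsubmx (c s)) t (lsubmx a).
Proof. by move=> dc k; under eq_fun do rewrite mxE; rewrite mxE; exact: dc. Qed.

Lemma vder_rsub n m (c : R -> 'rV[R]_(n + m)) (t : R) a : vder c t a -> vder (fun s => rsubmx (c s)) t (rsubmx a).
Proof. by move=> dc k; under eq_fun do rewrite mxE; rewrite mxE; exact: dc. Qed.

End field.

(** * The geodesic field on positions and velocities, and its linearisation *)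

Section spray.
Context {R : realType} (M : riemannian_manifold R).
Local Notation n := (mdim M).
Local Notation V := 'rV[R]_n.
Local Notation W := 'rV[R]_(n + n).
Implicit Types (i j : chart M) (y u v w m : V) (x z b : W).

(* The geodesic equation as a first-order system on positions and velocities. *)
Definition Fg i (z : W) : W := row_mx (rsubmx z) (- Gam i (lsubmx z) (rsubmx z) (rsubmx z)).

Definition Om i : set W := [set z | chart_img i (lsubmx z)].

Lemma Om_open i : open (Om i).
Proof.
rewrite openE => z iz; have [d d0 Hd] := open_ball (@chart_img_open _ _ i) iz.
apply/nbhs_ballP; exists d => // z' zz'; apply: Hd.
by rewrite -lsubB (le_lt_trans (lsub_norm _))// distrC; move: zz'; rewrite -ball_normE.
Qed.

Lemma christoffel_sd i (a b k : 'I_n) y : chart_img i y -> sd (christoffel i a b k) y.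
Proof.
move=> iy; apply: sd_mul; first exact: sd_cst.
have [d d0 Hd] := open_ball (@chart_img_open _ _ i) iy.
have sm (a' b' : 'I_n) : sd (fun q => metric i q a' b') y.
  by apply: (smooth_sd (U := chart_img i)) => //; [exact: chart_img_open|exact: metric_smooth].
have sp (k' a' b' : 'I_n) : sd (partial k' (fun q => metric i q a' b')) y.
  apply: (smooth_sd (U := chart_img i)) => //; first exact: chart_img_open.
  exact/smooth_partial/metric_smooth.
apply: sd_sum => l; apply: sd_mul.
  by apply: (sd_invmx d0) => // q /Hd; exact: metric_unit.
apply: sd_add; first exact: sd_add.
rewrite (_ : (fun _ => _) = fun q => -1 * partial l (fun q => metric i q a b) q).
  by apply: sd_mul => //; exact: sd_cst.
by apply/funext => q; rewrite mulN1r.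
Qed.

Definition dGam i y m u v : V :=
  \row_k \sum_a \sum_b dotv m (grad (christoffel i a b k) y) * u 0 a * v 0 b.

Definition dF i (z : W) (b : W) : W :=
  let u := rsubmx z in let y := lsubmx z in
  row_mx (rsubmx b) (- (dGam i y (lsubmx b) u u + Gam i y (rsubmx b) u + Gam i y u (rsubmx b))).

Lemma dF_linear i z a (u v : W) : dF i z (a *: u + v) = a *: dF i z u + dF i z v.
Proof.
rewrite /dF scale_row_mx add_row_mx; congr row_mx; first by apply/rowP => k; rewrite !mxE.
have -> : rsubmx (a *: u + v) = a *: rsubmx u + rsubmx v by apply/rowP => k; rewrite !mxE.
have -> : lsubmx (a *: u + v) = a *: lsubmx u + lsubmx v by apply/rowP => k; rewrite !mxE.
rewrite GamDl GamDr GamZl GamZr.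
have -> : dGam i (lsubmx z) (a *: lsubmx u + lsubmx v) (rsubmx z) (rsubmx z) =
   a *: dGam i (lsubmx z) (lsubmx u) (rsubmx z) (rsubmx z) + dGam i (lsubmx z) (lsubmx v) (rsubmx z) (rsubmx z).
  apply/rowP => k; rewrite !mxE mulr_sumr -big_split/=; apply: eq_bigr => c _.
  rewrite mulr_sumr -big_split/=; apply: eq_bigr => d _.
  by rewrite dotvDl dotvZl; ring.
by apply/rowP => k; rewrite !mxE; ring.
Qed.

(** Any matrix with this action will do: later arguments go through [DFE]. *)
Definition DF i (z : W) : 'M[R]_(n + n) := sval (cid (linear_mx (dF_linear i z))).

Lemma DFE i (z b : W) : b *m DF i z = dF i z b.
Proof. by rewrite /DF; case: cid. Qed.

Lemma Fg_sdiff i (z : W) : Om i z -> sdiff (Fg i) z (DF i z).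
Proof.
move=> iz; apply/sdiffP => l; rewrite -[l]splitK; case: (fintype.split l) => k /=.
  rewrite (_ : (fun _ => _) = fun y : W => y 0 (rshift n k)); last first.
    by apply/funext => y; rewrite row_mxEl mxE.
  apply: (@sdR_eq _ _ _ _ (fun b : W => b 0 (rshift n k))).
    by move=> b; rewrite DFE row_mxEl mxE.
  apply: sdR_lin; last by move=> y y'; rewrite !mxE.
  by exists 1 => // b; rewrite mul1r normv_coord.
have sr c : sdR (fun y : W => rsubmx y 0 c) z (fun b : W => rsubmx b 0 c).
  apply: sdR_lin; last by move=> y y'; rewrite !mxE.
  by exists 1 => // b; rewrite mul1r mxE normv_coord.
have sC c d : sdR (fun y : W => christoffel i c d k (lsubmx y)) z
    (fun b : W => dotv (lsubmx b) (grad (christoffel i c d k) (lsubmx z))).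
  apply: (@sdR_comp _ _ _ (christoffel i c d k) (@lsubmx R 1 n n) z
    (fun b : V => dotv b (grad (christoffel i c d k) (lsubmx z)))).
  - by move=> *; exact: lsubB.
  - by move=> *; exact: lsub_norm.
  - by apply: sdP; exact: christoffel_sd.
have S := sdR_mul (sdR_cst (-1) z) (sdR_sum (index_enum 'I_n) (fun c =>
  sdR_sum (index_enum 'I_n) (fun d => sdR_mul (sdR_mul (sC c d) (sr c)) (sr d)))).
rewrite (_ : (fun _ => _) = fun y : W => -1 * \sum_c \sum_d christoffel i c d k (lsubmx y) * rsubmx y 0 c * rsubmx y 0 d).
  apply: sdR_eq S => b; rewrite DFE row_mxEr !mxE mulr0 addr0 mulN1r -!big_split/=; congr (- _).
  apply: eq_bigr => c _; rewrite -!big_split/=; apply: eq_bigr => d _.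
  by rewrite !mxE; ring.
by apply/funext => y; rewrite /Fg row_mxEr !mxE mulN1r.
Qed.

End spray.

(** * Local uniqueness, reparametrisation and speed of geodesics *)

Section geodesics.
Context {R : realType} (M : riemannian_manifold R).
Local Notation n := (mdim M).
Local Notation V := 'rV[R]_n.
Local Notation W := 'rV[R]_(n + n).
Implicit Types (i j : chart M) (x y : M) (u v w m : V) (c : R -> M) (t s b : R) (z : R -> W).

Definition st i c t : W := row_mx (coord i (c t)) (cv i c t).

Lemma st_Om i c t : chart_dom i (c t) -> Om i (st i c t).
Proof. by move=> it; rewrite /Om/= row_mxKl; exact: coord_img. Qed.

Lemma geodesic_derivable i c t : geodesic_at c t -> chart_dom i (c t) ->
  \forall s \near t, derivable (coord i \o c) s 1.
Proof. by move=> g it; have [] := geodesic_at_vder g it. Qed.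

Lemma geodesic_continuous c t : geodesic_at c t -> {for t, continuous c}.
Proof. by case. Qed.

Lemma geodesic_vder i c t : geodesic_at c t -> chart_dom i (c t) -> vder (coord i \o c) t (cv i c t).
Proof. by move=> g it; apply: derivable_vder; exact: nbhs_singleton (geodesic_derivable g it). Qed.

Lemma st_vder i c t : geodesic_at c t -> chart_dom i (c t) -> vder (st i c) t (Fg i (st i c t)).
Proof.
move=> g it; have [_ d2] := geodesic_at_vder g it.
by rewrite /Fg /st row_mxKl row_mxKr; apply: vder_row => //; exact: geodesic_vder.
Qed.

(** Converse of [st_vder]: a solution of the first-order system is the state of the curve of its
    positions. *)
Lemma state_geodesic i c z t : Om i (z t) -> (\forall s \near t, vder z s (Fg i (z s))) ->
  (\forall s \near t, c s = param i (lsubmx (z s))) ->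
  geodesic_at c t /\ \forall s \near t, st i c s = z s.
Proof.
move=> iz dz cE.
have zO : \forall s \near t, Om i (z s).
  have zc := vder_continuous (nbhs_singleton dz).
  by apply: zc; apply: open_nbhs_nbhs; split=> //; exact: Om_open.
have qE : \forall s \near t, coord i (c s) = lsubmx (z s).
  by near=> s; rewrite (near cE s)// paramK//; near: s.
have dq : \forall s \near t, vder (coord i \o c) s (rsubmx (z s)).
  have := near_join qE; near_simpl => qE'.
  near=> s; have : vder (fun s => lsubmx (z s)) s (lsubmx (Fg i (z s))).
    by apply: vder_lsub; near: s.
  rewrite row_mxKl; apply: vder_near.
  have : \forall s' \near s, coord i (c s') = lsubmx (z s') by near: s.
  by apply: filterS => s' /= ->.
have vE : \forall s \near t, cv i c s = rsubmx (z s).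
  by apply: filterS dq => s /vder_derive1.
have it : chart_dom i (c t) by rewrite (nbhs_singleton cE); exact: param_dom.
have ci : \forall s \near t, chart_dom i (c s).
  by near=> s; rewrite (near cE s)//; apply: param_dom; near: s.
split; last first.
  near=> s; rewrite /st (near vE s)// (near qE s)//; exact: hsubmxK.
have cc : {for t, continuous c}.
  by apply: (near_fun_continuous ci); exact: vder_continuous (nbhs_singleton dq).
apply: (geodesic_at_of_chart cc it).
  by apply: filterS dq => s; exact: vder_derivable.
have := vder_rsub (nbhs_singleton dz).
rewrite row_mxKr (nbhs_singleton qE) (nbhs_singleton vE).
by apply: vder_near; apply: filterS vE => s ->.
Unshelve. all: by end_near. Qed.

Definition geo_on c b := forall t, 0 <= t <= b -> \forall s \near t, geodesic_at c s.

(** Agreement of position and velocity. One chart is enough as a witness; [same_all] transfers the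
    agreement to the others. *)
Definition same c d s := c s = d s /\ exists2 i, chart_dom i (c s) & cv i c s = cv i d s.

Lemma same_all c d s i : geodesic_at c s -> geodesic_at d s -> same c d s -> chart_dom i (c s) ->
  cv i c s = cv i d s.
Proof.
move=> gc gd [E [j jc Ej]] ic.
have jd : chart_dom j (d s) by rewrite -E. have id : chart_dom i (d s) by rewrite -E.
rewrite (cv_trans (geodesic_continuous gc) jc ic (vder_derivable (geodesic_vder gc jc))).
by rewrite (cv_trans (geodesic_continuous gd) jd id (vder_derivable (geodesic_vder gd jd))) Ej E.
Qed.

Lemma same_near c d t : (\forall s \near t, geodesic_at c s) -> (\forall s \near t, geodesic_at d s) ->
  same c d t -> \forall s \near t, same c d s.
Proof.
move=> gc gd S; have [E [i ic Ei]] := S.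
have id : chart_dom i (d t) by rewrite -E.
have nc := near_chart (geodesic_continuous (nbhs_singleton gc)) ic.
have nd := near_chart (geodesic_continuous (nbhs_singleton gd)) id.
have U := ode_unique (Fg_sdiff (st_Om ic)) (_ : st i c t = st i d t).
have {U} : \forall s \near t, st i c s = st i d s.
  apply: U; first by rewrite /st E Ei.
    by near=> s; apply: st_vder; near: s.
  by near=> s; apply: st_vder; near: s.
move=> EE; near=> s.
have /eq_row_mx[E1 E2] : st i c s = st i d s by near: s.
have ics : chart_dom i (c s) by near: s.
have ids : chart_dom i (d s) by near: s.
by split; [rewrite -(coordK ics) -(coordK ids) E1|exists i].
Unshelve. all: by end_near. Qed.

(** The closed half of uniqueness: the Hausdorff property identifies the limit points, after which
    the states are compared in one chart at the limit. *)
Lemma same_left c d t : geodesic_at c t -> geodesic_at d t ->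
  (forall e, 0 < e -> exists s, [/\ `|s - t| < e, geodesic_at c s, geodesic_at d s & same c d s]) -> same c d t.
Proof.
move=> gc gd H.
have E : c t = d t.
  apply: (@hausdorffM _ M) => A B /(geodesic_continuous gc)/nbhs_ballP[e /= e0 He].
  move=> /(geodesic_continuous gd)/nbhs_ballP[e' /= e'0 He'].
  have [|s [st _ _ [E _]]] := H (Num.min e e'); first by rewrite lt_min e0.
  move: st; rewrite lt_min distrC => /andP[h1 h2].
  by exists (c s); split; [exact: He|rewrite E; exact: He'].
split=> //; exists (chart_at (c t)); first exact: chart_atP.
set i := chart_at _; have ic : chart_dom i (c t) by exact: chart_atP.
have id : chart_dom i (d t) by rewrite -E.
have cc := vder_continuous (st_vder gc ic); have cd := vder_continuous (st_vder gd id).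
have nc := near_chart (geodesic_continuous gc) ic.
have F : st i c t = st i d t.
  apply/eqP; rewrite -subr_eq0 -normr_le0; apply/ler_addgt0Pl => e e0; rewrite addr0.
  have e2 : 0 < e / 2 by rewrite divr_gt0.
  have /nbhs_ballP[r /= r0 Hr] : \forall s \near t,
     [/\ chart_dom i (c s), `|st i c t - st i c s| < e / 2 & `|st i d t - st i d s| < e / 2].
    have /cvgrPdist_lt/(_ _ e2) N1 := cc; have /cvgrPdist_lt/(_ _ e2) N2 := cd.
    by apply: filterS3 nc N1 N2 => s h1 h2 h3; exact: And3 h1 h2 h3.
  have [s [sr gcs gds S]] := H _ r0.
  have [|h1 h2 h3] := Hr s; first by rewrite /ball/= distrC.
  have E' : st i c s = st i d s by rewrite /st (same_all gcs gds S h1) (proj1 S).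
  rewrite E' in h2.
  have -> : st i c t - st i d t = (st i c t - st i d s) - (st i d t - st i d s).
    by rewrite opprB addrA subrK.
  apply: (le_trans (ler_normB _ _)); rewrite [e]splitr; exact: lerD (ltW h2) (ltW h3).
by case/eq_row_mx: F.
Unshelve. all: by end_near. Qed.

Lemma geodesic_unique c d b : 0 <= b -> geo_on c b -> geo_on d b -> same c d 0 ->
  forall s, 0 <= s <= b -> \forall s' \near s, same c d s'.
Proof.
move=> b0 gc gd S0 s sb; apply: same_near; [exact: gc|exact: gd|].
apply: (real_induction (b := b)) sb => // {}s sb.
- move=> S; have /nbhs_ballP[r /= r0 Hr] := same_near (gc _ sb) (gd _ sb) S.
  exists r; [exact: r0|move=> s' /andP[ss' s'r] _; apply: Hr; rewrite /ball/= ler0_norm; lra].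
- have sb' : 0 <= s <= b by lra.
  move=> H; apply: same_left; [exact: nbhs_singleton (gc _ sb')|exact: nbhs_singleton (gd _ sb')|].
  move=> e e0; have sm : 0 < Num.min e s / 2 by rewrite divr_gt0// lt_min e0; case/andP: sb.
  have m1 : Num.min e s <= e by rewrite ge_min lexx.
  have m2 : Num.min e s <= s by rewrite ge_min lexx orbT.
  have h : 0 <= s - Num.min e s / 2 < s by lra.
  have hb : 0 <= s - Num.min e s / 2 <= b by lra.
  exists (s - Num.min e s / 2); split; last exact: H.
  + rewrite addrAC subrr add0r normrN gtr0_norm//; lra.
  + exact: nbhs_singleton (gc _ hb).
  + exact: nbhs_singleton (gd _ hb).
Qed.

Lemma is_derive_cast (f : R -> R) (t a a' : R) : is_derive t 1 f a -> a = a' -> is_derive t 1 f a'.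
Proof. by move=> ? <-. Qed.

Lemma affine_continuous (k a : R) t : {for t, continuous (fun s : R => k * s + a)}.
Proof. by apply: continuousD; [exact: mulrl_continuous|exact: cst_continuous]. Qed.

Lemma near_affine (P : R -> Prop) (k a t : R) : (\forall s \near (k * t + a), P s) ->
  \forall s \near t, P (k * s + a).
Proof. exact: affine_continuous. Qed.

Lemma cv_affine i c (k a : R) s : derivable (coord i \o c) (k * s + a) 1 ->
  vder (coord i \o (fun s => c (k * s + a))) s (k *: cv i c (k * s + a)).
Proof. by move=> /derivable_vder/vder_affine. Qed.

Lemma geodesic_affine c (k a : R) t : geodesic_at c (k * t + a) -> geodesic_at (fun s => c (k * s + a)) t.
Proof.
move=> g; have cc := geodesic_continuous g.
have ca := @affine_continuous k a t.
pose i := chart_at (c (k * t + a)); have ic : chart_dom i (c (k * t + a)) by exact: chart_atP.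
have [D1 D2] := geodesic_at_vder g ic.
pose P (r : R) := derivable (coord i \o c) r 1.
have N : \forall s \near t, P (k * s + a) by apply: near_affine.
have dv : \forall s \near t, vder (coord i \o (fun s => c (k * s + a))) s (k *: cv i c (k * s + a)).
  by apply: filterS N => s; exact: cv_affine.
have vE : \forall s \near t, cv i (fun s => c (k * s + a)) s = k *: cv i c (k * s + a).
  by apply: filterS dv => s; exact: vder_derive1.
have cc' : {for t, continuous (fun s => c (k * s + a))}.
  exact: (@continuous_comp _ _ _ (fun s : R => k * s + a) c t).
apply: (geodesic_at_of_chart cc' ic).
- by apply: filterS dv => s; exact: vder_derivable.
rewrite (nbhs_singleton vE) GamZl GamZr scalerA -scalerN.
have V1 := vder_affine D2.
have V2 : vder (fun s => k *: cv i c (k * s + a)) t (k *: (k *: - Gam i (coord i (c (k * t + a))) (cv i c (k * t + a)) (cv i c (k * t + a)))).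
  move=> l; under eq_fun do rewrite mxE; rewrite mxE; apply: is_deriveZ; exact: V1.
rewrite scalerA in V2; apply: vder_near V2; apply: filterS vE => s ->.
by [].
Qed.

Lemma geo_on_affine c (k a b b' : R) : (forall t, 0 <= t <= b' -> 0 <= k * t + a <= b) -> geo_on c b ->
  geo_on (fun s => c (k * s + a)) b'.
Proof.
move=> H gc t tb.
have := near_affine (gc _ (H _ tb)).
by apply: filterS => s; exact: geodesic_affine.
Qed.

Definition speed2 c t := ginner (c t) (velocity c t) (velocity c t).

Lemma ginnerE x u v : ginner x u v = gm (chart_at x) (coord (chart_at x) x) u v.
Proof. by []. Qed.

Lemma speed2E i c t : {for t, continuous c} -> chart_dom i (c t) -> derivable (coord i \o c) t 1 ->
  speed2 c t = gm i (coord i (c t)) (cv i c t) (cv i c t).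
Proof.
move=> cc it d; have jt := chart_atP (c t).
rewrite (gm_trans _ _ (overlap_coord it jt)) (trans_coord _ it).
by rewrite -(cv_trans cc it jt d).
Qed.

(** Conservation of energy: the Euler-Lagrange equation tested on the velocity itself. *)
Lemma speed_derive c t : (\forall s \near t, geodesic_at c s) -> is_derive t 1 (speed2 c) 0.
Proof.
move=> gn; have g := nbhs_singleton gn.
pose i := chart_at (c t); have ic : chart_dom i (c t) by exact: chart_atP.
have [D1 D2] := geodesic_at_vder g ic.
have := is_derive_gm (coord_img ic : chart_img i ((coord i \o c) t)) (geodesic_vder g ic) D2 D2.
have iy := coord_img ic.
have := (euler_lagrange (cv i c t) _ iy).1 erefl (cv i c t).
rewrite (gm_sym _ (- Gam _ _ _ _) iy) /= => E.
move=> D; apply: is_derive_near (is_derive_cast D _); last by clear -E; lra.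
near=> s.
have gs : geodesic_at c s by near: s.
have is_ : chart_dom i (c s) by near: s; exact: near_chart (geodesic_continuous g) ic.
by rewrite (speed2E (geodesic_continuous gs) is_)//; exact: vder_derivable (geodesic_vder gs is_).
Unshelve. all: by end_near. Qed.

Lemma speed_const c b s : geo_on c b -> 0 <= s <= b -> speed2 c s = speed2 c 0.
Proof.
move=> gc /andP[s0 sb]; apply: derive_eq0_cst => // r /andP[r0 rs].
by apply: speed_derive; apply: gc; rewrite r0 (le_trans rs).
Qed.

End geodesics.

(** * Smooth dependence of geodesics on their initial velocity *)

Section family.
Context {R : realType} (M : riemannian_manifold R).
Local Notation n := (mdim M).
Local Notation V := 'rV[R]_n.
Local Notation W := 'rV[R]_(n + n).
Implicit Types (i j : chart M) (p x y : M) (u v w m : V) (c d e : R -> M) (t s b : R) (z : W).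

Lemma near_cv i c d t : (\forall s \near t, c s = d s) -> \forall s \near t, cv i c s = cv i d s.
Proof.
move=> /near_join; apply: filterS => s cd; rewrite /cv !derive1E; apply: near_eq_derive.
by apply: filterS cd => r /= ->.
Qed.

Lemma near_geodesic c d t : (\forall s \near t, c s = d s) ->
  (\forall s \near t, geodesic_at c s) -> \forall s \near t, geodesic_at d s.
Proof.
move=> /near_join cd gc; apply: filterS2 cd gc => s cd g.
have E := nbhs_singleton cd.
pose i := chart_at (c s); have ic : chart_dom i (c s) by exact: chart_atP.
have [D1 D2] := geodesic_at_vder g ic.
have cE := near_cv i cd.
have cont : {for s, continuous d}.
  have N : \forall r \near s, chart_dom i (d r).
    by apply: filterS2 cd (near_chart (geodesic_continuous g) ic) => r ->.
  apply: (near_fun_continuous N); apply: (@vder_continuous _ _ _ _ (cv i c s)).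
  by apply: vder_near (geodesic_vder g ic); apply: filterS cd => r /= ->.
apply: (geodesic_at_of_chart (i := i) cont); first by rewrite -E.
- apply: filterS2 D1 (near_join cd) => r dr rd; apply: vder_derivable (derivable_vder _).
  by apply: vder_derivable; apply: vder_near (derivable_vder dr); apply: filterS rd => r' /= ->.
rewrite -E -(nbhs_singleton cE); apply: vder_near D2; exact: cE.
Qed.

Definition Fam p v s c := [/\ c 0 = p, velocity c 0 = v & geo_on c s].

(* [St p i v s] is the state at time [s] of the geodesic issued from [p] with velocity [v], a junk
   value if this geodesic does not live until time [s]. *)
Definition cc p v s : R -> M := xget (fun=> p) [set c | Fam p v s c].

Definition St p i v s : W := st i (cc p v s) s.

Lemma geo_on_le c s b : s <= b -> geo_on c b -> geo_on c s.
Proof. by move=> sb gc t /andP[t0 ts]; apply: gc; rewrite t0 (le_trans ts). Qed.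

Lemma Fam_le p v s b c : s <= b -> Fam p v b c -> Fam p v s c.
Proof. by move=> sb [? ? g]; split=> //; exact: geo_on_le g. Qed.

Lemma Fam_same p v s c d : Fam p v s c -> Fam p v s d ->
  forall r, 0 <= r <= s -> \forall r' \near r, same c d r'.
Proof.
move=> [c0 vc gc] [d0 vd gd] r rs; have s0 : 0 <= s by case/andP : rs => /le_trans h /h.
apply: (geodesic_unique s0 gc gd _ rs).
split; first by rewrite c0 d0.
exists (chart_at (c 0)); first exact: chart_atP.
by rewrite c0 /cv; move: vc vd; rewrite /velocity c0 d0 => -> ->.
Qed.

Lemma ccP p v s c : Fam p v s c -> Fam p v s (cc p v s).
Proof. by move=> H; apply: (xgetPex _ (ex_intro _ c H)). Qed.

Lemma StE p i v s b c : Fam p v b c -> 0 <= s <= b -> chart_dom i (c s) -> St p i v s = st i c s.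
Proof.
move=> F sb ic; have sb' : s <= b by case/andP: sb.
have ss : 0 <= s <= s by case/andP: sb => ->; rewrite lexx.
have Fs := Fam_le sb' F; have Fc := ccP Fs.
have [_ _ g1] := Fs; have [_ _ g2] := Fc.
have S := nbhs_singleton (Fam_same Fs Fc ss).
rewrite /St /st (same_all (nbhs_singleton (g1 _ ss)) (nbhs_singleton (g2 _ ss)) S ic).
by case: S => ->.
Qed.

(** By uniqueness the two pieces agree on a neighbourhood of s, so the glued curve coincides with
    one of them near every time. *)
Lemma geo_glue c e s s' : 0 <= s <= s' -> geo_on c s ->
  (forall t, s <= t <= s' -> \forall r \near t, geodesic_at e r) -> same c e s ->
  exists f, [/\ geo_on f s', forall r, r <= s -> \forall t \near r, c t = f t
    & forall r, s <= r -> \forall t \near r, e t = f t].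
Proof.
move=> /andP[s0 ss'] gc ge S.
have ss : 0 <= s <= s by rewrite s0 lexx.
have ss2 : s <= s <= s' by rewrite lexx.
have N : \forall r \near s, c r = e r.
  by apply: filterS (same_near (gc _ ss) (ge _ ss2) S) => r [].
pose f r := if r <= s then c r else e r.
have f1 r : r <= s -> \forall t \near r, c t = f t.
  rewrite le_eqVlt => /orP[/eqP->|rs].
    by apply: filterS N => t E; rewrite /f; case: ifP.
  by apply: filterS (lt_nbhsl rs) => t /ltW ts; rewrite /f ts.
have f2 r : s <= r -> \forall t \near r, e t = f t.
  rewrite le_eqVlt => /orP[/eqP<-|rs].
    by apply: filterS N => t E; rewrite /f; case: ifP.
  by apply: filterS (lt_nbhsr rs) => t; rewrite /f leNgt => ->.
exists f; split=> // t /andP[t0 ts'].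
have [ts|/ltW ts] := leP t s.
  by apply: near_geodesic (f1 _ ts) (gc _ _); rewrite t0.
by apply: near_geodesic (f2 _ ts) (ge _ _); rewrite ts.
Qed.

Lemma near_velocity c d t : (\forall s \near t, c s = d s) -> velocity c t = velocity d t.
Proof.
by move=> cd; rewrite /velocity -(nbhs_singleton cd); exact: nbhs_singleton (near_cv _ cd).
Qed.

(** Geodesics need not live for all times, so existence up to s' is extracted from a flow box
    entered at time s. *)
Lemma flow_extend p i v s s' c (phi : R -> W) (tau : R) : Fam p v s c -> 0 <= s <= s' -> s' - s < tau ->
  0 < tau ->
  chart_dom i (c s) -> phi 0 = st i c s ->
  (forall h, `|h| < tau -> Om i (phi h) /\ vder phi h (Fg i (phi h))) ->
  exists e, [/\ Fam p v s' e, chart_dom i (e s') & st i e s' = phi (s' - s)].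
Proof.
move=> [c0 vc gc] ss' s't tau0 ic phi0 Hphi.
pose z r := phi (r - s); pose g r := param i (lsubmx (z r)).
have near_s r : `|r - s| < tau -> \forall r' \near r, `|r' - s| < tau.
  move=> rs; apply/nbhs_ballP; exists (tau - `|r - s|); first by rewrite /= subr_gt0.
  move=> r'; rewrite /ball/= ltrBrDr distrC => h; apply: le_lt_trans h.
  by rewrite (le_trans _ (ler_normD _ _))// addrA subrK.
have zO r : `|r - s| < tau -> Om i (z r) by move=> /Hphi[].
have zV r : `|r - s| < tau -> vder z r (Fg i (z r)).
  move=> /Hphi[_ d]; have -> : z = fun r => phi (1 * r - s) by apply/funext => r'; rewrite /z mul1r.
  by rewrite -[X in vder _ _ X]scale1r; apply: vder_affine; rewrite mul1r.
have G r : `|r - s| < tau -> geodesic_at g r /\ \forall r' \near r, st i g r' = z r'.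
  move=> rs; apply: (state_geodesic (z := z)); first exact: zO.
    by apply: filterS (near_s _ rs) => r'; exact: zV.
  by apply: filterE.
have s0 : `|s - s| < tau by rewrite subrr normr0.
have E : st i g s = st i c s by rewrite (nbhs_singleton (G _ s0).2) /z subrr.
have gsE r : `|r - s| < tau -> chart_dom i (g r) by move=> rs; apply: param_dom; exact: zO.
have S : same c g s.
  have /eq_row_mx[E1 E2] := E; split; last by exists i.
  by rewrite -(coordK ic) -(coordK (gsE _ s0)) E1.
have gg t : s <= t <= s' -> \forall r \near t, geodesic_at g r.
  move=> /andP[st ts']; have ts : `|t - s| < tau.
    by rewrite ger0_norm ?subr_ge0//; apply: le_lt_trans s't; rewrite lerD2r.
  by apply: filterS (near_s _ ts) => r /G[].
have [f [gf f1 f2]] := geo_glue ss' gc gg S.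
exists f; case/andP: (ss') => sge0 sles'.
have s's : `|s' - s| < tau by rewrite ger0_norm// subr_ge0.
have Ef := f2 _ sles'.
have fs' : f s' = g s' by rewrite (nbhs_singleton Ef).
split.
- have E0 := f1 _ sge0.
  by split; [rewrite -(nbhs_singleton E0)|rewrite -(near_velocity E0)|].
- by rewrite fs'; exact: gsE.
- rewrite /st -(nbhs_singleton (near_cv i Ef)) fs'.
  exact: (nbhs_singleton (G _ s's).2).
Qed.

End family.

Section sdiff_more.
Context {R : realType}.

Lemma half_lt (r : R) : 0 < r -> r / 2 < r.
Proof. by move=> r0; rewrite ltr_pdivrMr// ltr_pMr// ltr1n. Qed.

Lemma sdiff_near m k (f g : 'rV[R]_m -> 'rV[R]_k) (x : 'rV[R]_m) A (d : R) : 0 < d ->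
  (forall y : 'rV[R]_m, `|y - x| < d -> f y = g y) -> sdiff f x A -> sdiff g x A.
Proof.
move=> d0 fg sf e /sf[d' d'0 Hd]; exists (Num.min d d') => [|y z]; first by rewrite lt_min d0.
by rewrite !lt_min => /andP[y1 y2] /andP[z1 z2]; rewrite -!fg//; exact: Hd.
Qed.

Lemma sdiff_comp m k l (f : 'rV[R]_m -> 'rV[R]_k) (g : 'rV[R]_k -> 'rV[R]_l) (x : 'rV[R]_m) A B :
  sdiff f x A -> sdiff g (f x) B -> sdiff (fun y => g (f y)) x (A *m B).
Proof.
move=> sf sg e e0.
have [r r0 Hr] := sdiff_lip sf.
have KA0 : 0 < opn A + 1 by rewrite ltr_wpDl// opn_ge0.
have KB0 : 0 < opn B + 1 by rewrite ltr_wpDl// opn_ge0.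
have [d1 d10 H1] := sg _ (divr_gt0 (divr_gt0 e0 (ltr0Sn _ 1)) KA0).
have [d2 d20 H2] := sf _ (divr_gt0 (divr_gt0 e0 (ltr0Sn _ 1)) KB0).
exists (Num.min r (Num.min d2 (d1 / (opn A + 1)))) => [|y z].
  by rewrite !lt_min r0 d20 divr_gt0.
rewrite !lt_min !ltr_pdivlMr// => /and3P[y1 y2 y3] /and3P[z1 z2 z3].
have fx w : `|w - x| < r -> `|w - x| * (opn A + 1) < d1 -> `|f w - f x| < d1.
  by move=> w1 w3; rewrite (le_lt_trans (Hr _ _ w1 _)) ?subrr ?normr0// mulrC.
have -> : g (f y) - g (f z) - (y - z) *m (A *m B) =
   (g (f y) - g (f z) - (f y - f z) *m B) + (f y - f z - (y - z) *m A) *m B.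
  by rewrite [in RHS](mulmxBl (f y - f z)) mulmxA addrA subrK.
rewrite (le_trans (ler_normD _ _))// [e in leRHS]splitr mulrDl lerD//.
  apply: (le_trans (H1 _ _ (fx _ y1 y3) (fx _ z1 z3))).
  rewrite mulrAC ler_pdivrMr// -[leRHS]mulrA ler_wpM2l ?divr_ge0 ?(ltW e0)// mulrC.
  exact: Hr.
rewrite (le_trans (normv_mul _ _))//.
rewrite (le_trans (ler_wpM2l (opn_ge0 B) (H2 _ _ y2 z2)))//.
rewrite mulrA ler_wpM2r// mulrCA ger_pMr ?divr_gt0// ler_pdivrMr// mul1r.
by rewrite lerDl.
Qed.

Lemma sdiff_unique m k (f : 'rV[R]_m -> 'rV[R]_k) (x : 'rV[R]_m) A B : sdiff f x A -> sdiff f x B -> A = B.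
Proof.
move=> sA sB; apply/row_matrixP => a; rewrite !rowE; apply: vder_unique.
  apply: (sdiff_chain (q := fun s => x + s *: delta_mx 0 a) (t := 0)) => //; last exact: vder_line.
  by rewrite scale0r addr0; exact: sA.
apply: (sdiff_chain (q := fun s => x + s *: delta_mx 0 a) (t := 0)) => //; last exact: vder_line.
by rewrite scale0r addr0; exact: sB.
Qed.

Lemma sd_coord m (j : 'I_m) (x : 'rV[R]_m) : sd (fun y : 'rV[R]_m => y 0 j) x.
Proof.
exists (delta_mx 0 j); apply: (@sdR_eq _ _ _ _ (fun b : 'rV[R]_m => b 0 j)).
  move=> b; rewrite /dotv (bigD1 j)//= big1 ?addr0; first by rewrite mxE !eqxx mulr1.
  by move=> k kj; rewrite mxE (negbTE kj) andbF mulr0.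
apply: sdR_lin; last by move=> y z; rewrite !mxE.
by exists 1 => // b; rewrite mul1r normv_coord.
Qed.

Lemma sd_lsub n m (f : 'rV[R]_n -> R) (z : 'rV[R]_(n + m)) : sd f (lsubmx z) -> sd (fun y : 'rV[R]_(n + m) => f (lsubmx y)) z.
Proof.
move=> [a sa]; exists (row_mx a 0).
have := sdR_comp (L := @lsubmx R 1 n m) (@lsubB _ _ _) (@lsub_norm _ _ _) sa.
apply: sdR_eq => b; rewrite /dotv big_split_ord/= [X in _ = _ + X]big1 ?addr0.
  by apply: eq_bigr => j _; rewrite row_mxEl mxE.
by move=> j _; rewrite row_mxEr mxE mulr0.
Qed.

Lemma sdiff_ex m k (f : 'rV[R]_m -> 'rV[R]_k) (x : 'rV[R]_m) : (forall l, sd (fun y => f y 0 l) x) -> exists A, sdiff f x A.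
Proof.
move=> H; exists (\matrix_(j, l) grad (fun y => f y 0 l) x 0 j); apply/sdiffP => l.
apply: sdR_eq (sdP (H l)) => b; rewrite mxE /dotv.
by apply: eq_bigr => j _; rewrite [in RHS]mxE.
Qed.

End sdiff_more.

Section dependence.
Context {R : realType} (M : riemannian_manifold R).
Local Notation n := (mdim M).
Local Notation V := 'rV[R]_n.
Local Notation W := 'rV[R]_(n + n).
Implicit Types (i j : chart M) (p x y : M) (u v w m : V) (c d e : R -> M) (t s b : R) (z : W).

(** The transition map of the tangent bundle. *)
Definition tangent_trans i j z : W := row_mx (trans i j (lsubmx z)) (rsubmx z *m Tm i j (lsubmx z)).

Lemma tangent_trans_sdiff i j z : overlap i j (lsubmx z) -> exists A, sdiff (tangent_trans i j) z A.
Proof.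
move=> Oz; apply: sdiff_ex => l; rewrite -[l]splitK; case: (fintype.split l) => k /=.
  under eq_fun do rewrite row_mxEl.
  apply: (@sd_lsub _ _ _ (fun y : V => trans i j y 0 k)).
  apply: (smooth_sd (U := overlap i j)) => //; first exact: overlap_open.
  exact: transition_smooth.
under eq_fun do rewrite row_mxEr mxE.
apply: sd_sum => a; apply: sd_mul.
  by under eq_fun do rewrite mxE; exact: sd_coord.
apply: (@sd_lsub _ _ _ (fun y : V => Tm i j y a k)); rewrite TmE.
apply: (smooth_sd (U := overlap i j)) => //; first exact: overlap_open.
exact/smooth_partial/transition_smooth.
Qed.

Lemma st_trans i j c t : geodesic_at c t -> chart_dom i (c t) -> chart_dom j (c t) ->
  st j c t = tangent_trans i j (st i c t).
Proof.
move=> g ic jc; rewrite /tangent_trans /st row_mxKl row_mxKr trans_coord//.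
by rewrite -(cv_trans (geodesic_continuous g) ic jc)//; exact: vder_derivable (geodesic_vder g ic).
Qed.

(** Openness of the domain of the time-s exponential map, to be propagated along the geodesic
    together with differentiability. *)
Definition near_fam p v0 s i :=
  exists2 d : R, 0 < d & forall v, `|v - v0| < d -> exists2 c, Fam p v s c & chart_dom i (c s).

Definition flow_data i zs (tau d : R) (phi : W -> R -> W) (Y : W -> R -> 'M[R]_(n + n)) :=
  [/\ 0 < tau, 0 < d & forall z, `|z - zs| < d ->
    [/\ phi z 0 = z, Y z 0 = 1%:M &
      forall h, `|h| < tau ->
      [/\ Om i (phi z h), vder (phi z) h (Fg i (phi z h)),
          sdiff (phi ^~ h) z (Y z h) &
          forall b : W, vder (fun h => b *m Y z h) h (b *m Y z h *m DF i (phi z h))]]].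

Lemma flow_dataP i zs : Om i zs -> exists tau (d : R) phi Y, flow_data i zs tau d phi Y.
Proof. by apply: local_flow; [exact: Om_open|exact: Fg_sdiff]. Qed.

Lemma Fam_StE p i v s c : 0 <= s -> Fam p v s c -> chart_dom i (c s) -> St p i v s = st i c s.
Proof. by move=> s0 F ic; apply: (StE F) => //; rewrite s0 lexx. Qed.

Lemma Fam_geo p v s c : 0 <= s -> Fam p v s c -> geodesic_at c s.
Proof. by move=> s0 [_ _ g]; apply: nbhs_singleton (g s _); rewrite s0 lexx. Qed.

Lemma dep_chart p v0 s c0 i j : 0 <= s -> Fam p v0 s c0 -> chart_dom i (c0 s) -> chart_dom j (c0 s) ->
  near_fam p v0 s i -> (exists L, sdiff (fun v => St p i v s) v0 L) ->
  near_fam p v0 s j /\ exists L, sdiff (fun v => St p j v s) v0 L.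
Proof.
move=> s0 F0 ic jc [d d0 Hd] [L sL].
have E0 := Fam_StE s0 F0 ic.
have O0 : overlap i j (lsubmx (St p i v0 s)).
  by rewrite E0 row_mxKl; exact: overlap_coord.
have [r r0 Hr] := open_ball (@overlap_open _ _ i j) O0.
have /continuous_epsP/(_ (r / 2))[|d' d'0 Hd'] := sdiff_continuous sL; first by rewrite divr_gt0.
have m0 : 0 < Num.min d d' by rewrite lt_min d0.
have K v : `|v - v0| < Num.min d d' -> exists c, [/\ Fam p v s c, chart_dom i (c s) & chart_dom j (c s)].
  rewrite lt_min => /andP[v1 v2]; have [c F cs] := Hd _ v1; have h := Hd' _ v2; exists c.
  suff cj : chart_dom j (c s) by exact: And3 F cs cj.
  have : overlap i j (lsubmx (St p i v s)).
    apply: Hr; rewrite -lsubB; exact: le_lt_trans (le_trans (lsub_norm _) h) (half_lt r0).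
  by rewrite (Fam_StE s0 F cs) row_mxKl => /overlapP[_]; rewrite coordK.
split; first by exists (Num.min d d'); [exact: m0|move=> v /K[c [F _ cj]]; exists c].
have [A sA] := tangent_trans_sdiff O0.
exists (L *m A); apply: (sdiff_near m0 _ (sdiff_comp sL sA)) => v /K[c [F ci cj]].
rewrite (Fam_StE s0 F cj) (Fam_StE s0 F ci).
exact/esym/(st_trans (Fam_geo s0 F) ci cj).
Qed.

(** Propagation through one flow box: the state at s' is the flow of the state at s, so the
    derivatives compose. *)
Lemma dep_step p v0 c0 b s s' i zs (tau d : R) phi Y L : flow_data i zs tau d phi Y ->
  Fam p v0 b c0 -> 0 <= s <= s' -> s' <= b -> s' - s < tau ->
  chart_dom i (c0 s) -> `|st i c0 s - zs| < d ->
  near_fam p v0 s i -> sdiff (fun v => St p i v s) v0 L ->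
  [/\ chart_dom i (c0 s'), st i c0 s' = phi (st i c0 s) (s' - s), near_fam p v0 s' i &
    sdiff (fun v => St p i v s') v0 (L *m Y (st i c0 s) (s' - s))].
Proof.
move=> [tau0 d0 Hflow] F0 ss' s'b s's ic cd [d1 d10 Hd1] sL.
have /andP[s0 s_s'] := ss'.
have s'0 := le_trans s0 s_s'.
have K v c : Fam p v s c -> chart_dom i (c s) -> `|st i c s - zs| < d ->
    exists e, [/\ Fam p v s' e, chart_dom i (e s') & st i e s' = phi (st i c s) (s' - s)].
  move=> F ci /Hflow[p0 _ H].
  by apply: (flow_extend F ss' s's tau0 ci p0) => h /H[].
have F0s := Fam_le (le_trans s_s' s'b) F0; have F0s' := Fam_le s'b F0.
have StE0 : St p i v0 s = st i c0 s by exact: Fam_StE.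
have [e [Fe ei eE]] := K _ _ F0s ic cd.
have ic' : chart_dom i (c0 s').
  have s's' : 0 <= s' <= s' by rewrite s'0 lexx.
  by rewrite (nbhs_singleton (Fam_same F0s' Fe s's')).1.
have E' : st i c0 s' = phi (st i c0 s) (s' - s).
  by rewrite -eE -(Fam_StE s'0 F0s' ic'); exact: Fam_StE.
have cd2 : 0 < (d - `|st i c0 s - zs|) / 2 by apply: divr_gt0; [rewrite subr_gt0|exact: ltr0Sn].
have /continuous_epsP/(_ _ cd2)[d2 d20 Hd2] := sdiff_continuous sL.
have m0 : 0 < Num.min d1 d2 by rewrite lt_min d10.
have N v : `|v - v0| < Num.min d1 d2 -> exists e, [/\ Fam p v s' e, chart_dom i (e s')
    & St p i v s' = phi (St p i v s) (s' - s)].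
  rewrite lt_min => /andP[/Hd1[c F ci] /Hd2]; rewrite StE0 (Fam_StE s0 F ci) => h.
  have cl : `|st i c s - zs| < d.
    rewrite -[st i c s](subrK (st i c0 s)) -addrA (le_lt_trans (ler_normD _ _))//.
    move: h cd2; clear; set A := `|_ - _|; set B := `|_ - _|; move: A B => A B; lra.
  have [e' [F' e'i e'E]] := K _ _ F ci cl; exists e'.
  by apply: (And3 F' e'i); rewrite (Fam_StE s'0 F' e'i).
split; [exact: ic'|exact: E'|..].
  by exists (Num.min d1 d2); [exact: m0|move=> v /N[e' [F' e'i _]]; exists e'].
have hs : `|s' - s| < tau by rewrite ger0_norm ?subr_ge0.
have [_ _ /(_ _ hs)[_ _ sphi _]] := Hflow _ cd.
rewrite -StE0 in sphi *.
apply: (sdiff_near m0 _ (sdiff_comp sL sphi)) => v /N[e' [_ _ E]]; exact: esym E.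
Qed.

Lemma dep_zero p v0 c0 : Fam p v0 0 c0 -> let i := chart_at p in
  near_fam p v0 0 i /\ sdiff (fun v => St p i v 0) v0 (row_mx 0 1%:M).
Proof.
move=> [c0p vc0 gc0] i; have ip : chart_dom i p by exact: chart_atP.
pose z v : W := row_mx (coord i p) v.
have Oz : Om i (z v0) by rewrite /Om/= row_mxKl; exact: coord_img.
have [tau [d [phi [Y [tau0 d0 H]]]]] := flow_dataP Oz.
have zz v : `|z v - z v0| <= `|v - v0|.
  have -> : z v - z v0 = row_mx 0 (v - v0) by rewrite /z opp_row_mx add_row_mx subrr.
  apply: normv_le => // l; rewrite -[l]splitK; case: (fintype.split l) => k /=.
    by rewrite row_mxEl mxE normr0.
  by rewrite row_mxEr normv_coord.
have N v : `|v - v0| < d -> exists2 c, Fam p v 0 c & chart_dom i (c 0) /\ st i c 0 = z v.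
  move=> vd; have [p0 _ Hf] := H (z v) (le_lt_trans (zz v) vd).
  pose c r := param i (lsubmx (phi (z v) r)).
  have near0 : \forall r \near (0 : R), `|r| < tau.
    by apply/nbhs_ballP; exists tau => // r; rewrite /ball/= sub0r normrN.
  have G : \forall r \near (0 : R), geodesic_at c r /\ \forall r' \near r, st i c r' = phi (z v) r'.
    near=> r; apply: (state_geodesic (z := phi (z v))).
    - by have [|] := Hf r => //; near: r.
    - have : \forall r' \near r, `|r'| < tau by near: r; exact: (near_join near0).
      by apply: filterS => r' /Hf[].
    - exact: filterE.
  have [G0 G0'] := nbhs_singleton G.
  have E0 : st i c 0 = z v by rewrite (nbhs_singleton G0') p0.
  have c0E : c 0 = p by rewrite /c p0 row_mxKl coordK.
  exists c; last by split=> //; rewrite c0E.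
  split=> //; last first.
    move=> t; rewrite -eq_le => /eqP <-; by apply: filterS G => r [].
  by rewrite /velocity c0E; have /eq_row_mx[_] := E0.
split; first by exists d => // v /N[c F [ci _]]; exists c.
apply: (sdiff_near (f := z) d0).
  by move=> v /N[c F [ci cE]]; rewrite (Fam_StE _ F ci).
move=> e e0; exists 1 => // v w _ _.
have -> : z v - z w - (v - w) *m row_mx 0 1%:M = 0.
  by rewrite mul_mx_row mulmx0 mulmx1 /z opp_row_mx add_row_mx subrr subrr.
by rewrite normr0 mulr_ge0// ltW.
Unshelve. all: by end_near. Qed.

End dependence.

(** * The derivative of geodesics in the initial velocity *)

Section jacobi_flow.
Context {R : realType} (M : riemannian_manifold R).
Local Notation n := (mdim M).
Local Notation V := 'rV[R]_n.
Local Notation W := 'rV[R]_(n + n).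
Implicit Types (i j : chart M) (p x y : M) (u v w m a : V) (c e : R -> M) (t s b d : R) (z : W).

Definition dep p v0 s i := near_fam p v0 s i /\ exists L, sdiff (fun v => St p i v s) v0 L.

(** To use the flow box around the state at s, one has to enter it at an earlier time, where the
    induction hypothesis is available. *)
Lemma approach_left i c0 s d tau : 0 < s -> 0 < d -> 0 < tau -> geodesic_at c0 s -> chart_dom i (c0 s) ->
  exists r, [/\ 0 <= r < s, s - r < tau, chart_dom i (c0 r) & `|st i c0 r - st i c0 s| < d].
Proof.
move=> s0 d0 tau0 g ic.
have nc := near_chart (geodesic_continuous g) ic.
have /cvgrPdist_lt/(_ _ d0) N := vder_continuous (st_vder g ic).
have NN : \forall r \near s, chart_dom i (c0 r) /\ `|st i c0 s - st i c0 r| < d.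
  by apply: filterS2 nc N => r; split.
move/nbhs_ballP : NN => [r /= r0 Hr].
pose h := Num.min r (Num.min s tau) / 2.
have m0 : 0 < Num.min r (Num.min s tau) by rewrite !lt_min r0 s0.
have h0 : 0 < h by rewrite divr_gt0.
have hm := half_lt m0; rewrite -/h !lt_min in hm; case/and3P: hm => hr hs ht.
exists (s - h); have [|h1 h2] := Hr (s - h).
  by rewrite /ball/= opprB addrC subrK gtr0_norm.
split.
- by rewrite subr_ge0 (ltW hs) ltrBlDr ltrDl.
- by rewrite opprB addrC subrK.
- exact: h1.
- by rewrite distrC.
Qed.

(** Real induction on the time; [dep_chart] changes charts when a new flow box is entered. *)
Lemma dep_all p v0 b c0 s i : Fam p v0 b c0 -> 0 <= s <= b -> chart_dom i (c0 s) -> dep p v0 s i.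
Proof.
move=> F0 sb.
suff: exists2 j, chart_dom j (c0 s) & dep p v0 s j.
  have s0 : 0 <= s by case/andP: sb. have s_b : s <= b by case/andP: sb.
  by move=> [j jc [D1 D2]] ic; exact: (dep_chart s0 (Fam_le s_b F0) jc ic D1 D2).
have b0 : 0 <= b by case/andP : sb => h /(le_trans h).
apply: (real_induction (b := b) (P := fun s => exists2 j, chart_dom j (c0 s) & dep p v0 s j)) sb.
- have F00 := Fam_le b0 F0; have [D1 D2] := dep_zero F00.
  exists (chart_at p); last by split; [exact: D1|exists (row_mx 0 1%:M)].
  by case: F0 => -> _ _; exact: chart_atP.
- move=> {}s sb [j jc [D1 [L D2]]].
  have [tau [d [phi [Y fd]]]] := flow_dataP (st_Om jc).
  have [tau0 d0 _] := fd; exists tau => // s' /andP[ss' s't] s'b.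
  have sd0 : `|st j c0 s - st j c0 s| < d by rewrite subrr normr0.
  have s0s' : 0 <= s <= s' by case/andP: sb => -> _.
  have s't' : s' - s < tau by rewrite ltrBlDl.
  have [E1 _ E2 E3] := dep_step fd F0 s0s' s'b s't' jc sd0 D1 D2.
  by exists j; [exact: E1|split; [exact: E2|exists (L *m Y (st j c0 s) (s' - s))]].
- move=> {}s /andP[s0 sb] IH.
  pose j := chart_at (c0 s); have jc : chart_dom j (c0 s) by exact: chart_atP.
  have [tau [d [phi [Y fd]]]] := flow_dataP (st_Om jc).
  have [tau0 d0 _] := fd.
  have g := Fam_geo (ltW s0) (Fam_le sb F0).
  have [r [rs sr jr rd]] := approach_left s0 d0 tau0 g jc.
  have [k kr [D1 D2]] := IH r rs; have /andP[r0 r_s] := rs.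
  have F0r := Fam_le (ltW (lt_le_trans r_s sb)) F0.
  have [{}D1 [L {}D2]] := dep_chart r0 F0r kr jr D1 D2.
  have r0s : 0 <= r <= s by rewrite r0 ltW.
  have [E1 _ E2 E3] := dep_step fd F0 r0s sb sr jr rd D1 D2.
  by exists j; [exact: E1|split; [exact: E2|exists (L *m Y (st j c0 r) (s - r))]].
Qed.

(* The rows of [Lm] are the Jacobi fields along the geodesic which vanish at time 0, together
   with their coordinate derivatives; [xget] gives the junk value 0 outside the domain. *)
Definition Lm p v0 i s : 'M[R]_(n, n + n) := xget 0 [set L | sdiff (fun v => St p i v s) v0 L].

Lemma LmE p v0 i s L : sdiff (fun v => St p i v s) v0 L -> Lm p v0 i s = L.
Proof.
move=> sL; apply: xget_unique; [exact: sL|move=> L' sL'; exact: sdiff_unique sL' sL].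
Qed.

Lemma LmP p v0 b c0 s i : Fam p v0 b c0 -> 0 <= s <= b -> chart_dom i (c0 s) ->
  sdiff (fun v => St p i v s) v0 (Lm p v0 i s).
Proof. by move=> F sb ic; have [_ [L sL]] := dep_all F sb ic; rewrite (LmE sL). Qed.

Lemma vder_shiftB (k : nat) (c : R -> 'rV[R]_k) t s q : vder c (t - s) q -> vder (fun r => c (r - s)) t q.
Proof.
move=> dc; have -> : (fun r => c (r - s)) = fun r => c (1 * r - s) by apply/funext => r; rewrite mul1r.
by rewrite -[q]scale1r; apply: vder_affine; rewrite mul1r.
Qed.

(** Around an interior time s, [Lm] is a constant matrix times the [Y] of a flow box entered
    slightly earlier, and inherits its linear equation. *)
Lemma Lm_ode p v0 b c0 s i a : Fam p v0 b c0 -> 0 < s < b -> chart_dom i (c0 s) ->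
  vder (fun r => a *m Lm p v0 i r) s (a *m Lm p v0 i s *m DF i (st i c0 s)).
Proof.
move=> F0 /andP[s0 sb] ic.
have [tau [d [phi [Y fd]]]] := flow_dataP (st_Om ic).
have [tau0 d0 Hf] := fd.
have g := Fam_geo (ltW s0) (Fam_le (ltW sb) F0).
have [r [/andP[r0 rs] sr ir rd]] := approach_left s0 d0 tau0 g ic.
have rb : 0 <= r <= b by rewrite r0 (ltW (lt_trans rs sb)).
have [D1 _] := dep_all F0 rb ir; have sL := LmP F0 rb ir.
have K r' : r < r' -> r' < r + tau -> r' < b -> st i c0 r' = phi (st i c0 r) (r' - r) /\
    Lm p v0 i r' = Lm p v0 i r *m Y (st i c0 r) (r' - r).
  move=> rr' r't r'b; have r0r' : 0 <= r <= r' by rewrite r0 ltW.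
  have r't' : r' - r < tau by rewrite ltrBlDl.
  have [_ E1 _ E2] := dep_step fd F0 r0r' (ltW r'b) r't' ir rd D1 sL.
  by split; [exact: E1|exact: LmE].
have sr' : s < r + tau by rewrite -ltrBlDl.
have [E1 E2] := K s rs sr' sb.
have hs : `|s - r| < tau by rewrite gtr0_norm ?subr_gt0.
have [_ _ /(_ _ hs)[_ _ _ /(_ (a *m Lm p v0 i r)) dY]] := Hf _ rd.
rewrite E2 E1 mulmxA; apply: vder_near (vder_shiftB dY).
apply: filterS3 (lt_nbhsr rs) (lt_nbhsl sr') (lt_nbhsl sb) => r' h1 h2 h3.
by rewrite (K r' h1 h2 h3).2 mulmxA.
Qed.

(** [Lm] is meaningful only for times >= 0, so derivatives at 0 are taken on the flow-box matrix
    [Y], defined on both sides of 0, which determines [Lm] on the right. *)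
Lemma Lm_zero p v0 b c0 : Fam p v0 b c0 -> 0 < b -> let i := chart_at p in
  exists (tau : R) (Y : R -> 'M[R]_(n + n)), [/\ 0 < tau, Y 0 = 1%:M,
    forall z : W, vder (fun h => z *m Y h) 0 (z *m DF i (st i c0 0)) &
    forall r, 0 <= r < tau -> [/\ r < b, chart_dom i (c0 r) & Lm p v0 i r = row_mx 0 1%:M *m Y r]].
Proof.
move=> F0 b0 i; have [c0p _ _] := F0.
have ic : chart_dom i (c0 0) by rewrite c0p; exact: chart_atP.
have [tau [d [phi [Y fd]]]] := flow_dataP (st_Om ic).
have [tau0 d0 Hf] := fd.
have d00 : `|st i c0 0 - st i c0 0| < d by rewrite subrr normr0.
have [p0 Y0 Hh] := Hf _ d00.
have F00 := Fam_le (ltW b0) F0; have [D1 D2] := dep_zero F00.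
exists (Num.min tau b), (Y (st i c0 0)); split; [by rewrite lt_min tau0|exact: Y0|..].
  move=> z; have t0 : `|0 : R| < tau by rewrite normr0.
  by have [_ _ _ /(_ z)] := Hh _ t0; rewrite Y0 mulmx1 p0.
move=> r /andP[r0]; rewrite lt_min => /andP[rt rb].
have z0r : (0 : R) <= 0 <= r by rewrite lexx.
have rt' : r - 0 < tau by rewrite subr0.
have [E1 _ _ E2] := dep_step fd F0 z0r (ltW rb) rt' ic d00 D1 D2.
by split; [exact: rb|exact: E1|rewrite (LmE E2) subr0].
Qed.

Lemma geo_on_extend c b : 0 <= b -> geo_on c b -> exists2 b', b < b' & geo_on c b'.
Proof.
move=> b0 g; have bb : 0 <= b <= b by rewrite b0 lexx.
have /nbhs_ballP[r /= r0 Hr] := near_join (g b bb).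
exists (b + r / 2) => [|t /andP[t0 tb]]; first by rewrite ltrDl divr_gt0.
have [tb'|tb'] := leP t b; first by apply: g; rewrite t0.
apply: Hr; rewrite /ball/= ltr0_norm ?subr_lt0// opprB.
by have := half_lt r0; lra.
Qed.

End jacobi_flow.

(** * Jacobi fields and comparison *)

Section curvature.
Context {R : realType} (M : riemannian_manifold R).
Local Notation n := (mdim M).
Local Notation V := 'rV[R]_n.
Implicit Types (i j : chart M) (y u v w m : V) (t : R).

Lemma gmDl i y u u' v : gm i y (u + u') v = gm i y u v + gm i y u' v.
Proof. exact: bilDl. Qed.

Lemma gmDr i y u v v' : gm i y u (v + v') = gm i y u v + gm i y u v'.
Proof. exact: bilDr. Qed.

Lemma gmZl i y k u v : gm i y (k *: u) v = k * gm i y u v.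
Proof. exact: bilZl. Qed.

Lemma gmZr i y k u v : gm i y u (k *: v) = k * gm i y u v.
Proof. exact: bilZr. Qed.

Lemma gmNl i y u v : gm i y (- u) v = - gm i y u v.
Proof. exact: bilNl. Qed.

Lemma metric_compat i y m u v : chart_img i y ->
  DG i y m u v = gm i y (Gam i y m u) v + gm i y u (Gam i y m v).
Proof.
move=> iy; rewrite (gm_sym u _ iy) !koszul// (DG_sym m v u iy) (DG_sym v m u iy) (DG_sym u m v iy).
by field.
Qed.

Lemma christoffel_sym i y (a b k : 'I_n) : chart_img i y -> christoffel i a b k y = christoffel i b a k y.
Proof.
move=> iy; have := Gam_sym (delta_mx 0 a) (delta_mx 0 b) iy => /rowP/(_ k).
have G (c d : 'I_n) : Gam i y (delta_mx 0 c) (delta_mx 0 d) 0 k = christoffel i c d k y.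
  rewrite mxE (bigD1 c)//= [X in _ + X]big1 ?addr0; last first.
    by move=> e ec; apply: big1 => f _; rewrite mxE (negbTE ec) andbF mulr0 mul0r.
  rewrite (bigD1 d)//= [X in _ + X]big1 ?addr0; last first.
    by move=> e ed; rewrite [X in _ * X]mxE (negbTE ed) andbF mulr0.
  by rewrite !mxE !eqxx !mulr1.
by rewrite !G.
Qed.

Lemma gradE (m : nat) (f : 'rV[R]_m -> R) (x : 'rV[R]_m) k : grad f x 0 k = partial k f x.
Proof. exact: mxE. Qed.

Lemma grad_christoffel_sym i y (a b k : 'I_n) : chart_img i y ->
  grad (christoffel i a b k) y = grad (christoffel i b a k) y.
Proof.
move=> iy; have N : \forall z \near y, christoffel i a b k z = christoffel i b a k z.
  apply: filterS (open_nbhs_nbhs (conj (@chart_img_open _ _ i) iy)) => z iz.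
  exact: christoffel_sym.
apply/rowP => l.
exact: (etrans (gradE _ _ _) (etrans (near_eq_derive (delta_mx 0 l) N) (esym (gradE _ _ _)))).
Qed.

Lemma dGam_sym i y m u v : chart_img i y -> dGam i y m u v = dGam i y m v u.
Proof.
move=> iy; apply/rowP => k; rewrite !mxE exchange_big/=; apply: eq_bigr => a _; apply: eq_bigr => b _.
rewrite mulrAC.
exact: (congr1 (fun g => dotv m g * v 0 a * u 0 b) (grad_christoffel_sym b a k iy)).
Qed.

Lemma GamNl i y u v : Gam i y (- u) v = - Gam i y u v.
Proof. by rewrite -scaleN1r GamZl scaleN1r. Qed.

(** The vector R(u, w) w, in the form in which it comes out of the linearised geodesic equation. *)
Definition Rv i y u w : V :=
  dGam i y u w w - dGam i y w u w + Gam i y u (Gam i y w w) - Gam i y w (Gam i y u w).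

Lemma curv4E i y u w : curv4 i y u w = gm i y (Rv i y u w) u.
Proof.
rewrite /gm bilE /curv4.
have E l : Rv i y u w 0 l = \sum_a \sum_b \sum_c u 0 a * w 0 b * w 0 c * riemann i a b c l y.
    have S1 : \sum_a \sum_b christoffel i a b l y * u 0 a * Gam i y w w 0 b =
    \sum_a \sum_b \sum_c \sum_m (u 0 a * w 0 b * w 0 c * (christoffel i a m l y * christoffel i b c m y)).
    apply: eq_bigr => a _; under eq_bigr do rewrite mxE mulr_sumr; rewrite exchange_big/=.
    apply: eq_bigr => b _; rewrite exchange_big/= exchange_big/=.
    under eq_bigr do rewrite mulr_sumr; rewrite exchange_big/=.
    by apply: eq_bigr => c _; apply: eq_bigr => m _; ring.
  have S2 : \sum_a \sum_b christoffel i a b l y * w 0 a * Gam i y u w 0 b =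
    \sum_a \sum_b \sum_c \sum_m (u 0 a * w 0 b * w 0 c * (christoffel i b m l y * christoffel i a c m y)).
    rewrite [RHS]exchange_big/=; apply: eq_bigr => b _.
    under eq_bigr do rewrite mxE mulr_sumr; rewrite exchange_big/=.
    apply: eq_bigr => a _.
    under eq_bigr do rewrite mulr_sumr; rewrite exchange_big/=.
    by apply: eq_bigr => c _; apply: eq_bigr => m _; ring.
  have S3 : \sum_a \sum_b dotv w (grad (christoffel i a b l) y) * u 0 a * w 0 b =
    \sum_a \sum_b \sum_c (u 0 a * w 0 b * w 0 c * partial b (christoffel i a c l) y).
    apply: eq_bigr => a _; rewrite exchange_big/=; apply: eq_bigr => c _.
    rewrite /dotv !mulr_suml; apply: eq_bigr => b _; rewrite gradE; ring.
  have S4 : \sum_a \sum_b dotv u (grad (christoffel i a b l) y) * w 0 a * w 0 b =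
    \sum_a \sum_b \sum_c (u 0 a * w 0 b * w 0 c * partial a (christoffel i b c l) y).
    rewrite [RHS]exchange_big/=; apply: eq_bigr => b _; rewrite exchange_big/=; apply: eq_bigr => c _.
    rewrite /dotv !mulr_suml; apply: eq_bigr => a _; rewrite gradE; ring.
  rewrite !mxE S1 S2 S3 S4 -sumrB -big_split/= -sumrB; apply: eq_bigr => a _.
  rewrite -sumrB -big_split/= -sumrB; apply: eq_bigr => b _.
  rewrite -sumrB -big_split/= -sumrB; apply: eq_bigr => c _.
  rewrite /riemann sumrB -!mulr_sumr.
  have H (x P Q S T : R) : x * P - x * Q + x * S - x * T = x * (P - Q + (S - T)) by ring.
  exact: H.
rewrite [RHS]pair_bigA/=.
have L (F : 'I_n -> 'I_n -> 'I_n -> 'I_n * 'I_n -> R) :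
    \sum_a \sum_b \sum_c \sum_p F a b c p = \sum_p \sum_a \sum_b \sum_c F a b c p.
  rewrite [RHS]exchange_big/=; apply: eq_bigr => a _; rewrite [RHS]exchange_big/=; apply: eq_bigr => b _.
  exact: exchange_big.
under eq_bigr do under eq_bigr do under eq_bigr do rewrite pair_bigA.
rewrite L; apply: eq_bigr => p _ /=; rewrite E !mulr_suml; apply: eq_bigr => a _.
rewrite !mulr_suml; apply: eq_bigr => b _; rewrite !mulr_suml; apply: eq_bigr => c _.
by [].
Qed.

Lemma RvZ i y k w : Rv i y (k *: w) w = 0.
Proof.
rewrite /Rv; have -> : forall m u v c, dGam i y (c *: m) u v = c *: dGam i y m u v.
  move=> m u v c; apply/rowP => l; rewrite !mxE mulr_sumr; apply: eq_bigr => a _.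
  by rewrite mulr_sumr; apply: eq_bigr => b _; rewrite dotvZl; ring.
have -> : forall m u v c, dGam i y m (c *: u) v = c *: dGam i y m u v.
  move=> m u v c; apply/rowP => l; rewrite !mxE mulr_sumr; apply: eq_bigr => a _.
  by rewrite mulr_sumr; apply: eq_bigr => b _; rewrite mxE; ring.
by rewrite !GamZl GamZr subrr add0r subrr.
Qed.

(* Both sides vanish when u and w are linearly dependent, where the sectional
   curvature is a junk value. *)
Lemma curv4_le kmin kmax i y u w : sectional_in M kmin kmax -> chart_img i y ->
  curv4 i y u w <= Num.max kmax 0 * gm i y w w * gm i y u u.
Proof.
move=> sec iy.
have gu := gm_ge0 u iy; have gw := gm_ge0 w iy.
have m0 : 0 <= Num.max kmax 0 by rewrite le_max lexx orbT.
have rhs0 : 0 <= Num.max kmax 0 * gm i y w w * gm i y u u by rewrite !mulr_ge0.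
have [->|w0] := eqVneq w 0.
  have -> : curv4 i y u 0 = 0.
    rewrite /curv4 big1// => a _; rewrite big1// => b _; rewrite big1// => c _.
    by rewrite big1// => l _; rewrite big1// => m _; rewrite [X in _ * X * _ * _ * _ * _]mxE mulr0 !mul0r.
  by rewrite /gm bil0l mulr0 mul0r.
have gw0 := gm_gt0 iy w0.
(* [u - k *: w] is the component of u orthogonal to w; its squared norm times that of w is the Gram
   determinant [area2]. *)
pose k := gm i y u w / gm i y w w.
have E : gm i y (u - k *: w) (u - k *: w) * gm i y w w = area2 i y u w.
  rewrite /area2 -!/(bil _ _ _) -!/(gm _ _ _ _).
  rewrite -scaleNr !gmDl !gmDr !gmZl !gmZr (gm_sym w u iy) /k; field; exact: lt0r_neq0.
have a0 : 0 <= area2 i y u w by rewrite -E mulr_ge0// gm_ge0.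
have [Z|NZ] := eqVneq (area2 i y u w) 0.
  have : u - k *: w = 0.
    apply/eqP; apply: contraT => h; have := gm_gt0 iy h.
    by move: E; rewrite Z => /eqP; rewrite mulf_eq0 (gt_eqF gw0) orbF => /eqP ->; rewrite ltxx.
  by move=> /eqP; rewrite subr_eq0 => /eqP ->; rewrite curv4E RvZ /gm bil0l !mulr_ge0 ?gm_ge0.
have /andP[_] := sec i y u w iy NZ.
rewrite /sectional ler_pdivrMr ?lt0r ?NZ// => /le_trans; apply.
have a_le : area2 i y u w <= gm i y w w * gm i y u u.
  have := sqr_ge0 (gm i y u w); rewrite /area2 -!/(bil _ _ _) -!/(gm _ _ _ _).
  move: (gm _ _ _ _) (gm _ _ _ _) (gm _ _ _ _) => *; lra.
rewrite -mulrA; apply: (@le_trans _ _ (Num.max kmax 0 * area2 i y u w)).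
  by rewrite ler_wpM2r// le_max lexx.
by rewrite ler_wpM2l.
Qed.

Lemma is_derive_gm_cov i (q u v : R -> V) (q' u' v' : V) (t : R) : chart_img i (q t) ->
  vder q t q' -> vder u t u' -> vder v t v' ->
  is_derive t 1 (fun s => gm i (q s) (u s) (v s))
    (gm i (q t) (u' + Gam i (q t) q' (u t)) (v t) + gm i (q t) (u t) (v' + Gam i (q t) q' (v t))).
Proof.
move=> iq dq du dv; apply: is_derive_cast (is_derive_gm iq dq du dv) _.
rewrite metric_compat// gmDl gmDr; ring.
Qed.

Lemma vder_Gam i (q u v : R -> V) (q' u' v' : V) (t : R) : chart_img i (q t) ->
  vder q t q' -> vder u t u' -> vder v t v' ->
  vder (fun s => Gam i (q s) (u s) (v s)) t
    (dGam i (q t) q' (u t) (v t) + Gam i (q t) u' (v t) + Gam i (q t) (u t) v').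
Proof.
move=> iq dq du dv k.
have dC (a b : 'I_n) : is_derive t 1 (fun s => christoffel i a b k (q s)) (dotv q' (grad (christoffel i a b k) (q t))).
  apply: sg_chain dq; apply: sdP; exact: christoffel_sd.
pose A s : 'M[R]_n := \matrix_(a, b) christoffel i a b k (q s).
pose A' : 'M[R]_n := \matrix_(a, b) dotv q' (grad (christoffel i a b k) (q t)).
have AE s (u1 v1 : V) : bil (A s) u1 v1 = Gam i (q s) u1 v1 0 k.
  rewrite bilE mxE; apply: eq_bigr => a _; apply: eq_bigr => b _; rewrite mxE; ring.
have dA a b : is_derive t 1 (fun s => A s a b) (A' a b).
  by under eq_fun do rewrite mxE; rewrite mxE.
have := is_derive_bil dA du dv; under eq_fun do rewrite AE.
move=> /is_derive_cast; apply; rewrite !AE !mxE; congr (_ + _ + _).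
rewrite bilE; apply: eq_bigr => a _; apply: eq_bigr => b _; rewrite mxE; ring.
Qed.

Section jacobi.
Variables (i : chart M) (q v J K : R -> V) (t : R).
Hypothesis iq : chart_img i (q t).
Hypothesis dq : vder q t (v t).
Hypothesis dv : vder v t (- Gam i (q t) (v t) (v t)).
Hypothesis dJ : vder J t (K t).
Hypothesis dK : vder K t (- (dGam i (q t) (J t) (v t) (v t)
   + Gam i (q t) (K t) (v t) + Gam i (q t) (v t) (K t))).

(** The covariant derivative of J along q. *)
Definition DJ s := K s + Gam i (q s) (v s) (J s).

Lemma jacobi_norm_derive :
  is_derive t 1 (fun s => gm i (q s) (J s) (J s)) (2 * gm i (q t) (DJ t) (J t)).
Proof.
apply: is_derive_cast (is_derive_gm_cov iq dq dJ dJ) _.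
by rewrite (gm_sym (J t) _ iq) -/(DJ t); ring.
Qed.

(** Behind the last identity of the proof is the Jacobi equation D^2 J = - R(J, v) v, the covariant
    form of the linearised geodesic equation [dK]. *)
Lemma jacobi_cross_derive :
  is_derive t 1 (fun s => gm i (q s) (DJ s) (J s))
    (gm i (q t) (DJ t) (DJ t) - curv4 i (q t) (J t) (v t)).
Proof.
apply: is_derive_cast (is_derive_gm_cov iq dq (vderD dK (vder_Gam iq dq dv dJ)) dJ) _.
rewrite -/(DJ t) curv4E -gmNl [RHS]addrC; congr (_ + _); congr gm.
rewrite /Rv /DJ (dGam_sym (v t) (J t) (v t) iq) (Gam_sym (J t) (v t) iq) (Gam_sym (J t) (Gam _ _ _ _) iq).
rewrite (Gam_sym (K t) (v t) iq) GamDr GamNl.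
move: (dGam _ _ _ _ _) (dGam _ _ _ _ _) => A B; do 3 move: (Gam _ _ _ _) => ?.
by apply/rowP => l; rewrite !mxE; ring.
Qed.

End jacobi.
End curvature.

(** * Jacobi fields along a geodesic crossing several charts *)

Section along.
Context {R : realType} (M : riemannian_manifold R).
Local Notation n := (mdim M).
Local Notation V := 'rV[R]_n.
Local Notation W := 'rV[R]_(n + n).
Implicit Types (i j : chart M) (u w m : V) (t s r : R).

Lemma Fam_speed p (v : V) s c i : 0 <= s -> Fam p v s c -> chart_dom i (c s) ->
  gm i (coord i (c s)) (cv i c s) (cv i c s) = ginner p v v.
Proof.
move=> s0 F ic; have g := Fam_geo s0 F; have [cp vc gc] := F.
rewrite -(speed2E (geodesic_continuous g) ic (vder_derivable (geodesic_vder g ic))).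
by rewrite (speed_const gc) ?s0 ?lexx// /speed2 cp vc.
Qed.

Variables (p : M) (v : V) (b : R) (c : R -> M) (a : V).
Hypothesis F0 : Fam p v b c.

Definition Jf i s : V := lsubmx (a *m Lm p v i s).
Definition Kf i s : V := rsubmx (a *m Lm p v i s).
Local Notation Q := (fun i s => coord i (c s)).

Lemma along_geo s : 0 <= s <= b -> geodesic_at c s.
Proof. by move=> sb; have [_ _ g] := F0; exact: nbhs_singleton (g _ sb). Qed.

Lemma open_in s : 0 < s < b -> \forall r \near s, 0 < r < b.
Proof.
move=> /andP[s0 sb]; apply: filterS2 (lt_nbhsr s0) (lt_nbhsl sb) => r h1 h2.
by rewrite h1.
Qed.

Lemma wkin s : 0 < s < b -> 0 <= s <= b.
Proof. by move=> /andP[/ltW-> /ltW->]. Qed.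

Lemma J_ode i s : 0 < s < b -> chart_dom i (c s) -> vder (Jf i) s (Kf i s).
Proof.
move=> sb ic; have := vder_lsub (Lm_ode a F0 sb ic).
by rewrite DFE /dF row_mxKl.
Qed.

Lemma K_ode i s : 0 < s < b -> chart_dom i (c s) ->
  vder (Kf i) s (- (dGam i (coord i (c s)) (Jf i s) (cv i c s) (cv i c s)
   + Gam i (coord i (c s)) (Kf i s) (cv i c s) + Gam i (coord i (c s)) (cv i c s) (Kf i s))).
Proof.
move=> sb ic; have := vder_rsub (Lm_ode a F0 sb ic).
by rewrite DFE /dF row_mxKr /st row_mxKl row_mxKr.
Qed.

Lemma St_line i s : 0 <= s <= b -> chart_dom i (c s) ->
  vder (fun r => St p i (v + r *: a) s) 0 (a *m Lm p v i s).
Proof.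
move=> sb ic; apply: (sdiff_chain (f := fun v => St p i v s) (q := fun r => v + r *: a)).
  by rewrite scale0r addr0; exact: LmP F0 sb ic.
exact: vder_line.
Qed.

Lemma near_fam_line i s : 0 <= s <= b -> chart_dom i (c s) ->
  \forall r \near (0 : R), exists2 e, Fam p (v + r *: a) s e & chart_dom i (e s).
Proof.
move=> sb ic; have [[d d0 Hd] _] := dep_all F0 sb ic.
have /vder_continuous/cvgrPdist_lt/(_ _ d0) := vder_line v a 0.
apply: filterS => r; rewrite scale0r addr0 distrC => h; exact: Hd.
Qed.

Lemma J_trans i j s : 0 <= s <= b -> chart_dom i (c s) -> chart_dom j (c s) ->
  Jf j s = Jf i s *m Tm i j (coord i (c s)).
Proof.
move=> sb ic jc; have /andP[s0 s_b] := sb.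
have di := vder_lsub (St_line sb ic); have dj := vder_lsub (St_line sb jc).
apply: vder_unique dj _.
have E : lsubmx (St p i (v + 0 *: a) s) = coord i (c s).
  by rewrite scale0r addr0 (StE F0 sb ic) row_mxKl.
have T := @trans_sdiff _ _ _ _ _ (overlap_coord ic jc); rewrite -E in T *.
apply: vder_near (sdiff_chain T di).
apply: filterS2 (near_fam_line sb ic) (near_fam_line sb jc) => r [e Fe ei] [f Ff fj].
have ss : 0 <= s <= s by rewrite s0 lexx.
have [ef _] := nbhs_singleton (Fam_same Fe Ff ss).
rewrite (StE Fe ss ei) (StE Ff ss fj) /st !row_mxKl trans_coord// ef.
by [].
Qed.

(* With J the Jacobi field, D the covariant derivative and c' the velocity, in any chart:
   NJ = <J, J>, BJ = <DJ, J> = NJ' / 2 and PJ = <c', J>. *)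
Definition NJ i s := gm i (coord i (c s)) (Jf i s) (Jf i s).
Definition DJi i s := DJ i (fun s => coord i (c s)) (cv i c) (Jf i) (Kf i) s.
Definition BJ i s := gm i (coord i (c s)) (DJi i s) (Jf i s).
Definition PJ i s := gm i (coord i (c s)) (cv i c s) (Jf i s).

Lemma NJ_derive i s : 0 < s < b -> chart_dom i (c s) -> is_derive s 1 (NJ i) (2 * BJ i s).
Proof.
move=> sb ic; have g := along_geo (wkin sb).
exact: (jacobi_norm_derive (coord_img ic) (geodesic_vder g ic) (J_ode sb ic)).
Qed.

Lemma BJ_derive i s : 0 < s < b -> chart_dom i (c s) ->
  is_derive s 1 (BJ i) (gm i (coord i (c s)) (DJi i s) (DJi i s)
    - curv4 i (coord i (c s)) (Jf i s) (cv i c s)).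
Proof.
move=> sb ic; have g := along_geo (wkin sb).
have [_ D2] := geodesic_at_vder g ic.
exact: (jacobi_cross_derive (coord_img ic) (geodesic_vder g ic) D2 (J_ode sb ic) (K_ode sb ic)).
Qed.

Lemma NJ_chart i j s : 0 <= s <= b -> chart_dom i (c s) -> chart_dom j (c s) -> NJ i s = NJ j s.
Proof.
move=> sb ic jc; rewrite /NJ (gm_trans _ _ (overlap_coord ic jc)) (trans_coord _ ic).
by rewrite -(J_trans sb ic jc).
Qed.

Lemma PJ_chart i j s : 0 <= s <= b -> chart_dom i (c s) -> chart_dom j (c s) -> PJ i s = PJ j s.
Proof.
move=> sb ic jc; rewrite /PJ (gm_trans _ _ (overlap_coord ic jc)) (trans_coord _ ic).
rewrite -(J_trans sb ic jc); have g := along_geo sb.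
by rewrite -(cv_trans (geodesic_continuous g) ic jc (vder_derivable (geodesic_vder g ic))).
Qed.

Lemma near_in_chart i s : 0 < s < b -> chart_dom i (c s) ->
  \forall r \near s, 0 < r < b /\ chart_dom i (c r).
Proof.
move=> sb ic; apply: filterS2 (open_in sb) (near_chart (geodesic_continuous (along_geo (wkin sb))) ic).
by move=> r; split.
Qed.

(** [BJ] is half the derivative of [NJ], whose chart independence is immediate; this avoids
    transforming the covariant derivative. *)
Lemma BJ_chart i j s : 0 < s < b -> chart_dom i (c s) -> chart_dom j (c s) -> BJ i s = BJ j s.
Proof.
move=> sb ic jc.
have /(is_derive_unique (NJ_derive sb ic)) : is_derive s 1 (NJ i) (2 * BJ j s).
  apply: is_derive_near (NJ_derive sb jc).
  apply: filterS2 (near_in_chart sb ic) (near_in_chart sb jc) => r [rb ri] [_ rj].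
  exact: NJ_chart (wkin rb) rj ri.
by apply: mulfI; rewrite pnatr_eq0.
Qed.

Definition NN s := NJ (chart_at (c s)) s.
Definition BB s := BJ (chart_at (c s)) s.
Definition PP s := PJ (chart_at (c s)) s.

Lemma NN_derive s : 0 < s < b -> is_derive s 1 NN (2 * BB s).
Proof.
move=> sb; have ic := chart_atP (c s); apply: is_derive_near (NJ_derive sb ic).
by apply: filterS (near_in_chart sb ic) => r [/wkin rb ri]; apply: NJ_chart => //; exact: chart_atP.
Qed.

Lemma BB_derive s : 0 < s < b -> let i := chart_at (c s) in
  is_derive s 1 BB (gm i (coord i (c s)) (DJi i s) (DJi i s) - curv4 i (coord i (c s)) (Jf i s) (cv i c s)).
Proof.
move=> sb i; have ic := chart_atP (c s); apply: is_derive_near (BJ_derive sb ic).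
by apply: filterS (near_in_chart sb ic) => r [rb ri]; apply: BJ_chart => //; exact: chart_atP.
Qed.

Lemma DG0m i y u w : DG i y 0 u w = 0.
Proof. by rewrite -(scale0r 0) DGZm mul0r. Qed.

(* Differentiate the conserved energy of the geodesics issued from p with
   respect to their initial velocity. *)
Lemma energy_variation i s : 0 <= s <= b -> chart_dom i (c s) ->
  2^-1 * DG i (coord i (c s)) (Jf i s) (cv i c s) (cv i c s) + gm i (coord i (c s)) (cv i c s) (Kf i s)
    = ginner p v a.
Proof.
move=> sb ic; have /andP[s0 s_b] := sb.
have dS := St_line sb ic.
have E : St p i (v + 0 *: a) s = st i c s by rewrite scale0r addr0 (StE F0 sb ic).
have iS : chart_img i (lsubmx (St p i (v + 0 *: a) s)) by rewrite E row_mxKl; exact: coord_img.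
have D1 := is_derive_gm iS (vder_lsub dS) (vder_rsub dS) (vder_rsub dS).
have ip : chart_img (chart_at p) (coord (chart_at p) p) by exact/coord_img/chart_atP.
have D2 := is_derive_gm (ip : chart_img (chart_at p) ((fun=> coord (chart_at p) p) (0 : R)))
  (vder_cst _ _) (vder_line v a 0) (vder_line v a 0).
have {D1} := fun N => is_derive_unique (is_derive_near N D1) D2.
move=> /(_ _)/wrap[].
  apply: filterS (near_fam_line sb ic) => r [e Fe ei].
  have ss : 0 <= s <= s by rewrite s0 lexx.
  rewrite (StE Fe ss ei) /st row_mxKl row_mxKr; exact: Fam_speed s0 Fe ei.
rewrite E /st row_mxKl row_mxKr DG0m scale0r addr0 add0r -!ginnerE.
rewrite -/(Jf i s) -/(Kf i s) (gm_sym (Kf i s) _ (coord_img ic)).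
rewrite (_ : ginner p a v = ginner p v a); last exact: gm_sym ip.
lra.
Qed.

(** The Euler-Lagrange equation tested on the Jacobi field turns the derivative into the quantity
    that [energy_variation] shows to be constant. *)
Lemma PJ_derive i s : 0 < s < b -> chart_dom i (c s) -> is_derive s 1 (PJ i) (ginner p v a).
Proof.
move=> sb ic; have g := along_geo (wkin sb).
have [_ D2] := geodesic_at_vder g ic; have iy := coord_img ic.
have D := is_derive_gm (iy : chart_img i ((coord i \o c) s)) (geodesic_vder g ic) D2 (J_ode sb ic).
apply: is_derive_cast D _; rewrite -(energy_variation (wkin sb) ic) /=.
have := (euler_lagrange (cv i c s) _ iy).1 erefl (Jf i s); lra.
Qed.

Lemma PP_derive s : 0 < s < b -> is_derive s 1 PP (ginner p v a).
Proof.
move=> sb; have ic := chart_atP (c s); apply: is_derive_near (PJ_derive sb ic).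
by apply: filterS (near_in_chart sb ic) => r [/wkin rb ri]; apply: PJ_chart => //; exact: chart_atP.
Qed.

(** Initial conditions for the comparison: N = o(s) is the rate that beats the 1 / s singularity of
    [cotk], and the limit of P starts the Gauss lemma. *)
Lemma zero_behaviour (e : R) : 0 < b -> 0 < e -> exists2 d, 0 < d & forall s, 0 < s < d ->
  [/\ s < b, NN s <= e * s, `|BB s| <= e & `|PP s| <= e].
Proof.
move=> b0 e0; have [tau [Y [tau0 Y0 dY HY]]] := Lm_zero F0 b0.
have [cp _ _] := F0; pose i := chart_at p.
have ic : chart_dom i (c 0) by rewrite cp; exact: chart_atP.
have zb : (0 : R) <= 0 <= b by rewrite lexx ltW.
have g := along_geo zb; have [_ D2] := geodesic_at_vder g ic; have iy := coord_img ic.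
pose z : W := row_mx 0 a.
(* Extensions of the Jacobi field and of its derivative across time 0, which can be differentiated
   there. *)
pose J0 s : V := lsubmx (z *m Y s); pose K0 s : V := rsubmx (z *m Y s).
have J00 : J0 0 = 0 by rewrite /J0 Y0 mulmx1 row_mxKl.
have K00 : K0 0 = a by rewrite /K0 Y0 mulmx1 row_mxKr.
have dZ := dY z; rewrite DFE /dF row_mxKr row_mxKl /st row_mxKr row_mxKl in dZ.
have dJ : vder J0 0 (K0 0) by rewrite K00; have := vder_lsub dZ; rewrite row_mxKl.
have dK : vder K0 0 (- (dGam i (coord i (c 0)) (J0 0) (cv i c 0) (cv i c 0)
   + Gam i (coord i (c 0)) (K0 0) (cv i c 0) + Gam i (coord i (c 0)) (cv i c 0) (K0 0))).
  by rewrite J00 K00; have := vder_rsub dZ; rewrite row_mxKr.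
have N' := jacobi_norm_derive iy (geodesic_vder g ic) dJ.
have B' := jacobi_cross_derive iy (geodesic_vder g ic) D2 dJ dK.
have P' := is_derive_gm iy (geodesic_vder g ic) D2 dJ.
have gm0 y u : gm i y u 0 = 0 by rewrite /gm bil0r.
rewrite /= J00 gm0 mulr0 in N'.
have {N'}[d1 d10 H1] := (is_derive_epsP _ _ _).1 N' e e0; rewrite /= J00 gm0 in H1.
have {B'}/continuous_epsP/(_ e e0)[d2 d20 H2] := is_derive_continuous B'; rewrite /= J00 gm0 in H2.
have {P'}/continuous_epsP/(_ e e0)[d3 d30 H3] := is_derive_continuous P'; rewrite /= J00 gm0 in H3.
exists (Num.min tau (Num.min d1 (Num.min d2 d3))); first by rewrite !lt_min tau0 d10 d20.
move=> s /andP[s0]; rewrite !lt_min => /and4P[st s1 s2 s3].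
have s_tau : 0 <= s < tau by rewrite (ltW s0).
have [sb sc LE] := HY s s_tau.
have sin : 0 < s < b by rewrite s0.
have E : a *m Lm p v i s = z *m Y s by rewrite LE mulmxA mul_mx_row mulmx0 mulmx1.
have jc := chart_atP (c s).
have EJ : Jf i s = J0 s by rewrite /Jf E.
have EK : Kf i s = K0 s by rewrite /Kf E.
have s00 : `|s - 0| = s by rewrite subr0 gtr0_norm.
split; first exact: sb.
- rewrite /NN (NJ_chart (wkin sin) jc sc) /NJ EJ.
  have := H1 s; rewrite s00 => /(_ s1); rewrite subr0 mul0r subr0.
  exact: le_trans (ler_norm _).
- rewrite /BB (BJ_chart sin jc sc) /BJ /DJi /DJ EJ EK.
  by have := H2 s; rewrite s00 => /(_ s2); rewrite subr0.
- rewrite /PP (PJ_chart (wkin sin) jc sc) /PJ EJ.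
  by have := H3 s; rewrite s00 => /(_ s3); rewrite subr0.
Qed.

End along.

(** * The comparison functions of constant curvature *)

Section riccati.
Context {R : realType}.

(* [cotk] solves the Riccati equation u' = - (k ^ 2 + u ^ 2) of constant curvature k ^ 2. *)
Definition cotk (k s : R) : R := if k == 0 then s^-1 else k * cos (k * s) / sin (k * s).
Definition sink (k s : R) : R := if k == 0 then s else sin (k * s).

Lemma sin_ks_gt0 (k s : R) : 0 < k -> k < pi -> 0 < s <= 1 -> 0 < sin (k * s).
Proof.
move=> k0 kpi /andP[s0 s1]; apply: sin_gt0_pi; rewrite mulr_gt0//=.
by apply: le_lt_trans kpi; rewrite ger_pMr.
Qed.

Lemma sink_gt0 (k s : R) : 0 <= k -> k < pi -> 0 < s <= 1 -> 0 < sink k s.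
Proof.
rewrite /sink; case: eqP => [_ _ _ /andP[]//|/eqP k0 kge kpi].
by apply: sin_ks_gt0 => //; rewrite lt0r k0.
Qed.

Lemma is_derive_lin (k s : R) : is_derive s 1 (fun r => k * r) k.
Proof.
apply/is_derive_epsP => e e0; exists 1 => // r _.
by rewrite -mulrBr subrr normr0 mulr_ge0// ltW.
Qed.

Lemma is_derive_sin_ks (k s : R) : is_derive s 1 (fun r => sin (k * r)) (k * cos (k * s)).
Proof.
have D := is_derive1_comp (is_derive_sin (k * s)) (is_derive_lin k s).
apply: is_derive_cast D _.
by rewrite mulrC.
Qed.

Lemma is_derive_cos_ks (k s : R) : is_derive s 1 (fun r => cos (k * r)) (- k * sin (k * s)).
Proof.
have D := is_derive1_comp (is_derive_cos (k * s)) (is_derive_lin k s).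
apply: is_derive_cast D _.
by rewrite mulrC mulrN mulNr.
Qed.

Lemma is_derive_div (f g : R -> R) (s f' g' : R) : g s != 0 -> is_derive s 1 f f' -> is_derive s 1 g g' ->
  is_derive s 1 (fun r => f r / g r) ((f' * g s - f s * g') / g s ^+ 2).
Proof.
move=> gs df dg; have dV := is_deriveV gs dg.
apply: is_derive_cast (is_deriveM df dV) _.
by rewrite /GRing.scale/=; field.
Qed.

Lemma cotk_derive (k s : R) : 0 <= k -> k < pi -> 0 < s <= 1 ->
  is_derive s 1 (cotk k) (- (k ^+ 2 + cotk k s ^+ 2)).
Proof.
move=> k0 kpi s01; rewrite /cotk; case: eqP => [->|/eqP kn0].
  have s0 : s != 0 by case/andP : s01 => /lt0r_neq0.
  apply: is_derive_cast (is_deriveV s0 (is_derive_id _ _)) _.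
  by rewrite /GRing.scale/=; field.
have kp : 0 < k by rewrite lt0r kn0.
have S := lt0r_neq0 (sin_ks_gt0 kp kpi s01).
have dc : is_derive s 1 (fun r => k * cos (k * r)) (k * (- k * sin (k * s))).
  by apply: is_derive_cast (is_deriveZ _ (is_derive_cos_ks _ _)) _.
apply: is_derive_cast (is_derive_div S dc (is_derive_sin_ks _ _)) _.
by field.
Qed.

Lemma sink_derive (k s : R) : 0 <= k -> k < pi -> 0 < s <= 1 ->
  is_derive s 1 (sink k) (cotk k s * sink k s).
Proof.
move=> k0 kpi s01; rewrite /cotk /sink; case: eqP => [_|/eqP kn0].
  have s0 : s != 0 by case/andP : s01 => /lt0r_neq0.
  by rewrite mulVf//; exact: is_derive_id.
have kp : 0 < k by rewrite lt0r kn0.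
have S := lt0r_neq0 (sin_ks_gt0 kp kpi s01).
by rewrite divfK//; exact: is_derive_sin_ks.
Qed.

Lemma cotk_bound (k : R) : 0 <= k -> k < pi -> exists2 d, 0 < d & forall s, 0 < s < d -> `|cotk k s| <= 2 / s.
Proof.
move=> kge kpi; rewrite /cotk; case: eqP => [_|/eqP k0].
  exists 1 => // s /andP[s0 _]; rewrite ger0_norm ?invr_ge0 ?(ltW s0)//.
  by rewrite ler_pMl ?invr_gt0// ler1n.
have kp : 0 < k by rewrite lt0r k0.
have /is_derive_epsP/(_ 2^-1) := is_derive_sin_ks k 0.
rewrite mulr0 sin0 cos0 mulr1 => H.
have [|d d0 Hd] := (is_derive_epsP _ _ _).1 (is_derive_sin_ks k 0) (k / 2); first by rewrite divr_gt0.
exists d => // s /andP[s0 sd].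
have := Hd s; rewrite mulr0 sin0 cos0 mulr1 !subr0 (gtr0_norm s0) => /(_ sd).
rewrite ler_norml => /andP[h _].
have sk : k * s / 2 <= sin (k * s) by move: h; rewrite mulrAC; lra.
have sp : 0 < sin (k * s) by apply: lt_le_trans sk; rewrite divr_gt0// mulr_gt0.
rewrite normrM (normfV (sin _)) (gtr0_norm sp) ler_pdivrMr// normrM (gtr0_norm kp).
have c1 : `|cos (k * s)| <= 1 by rewrite ler_norml cos_geN1 cos_le1.
apply: (le_trans (ler_wpM2l kge c1)); rewrite mulr1.
rewrite mulrAC ler_pdivlMr//; lra.
Qed.

Lemma three_eps (x y z e : R) : x - y <= z -> y <= 2 * (e / 3) -> - (e / 3) <= x -> 0 <= e + z.
Proof. lra. Qed.

End riccati.

(** * Riccati comparison, conjugate points and the Gauss lemma *)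

Section comparison.
Context {R : realType} (M : riemannian_manifold R).
Local Notation n := (mdim M).
Local Notation V := 'rV[R]_n.
Implicit Types (i j : chart M) (u w m : V) (t s r : R).
Variables (p : M) (v : V) (b : R) (c : R -> M) (a : V) (kmin kmax k : R).
Hypothesis F0 : Fam p v b c.
Hypothesis b1 : 1 < b.
Hypothesis sec : sectional_in M kmin kmax.
Hypothesis k0 : 0 <= k.
Hypothesis kpi : k < pi.
Hypothesis kv : Num.max kmax 0 * ginner p v v <= k ^+ 2.

Lemma gm_square_ge0 i (y x w : V) (u : R) : chart_img i y ->
  0 <= gm i y x x - 2 * u * gm i y x w + u ^+ 2 * gm i y w w.
Proof.
move=> iy; have := gm_ge0 (x - u *: w) iy.
by rewrite -scaleNr gmDl !gmDr !gmZl !gmZr (gm_sym w x iy); congr (_ <= _); ring.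
Qed.

Local Notation N := (NN p v c a).
Local Notation B := (BB p v c a).

Lemma in01b s : 0 < s <= 1 -> 0 < s < b.
Proof. by move=> /andP[-> s1]/=; exact: le_lt_trans b1. Qed.

(** By the Riccati equation, with u = [cotk k s], the derivative is |DJ - u J|^2 plus k^2 |J|^2
    minus the curvature term, and the curvature bound makes the difference of the last two
    nonnegative. *)
Lemma riccati_monotone s : 0 < s <= 1 -> exists2 D, 0 <= D &
  is_derive s 1 (fun r => B r - cotk k r * N r) D.
Proof.
move=> s01; have sb := in01b s01.
pose i := chart_at (c s); have ic : chart_dom i (c s) by exact: chart_atP.
have iy := coord_img ic.
have dB := BB_derive a F0 sb; have dN := NN_derive a F0 sb; have du := cotk_derive k0 kpi s01.
have D := is_deriveB dB (is_deriveM du dN).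
eexists; last exact: D.
rewrite /GRing.scale/= -/i.
have C := curv4_le (Jf p v a i s) (cv i c s) sec iy.
have s0 : 0 <= s by case/andP : s01 => /ltW.
rewrite (Fam_speed s0 (Fam_le (ltW (proj2 (andP sb))) F0) ic) in C.
have NE : N s = gm i (coord i (c s)) (Jf p v a i s) (Jf p v a i s) by [].
have BE : B s = gm i (coord i (c s)) (DJi p v c a i s) (Jf p v a i s) by [].
have {C} : curv4 i (coord i (c s)) (Jf p v a i s) (cv i c s) <= k ^+ 2 * N s.
  by apply: le_trans C _; rewrite NE ler_wpM2r// gm_ge0.
have := gm_square_ge0 (DJi p v c a i s) (Jf p v a i s) (cotk k s) iy.
rewrite -NE -BE.
move: (curv4 _ _ _ _) (gm _ _ _ _) (N s) (B s) (cotk k s) => *; lra.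
Qed.

(** The nondecreasing difference of [riccati_monotone] tends to 0 at time 0: at a small r, its two
    terms cost 2/3 and 1/3 of e. *)
Lemma hessian_comparison s : 0 < s <= 1 -> cotk k s * N s <= B s.
Proof.
move=> s01; have /andP[s0 s1] := s01.
rewrite -subr_ge0; apply/ler_addgt0Pl => e e0.
have e3 : 0 < e / 3 by rewrite divr_gt0.
have [d d0 Hd] := zero_behaviour a F0 (lt_trans ltr01 b1) e3.
have [d' d'0 Hd'] := cotk_bound k0 kpi.
pose r := Num.min s (Num.min d d') / 2.
have m0 : 0 < Num.min s (Num.min d d') by rewrite !lt_min s0 d0.
have r0 : 0 < r by rewrite divr_gt0.
have := half_lt m0; rewrite -/r !lt_min => /and3P[rs rd rd'].
have [_ h1 h2 _] : [/\ r < b, N r <= e / 3 * r, `|B r| <= e / 3 & `|PP p v c a r| <= e / 3].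
  by apply: Hd; rewrite r0.
have h3 : `|cotk k r| <= 2 / r by apply: Hd'; rewrite r0.
have N0 : 0 <= N r by apply: gm_ge0; exact/coord_img/chart_atP.
have P : forall q, exists D, r <= q <= s -> 0 <= D /\ is_derive q 1 (fun r => B r - cotk k r * N r) D.
  move=> q; have [rq|] := boolP (r <= q <= s); last by exists 0.
  have [|D D0 dD] := @riccati_monotone q; last by exists D.
  by case/andP : rq => /(lt_le_trans r0) -> /le_trans; apply.
have [D HD] := choice P.
have mono : B r - cotk k r * N r <= B s - cotk k s * N s.
  apply: (derive_ge0_le (f := fun r => B r - cotk k r * N r) (f' := D) (ltW rs)).
    by move=> q /HD[].
  by move=> q /HD[].
have h4 : cotk k r * N r <= 2 * (e / 3).
  apply: (le_trans (ler_norm _)); rewrite normrM (ger0_norm N0).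
  apply: (le_trans (ler_pM _ _ h3 h1)) => //.
  by rewrite mulrACA [r^-1 * r]mulVf ?mulr1 ?gt_eqF.
have h5 : - (e / 3) <= B r by move: h2; rewrite ler_norml => /andP[].
exact: three_eps mono h4 h5.
Qed.

(** By [hessian_comparison], N divided by the square of [sink] is nondecreasing. If it vanishes at
    time 1 it vanishes on (0, 1], and so does a, the derivative of the field at time 0. *)
Lemma jacobi_nondeg i : chart_dom i (c 1) -> Jf p v a i 1 = 0 -> a = 0.
Proof.
move=> ic J1.
have o1 : 0 < (1 : R) <= 1 by rewrite ltr01 lexx.
have N1 : N 1 = 0.
  have := NJ_chart a F0 (wkin (in01b o1)) (chart_atP (c 1)) ic.
  by rewrite -/(NN p v c a 1) => ->; rewrite /NJ J1 /gm bil0l.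
have N0 s : 0 < s <= 1 -> N s = 0.
  move=> /andP[s0 s1].
  have H : N s / sink k s ^+ 2 <= N 1 / sink k 1 ^+ 2.
    apply: (derive_ge0_le (f := fun r => N r / sink k r ^+ 2) (f' := fun r =>
      ((2 * B r) * sink k r ^+ 2 - N r * (2 * sink k r * (cotk k r * sink k r))) / (sink k r ^+ 2) ^+ 2) s1).
      move=> q /andP[sq q1]; have q01 : 0 < q <= 1 by rewrite (lt_le_trans s0 sq).
      have S0 := sink_gt0 k0 kpi q01; have S2 : sink k q ^+ 2 != 0 by rewrite expf_neq0 ?gt_eqF.
      apply: (is_derive_div (g := fun r => sink k r ^+ 2) S2 (NN_derive a F0 (in01b q01))).
      have dS := sink_derive k0 kpi q01.
      by apply: is_derive_cast (is_deriveM dS dS) _; rewrite /GRing.scale/=; ring.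
    move=> q /andP[sq q1]; have q01 : 0 < q <= 1 by rewrite (lt_le_trans s0 sq).
    rewrite divr_ge0 ?sqr_ge0//.
    have -> : 2 * B q * sink k q ^+ 2 - N q * (2 * sink k q * (cotk k q * sink k q)) =
      2 * sink k q ^+ 2 * (B q - cotk k q * N q) by ring.
    apply: mulr_ge0; [apply: mulr_ge0; [exact: ler0n|exact: sqr_ge0]|].
    by rewrite subr_ge0; exact: hessian_comparison.
  have Ns : 0 <= N s by apply: gm_ge0; exact/coord_img/chart_atP.
  have S0 : 0 < sink k s ^+ 2 by rewrite exprn_gt0// sink_gt0// s0.
  rewrite N1 mul0r (ler_pdivrMr _ _ S0) mul0r in H.
  by apply: le_anti; rewrite H Ns.
have [tau [Y [tau0 Y0 dY HY]]] := Lm_zero F0 (lt_trans ltr01 b1).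
pose z : 'rV[R]_(n + n) := row_mx 0 a.
have /vder_lsub/vder_epsP dJ := dY z.
rewrite DFE /dF row_mxKl row_mxKr Y0 mulmx1 row_mxKl in dJ.
apply/eqP; rewrite -normr_le0; apply/ler_addgt0Pl => e e0; rewrite addr0.
have [d d0 Hd] := dJ e e0.
pose s := Num.min d (Num.min tau 1) / 2.
have m0 : 0 < Num.min d (Num.min tau 1) by rewrite !lt_min d0 tau0 ltr01.
have s0 : 0 < s by rewrite divr_gt0.
have := half_lt m0; rewrite -/s !lt_min => /and3P[sd stau s1].
have s_tau : 0 <= s < tau by rewrite (ltW s0).
have [sb ip LE] := HY s s_tau.
have s01 : 0 < s <= 1 by rewrite s0 ltW.
have Js : Jf p v a (chart_at p) s = 0.
  have NI := NJ_chart a F0 (wkin (in01b s01)) (chart_atP (c s)) ip.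
  have {NI} Z : NJ p v c a (chart_at p) s = 0 by rewrite -NI; exact: N0.
  apply/eqP; apply: contraT => J0; have := gm_gt0 (coord_img ip) J0.
  by rewrite -/(NJ p v c a (chart_at p) s) Z ltxx.
have E : lsubmx (z *m Y s) = 0.
  by rewrite -Js /Jf LE mulmxA mul_mx_row mulmx0 mulmx1.
have := Hd s; rewrite subr0 gtr0_norm// => /(_ sd).
by rewrite E !sub0r oppr0 sub0r normrN normrZ gtr0_norm// mulrC ler_pM2r.
Qed.

(** [PP] minus s times the inner product of v and a is constant, and tends to 0 at time 0. *)
Lemma gauss : PP p v c a 1 = ginner p v a.
Proof.
apply/eqP; rewrite -subr_eq0 -normr_le0; apply/ler_addgt0Pl => e e0; rewrite addr0.
set g := ginner p v a.
have g1 : 0 < `|g| + 1 by rewrite ltr_wpDl.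
have e2 : 0 < e / 2 by rewrite divr_gt0.
have [d d0 Hd] := zero_behaviour a F0 (lt_trans ltr01 b1) e2.
pose m := Num.min d (Num.min 1 (e / 2 / (`|g| + 1))).
have m0 : 0 < m by rewrite !lt_min d0 ltr01 divr_gt0.
pose r := m / 2; have r0 : 0 < r by rewrite divr_gt0.
have := half_lt m0; rewrite -/r /m !lt_min => /and3P[rd r1 re].
have [_ _ _ h] : [/\ r < b, N r <= e / 2 * r, `|B r| <= e / 2 & `|PP p v c a r| <= e / 2].
  by apply: Hd; rewrite r0.
have E : PP p v c a 1 - 1 * g = PP p v c a r - r * g.
  apply: (derive_eq0_cst (f := fun s => PP p v c a s - s * g) (ltW r1)) => s /andP[rs s1].
  have s01 : 0 < s <= 1 by rewrite (lt_le_trans r0).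
  apply: is_derive_cast (is_deriveB (PP_derive a F0 (in01b s01)) (_ : is_derive s 1 _ g)) _.
    by under eq_fun do rewrite mulrC; exact: is_derive_lin.
  by rewrite subrr.
rewrite mul1r in E; rewrite E (le_trans (ler_normB _ _))// [e in leRHS]splitr lerD//.
move: re; rewrite ltr_pdivlMr// => re.
rewrite normrM gtr0_norm//; apply: le_trans (ltW re).
by rewrite ler_wpM2l ?lerDl// ltW.
Qed.

End comparison.

(** * The squared distance function *)

Section log.
Context {R : realType} (M : riemannian_manifold R).
Local Notation n := (mdim M).
Local Notation V := 'rV[R]_n.
Local Notation W := 'rV[R]_(n + n).
Implicit Types (i j : chart M) (p x y : M) (u v w m a : V) (c e : R -> M) (t s b : R).

Lemma geodesicP x y c : geodesic x y c <-> c 1 = y /\ Fam x (velocity c 0) 1 c.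
Proof. by split=> [[c0 c1 g]|[c1 [c0 _ g]]]; split. Qed.

Lemma Fam_geodesic p v c : Fam p v 1 c -> geodesic p (c 1) c.
Proof. by move=> [c0 _ g]; split. Qed.

(** [uniquely_geodesic] identifies geodesics on [0, 1] only, so their velocities at 0 have to be
    compared from the right. *)
Lemma vder_right (m : nat) (c d : R -> 'rV[R]_m) (t e : R) (a b : 'rV[R]_m) : 0 < e ->
  (forall s, t <= s < t + e -> c s = d s) -> vder c t a -> vder d t b -> a = b.
Proof.
move=> e0 E da db; have := vder_sub da db => /vder_epsP H.
apply/eqP; rewrite -subr_eq0 -normr_le0; apply/ler_addgt0Pl => r r0; rewrite addr0.
have [d0 d0p Hd] := H r r0.
pose h := Num.min d0 e / 2.
have m0 : 0 < Num.min d0 e by rewrite lt_min d0p.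
have h0 : 0 < h by rewrite divr_gt0.
have := half_lt m0; rewrite -/h !lt_min => /andP[hd he].
have := Hd (t + h); rewrite addrAC subrr add0r gtr0_norm// => /(_ hd).
rewrite !E ?lexx ?ltrDl ?lerDl ?(ltW h0) ?ltrD2l ?he// !subrr sub0r normrN normrZ gtr0_norm//.
by rewrite mulrC ler_pM2r.
Qed.

Hypothesis UG : uniquely_geodesic M.

Lemma velocity_unique x y c d : geodesic x y c -> geodesic x y d -> velocity c 0 = velocity d 0.
Proof.
move=> gc gd; have [_ /(_ c d gc gd) E] := UG x y.
have [c0 _ Gc] := gc; have [d0 _ Gd] := gd.
have z01 : 0 <= (0 : R) <= 1 by rewrite lexx ler01.
have g1 := nbhs_singleton (Gc _ z01); have g2 := nbhs_singleton (Gd _ z01).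
rewrite /velocity c0 d0; have := chart_atP x; set i := chart_at x => ix.
apply: (@vder_right _ (coord i \o c) (coord i \o d) 0 1 _ _ ltr01).
- by move=> s /andP[s0]; rewrite add0r => /ltW s1 /=; rewrite E// s0.
- by apply: (geodesic_vder g1); rewrite c0.
- by apply: (geodesic_vder g2); rewrite d0.
Qed.

Lemma log_velocity x y c : geodesic x y c -> velocity c 0 = Exp_inv x y.
Proof.
move=> g; have : exp_graph x (Exp_inv x y) y.
  by apply: (xgetPex 0 (P := fun v => exp_graph x v y)); exists (velocity c 0), c.
by move=> [d [gd <-]]; exact: velocity_unique g gd.
Qed.

Lemma log_Fam x y : exists2 c, Fam x (Exp_inv x y) 1 c & c 1 = y.
Proof.
have [[c g] _] := UG x y; exists c; last by case: g.
by rewrite -(log_velocity g); have /geodesicP[] := g.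
Qed.

Lemma Fam_log x v c : Fam x v 1 c -> Exp_inv x (c 1) = v.
Proof. by move=> F; rewrite -(log_velocity (Fam_geodesic F)); case: F. Qed.

Lemma Exp_Fam x v c : Fam x v 1 c -> Exp x v = c 1.
Proof.
move=> F; apply: xget_unique.
  by exists c; split; [exact: Fam_geodesic F|case: F].
move=> y [d [gd vd]]; have [d1 Fd] := (geodesicP _ _ _).1 gd.
rewrite vd in Fd; have o1 : 0 <= (1 : R) <= 1 by rewrite ler01 lexx.
by have [-> _] := nbhs_singleton (Fam_same F Fd o1); rewrite d1.
Qed.

Section at_point.
Variables (p : M) (v0 : V) (c0 : R -> M).
Hypothesis F0 : Fam p v0 1 c0.
Variable i : chart M.
Hypothesis ic : chart_dom i (c0 1).

Let o01 : 0 <= (1 : R) <= 1. Proof. by rewrite ler01 lexx. Qed.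

Definition expc v : V := lsubmx (St p i v 1).
Definition Dexp v : 'M[R]_n := lsubmx (Lm p v i 1).

Lemma JfE v a : Jf p v a i 1 = a *m Dexp v.
Proof. by rewrite /Jf /Dexp -[in LHS](hsubmxK (Lm p v i 1)) mul_mx_row row_mxKl. Qed.

Lemma expc_sdiff : exists2 d : R, 0 < d & forall v, `|v - v0| < d ->
  [/\ sdiff expc v (Dexp v), (exists2 c, Fam p v 1 c & chart_dom i (c 1)) &
    forall c, Fam p v 1 c -> chart_dom i (c 1) -> expc v = coord i (c 1)].
Proof.
have [[d d0 Hd] _] := dep_all F0 o01 ic.
exists d => // v /Hd[c F ci]; split; last 1 first.
- by move=> e Fe ei; rewrite /expc (StE Fe o01 ei) row_mxKl.
- have := LmP F o01 ci => /sdiffP sL; apply/sdiffP => l.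
  have := sL (lshift n l).
  rewrite (_ : (fun u => St p i u 1 0 (lshift n l)) = fun u => expc u 0 l); last first.
    by apply/funext => u; rewrite /expc [RHS]mxE.
  by apply: sdR_eq => b; rewrite -JfE /Jf [in RHS]mxE.
- by exists c.
Qed.

(** Uniqueness of geodesics makes exp injective where it is defined; by invariance of domain its
    image contains a neighbourhood of the endpoint, on which log takes values near v0. Conjugate
    endpoints are covered as well. *)
Lemma log_near r : 0 < r -> \forall y \near (coord i (c0 1) : V),
  `|Exp_inv p (param i y) - v0| < r /\ expc (Exp_inv p (param i y)) = y.
Proof.
move=> r0; have [d d0 Hd] := expc_sdiff.
pose r' := Num.min r d; have r'0 : 0 < r' by rewrite lt_min r0.
have sub v : `|v - v0| < r' -> `|v - v0| < d by rewrite lt_min => /andP[].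
have inj v v' : `|v - v0| < r' -> `|v' - v0| < r' -> expc v = expc v' -> v = v'.
  move=> /sub/Hd[_ [c F ci] E] /sub/Hd[_ [c' F' c'i] E'].
  rewrite (E c F ci) (E' c' F' c'i) => cc.
  by rewrite -(Fam_log F) -(Fam_log F') -(coordK ci) -(coordK c'i) cc.
have sde v : `|v - v0| < r' -> sdiff expc v (Dexp v) by move=> /sub/Hd[].
have [e e0 He] := invariance_of_domain r'0 sde inj.
have v00 : `|v0 - v0| < d by rewrite subrr normr0.
have [_ _ /(_ c0 F0 ic) E0] := Hd v0 v00.
apply/nbhs_ballP; exists e => // y; rewrite -ball_normE/= distrC => ye.
have [|v vr' vE] := He y; first by rewrite E0.
have [_ [c F ci] E] := Hd _ (sub _ vr').
have -> : Exp_inv p (param i y) = v by rewrite -vE (E c F ci) coordK// (Fam_log F).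
by split=> //; move: vr'; rewrite lt_min => /andP[].
Qed.

Lemma log_sdiff : Dexp v0 \in unitmx ->
  sdiff (fun y : V => Exp_inv p (param i y)) (coord i (c0 1)) (invmx (Dexp v0)).
Proof.
move=> u; have [d d0 Hd] := expc_sdiff.
have v00 : `|v0 - v0| < d by rewrite subrr normr0.
have [s0 _ /(_ c0 F0 ic) E0] := Hd v0 v00.
have L0 : Exp_inv p (param i (coord i (c0 1))) = v0 by rewrite coordK// (Fam_log F0).
have /nbhs_ballP[r /= r0 Hr] := log_near ltr01.
apply: (sdiff_inverse (f := expc) (d := r)) => //.
- by rewrite L0.
- by move=> y yr; have [] := Hr y; first by rewrite -ball_normE/= distrC.
- apply/continuous_epsP => e e0; have /nbhs_ballP[r' /= r'0 Hr'] := log_near e0.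
  exists r' => // y yr; have [|/ltW + _] := Hr' y; first by rewrite -ball_normE/= distrC.
  by rewrite L0.
Qed.

End at_point.

Lemma log_continuous p y0 : {for y0, continuous (Exp_inv p : M -> V)}.
Proof.
have [c0 F0 c1] := log_Fam p y0.
pose i := chart_at y0; have ic : chart_dom i (c0 1) by rewrite c1; exact: chart_atP.
apply/cvgrPdist_lt => e e0; have N := log_near F0 ic e0; rewrite c1 in N ic.
have := chart_continuous ic N; near_simpl => N'.
have D : \forall y \near y0, chart_dom i y.
  by apply: open_nbhs_nbhs; split=> //; exact: chart_dom_open.
by apply: filterS2 D N' => y iy [+ _]; rewrite coordK// distrC.
Qed.

End log.

Section taylor.
Context {R : realType}.

Lemma is_derive_scale_sq (m t : R) : is_derive t 1 (fun s => m * s ^+ 2) (m * (2 * t)).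
Proof.
have d := is_deriveM (is_derive_lin m t) (is_derive_id t (1 : R)).
rewrite (_ : (fun s => _) = (fun s => m * s) * id); last first.
  by apply/funext => s; rewrite fctE/=; ring.
by apply: is_derive_cast d _; rewrite /GRing.scale/=; ring.
Qed.

Lemma second_order_lower (f g D : R -> R) (m : R) :
  (forall t : R, 0 <= t <= 1 -> is_derive t 1 f (2 * g t)) ->
  (forall t : R, 0 <= t <= 1 -> is_derive t 1 g (D t)) ->
  (forall t : R, 0 <= t <= 1 -> m <= D t) -> f 0 + 2 * g 0 + m <= f 1.
Proof.
move=> df dg mD.
have A1 (t : R) : 0 <= t <= 1 -> g 0 + m * t <= g t.
  move=> /andP[t0 t1].
  have H : g 0 - m * 0 <= g t - m * t.
    apply: (derive_ge0_le (f := fun t => g t - m * t) (f' := fun t => D t - m) t0).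
      move=> s /andP[s0 st]; apply: is_deriveB (is_derive_lin _ _).
      by apply: dg; rewrite s0 (le_trans st).
    by move=> s /andP[s0 st]; rewrite subr_ge0 mD// s0 (le_trans st).
  lra.
have H : f 0 - 2 * g 0 * 0 - m * 0 ^+ 2 <= f 1 - 2 * g 0 * 1 - m * 1 ^+ 2.
  apply: (derive_ge0_le (f := fun t => f t - (2 * g 0) * t - m * t ^+ 2)
    (f' := fun t => 2 * g t - 2 * g 0 - m * (2 * t)) ler01).
    move=> t t01; apply: is_deriveB (is_derive_scale_sq _ _).
    by apply: is_deriveB (is_derive_lin _ _); exact: df.
  by move=> t t01; have := A1 t t01; lra.
lra.
Qed.

End taylor.

(** * First and second derivatives of the squared distance *)

Section hessian.
Context {R : realType} (M : riemannian_manifold R).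
Local Notation n := (mdim M).
Local Notation V := 'rV[R]_n.
Local Notation W := 'rV[R]_(n + n).
Implicit Types (i j : chart M) (p x y : M) (u v w m a : V) (c e : R -> M) (t s b : R).
Variables (kmin kmax : R).
Hypothesis UG : uniquely_geodesic M.
Hypothesis sec : sectional_in M kmin kmax.

Let o01 : 0 <= (1 : R) <= 1. Proof. by rewrite ler01 lexx. Qed.
Let z01 : 0 <= (0 : R) <= 1. Proof. by rewrite lexx ler01. Qed.

(* The squared length of the geodesic from [p] to [y]; [okp] says that it is shorter than the
   conjugate radius of the model space of curvature [kmax]. *)
Definition rsq p y := ginner p (Exp_inv p y) (Exp_inv p y).

Definition okp p y := Num.max kmax 0 * rsq p y < pi ^+ 2.

Lemma ginner_sym x u v : ginner x u v = ginner x v u.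
Proof. by apply: gm_sym; exact/coord_img/chart_atP. Qed.

Lemma ginner_ge0 x u : 0 <= ginner x u u.
Proof. by apply: gm_ge0; exact/coord_img/chart_atP. Qed.

Lemma rsq_ge0 p y : 0 <= rsq p y. Proof. exact: ginner_ge0. Qed.

Lemma okp_sqrt p y : okp p y -> exists k, [/\ 0 <= k, k < pi & Num.max kmax 0 * rsq p y <= k ^+ 2].
Proof.
move=> ok; exists (Num.sqrt (Num.max kmax 0 * rsq p y)).
have m0 : 0 <= Num.max kmax 0 * rsq p y by rewrite mulr_ge0 ?rsq_ge0// le_max lexx orbT.
split; first exact: sqrtr_ge0.
  by rewrite -(ger0_norm (pi_ge0 R)) -sqrtr_sqr ltr_sqrt// exprn_gt0// pi_gt0.
by rewrite sqr_sqrtr.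
Qed.

Lemma Fam_extend p v c : Fam p v 1 c -> exists2 b, 1 < b & Fam p v b c.
Proof.
by move=> [cp vc g]; have [b b1 gb] := geo_on_extend ler01 g; exists b.
Qed.

Lemma Dexp_unit p v c i k : Fam p v 1 c -> chart_dom i (c 1) -> 0 <= k -> k < pi ->
  Num.max kmax 0 * ginner p v v <= k ^+ 2 -> Dexp p i v \in unitmx.
Proof.
move=> F ic k0 kpi kv; have [b b1 Fb] := Fam_extend F.
rewrite -row_free_unit -kermx_eq0; apply/eqP/row_matrixP => l; rewrite row0.
set a := row l _; have aB : a *m Dexp p i v = 0 by apply/eqP; rewrite -sub_kermx row_sub.
by apply: (jacobi_nondeg Fb b1 sec k0 kpi kv ic); rewrite JfE.
Qed.

(** Moving the endpoint with velocity a' varies the geodesic from p through a Jacobi field that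
    vanishes at p and ends at a'; the derivative of log is the initial derivative a of that
    field. *)
Lemma log_curve p c t i a' : {for t, continuous c} -> chart_dom i (c t) -> vder (coord i \o c) t a' ->
  okp p (c t) -> exists a, vder (fun s => Exp_inv p (c s)) t a /\ Jf p (Exp_inv p (c t)) a i 1 = a'.
Proof.
move=> cc it dc /okp_sqrt[k [k0 kpi kv]].
have [g Fg g1] := log_Fam UG p (c t).
have ig : chart_dom i (g 1) by rewrite g1.
have U := Dexp_unit Fg ig k0 kpi kv.
have sl := log_sdiff UG Fg ig U; rewrite g1 in sl.
exists (a' *m invmx (Dexp p i (Exp_inv p (c t)))); split; last by rewrite JfE mulmxKV.
apply: vder_near (sdiff_chain sl dc).
by apply: filterS (near_chart cc it) => s is_ /=; rewrite coordK.
Qed.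

(** Half the gradient of [rsq p] at y, namely the final velocity of the geodesic from p to y. *)
Definition radial p i y : V := rsubmx (St p i (Exp_inv p y) 1).

Lemma radialE p y i g : Fam p (Exp_inv p y) 1 g -> chart_dom i (g 1) -> radial p i y = cv i g 1.
Proof. by move=> F ig; rewrite /radial (StE F o01 ig) row_mxKr. Qed.

(** First variation formula: differentiate the squared norm of log, then move the inner product from
    p to the endpoint with [gauss]. *)
Lemma rsq_derive p c t i a' : {for t, continuous c} -> chart_dom i (c t) -> vder (coord i \o c) t a' ->
  okp p (c t) ->
  is_derive t 1 (fun s => rsq p (c s)) (2 * gm i (coord i (c t)) (radial p i (c t)) a').
Proof.
move=> cc it dc ok; have [a [da Ja]] := log_curve cc it dc ok.
have [g Fg g1] := log_Fam UG p (c t); have [b b1 Fb] := Fam_extend Fg.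
have ig : chart_dom i (g 1) by rewrite g1.
have [k [k0 kpi kv]] := okp_sqrt ok.
have ip : chart_img (chart_at p) (coord (chart_at p) p) by exact/coord_img/chart_atP.
have D := is_derive_gm (ip : chart_img (chart_at p) ((fun=> coord (chart_at p) p) t))
  (vder_cst _ _) da da.
apply: is_derive_cast D _.
rewrite DG0m add0r -!ginnerE (ginner_sym p a) -(gauss a Fb b1) /PP.
have o1b : 0 <= (1 : R) <= b by rewrite ler01 ltW.
by rewrite (PJ_chart a Fb o1b (chart_atP (g 1)) ig) /PJ Ja (radialE Fg ig) g1 mulr_natl mulr2n.
Qed.

(** Along c, the derivative of [radial] is the component [Kf] of the Jacobi field ending at the
    velocity of c, so its covariant derivative is DJ at time 1 and [hessian_comparison] applies. *)
Lemma radial_hessian p c t i k : (\forall s \near t, geodesic_at c s) -> chart_dom i (c t) -> okp p (c t) ->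
  0 <= k -> k < pi -> Num.max kmax 0 * rsq p (c t) <= k ^+ 2 ->
  exists2 D, cotk k 1 * gm i (coord i (c t)) (cv i c t) (cv i c t) <= D &
    is_derive t 1 (fun s => gm i (coord i (c s)) (radial p i (c s)) (cv i c s)) D.
Proof.
move=> gn it ok k0 kpi kv; have gc := nbhs_singleton gn.
have cc := geodesic_continuous gc; have dc := geodesic_vder gc it.
have [a [da Ja]] := log_curve cc it dc ok.
have [g Fg g1] := log_Fam UG p (c t); have [b b1 Fb] := Fam_extend Fg.
have ig : chart_dom i (g 1) by rewrite g1.
have dS := sdiff_chain (LmP Fg o01 ig) da.
have dw := vder_rsub dS.
have [_ D2] := geodesic_at_vder gc it.
have iy := coord_img it.
have D := is_derive_gm_cov (iy : chart_img i ((coord i \o c) t)) dc dw D2.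
eexists; last exact: D.
rewrite /= addNr [X in _ + X]bil0r addr0 -/(radial p i (c t)) -/(Kf p (Exp_inv p (c t)) a i 1).
rewrite (Gam_sym _ (radial p i (c t)) iy).
have H := hessian_comparison a Fb b1 sec k0 kpi kv (_ : 0 < (1 : R) <= 1).
have {H} := H _; rewrite ltr01 lexx => /(_ isT).
have o1b : 0 <= (1 : R) <= b by rewrite ler01 ltW.
have o1b' : 0 < (1 : R) < b by rewrite ltr01.
have -> : NN p (Exp_inv p (c t)) g a 1 = NJ p (Exp_inv p (c t)) g a i 1.
  exact: (NJ_chart a Fb o1b (chart_atP (g 1)) ig).
have -> : BB p (Exp_inv p (c t)) g a 1 = BJ p (Exp_inv p (c t)) g a i 1.
  exact: (BJ_chart a Fb o1b' (chart_atP (g 1)) ig).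
by rewrite /NJ /BJ /DJi /DJ Ja -(radialE Fg ig) g1.
Qed.

Lemma continuous_sum_at (I : Type) (r : seq I) (f : I -> R -> R) t : (forall k, {for t, continuous (f k)}) ->
  {for t, continuous (fun s => \sum_(k <- r) f k s)}.
Proof.
move=> H; elim: r => [|k r IH].
  by rewrite (_ : (fun s => _) = fun=> 0); [exact: cvg_cst|apply/funext => s; rewrite big_nil].
rewrite (_ : (fun s => _) = fun s => f k s + \sum_(k <- r) f k s).
  by apply: cvgD; [exact: H|exact: IH].
by apply/funext => s; rewrite big_cons.
Qed.

Lemma ginner_cont x (f : R -> V) t : {for t, continuous f} -> {for t, continuous (fun s => ginner x (f s) (f s))}.
Proof.
move=> cf; rewrite (_ : (fun s => _) = fun s => \sum_a \sum_b
   f s 0 a * metric (chart_at x) (coord (chart_at x) x) a b * f s 0 b); last first.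
  by apply/funext => s; rewrite /ginner -/(bil _ _ _) bilE.
have cfa (a : 'I_n) : {for t, continuous (fun s => f s 0 a)}.
  by apply: (@continuous_comp _ _ _ f (fun v : V => v 0 a)) => //; exact: coordv_continuous.
apply: continuous_sum_at => a; apply: continuous_sum_at => b.
apply: cvgM; last exact: cfa.
by apply: cvgM; [exact: cfa|exact: cvg_cst].
Qed.

(** Valid beyond the conjugate radius too, since [log_continuous] is; this is what makes [okp] an
    open condition. *)
Lemma rsq_continuous p c t : {for t, continuous c} -> {for t, continuous (fun s => rsq p (c s))}.
Proof.
move=> cc; apply: ginner_cont.
by apply: (@continuous_comp _ _ _ c (fun y => Exp_inv p y : V)) => //; exact: log_continuous.
Qed.

Lemma okp_near p c t : {for t, continuous c} -> okp p (c t) -> \forall s \near t, okp p (c s).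
Proof.
move=> cc ok; have C : {for t, continuous (fun s => Num.max kmax 0 * rsq p (c s))}.
  by apply: cvgM; [exact: cvg_cst|exact: rsq_continuous].
exact: (C _ (lt_nbhsl ok)).
Qed.

Definition rad' p c s := let i := chart_at (c s) in gm i (coord i (c s)) (radial p i (c s)) (cv i c s).

Lemma rsq_geodesic_derive p c t i : geodesic_at c t -> okp p (c t) -> chart_dom i (c t) ->
  is_derive t 1 (fun s => rsq p (c s)) (2 * gm i (coord i (c t)) (radial p i (c t)) (cv i c t)).
Proof. by move=> g ok ic; apply: rsq_derive => //; [exact: geodesic_continuous|exact: geodesic_vder]. Qed.

Lemma rad'_derive p c t k : (\forall s \near t, geodesic_at c s) -> okp p (c t) ->
  0 <= k -> k < pi -> Num.max kmax 0 * rsq p (c t) <= k ^+ 2 ->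
  exists2 D, cotk k 1 * speed2 c t <= D & is_derive t 1 (rad' p c) D.
Proof.
move=> gn ok k0 kpi kv; have gc := nbhs_singleton gn; have cc := geodesic_continuous gc.
pose i := chart_at (c t); have ic : chart_dom i (c t) by exact: chart_atP.
have [D HD dD] := radial_hessian gn ic ok k0 kpi kv.
exists D; first exact: HD.
(* Chart independence of the pairing with [radial] follows from uniqueness of the derivative of
   [rsq]. *)
apply: is_derive_near dD.
apply: filterS3 gn (near_chart cc ic) (okp_near cc ok) => s gs si oks.
have := is_derive_unique (rsq_geodesic_derive gs oks si) (rsq_geodesic_derive gs oks (chart_atP (c s))).
by apply: mulfI; rewrite pnatr_eq0.
Qed.

Lemma rsq_second_order p c (k m : R) : geo_on c 1 -> (forall t, 0 <= t <= 1 -> okp p (c t)) ->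
  0 <= k -> k < pi -> (forall t, 0 <= t <= 1 -> Num.max kmax 0 * rsq p (c t) <= k ^+ 2) ->
  m = cotk k 1 * speed2 c 0 ->
  rsq p (c 0) + 2 * rad' p c 0 + m <= rsq p (c 1).
Proof.
move=> gc ok k0 kpi kv mE.
have P t : exists D, 0 <= t <= 1 -> m <= D /\ is_derive t 1 (rad' p c) D.
  have [t01|] := boolP (0 <= t <= 1); last by exists 0.
  have [D HD dD] := rad'_derive (gc t t01) (ok t t01) k0 kpi (kv t t01).
  by exists D => _; rewrite mE -(speed_const gc t01).
have [D HD] := choice P.
apply: (second_order_lower (f := fun s => rsq p (c s)) (D := D)).
- move=> t t01; have g := nbhs_singleton (gc t t01).
  exact: (rsq_geodesic_derive g (ok t t01) (chart_atP (c t))).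
- by move=> t /HD[].
- by move=> t /HD[].
Qed.

Lemma reverse_geodesic x y c : geodesic x y c -> geodesic y x (fun s => c (1 - s)).
Proof.
have -> : (fun s => c (1 - s)) = (fun s => c (-1 * s + 1)).
  by apply/funext => s; congr c; ring.
move=> [c0 c1 g]; split; [by rewrite mulr0 add0r|by rewrite mulr1 addNr|].
apply: (geo_on_affine (b := 1)) g => t; lra.
Qed.

Lemma velocity_end x y c : geodesic x y c -> velocity c 1 = - Exp_inv y x.
Proof.
move=> g; have g' := reverse_geodesic g.
rewrite -(log_velocity UG g'); have [c0 c1 gc] := g.
have g1 := nbhs_singleton (gc 1 o01).
rewrite /velocity subr0; set i := chart_at (c 1); have ic : chart_dom i (c 1) by exact: chart_atP.
have E : (fun s => c (1 - s)) = (fun s => c (-1 * s + 1)).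
  by apply/funext => s; congr c; ring.
have D : derivable (coord i \o c) (-1 * 0 + 1) 1.
  by rewrite mulr0 add0r; exact: vder_derivable (geodesic_vder g1 ic).
have := vder_derive1 (cv_affine D); rewrite -E mulr0 add0r scaleN1r => ->.
by rewrite opprK.
Qed.

Lemma rad'_start p x y c : geodesic x y c -> rad' p c 0 = - ginner x (Exp_inv x p) (Exp_inv x y).
Proof.
move=> g; have [c0 _ _] := g; rewrite /rad' c0.
have [d F d1] := log_Fam UG p x; have gd := Fam_geodesic F; rewrite d1 in gd.
have ix := chart_atP x.
rewrite (radialE F) ?d1//; have := velocity_end gd; rewrite /velocity d1 /cv => ->.
have := log_velocity UG g; rewrite /velocity c0 => ->.
by rewrite /gm bilNl.
Qed.

Lemma rsq_sym x y : rsq x y = rsq y x.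
Proof.
have [c F c1] := log_Fam UG x y; have g := Fam_geodesic F; rewrite c1 in g.
have [c0 _ gc] := g; have := speed_const gc o01.
rewrite /speed2 c0 c1 (log_velocity UG g) (velocity_end g) => E.
by rewrite /rsq -E /ginner -!/(bil _ _ _) bilNl bilNr opprK.
Qed.

End hessian.

Section primitive.
Context {R : realType}.

Definition clamp01 (t : R) : R := Num.max 0 (Num.min 1 t).

Lemma clamp01_in t : 0 <= clamp01 t <= 1.
Proof. by rewrite /clamp01 le_max lexx/= ge_max ler01 ge_min lexx. Qed.

Lemma clamp01_id t : 0 <= t <= 1 -> clamp01 t = t.
Proof. by move=> /andP[t0 t1]; rewrite /clamp01 (min_idPr t1) (max_idPr t0). Qed.

Lemma clamp01_continuous : continuous clamp01.
Proof.
move=> t; apply: continuous_max; first exact: cvg_cst.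
by apply: continuous_min; [exact: cvg_cst|exact: cvg_id].
Qed.

Lemma primitive01 (f : R -> R) : (forall t : R, 0 <= t <= 1 -> {for t, continuous f}) ->
  exists F : R -> R, (forall t : R, 0 <= t <= 1 -> is_derive t 1 F (f t)) /\
    \int[lebesgue_measure]_(t in `[0%R, 1%R]) f t = F 1 - F 0.
Proof.
move=> cf.
pose g t := f (clamp01 t).
have cg : continuous g.
  by move=> t; apply: continuous_comp; [exact: clamp01_continuous|apply: cf; exact: clamp01_in].
(* [continuous_primitive] controls (-1, 1) only; halving the variable brings [0, 1] inside. *)
have c2 : continuous (fun t : R => g (2 * t)).
  by move=> t; apply: continuous_comp; [exact: mulrl_continuous|exact: cg].
have [F HF] := continuous_primitive c2.
pose G t := 2 * F (2^-1 * t).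
have dG (t : R) : 0 <= t <= 1 -> is_derive t 1 G (f t).
  move=> t01; have th : `|2^-1 * t| < 1.
    by case/andP: t01 => t0 t1; rewrite ger0_norm ?mulr_ge0// mulrC ltr_pdivrMr// mul1r (le_lt_trans t1)// ltr1n.
  have D := is_derive1_comp (HF _ th) (is_derive_lin 2^-1 t).
  apply: is_derive_cast (is_deriveZ 2 D) _.
  have -> : 2 * (2^-1 * t) = t by field.
  by rewrite /GRing.scale/= /g clamp01_id//; field.
exists G; split=> //.
have cG (t : R) : 0 <= t <= 1 -> {for t, continuous G} by move=> /dG/is_derive_continuous.
rewrite /Rintegral (@continuous_FTC2 _ f G 0 1)//.
- apply: continuous_in_subspaceT => t; rewrite inE/= in_itv/=; exact: cf.
- split=> [t||].
  + by rewrite in_itv/= => /andP[t0 t1]; have [] := dG t _; rewrite ?(ltW t0) ?(ltW t1).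
  + by apply: cvg_at_right_filter; apply: cG; rewrite lexx ler01.
  + by apply: cvg_at_left_filter; apply: cG; rewrite lexx ler01.
- move=> t; rewrite in_itv/= => /andP[t0 t1].
  have t01 : 0 <= t <= 1 by rewrite !ltW.
  by have [_ E] := dG t t01; rewrite derive1E E.
Qed.

End primitive.

(** * Geodesic length against the length of arbitrary curves *)

Section curves.
Context {R : realType} (M : riemannian_manifold R).
Local Notation n := (mdim M).
Local Notation V := 'rV[R]_n.
Implicit Types (i j : chart M) (p x y : M) (u v w m a : V) (c e : R -> M) (t s b : R).

Lemma gm_continuous i (q u : R -> V) t : chart_img i (q t) -> {for t, continuous q} ->
  {for t, continuous u} -> {for t, continuous (fun s => gm i (q s) (u s) (u s))}.
Proof.
move=> iq cq cu; rewrite (_ : (fun s => _) = fun s => \sum_a \sum_b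
   u s 0 a * metric i (q s) a b * u s 0 b); last by apply/funext => s; rewrite /gm bilE.
have cfa (a : 'I_n) : {for t, continuous (fun s => u s 0 a)}.
  by apply: (@continuous_comp _ _ _ u (fun v : V => v 0 a)) => //; exact: coordv_continuous.
apply: continuous_sum_at => a; apply: continuous_sum_at => b.
apply: cvgM; last exact: cfa.
apply: cvgM; first exact: cfa.
apply: (@continuous_comp _ _ _ q (fun y : V => metric i y a b)) => //.
exact: sdR_continuous (metric_sg a b iq).
Qed.

Lemma gm_cauchy_schwarz i (y : V) u w : chart_img i y -> gm i y u w ^+ 2 <= gm i y u u * gm i y w w.
Proof.
move=> iy; have [->|w0] := eqVneq w 0; first by rewrite /gm !bil0r expr0n mulr0.
have gw := gm_gt0 iy w0.
have := gm_square_ge0 u w (gm i y u w / gm i y w w) iy.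
rewrite -(pmulr_lge0 _ gw) -subr_ge0 => H; rewrite -subr_ge0; move: H.
by congr (_ <= _); field; exact: lt0r_neq0.
Qed.

Definition spd c t := Num.sqrt (speed2 c t).

Lemma spd_continuous c t : (\forall s \near t, C1_at c s) -> {for t, continuous (spd c)}.
Proof.
move=> cn; have [cc H] := nbhs_singleton cn.
pose i := chart_at (c t); have ic : chart_dom i (c t) by exact: chart_atP.
have [D1 D2] := H i ic.
have cq : {for t, continuous (coord i \o c)}.
  exact: vder_continuous (derivable_vder (nbhs_singleton D1)).
have := gm_continuous (coord_img ic : chart_img i ((coord i \o c) t)) cq D2 => C.
apply: (@continuous_comp _ _ _ (speed2 c) Num.sqrt); last exact: sqrt_continuous.
have E : \forall s \near t, gm i ((coord i \o c) s) (cv i c s) (cv i c s) = speed2 c s.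
  apply: filterS3 cn (near_chart cc ic) D1 => s [cs _] is_ ds.
  by rewrite (speed2E cs is_ ds).
have E0 := nbhs_singleton E; rewrite /prop_for /continuous_at -E0.
by apply: cvg_trans C; apply: near_eq_cvg.
Qed.

Variables (kmin kmax : R).
Hypothesis UG : uniquely_geodesic M.
Hypothesis sec : sectional_in M kmin kmax.

Let o01 : 0 <= (1 : R) <= 1. Proof. by rewrite ler01 lexx. Qed.
Let z01 : 0 <= (0 : R) <= 1. Proof. by rewrite lexx ler01. Qed.

(** The term e smooths the square root where the curve meets p; the bound is Cauchy-Schwarz against
    the radial vector, whose squared norm is [rsq]. *)
Lemma radial_speed p c t (e : R) : C1_at c t -> okp kmax p (c t) -> 0 < e -> exists2 D, D <= spd c t &
  is_derive t 1 (fun s => Num.sqrt (rsq p (c s) + e)) D.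
Proof.
move=> [cc H] ok e0.
pose i := chart_at (c t); have ic : chart_dom i (c t) by exact: chart_atP.
have [D1 _] := H i ic; have dt := nbhs_singleton D1.
have dr := rsq_derive UG sec cc ic (derivable_vder dt) ok.
have pos : 0 < rsq p (c t) + e by rewrite ltr_wpDl// rsq_ge0.
have de : is_derive t 1 (fun s => rsq p (c s) + e) (2 * gm i (coord i (c t)) (radial p i (c t)) (cv i c t)).
  by apply: is_derive_cast (is_deriveD dr (is_derive_cst e t 1)) _; rewrite addr0.
have D := is_derive1_comp (g := fun s => rsq p (c s) + e) (is_derive1_sqrt pos) de.
eexists; last exact: D.
have iy := coord_img ic.
have [g Fg g1] := log_Fam UG p (c t); have ig : chart_dom i (g 1) by rewrite g1.
have R2 : gm i (coord i (c t)) (radial p i (c t)) (radial p i (c t)) = rsq p (c t).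
  by rewrite (radialE Fg ig); have := Fam_speed ler01 Fg ig; rewrite g1.
have := gm_cauchy_schwarz (radial p i (c t)) (cv i c t) iy.
rewrite R2 -(speed2E cc ic dt).
have S0 : 0 <= speed2 c t by exact: ginner_ge0.
have sp := sqrtr_gt0 (rsq p (c t) + e); rewrite pos in sp.
set X := gm _ _ _ _ => H2.
rewrite invfM mulrACA mulVf ?pnatr_eq0// mul1r mulrC ler_pdivrMr ?sp//.
apply: le_trans (ler_norm _) _; rewrite -sqrtr_sqr -sqrtrM//.
rewrite ler_wsqrtr//; apply: le_trans H2 _.
by rewrite mulrC ler_wpM2l// lerDl ltW.
Qed.

Definition rr p y := Num.sqrt (rsq p y).

Lemma rr_ge0 p y : 0 <= rr p y. Proof. exact: sqrtr_ge0. Qed.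

Lemma rr_sq p y : rr p y ^+ 2 = rsq p y.
Proof. by rewrite sqr_sqrtr// rsq_ge0. Qed.

Definition okr (r : R) := Num.max kmax 0 * r ^+ 2 < pi ^+ 2.

Lemma okr_le r r' : 0 <= r -> r <= r' -> okr r' -> okr r.
Proof.
move=> r0 rr' ; apply: le_lt_trans; rewrite ler_wpM2l ?le_max ?lexx ?orbT//.
by rewrite ler_sqr ?nnegrE// (le_trans r0).
Qed.

Lemma okpE p y : okp kmax p y = okr (rr p y).
Proof. by rewrite /okr rr_sq. Qed.

(** [rr] grows at most at the speed of the curve, but this is known only within the conjugate
    radius; the bound proved up to time t is what keeps the curve there, hence real induction along
    the curve. *)
Lemma curve_length_ge c p : around01 (C1_at c) -> okr (rr p (c 0) + curve_length c) ->
  rr p (c 1) <= rr p (c 0) + curve_length c.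
Proof.
move=> cn ok.
have [F [dF LE]] := primitive01 (fun t t01 => spd_continuous (cn t t01)).
have {}LE : curve_length c = F 1 - F 0 by exact: LE.
have Fmono s t : 0 <= s -> s <= t -> t <= 1 -> F s <= F t.
  move=> s0 st t1; apply: (derive_ge0_le (f' := spd c) st) => r /andP[sr rt].
    by apply: dF; rewrite (le_trans s0)//= (le_trans rt).
  exact: sqrtr_ge0.
have ok_of t : 0 <= t <= 1 -> rr p (c t) <= rr p (c 0) + (F t - F 0) -> okp kmax p (c t).
  move=> /andP[t0 t1] h; rewrite okpE; apply: okr_le (rr_ge0 _ _) _ ok.
  by apply: le_trans h _; rewrite LE lerD2l lerD2r Fmono.
rewrite LE; apply: (real_induction (b := 1) (P := fun t => rr p (c t) <= rr p (c 0) + (F t - F 0)) _ _ _ o01).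
- by rewrite subrr addr0.
- move=> t t01 Pt; have ct := cn t t01; have [cc _] := nbhs_singleton ct.
  have okn := okp_near UG cc (ok_of t t01 Pt).
  have [d d0 Hd] : exists2 d, 0 < d & forall s, `|s - t| < d -> C1_at c s /\ okp kmax p (c s).
    have /nbhs_ballP[d /= d0 Hd] : \forall s \near t, C1_at c s /\ okp kmax p (c s).
      by apply: filterS2 ct okn => s; split.
    by exists d => // s sd; apply: Hd; rewrite /ball/= distrC.
  exists d => // s /andP[ts std] s1.
  suff : rr p (c s) <= rr p (c t) + (F s - F t).
    by move=> h; apply: le_trans h _; rewrite -lerBrDr (le_trans Pt)//; lra.
  (* The square root is smoothed by e^2, because sqrt (rr^2 + e^2) <= rr + e. *)
  apply/ler_addgt0Pl => e e0.
  have e20 : 0 < e ^+ 2 by rewrite exprn_gt0.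
  have P r : exists D, t <= r <= s -> D <= spd c r /\
      is_derive r 1 (fun q => Num.sqrt (rsq p (c q) + e ^+ 2)) D.
    have [/andP[tr rs]|] := boolP (t <= r <= s); last by exists 0.
    have [|h1 h2] := Hd r; first by rewrite ger0_norm ?subr_ge0// ltrBlDl (le_lt_trans rs).
    by have [D D1 D2] := radial_speed h1 h2 e20; exists D.
  have [D HD] := choice P.
  have mono : F t - Num.sqrt (rsq p (c t) + e ^+ 2) <= F s - Num.sqrt (rsq p (c s) + e ^+ 2).
    apply: (derive_ge0_le (f := fun r => F r - Num.sqrt (rsq p (c r) + e ^+ 2))
      (f' := fun r => spd c r - D r) ts) => r rts; have [DS dD] := HD r rts.
      apply: is_deriveB dD; apply: dF.
      by case/andP : rts t01 => h1 h2 /andP[h3 h4]; rewrite (le_trans h3)//= (le_trans h2).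
    by rewrite subr_ge0.
  have h1 : rr p (c s) <= Num.sqrt (rsq p (c s) + e ^+ 2).
    by rewrite ler_wsqrtr// lerDl ltW.
  have h2 : Num.sqrt (rsq p (c t) + e ^+ 2) <= rr p (c t) + e.
    rewrite -(@ger0_norm _ (rr p (c t) + e)) ?addr_ge0 ?rr_ge0 ?(ltW e0)// -sqrtr_sqr ler_wsqrtr//.
    by rewrite sqrrD rr_sq lerD2r lerDl mulrn_wge0// mulr_ge0 ?rr_ge0 ?ltW.
  move: mono h1 h2; clear; move: (F t) (F s) (rr _ _) (rr _ _) (Num.sqrt _) (Num.sqrt _) => *; lra.
- move=> t /andP[t0 t1] Pt; have t01 : 0 <= t <= 1 by rewrite ltW.
  have [cc _] := nbhs_singleton (cn t t01).
  have C : {for t, continuous (fun s => rr p (c s) - F s)}.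
    apply: cvgB; last exact: is_derive_continuous (dF t t01).
    apply: (@continuous_comp _ _ _ (fun s => rsq p (c s)) Num.sqrt); last exact: sqrt_continuous.
    exact: rsq_continuous.
  apply/ler_addgt0Pl => e e0.
  have [d d0 Hd] := (continuous_epsP _ _).1 C e e0.
  pose s := t - Num.min d t / 2.
  have m0 : 0 < Num.min d t by rewrite lt_min d0.
  have := half_lt m0; rewrite lt_min => /andP[h1 h2].
  have h0 : 0 < Num.min d t / 2 by rewrite divr_gt0.
  have := Hd s; rewrite /s addrAC subrr add0r normrN gtr0_norm// => /(_ h1).
  have : 0 <= s < t by rewrite subr_ge0 (ltW h2) ltrBlDr ltrDl.
  move=> /Pt; rewrite -/s ler_norml => K /andP[K2 _].
  move: K K2; clear; move: (F t) (F s) (F 0) (rr _ _) (rr _ _) (rr _ _) => *; lra.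
Qed.

End curves.

(** * The Riemannian distance and the hinge inequality *)

Section distance.
Context {R : realType} (M : riemannian_manifold R).
Local Notation n := (mdim M).
Local Notation V := 'rV[R]_n.
Implicit Types (i j : chart M) (p x y : M) (u v w m a : V) (c e : R -> M) (t s b : R).

Lemma geodesic_C1 c t : (\forall s \near t, geodesic_at c s) -> C1_at c t.
Proof.
move=> gn; have g := nbhs_singleton gn; split; first exact: geodesic_continuous.
move=> i ic; have [D1 D2] := geodesic_at_vder g ic; split; first exact: D1.
exact: vder_continuous D2.
Qed.

Lemma geodesic_around_C1 x y c : geodesic x y c -> around01 (C1_at c).
Proof.
move=> [_ _ gc] t t01; have N := near_join (gc t t01).
by apply: filterS N => s; exact: geodesic_C1.
Qed.

Section uniquely.
Hypothesis UG : uniquely_geodesic M.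

Let o01 : 0 <= (1 : R) <= 1. Proof. by rewrite ler01 lexx. Qed.
Let z01 : 0 <= (0 : R) <= 1. Proof. by rewrite lexx ler01. Qed.

Lemma geodesic_exists x y : exists c, geodesic x y c.
Proof. by have [] := UG x y. Qed.

Lemma rr_sym x y : rr x y = rr y x.
Proof. by rewrite /rr rsq_sym. Qed.

Lemma geodesic_spd x y c t : geodesic x y c -> 0 <= t <= 1 -> spd c t = rr x y.
Proof.
move=> g t01; have [c0 _ gc] := g.
by rewrite /spd (speed_const gc t01) /speed2 (log_velocity UG g) c0.
Qed.

Lemma geodesic_length x y c : geodesic x y c -> curve_length c = rr x y.
Proof.
move=> g; have gC := geodesic_around_C1 g.
have [F [dF LE]] := primitive01 (fun t t01 => spd_continuous (gC t t01)).
have -> : curve_length c = F 1 - F 0 by exact: LE.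
have E : F 1 - rr x y * 1 = F 0 - rr x y * 0.
  apply: (derive_eq0_cst (f := fun t => F t - rr x y * t) ler01) => t t01.
  apply: is_derive_cast (is_deriveB (dF t t01) (is_derive_lin (rr x y) t)) _.
  by rewrite (geodesic_spd g t01) subrr.
by move: E; rewrite mulr1 mulr0; lra.
Qed.

Lemma curve_length_ge0 c : around01 (C1_at c) -> 0 <= curve_length c.
Proof.
move=> gC.
have [F [dF LE]] := primitive01 (fun t t01 => spd_continuous (gC t t01)).
have -> : curve_length c = F 1 - F 0 by exact: LE.
rewrite subr_ge0; apply: (derive_ge0_le (f := F) (f' := spd c) ler01) => t t01; exact: sqrtr_ge0.
Qed.

Definition curves x y := [set c : R -> M | [/\ c 0 = x, c 1 = y & around01 (C1_at c)]].

Lemma curves_lbound x y : has_lbound [set curve_length c | c in curves x y].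
Proof. by exists 0 => _ [c [_ _ cC] <-]; exact: curve_length_ge0. Qed.

Lemma curves_rr x y : [set curve_length c | c in curves x y] (rr x y).
Proof.
have [c g] := geodesic_exists x y; exists c; last exact: geodesic_length.
by have [c0 c1 _] := g; split=> //; exact: geodesic_around_C1 g.
Qed.

Lemma dist_le_rr x y : dist x y <= rr x y.
Proof. by apply: ge_inf; [exact: curves_lbound|exact: curves_rr]. Qed.

Lemma dist_ge0 x y : 0 <= dist x y.
Proof.
apply: lb_le_inf; first by exists (rr x y); exact: curves_rr.
by move=> _ [c [_ _ cC] <-]; exact: curve_length_ge0.
Qed.

(** The constant curve is the geodesic from x to itself, reparametrised at speed 0. *)
Lemma geodesic_const x : geodesic x x (fun=> x).
Proof.
have [c [c0 c1 g]] := geodesic_exists x x; split=> //.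
have -> : (fun=> x) = (fun s => c (0 * s + 0)).
  by apply/funext => s; rewrite mul0r addr0 c0.
apply: (geo_on_affine (b := 1)) g => t _; rewrite mul0r addr0; exact: z01.
Qed.

Lemma log_self x : Exp_inv x x = 0.
Proof.
rewrite -(log_velocity UG (geodesic_const x)) /velocity; apply: vder_derive1.
exact: vder_cst.
Qed.

Lemma rr_self x : rr x x = 0.
Proof. by rewrite /rr /rsq log_self /ginner mul0mx mul0mx mxE sqrtr0. Qed.

Lemma log_rr0 x y : rr x y = 0 -> Exp_inv x y = 0.
Proof.
move=> r0; apply/eqP; apply: contraT => L0.
have := gm_gt0 (coord_img (chart_atP x)) L0; rewrite -ginnerE.
have := rr_sq x y; rewrite r0 expr0n/= /rsq => <-; by rewrite ltxx.
Qed.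

Lemma rr0_eq x y : rr x y = 0 -> y = x.
Proof.
move=> /log_rr0 L; have [c F c1] := log_Fam UG x y; rewrite L in F.
have [_ F'] := (geodesicP _ _ _).1 (geodesic_const x).
rewrite (log_velocity UG (geodesic_const x)) log_self in F'.
by rewrite -c1; have [] := nbhs_singleton (Fam_same F F' o01).
Qed.

Lemma sub_geodesic x y c s : geodesic x y c -> 0 <= s <= 1 -> geodesic x (c s) (fun t => c (s * t)).
Proof.
move=> [c0 c1 g] /andP[s0 s1].
have -> : (fun t => c (s * t)) = (fun t => c (s * t + 0)) by apply/funext => t; rewrite addr0.
split; [by rewrite mulr0 addr0|by rewrite mulr1 addr0|].
apply: (geo_on_affine (b := 1)) g => t /andP[t0 t1].
by rewrite addr0 mulr_ge0//= mulr_ile1.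
Qed.

Lemma log_sub x y c s : geodesic x y c -> 0 <= s <= 1 -> Exp_inv x (c s) = s *: Exp_inv x y.
Proof.
move=> g s01; rewrite -(log_velocity UG (sub_geodesic g s01)) -(log_velocity UG g).
have [c0 _ gc] := g; have g0 := nbhs_singleton (gc 0 z01).
rewrite /velocity mulr0 c0; set i := chart_at x.
have ic : chart_dom i (c 0) by rewrite c0; exact: chart_atP.
have D : derivable (coord i \o c) (s * 0 + 0) 1.
  by rewrite mulr0 addr0; exact: vder_derivable (geodesic_vder g0 ic).
have E : (fun t => c (s * t)) = (fun t => c (s * t + 0)) by apply/funext => t; rewrite addr0.
have := vder_derive1 (cv_affine D); rewrite -E mulr0 addr0 => ->.
by [].
Qed.

Lemma rr_sub x y c s : geodesic x y c -> 0 <= s <= 1 -> rr x (c s) = s * rr x y.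
Proof.
move=> g s01; rewrite /rr /rsq (log_sub g s01) /ginner -!/(bil _ _ _) bilZl bilZr mulrA -expr2.
by rewrite sqrtrM ?sqr_ge0// sqrtr_sqr ger0_norm//; case/andP: s01.
Qed.

Lemma Exp_log x y c s : geodesic x y c -> 0 <= s <= 1 -> Exp x (s *: Exp_inv x y) = c s.
Proof.
move=> g s01; have gs := sub_geodesic g s01.
have [E F] := (geodesicP _ _ _).1 gs.
rewrite (log_velocity UG gs) (log_sub g s01) in F.
by rewrite (Exp_Fam F) mulr1.
Qed.

Variables (kmin kmax : R).
Hypothesis sec : sectional_in M kmin kmax.

Lemma rr_triangle p x y : okr kmax (rr p x + rr x y) -> rr p y <= rr p x + rr x y.
Proof.
have [c g] := geodesic_exists x y; have [c0 c1 _] := g.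
rewrite -(geodesic_length g) -{1 2}c0 -{1}c1.
exact: (curve_length_ge UG sec (geodesic_around_C1 g)).
Qed.

Lemma okrP (r : R) : 0 <= r -> okr kmax r <-> Num.sqrt (Num.max kmax 0) * r < pi.
Proof.
move=> r0; have m0 : 0 <= Num.max kmax 0 by rewrite le_max lexx orbT.
rewrite /okr -{1}(sqr_sqrtr m0) -exprMn ltr_sqr ?nnegrE ?mulr_ge0 ?sqrtr_ge0//.
exact: pi_ge0.
Qed.

Lemma okr_open (r : R) : 0 <= r -> okr kmax r -> exists2 e, 0 < e & okr kmax (r + e).
Proof.
move=> r0 /(okrP r0) h; set m := Num.sqrt _ in h.
have m0 : 0 <= m := sqrtr_ge0 _.
have m1 : 0 < m + 1 by rewrite ltr_wpDl.
pose e := (pi - m * r) / (m + 1).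
have e0 : 0 < e by rewrite divr_gt0// subr_gt0.
exists e => //; apply/okrP; first by rewrite addr_ge0// ltW.
rewrite -/m mulrDr -ltrBrDl /e mulrCA gtr_pMr ?subr_gt0//.
by rewrite ltr_pdivrMr// mul1r ltrDl.
Qed.

(** [okr] is an open condition, so a curve of nearly minimal length is still short enough for
    [curve_length_ge]. *)
Lemma rr_dist x y : okr kmax (dist x y) -> rr x y = dist x y.
Proof.
move=> ok; apply/eqP; rewrite eq_le dist_le_rr andbT; apply/ler_addgt0Pl => e e0.
have [e' e'0 ok'] := okr_open (dist_ge0 x y) ok.
have m0 : 0 < Num.min e e' by rewrite lt_min e0.
have [|_ [c [c0 c1 cC] <-] L] := inf_adherent m0 (E := [set curve_length c | c in curves x y]).
  by split; [exists (rr x y); exact: curves_rr|exact: curves_lbound].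
have L1 : curve_length c < dist x y + e by apply: lt_le_trans L _; rewrite lerD2l ge_min lexx.
have L2 : curve_length c < dist x y + e' by apply: lt_le_trans L _; rewrite lerD2l ge_min lexx orbT.
have := curve_length_ge UG sec (p := x) cC; rewrite c0 c1 rr_self !add0r => H.
rewrite addrC; apply: le_trans (ltW L1); apply: H.
by apply: okr_le ok'; [exact: curve_length_ge0|exact: ltW].
Qed.

(** The excluded case is rho = 0 with kmax > 0: there [delta] is 0 by division by zero, while [cotk]
    takes its flat value 1. *)
Lemma delta_cotk (rho : R) : 0 < rho \/ kmax <= 0 -> delta kmax rho = cotk (Num.sqrt (Num.max kmax 0) * rho) 1.
Proof.
move=> H; rewrite /delta /cotk; have [k0|k0] := ltP 0 kmax.
  case: H => [r0|]; last by rewrite leNgt k0.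
  rewrite mulf_eq0 (gt_eqF r0) gt_eqF ?sqrtr_gt0//= mulr1 mulrA.
  by rewrite (mulrC rho).
by rewrite sqrtr0 mul0r eqxx invr1.
Qed.

(** Integrate the Hessian bound twice along the side from x to y; a common bound rho for the whole
    side gives a single comparison constant. *)
Lemma hinge p x y c (rho : R) : geodesic x y c -> 0 <= rho -> okr kmax rho ->
  (forall t, 0 <= t <= 1 -> rr p (c t) <= rho) ->
  rr p x ^+ 2 - 2 * ginner x (Exp_inv x p) (Exp_inv x y) + delta kmax rho * rr x y ^+ 2 <= rr p y ^+ 2.
Proof.
move=> g r0 ok H; have [c0 c1 gc] := g.
have [rp|[k0 rz]] : (0 < rho \/ kmax <= 0) \/ (0 < kmax /\ rho = 0).
  have [?|k0] := leP kmax 0; first by left; right.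
  by have [->|rz] := eqVneq rho 0; [right|left; left; rewrite lt0r rz].
- have m0 : 0 <= Num.max kmax 0 by rewrite le_max lexx orbT.
  have K t : 0 <= t <= 1 -> Num.max kmax 0 * rsq p (c t) <= (Num.sqrt (Num.max kmax 0) * rho) ^+ 2.
    move=> /H h; by rewrite exprMn sqr_sqrtr// ler_wpM2l// -rr_sq ler_sqr ?nnegrE ?rr_ge0.
  have := @rsq_second_order _ _ kmin kmax UG sec p c (Num.sqrt (Num.max kmax 0) * rho) _ gc _ _ _ K erefl.
  rewrite c0 c1 (rad'_start UG _ g) -(delta_cotk rp) !rr_sq.
  have -> : speed2 c 0 = rsq x y by rewrite /speed2 (log_velocity UG g) c0.
  rewrite mulrN; apply.
  + by move=> t /H h; rewrite okpE; apply: okr_le ok; [exact: rr_ge0|].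
  + by rewrite mulr_ge0// sqrtr_ge0.
  + exact/okrP.
(* The case left out by [delta_cotk]: the constant is 0, but the triangle is degenerate, as
   [rr p x = 0]. *)
- rewrite rz in H *; rewrite /delta k0 !mul0r addr0.
  have px : rr p x = 0 by apply: le_anti; rewrite rr_ge0 -c0 H.
  have -> : Exp_inv x p = 0 by apply: log_rr0; rewrite rr_sym.
  by rewrite px /ginner mul0mx mul0mx mxE mulr0 expr0n/= subrr sqr_ge0.
Qed.

Lemma rr_sq_derive p x y c : geodesic x y c -> okr kmax (rr p x) ->
  is_derive (0 : R) 1 (fun s => rr p (c s) ^+ 2) (- (2 * ginner x (Exp_inv x p) (Exp_inv x y))).
Proof.
move=> g ok; have [c0 _ gc] := g.
have ok' : okp kmax p (c 0) by rewrite okpE c0.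
have D := rsq_geodesic_derive UG sec (nbhs_singleton (gc 0 z01)) ok' (chart_atP (c 0)).
rewrite (_ : (fun s => _) = (fun s => rsq p (c s))); last by apply/funext => s; rewrite rr_sq.
apply: is_derive_cast D _; rewrite -/(rad' p c 0) (rad'_start UG _ g).
by rewrite mulrN.
Qed.

End uniquely.
End distance.

(** * Proximal point steps *)

Section proximal.
Context {R : realType} (M : riemannian_manifold R).
Local Notation n := (mdim M).
Local Notation V := 'rV[R]_n.
Implicit Types (p x y z u : M) (v w r : V) (c : R -> M) (t s : R).
Variables (kmin kmax L : R).
Hypothesis UG : uniquely_geodesic M.
Hypothesis sec : sectional_in M kmin kmax.
Hypothesis L0 : 0 <= L.
Hypothesis okL : okr kmax L.

Lemma ok_small (r : R) : 0 <= r -> r <= L -> okr kmax r.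
Proof. by move=> r0 rL; exact: okr_le okL. Qed.

(** Up to L the distance is the length of the geodesic; symmetry, the triangle inequality and
    separation are then read off from [rr]. *)
Lemma d_rr x y : dist x y <= L -> rr x y = dist x y.
Proof. by move=> h; apply: (rr_dist UG sec); apply: ok_small h; exact: dist_ge0. Qed.

Lemma d_sym x y : dist x y <= L -> dist y x = dist x y.
Proof.
move=> h; have := dist_le_rr UG y x; rewrite (rr_sym UG) (d_rr h) => h'.
by rewrite -(d_rr (le_trans h' h)) (rr_sym UG) d_rr.
Qed.

Lemma d_tri p x y : dist p x + dist x y <= L -> dist p y <= dist p x + dist x y.
Proof.
move=> h; have hp : dist p x <= L by apply: le_trans h; rewrite lerDl dist_ge0.
have hy : dist x y <= L by apply: le_trans h; rewrite lerDr dist_ge0.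
rewrite -(d_rr hp) -(d_rr hy) in h *; apply: le_trans (dist_le_rr UG p y) _.
apply: (rr_triangle UG sec); apply: ok_small h; by rewrite addr_ge0 ?rr_ge0.
Qed.

Lemma d_self x : dist x x = 0.
Proof. by apply: le_anti; rewrite (dist_ge0 UG) andbT -(rr_self UG x) dist_le_rr. Qed.

Lemma d_eq0 x y : dist x y = 0 -> y = x.
Proof. by move=> h; apply: (rr0_eq UG); rewrite d_rr h. Qed.

Lemma geodesic_near_end u x z c t : geodesic x z c -> 0 <= t <= 1 -> dist u z + dist z x <= L ->
  rr u (c t) <= dist u z + dist z x.
Proof.
move=> g /andP[t0 t1] h; have uz := dist_ge0 UG u z; have zx := dist_ge0 UG z x.
have zL : dist z x <= L by apply: le_trans h; rewrite lerDr.
have uL : dist u z <= L by apply: le_trans h; rewrite lerDl.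
have g' := reverse_geodesic g.
have t1' : 0 <= 1 - t <= 1 by rewrite subr_ge0 t1 gerBl.
have E : rr z (c t) = (1 - t) * dist z x.
  have := rr_sub UG g' t1'; rewrite (d_rr zL) => <-.
  by congr (rr z (c _)); ring.
have le1 : rr u z + rr z (c t) <= dist u z + dist z x.
  by rewrite (d_rr uL) E lerD2l ler_piMl// gerBl.
apply: (le_trans _ le1); apply: (rr_triangle UG sec).
by have le2 := le_trans le1 h; apply: ok_small le2; rewrite addr_ge0 ?rr_ge0.
Qed.

Lemma hinge_d u x z : dist u z + dist z x <= L ->
  dist u x ^+ 2 - 2 * ginner x (Exp_inv x u) (Exp_inv x z) + delta kmax L * dist x z ^+ 2 <= dist u z ^+ 2.
Proof.
move=> h; have [c g] := geodesic_exists UG x z.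
have zL : dist z x <= L by apply: le_trans h; rewrite lerDr (dist_ge0 UG).
have uL : dist u z <= L by apply: le_trans h; rewrite lerDl (dist_ge0 UG).
have ux := le_trans (d_tri h) h.
have := hinge UG sec g L0 okL (p := u); rewrite (d_rr ux) (d_rr uL).
rewrite (rr_sym UG x z) (d_rr zL) (d_sym zL); apply.
by move=> t t01; apply: le_trans (geodesic_near_end g t01 h) h.
Qed.

Lemma ginnerDl x v v' w : ginner x (v + v') w = ginner x v w + ginner x v' w.
Proof. exact: bilDl. Qed.

Lemma ginnerZl x (k : R) v w : ginner x (k *: v) w = k * ginner x v w.
Proof. exact: bilZl. Qed.

Lemma ginner_young x v w (D : R) : 0 < D ->
  - (2 * ginner x v w) <= ginner x v v / D + D * ginner x w w.
Proof.
move=> D0; have := ginner_ge0 x (v + D *: w).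
have -> : ginner x (v + D *: w) (v + D *: w) = ginner x v v + 2 * D * ginner x v w + D ^+ 2 * ginner x w w.
  rewrite ginnerDl ginnerZl !(ginner_sym x _ (v + _)) !ginnerDl !ginnerZl (ginner_sym x w v); ring.
rewrite -subr_ge0 => H; rewrite -subr_ge0 -(pmulr_lge0 _ D0); move: H.
by rewrite subr0; congr (_ <= _); field; exact: lt0r_neq0.
Qed.

(* The hinge inequality in the triangle (x, z, u), with the inexactness [r] of the
   subgradient [v] absorbed by Young's inequality; it holds whatever the sign of
   the comparison constant. *)
Lemma prox_step u x z v r (eta D : R) : dist u z + dist z x <= L -> 0 < D ->
  r = eta *: v - Exp_inv x z ->
  - (2 * eta * ginner x v (Exp_inv x u)) <=
    dist u z ^+ 2 - (1 - D) * dist u x ^+ 2 - delta kmax L * dist x z ^+ 2 + ginner x r r / D.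
Proof.
move=> h D0 rE; have ux := le_trans (d_tri h) h.
have H := hinge_d h.
have Y := ginner_young x r (Exp_inv x u) D0.
have E : eta * ginner x v (Exp_inv x u) = ginner x r (Exp_inv x u) + ginner x (Exp_inv x u) (Exp_inv x z).
  by rewrite -ginnerZl (ginner_sym x _ (Exp_inv x z)) -ginnerDl rE subrK.
have N : ginner x (Exp_inv x u) (Exp_inv x u) = dist u x ^+ 2.
  by rewrite -/(rsq x u) -rr_sq (rr_sym UG) (d_rr ux).
rewrite N in Y; rewrite -mulrA E; move: H Y; clear; move: (ginner _ _ _) (ginner _ _ _) (ginner _ _ _ / D) => *; lra.
Qed.

(** First-order optimality along geodesics: move a fraction s from w towards y, use convexity of h
    and [rr_sq_derive] for the squared distance, and divide by s. *)
Lemma prox_subgrad (S : set M) (h : M -> \bar R) (w : M) z (eta a : R) : 0 < eta ->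
  gconvex_fun S h -> (forall y, S y -> exists2 c, geodesic w y c & forall t, 0 <= t <= 1 -> S (c t)) ->
  (forall y, S y -> h y != -oo%E) -> h w = a%:E -> dist w z <= L ->
  (forall y, (h w + ((2 * eta)^-1 * dist w z ^+ 2)%:E <= h y + ((2 * eta)^-1 * dist y z ^+ 2)%:E)%E) ->
  subdiff S h w (eta^-1 *: Exp_inv w z).
Proof.
move=> eta0 conv segS hno hw wz prox y Sy.
have [c g cS] := segS y Sy; rewrite hw.
case hy : (h y) => [b||]; [|by rewrite leey|by have := hno y Sy; rewrite hy].
rewrite -EFinD lee_fin ginnerZl.
have zw : rr z w = dist w z by rewrite (rr_sym UG) (d_rr wz).
have ok : okr kmax (rr z w) by rewrite zw; apply: ok_small => //; exact: dist_ge0.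
have D := rr_sq_derive UG sec g ok; set m := ginner _ _ _ in D *.
have [c0 _ _] := g.
apply/ler_addgt0Pl => e e0.
have e20 : 0 < 2 * eta * e by rewrite !mulr_gt0.
have [d d0 Hd] := (is_derive_epsP _ _ _).1 D _ e20.
pose s := Num.min d 1 / 2.
have m0 : 0 < Num.min d 1 by rewrite lt_min d0 ltr01.
have s0 : 0 < s by rewrite divr_gt0.
have := half_lt m0; rewrite -/s lt_min => /andP[sd s1].
have s01 : 0 <= s <= 1 by rewrite !ltW.
have := Hd s; rewrite subr0 gtr0_norm// => /(_ sd).
rewrite c0 ler_norml => /andP[_ H1].
have := conv w y c g cS s s01; rewrite hw hy -!EFinM -EFinD => H2.
have := prox (c s); rewrite hw; case hc : (h (c s)) H2 => [q||] // H2.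
rewrite -!EFinD !lee_fin in H2 * => H3.
(* At [c s] the inequality [dist <= rr] already goes in the right direction. *)
have H4 : dist (c s) z ^+ 2 <= rr z (c s) ^+ 2.
  rewrite ler_sqr ?nnegrE ?rr_ge0 ?(dist_ge0 UG)// (rr_sym UG); exact: dist_le_rr.
rewrite -zw in H3.
have H5 : 2 * eta * (a - q) <= rr z (c s) ^+ 2 - rr z w ^+ 2.
  have E2 : 0 < 2 * eta by rewrite mulr_gt0.
  have : (2 * eta)^-1 * rr z w ^+ 2 - (2 * eta)^-1 * dist (c s) z ^+ 2 <= q - a by lra.
  rewrite -mulrBr ler_pdivrMl// => H6; lra.
have H7 : 2 * eta * s * (a - b) <= s * (- (2 * m) + 2 * eta * e).
  have : s * (a - b) <= a - q by lra.
  move=> /(ler_wpM2l (ltW (mulr_gt0 (ltr0Sn R 1) eta0))); lra.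
rewrite mulrAC -[2 * eta * (a - b) * s]mulrC ler_pM2l// in H7.
have : a - b <= - (eta^-1 * m) + e.
  rewrite -(ler_pM2l (mulr_gt0 (ltr0Sn R 1) eta0)); apply: le_trans H7 _.
  rewrite mulrDr mulrN mulrA -[2 * eta / eta]mulrA divff ?gt_eqF// mulr1; lra.
lra.
Qed.

Lemma segment_unique (S : set M) x y c : gconvex_set S -> S x -> S y -> geodesic x y c ->
  forall t, 0 <= t <= 1 -> S (c t).
Proof.
move=> cS Sx Sy g t t01; have [d gd dS] := cS x y Sx Sy.
by have [_ E] := UG x y; rewrite (E c d g gd t t01); exact: dS.
Qed.

Lemma gavgS (z : nat -> M) (T : nat) : (0 < T)%N ->
  gavg z T.+1 = Exp (gavg z T) (T.+1%:R^-1 *: Exp_inv (gavg z T) (z T.+1)).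
Proof. by case: T. Qed.

Lemma gavg_in (S : set M) (z : nat -> M) (T : nat) : gconvex_set S ->
  (forall t : nat, (0 < t <= T)%N -> S (z t)) -> forall t : nat, (0 < t <= T)%N -> S (gavg z t).
Proof.
move=> cS Sz; elim=> // -[_ h1|t IH tT]; first exact: Sz h1.
have Sg : S (gavg z t.+1) by apply: IH; rewrite ltnS leq0n ltnW.
have [c g cin] := cS _ _ Sg (Sz _ tT).
rewrite gavgS// (Exp_log UG g); last first.
  by rewrite invr_ge0 ler0n invf_le1 ?ltr0n// ler1n.
by apply: cin; rewrite invr_ge0 ler0n invf_le1 ?ltr0n// ler1n.
Qed.

Lemma gavg_jensen (S : set M) (h : M -> \bar R) (z : nat -> M) (T : nat) (b : nat -> R) :
  gconvex_set S -> gconvex_fun S h ->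
  (forall t : nat, (0 < t <= T)%N -> S (z t) /\ (h (z t) <= (b t)%:E)%E) ->
  forall t : nat, (0 < t <= T)%N -> (h (gavg z t) <= (t%:R^-1 * \sum_(i < t) b i.+1)%:E)%E.
Proof.
move=> cS ch Sz; elim=> // -[_ tT|t IH tT].
  by rewrite big_ord1 invr1 mul1r; have [] := Sz 1%N tT.
have t1T : (0 < t.+1 <= T)%N by rewrite ltnS leq0n ltnW.
have Sg : S (gavg z t.+1) by apply: (gavg_in (T := T)) t1T => // s /Sz[].
have [Sz' hz'] := Sz _ tT.
have [c g cin] := cS _ _ Sg Sz'.
have s01 : 0 <= (t.+2%:R^-1 : R) <= 1.
  by rewrite invr_ge0 ler0n invf_le1 ?ltr0n// ler1n.
rewrite gavgS// (Exp_log UG g s01).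
apply: le_trans (ch _ _ _ g cin _ s01) _.
set s : R := _^-1 in s01 *; have /andP[s0 s1] := s01.
have s1' : 0 <= 1 - s by rewrite subr_ge0.
apply: le_trans (leeD (lee_wpmul2l _ (IH t1T)) (lee_wpmul2l _ hz')) _; rewrite ?lee_fin//.
rewrite [in leRHS]big_ord_recr/= mulrDr lerD2r.
rewrite mulrA le_eqVlt; apply/orP; left; apply/eqP; congr (_ * _).
rewrite /s; have t1 : t.+1%:R != 0 :> R by rewrite pnatr_eq0.
have t2 : t.+2%:R != 0 :> R by rewrite pnatr_eq0.
have -> : t.+2%:R = t.+1%:R + 1 :> R by rewrite -natr1.
have G (x : R) : x != 0 -> x + 1 != 0 -> (1 - (x + 1)^-1) / x = (x + 1)^-1.
  by move=> x0 x1; field; rewrite ?x0 ?x1.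
by apply: G => //; rewrite natr1.
Qed.

End proximal.

(** * Scalar recursions and constants *)

Section recursions.
Context {R : realType}.
Implicit Types (d e g : nat -> R) (K rho a : R) (T t : nat).

Lemma inv_sq_telescope t : ((t.+2%:R ^+ 2)^-1 : R) <= t.+1%:R^-1 - t.+2%:R^-1.
Proof.
have G (x : R) : 0 < x -> ((x + 1) ^+ 2)^-1 <= x^-1 - (x + 1)^-1.
  move=> x0; have x1 : 0 < x + 1 by rewrite addr_gt0.
  have -> : x^-1 - (x + 1)^-1 = (x * (x + 1))^-1 by field; rewrite !lt0r_neq0.
  by rewrite lef_pV2 ?posrE ?mulr_gt0 ?exprn_gt0// expr2 ler_wpM2r ?(ltW x1)// lerDl.
by rewrite -(natr1 t.+1); exact: G.
Qed.

(** The factors 1 - 1/(s + 1)^2 for s = 1, ..., t multiply to (t + 2) / (2 (t + 1)), which stays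
    above 1/2: hence a factor 2 on squared distances, and the radius sqrt 2 R. *)
Lemma inexact_bound d rho T : 0 <= rho -> d 0%N <= rho ->
  (forall t, (t < T)%N -> d t <= 2 * rho -> (1 - (t.+2%:R ^+ 2)^-1) * d t.+1 <= d t) ->
  forall t, (t <= T)%N -> d t <= 2 * rho.
Proof.
move=> r0 d0 step.
have pos t : 0 < t.+1%:R :> R by [].
have le2 t : 2 * t.+1%:R / t.+2%:R * rho <= 2 * rho.
  rewrite ler_wpM2r// ler_pdivrMr ?pos// ler_wpM2l// ler_nat; exact: leqnSn.
suff H t : (t <= T)%N -> d t <= 2 * t.+1%:R / t.+2%:R * rho.
  by move=> t tT; apply: le_trans (H t tT) (le2 t).
elim: t => [_|t IH tT]; first by rewrite mulr1 divff ?mul1r.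
have dt := IH (ltnW tT); have := step t tT (le_trans dt (le2 t)) => /le_trans/(_ dt).
have G (x : R) : 0 < x -> 1 - ((x + 1) ^+ 2)^-1 = x * (x + 2) / (x + 1) ^+ 2.
  by move=> x0; field; rewrite lt0r_neq0// addr_gt0.
have E1 : t.+2%:R = t.+1%:R + 1 :> R by rewrite natr1.
have E2 : t.+3%:R = t.+1%:R + 2 :> R by rewrite -addn2 natrD.
rewrite E2 E1 G//; move: (t.+1%:R) (pos t) => x x0.
have x1 : 0 < x + 1 by rewrite addr_gt0.
have x2 : 0 < x + 2 by rewrite addr_gt0.
have P : 0 < x * (x + 2) / (x + 1) ^+ 2 by rewrite !mulr_gt0// invr_gt0 exprn_gt0.
move=> H; rewrite -(ler_pM2l P); apply: le_trans H _.
rewrite le_eqVlt; apply/orP; left; apply/eqP; field; by rewrite !lt0r_neq0.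
Qed.

(** The error terms are at most K (1/(t + 1) - 1/(t + 2)), so together they cost at most K. *)
Lemma inexact_sum g e K T : 0 <= K -> (forall t, 0 <= e t) ->
  (forall t, (t < T)%N -> e t.+1 <= K) ->
  (forall t, (t < T)%N -> g t <= e t - (1 - (t.+2%:R ^+ 2)^-1) * e t.+1) ->
  \sum_(t < T) g t <= e 0%N + K.
Proof.
move=> K0 e0 eK H.
suff S t : (t <= T)%N -> \sum_(s < t) g s <= e 0%N - e t + K * (1 - t.+1%:R^-1).
  apply: le_trans (S T (leqnn T)) _; rewrite lerD ?gerBl ?ler_piMr// gerBl invr_ge0 ler0n.
elim: t => [_|t IH tT]; first by rewrite big_ord0 subrr add0r invr1 subrr mulr0.
rewrite big_ord_recr/=; have := IH (ltnW tT); have := H t tT.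
have D : (t.+2%:R ^+ 2)^-1 * e t.+1 <= K * (t.+1%:R^-1 - t.+2%:R^-1).
  rewrite mulrC ler_pM ?eK ?inv_sq_telescope// invr_ge0 sqr_ge0.
move: D; move: (\sum_(i < t) _) ((t.+2%:R ^+ 2)^-1) (t.+2%:R^-1) (t.+1%:R^-1) => *; lra.
Qed.

Lemma linear_rate d a eps T : 0 < a -> 0 < eps -> (forall t, 0 <= d t) ->
  (forall t, (t < T)%N -> d t.+1 <= (1 + a)^-1 * d t) ->
  (1 + a^-1) * ln (d 0%N / eps) <= T%:R -> d T <= eps.
Proof.
move=> a0 e0 d0 H HT.
have a1 : 0 < 1 + a by rewrite addr_gt0.
have S t : (t <= T)%N -> d t <= (1 + a)^-1 ^+ t * d 0%N.
  elim: t => [_|t IH tT]; first by rewrite expr0 mul1r.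
  apply: le_trans (H t tT) _; rewrite exprS -mulrA ler_wpM2l ?invr_ge0 ?(ltW a1)//.
  exact: IH (ltnW tT).
have q1 : (1 + a)^-1 <= 1 by rewrite invf_le1// lerDl ltW.
have [small|big] := leP (d 0%N) eps.
  apply: le_trans (S T (leqnn T)) _; apply: le_trans small.
  by rewrite ler_piMl// exprn_ile1// invr_ge0 ltW.
have dp : 0 < d 0%N by exact: lt_trans big.
apply: le_trans (S T (leqnn T)) _.
(* 1/(1 + a) = 1 - 1/(1 + 1/a), and 1 + x <= exp x. *)
have q : (1 + a)^-1 <= expR (- (1 + a^-1)^-1).
  apply: le_trans (expR_ge1Dx _).
  have an0 := lt0r_neq0 a0; have a1n0 := lt0r_neq0 a1.
  have -> : 1 + a^-1 = (1 + a) / a by rewrite mulrDl mul1r divff// addrC.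
  rewrite invf_div le_eqVlt; apply/orP; left; apply/eqP; field; exact: a1n0.
have q0 : 0 <= (1 + a)^-1 by rewrite invr_ge0 ltW.
have : (1 + a)^-1 ^+ T <= expR (- ln (d 0%N / eps)).
  apply: le_trans (lerXn2r T q0 (ltW (expR_gt0 _)) q) _.
  rewrite -expRM_natl ler_expR mulrN lerN2.
  have ai : 0 < 1 + a^-1 by rewrite addr_gt0// invr_gt0.
  by rewrite ler_pdivlMr// mulrC.
rewrite expRN lnK ?posrE ?divr_gt0// invf_div => /(ler_wpM2r (ltW dp)) h.
by apply: le_trans h _; rewrite divfK ?lt0r_neq0.
Qed.

Lemma sqrt2_ball (x r : R) : 0 <= x -> 0 <= r -> (x <= Num.sqrt 2 * r) = (x ^+ 2 <= 2 * r ^+ 2).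
Proof.
move=> x0 r0; have s0 : 0 <= Num.sqrt 2 * r by rewrite mulr_ge0 ?sqrtr_ge0.
by rewrite -(ler_sqr x0 s0) exprMn sqr_sqrtr.
Qed.

(** 3/2 replaces sqrt 2, so that the bookkeeping of distances is linear arithmetic over the
    rationals. *)
Lemma sq_le2 (x r : R) : 0 <= r -> x ^+ 2 <= 2 * r ^+ 2 -> x <= 3 / 2 * r.
Proof.
move=> r0 h; have [x0|/ltW x0] := leP 0 x; last by apply: le_trans x0 _; rewrite mulr_ge0.
rewrite -ler_sqr ?nnegrE ?mulr_ge0//; apply: le_trans h _.
rewrite exprMn ler_wpM2r ?sqr_ge0//; lra.
Qed.

Lemma half_of_sq (x y : R) : 0 <= y -> x ^+ 2 <= 4^-1 * y ^+ 2 -> x <= y / 2.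
Proof.
move=> y0 h; have [x0|/ltW x0] := leP 0 x; last by apply: le_trans x0 _; rewrite divr_ge0.
rewrite -ler_sqr ?nnegrE ?divr_ge0//; apply: le_trans h _.
by rewrite expr_div_n; lra.
Qed.

End recursions.

Section arith.
Context {R : realType}.

(** The cross term is absorbed by (q - r)^2 >= 0, which leaves 3/2 of q^2; p will be the distance of
    the inexact iterate and r that of the exact proximal point. *)
Lemma sq_sum_le (p q r rad : R) : p ^+ 2 <= (q / 2 + r) ^+ 2 -> 2 * r ^+ 2 <= q ^+ 2 -> q ^+ 2 <= rad ^+ 2 ->
  p ^+ 2 <= 2 * rad ^+ 2.
Proof. by move=> h1 h2 h3; have := sqr_ge0 (q - r); have := sqr_ge0 rad; lra. Qed.

Lemma sum_affine (b : nat -> R) (k c : R) (T : nat) :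
  \sum_(t < T) k * (b t.+1 - c) = k * (\sum_(t < T) b t.+1 - T%:R * c).
Proof.
rewrite -mulr_sumr; congr (_ * _); rewrite sumrB; congr (_ - _).
by rewrite sumr_const card_ord mulr_natl.
Qed.

End arith.

Section step.
Context {R : realType} (M : riemannian_manifold R).
Local Notation n := (mdim M).
Local Notation V := 'rV[R]_n.
Implicit Types (p x y z u : M) (v w r : V) (c : R -> M).
Variables (kmin kmax L : R).
Hypothesis UG : uniquely_geodesic M.
Hypothesis sec : sectional_in M kmin kmax.
Hypothesis L0 : 0 <= L.
Hypothesis okL : okr kmax L.

Lemma step_distances zs z zp z' (a b e : R) : dist z zs <= a -> dist zp z <= b -> dist z' zp <= e ->
  a + b + e <= L ->
  [/\ dist zs z <= a, dist z z' <= b + e, dist z' z <= b + e, dist z' zs <= a + b + e & dist zs z' <= a + b + e].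
Proof.
move=> ha hb he H.
have a0 := le_trans (dist_ge0 UG _ _) ha; have b0 := le_trans (dist_ge0 UG _ _) hb.
have e0 := le_trans (dist_ge0 UG _ _) he.
have aL : a <= L by lra.
have bL : b <= L by lra.
have eL : e <= L by lra.
have beL : b + e <= L by lra.
have sa : dist zs z <= a by rewrite (d_sym UG sec okL (le_trans ha aL)).
have z'z : dist z' z <= b + e.
  have h : dist z' zp + dist zp z <= b + e by rewrite addrC lerD.
  by apply: le_trans (d_tri UG sec okL (le_trans h beL)) h.
have zz' : dist z z' <= b + e by rewrite (d_sym UG sec okL (le_trans z'z beL)).
have z'zs : dist z' zs <= a + b + e.
  have h : dist z' z + dist z zs <= a + b + e by rewrite -addrA addrC lerD.
  by apply: le_trans (d_tri UG sec okL (le_trans h H)) h.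
by split=> //; rewrite (d_sym UG sec okL (le_trans z'zs H)).
Qed.

End step.

(** * One step of the algorithm for minimization *)

Section minimization.
Context {R : realType} (M : riemannian_manifold R).
Local Notation n := (mdim M).
Local Notation V := 'rV[R]_n.
Implicit Types (p x y z u : M) (v w r : V) (c : R -> M).
Variables (kmin kmax rad : R).
Hypothesis UG : uniquely_geodesic M.
Hypothesis sec : sectional_in M kmin kmax.
Hypothesis r0 : 0 <= rad.
Hypothesis okL : okr kmax (5 * rad).
Variables (f : M -> \bar R) (zs : M).
Local Notation X := (cball zs (5 * rad)).
Local Notation B := (cball zs (Num.sqrt 2 * rad)).
Hypothesis GX : Gamma X f.
Hypothesis minf : minimizer f zs.

Let L0 : 0 <= 5 * rad. Proof. exact: mulr_ge0. Qed.

Lemma X_zs : X zs.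
Proof. by rewrite /cball/= (d_self UG). Qed.

Lemma f_zs : exists fs, f zs = fs%:E.
Proof.
have [_ fno [[_ [x _ fx]] _ _]] := GX.
have := minf x; have := fno zs; case E : (f zs) => [fs||] // _; first by exists fs.
by rewrite leye_eq => /eqP E'; rewrite E' in fx.
Qed.

(** Test the minimality of zp against [zs]: f is no larger there, so zp must be at least as close to
    z as [zs] is. *)
Lemma prox_near (eta : R) z zp : 0 < eta -> is_prox eta f z zp ->
  (exists a, f zp = a%:E) /\ dist zp z <= dist zs z.
Proof.
move=> eta0 prox; have [fs E] := f_zs; have [_ fno _] := GX.
have := prox zs; have := minf zp; have := fno zp; rewrite E.
case: (f zp) => [a||] //= _; rewrite -!EFinD !lee_fin => h1 h2; split; first by exists a.
have q : 0 < (2 * eta)^-1 by rewrite invr_gt0 mulr_gt0.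
rewrite -ler_sqr ?nnegrE ?(dist_ge0 UG)// -(ler_pM2l q); lra.
Qed.

(** In multiples of rad, 3/2 + 3/2 + 3/4 = 15/4, which is below 5: the next iterate is in X. *)
Lemma iterate_distances (eta : R) z zp z' : 0 < eta -> dist z zs ^+ 2 <= 2 * rad ^+ 2 -> is_prox eta f z zp ->
  dist z' zp ^+ 2 <= 4^-1 * dist z zp ^+ 2 ->
  [/\ dist z zs <= 3 / 2 * rad, dist zp z <= dist z zs, dist z' zp <= dist zp z / 2 & X z'].
Proof.
move=> eta0 d2 prox dz'.
have zd := sq_le2 r0 d2.
have zL : dist z zs <= 5 * rad by apply: le_trans zd _; rewrite ler_wpM2r//; lra.
have [_ zpz] := prox_near eta0 prox; rewrite (d_sym UG sec okL zL) in zpz.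
have e : dist z' zp <= dist z zp / 2 by apply: half_of_sq dz'; exact: dist_ge0.
have zpL := le_trans zpz zL; rewrite (d_sym UG sec okL zpL) in e.
have dz0 := dist_ge0 UG zp z.
have sm : dist z zs + dist z zs + dist zp z / 2 <= 5 * rad by lra.
have [_ _ _ h _] := step_distances UG sec okL (lexx (dist z zs)) zpz e sm.
split=> //; rewrite /cball/=; lra.
Qed.

(* [m] is the gain of strong convexity, if any. *)
Lemma min_step (eta D m : R) z zp z' v fs : 0 < eta -> 0 < D -> f zs = fs%:E ->
  dist z zs ^+ 2 <= 2 * rad ^+ 2 -> is_prox eta f z zp ->
  dist z' zp ^+ 2 <= 4^-1 * dist z zp ^+ 2 ->
  ginner z' (eta *: v - Exp_inv z' z) (eta *: v - Exp_inv z' z)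
    <= D * delta kmax (5 * rad) * dist z' z ^+ 2 ->
  (f z' + (ginner z' v (Exp_inv z' zs) + m)%:E <= f zs)%E ->
  exists a, [/\ f z' = a%:E, fs <= a &
    2 * eta * (a - fs) <= dist z zs ^+ 2 - (1 - D) * dist z' zs ^+ 2 - 2 * eta * m].
Proof.
move=> eta0 D0 fsE d2 prox dz' dr sub.
have [zd zpz e Xz'] := iterate_distances eta0 d2 prox dz'.
have dz0 := dist_ge0 UG zp z.
have sm : dist z zs + dist z zs + dist zp z / 2 <= 5 * rad by lra.
have [h1 h2 h3 h4 h5] := step_distances UG sec okL (lexx (dist z zs)) zpz e sm.
have sm2 : dist zs z + dist z z' <= 5 * rad by lra.
have P := prox_step UG sec L0 okL sm2 D0 (erefl (eta *: v - Exp_inv z' z)).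
have zL : dist z zs <= 5 * rad by lra.
rewrite (d_sym UG sec okL zL) (d_sym UG sec okL Xz') in P.
have dr' : ginner z' (eta *: v - Exp_inv z' z) (eta *: v - Exp_inv z' z) / D <= delta kmax (5 * rad) * dist z' z ^+ 2.
  by rewrite ler_pdivrMr// mulrC mulrA.
have := minf z'; have [_ fno _] := GX; have := fno z'; move: sub; rewrite fsE.
case: (f z') => [a||] //=; rewrite -EFinD !lee_fin => H _ afs; exists a; split=> //.
have : 2 * eta * (a + (ginner z' v (Exp_inv z' zs) + m)) <= 2 * eta * fs by rewrite ler_wpM2l// mulr_ge0 ?(ltW eta0).
move: P dr'; clear; move: (ginner _ _ _ / D) (ginner _ _ _) (delta _ _ * _) => *; lra.
Qed.

Lemma subdiff_zs z' v : subdiff X f z' v -> (f z' + (ginner z' v (Exp_inv z' zs) + 0)%:E <= f zs)%E.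
Proof. by move=> /(_ zs X_zs); rewrite addr0. Qed.

Lemma mul_inv_eta (eta k : R) z v w : 0 < eta -> ginner z (eta^-1 *: v) w <= k -> ginner z v w <= eta * k.
Proof. by move=> eta0; rewrite ginnerZl ler_pdivrMl. Qed.

(** Strong convexity is assumed in B only, so z' has to be located first. If eta mu <= 1, the step
    without strong convexity loses at most a factor 2 on the squared distance. Otherwise the exact
    proximal point halves it, and z' is within half of [dist z zs] of that point. *)
Lemma strong_ball (eta mu : R) z zp z' v : 0 < eta -> 0 < mu -> strongly_gconvex mu X B f ->
  dist z zs ^+ 2 <= rad ^+ 2 -> is_prox eta f z zp ->
  dist z' zp ^+ 2 <= 4^-1 * dist z zp ^+ 2 -> subdiff X f z' v ->
  ginner z' (eta *: v - Exp_inv z' z) (eta *: v - Exp_inv z' z)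
    <= eta * mu / 2 * delta kmax (5 * rad) * dist z' z ^+ 2 -> B z'.
Proof.
move=> eta0 mu0 str d2 prox dz' sv dr.
have d22 : dist z zs ^+ 2 <= 2 * rad ^+ 2 by have := sqr_ge0 rad; lra.
have em0 : 0 < eta * mu / 2 by rewrite !mulr_gt0 ?invr_gt0.
have [fs fsE] := f_zs.
rewrite /cball/= sqrt2_ball ?(dist_ge0 UG)//.
have [small|big] := leP (eta * mu / 2) (1 / 2).
  have [a [_ afs H]] := min_step eta0 em0 fsE d22 prox dz' dr (subdiff_zs sv).
  have : 0 <= 2 * eta * (a - fs) by rewrite !mulr_ge0 ?(ltW eta0)// subr_ge0.
  have : (1 / 2) * dist z' zs ^+ 2 <= (1 - eta * mu / 2) * dist z' zs ^+ 2.
    by rewrite ler_wpM2r ?sqr_ge0//; lra.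
  lra.
have [zd zpz e Xz'] := iterate_distances eta0 d22 prox dz'.
have dzp := dist_ge0 UG zp z.
(* A negative comparison constant makes the bound on the residual nonpositive, which forces z' =
   z. *)
have [dneg|dpos] := ltP (delta kmax (5 * rad)) 0.
  have : 0 <= eta * mu / 2 * delta kmax (5 * rad) * dist z' z ^+ 2 by apply: le_trans dr; exact: ginner_ge0.
  rewrite nmulr_rge0 ?pmulr_rlt0// => sq0.
  have /d_eq0 E : dist z' z = 0.
    by apply/eqP; rewrite -sqrf_eq0; apply/eqP/le_anti; rewrite sq0 sqr_ge0.
  by rewrite -(E _ _ _ UG sec L0 okL).
have zpL : dist zp z <= 5 * rad by lra.
have zL : dist z zs <= 5 * rad by lra.
have tri : dist zp z + dist z zs <= 5 * rad by lra.
have Xzp : X zp by apply: le_trans (d_tri UG sec okL tri) tri.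
have [[a aE] _] := prox_near eta0 prox.
have [cX fno [_ _ conv]] := GX.
have sub : subdiff X f zp (eta^-1 *: Exp_inv zp z).
  apply: (prox_subgrad UG sec okL eta0 conv _ _ aE zpL).
  - by move=> y Xy; exact: cX.
  - by move=> y _.
  - by move=> y; exact: prox.
have afs : fs <= a by have := minf zp; rewrite fsE aE lee_fin.
have tri2 : dist zs z + dist z zp <= 5 * rad.
  by rewrite (d_sym UG sec okL zL) (d_sym UG sec okL zpL); lra.
have H := hinge_d UG sec L0 okL tri2.
rewrite (d_sym UG sec okL Xzp) (d_sym UG sec okL zL) (ginner_sym zp) in H.
have db : 0 <= delta kmax (5 * rad) * dist zp z ^+ 2 by rewrite mulr_ge0 ?sqr_ge0.
(* Plain convexity comes first: it puts zp in B, where strong convexity may then be applied. *)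
have g0 : ginner zp (Exp_inv zp z) (Exp_inv zp zs) <= eta * 0.
  apply: mul_inv_eta => //; have := sub zs X_zs; rewrite aE fsE -EFinD lee_fin; lra.
rewrite mulr0 in g0.
have Bzp : B zp.
  by rewrite /cball/= sqrt2_ball ?(dist_ge0 UG)//; have := sqr_ge0 rad; lra.
have Bzs : B zs by rewrite /cball/= (d_self UG) mulr_ge0// sqrtr_ge0.
have g1 : ginner zp (Exp_inv zp z) (Exp_inv zp zs) <= eta * (- (mu / 2 * dist zp zs ^+ 2)).
  apply: mul_inv_eta => //; have := str zp zs _ Bzp Bzs sub; rewrite aE fsE -EFinD lee_fin; lra.
have em1 : dist zp zs ^+ 2 <= eta * mu * dist zp zs ^+ 2.
  by rewrite ler_peMl ?sqr_ge0//; lra.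
have half : 2 * dist zp zs ^+ 2 <= dist z zs ^+ 2 by lra.
have tri3 : dist z' zp + dist zp zs <= 5 * rad.
  have := d_tri UG sec okL tri; lra.
have le1 := d_tri UG sec okL tri3.
have D1 := dist_ge0 UG z' zs; have D2 := dist_ge0 UG zp zs; have D3 := dist_ge0 UG z zs.
have le2 : dist z' zs ^+ 2 <= (dist z zs / 2 + dist zp zs) ^+ 2.
  by rewrite ler_sqr ?nnegrE//; lra.
exact: (sq_sum_le le2 half d2).
Qed.

End minimization.

Section minimization_theorem.
Context {R : realType}.

(** [linear_rate] with a = eta mu / 2 asks for the factor 1 + 2 / (eta mu), which 50 dominates once
    the logarithm is nonnegative. *)
Lemma rate_conclusion (d : nat -> R) (eta mu rho eps : R) (T : nat) : 0 < eta -> 0 < mu -> 0 < eps ->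
  d 0%N = rho -> (forall t, 0 <= d t) ->
  (forall t, (t < T)%N -> d t.+1 <= (1 + eta * mu / 2)^-1 * d t) ->
  50 * ((1 + (mu * eta)^-1) * ln (rho / eps)) <= T%:R -> d T <= eps.
Proof.
move=> eta0 mu0 eps0 dE d0 rate HT.
have em0 : 0 < eta * mu by rewrite mulr_gt0.
have a0 : 0 < eta * mu / 2 by rewrite divr_gt0.
(* Here the logarithm may be negative and the hypothesis on T carries no information, but the
   distances are nonincreasing. *)
have small_case : rho <= eps -> d T <= eps.
  move=> h; apply: le_trans h; rewrite -dE.
  have S t : (t <= T)%N -> d t <= d 0%N.
    elim: t => // t IH tT; apply: le_trans (IH (ltnW tT)); apply: le_trans (rate t tT) _.
    rewrite ler_piMl// invf_le1 ?lerDl ?(ltW a0)//; exact: addr_gt0.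
  exact: S.
have [/small_case//|big] := leP rho eps.
apply: (linear_rate a0 eps0 d0 rate); apply: le_trans HT; rewrite dE mulrA ler_wpM2r//.
  by rewrite ln_ge0// ler_pdivlMr// mul1r ltW.
rewrite invf_div (mulrC mu) mulrDr mulr1 lerD ?ler1n// ler_wpM2r ?invr_ge0 ?(ltW em0)//.
by rewrite ler_nat.
Qed.

Lemma ok_rad (kmax rad : R) : 0 <= rad -> (0 < kmax -> 5 * rad * Num.sqrt kmax < pi) -> okr kmax (5 * rad).
Proof.
move=> r0 H; apply/okrP; first exact: mulr_ge0.
have [k0|k0] := ltP 0 kmax; last by rewrite sqrtr0 mul0r pi_gt0.
by rewrite mulrC H.
Qed.

Lemma rippa_minimization (M : riemannian_manifold R) (kmin kmax eta : R)
    (f : M -> \bar R) (zs : M) (z : nat -> M) (T : nat) :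
  let rad := dist (z 0%N) zs in
  let X := cball zs (5 * rad) in
  let B := cball zs (Num.sqrt 2 * rad) in
  uniquely_geodesic M -> sectional_in M kmin kmax ->
  (0 < kmax -> 5 * rad * Num.sqrt kmax < pi) ->
  0 < eta -> minimizer f zs -> Gamma X f ->
  (rippa X f kmax rad eta 0 T z ->
    (forall t, (t <= T)%N -> B (z t)) /\
    (forall eps, 0 < eps -> (0 < T)%N ->
      50 * (rad ^+ 2 / (eta * eps)) <= T%:R ->
      eps_minimizer f zs eps (gavg z T))) /\
  (forall mu, 0 < mu -> strongly_gconvex mu X B f ->
    rippa X f kmax rad eta mu T z ->
    [/\ forall t, (t <= T)%N -> B (z t),
        forall t, (t < T)%N ->
          dist (z t.+1) zs ^+ 2
            <= (1 + eta * mu / 2)^-1 * dist (z t) zs ^+ 2 &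
        forall eps_d, 0 < eps_d ->
          50 * ((1 + (mu * eta)^-1) * ln (rad ^+ 2 / eps_d)) <= T%:R ->
          dist (z T) zs ^+ 2 <= eps_d]).
Proof.
move=> rad X B UG sec hk eta0 minf GX.
have r0 : 0 <= rad := dist_ge0 UG _ _.
have okL := ok_rad r0 hk.
have [fs fsE] := f_zs GX minf.
split.
  move=> rip.
  have D0 t : 0 < (t.+2%:R ^+ 2)^-1 :> R by rewrite invr_gt0 exprn_gt0.
  have step t : (t < T)%N -> dist (z t) zs ^+ 2 <= 2 * rad ^+ 2 -> X (z t.+1) /\ exists a, [/\ f (z t.+1) = a%:E, fs <= a &
      2 * eta * (a - fs) <= dist (z t) zs ^+ 2 - (1 - (t.+2%:R ^+ 2)^-1) * dist (z t.+1) zs ^+ 2 - 2 * eta * 0].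
    move=> tT dt; have [zp [v [prox dz' sv]]] := rip t tT.
    rewrite /Delta eqxx => dr.
    have [_ _ _ Xz] := iterate_distances UG sec r0 okL GX minf eta0 dt prox dz'.
    split; first exact: Xz.
    exact: (min_step UG sec r0 okL GX minf eta0 (D0 t) fsE dt prox dz' dr (subdiff_zs UG r0 sv)).
  have bound : forall t, (t <= T)%N -> dist (z t) zs ^+ 2 <= 2 * rad ^+ 2.
    apply: (inexact_bound (d := fun t => dist (z t) zs ^+ 2)) => [||t tT dt]; [exact: sqr_ge0|exact: lexx|].
    have [_ [a [_ afs H]]] := step t tT dt.
    have h : 0 <= 2 * eta * (a - fs) by rewrite !mulr_ge0 ?(ltW eta0)// subr_ge0.
    by rewrite mulr0 subr0 in H; rewrite -subr_ge0; exact: le_trans h H.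
  split.
    by move=> t tT; rewrite /B/cball/= sqrt2_ball ?(dist_ge0 UG)//; exact: bound.
  move=> eps eps0 T0 HT.
  pose b t := fine (f (z t)).
  have S := inexact_sum (g := fun t => 2 * eta * (b t.+1 - fs)) (e := fun t => dist (z t) zs ^+ 2)
    (K := 2 * rad ^+ 2) (T := T).
  (* All squared distances are at most 2 rad^2, so inexactness costs 2 rad^2 on top of the initial
     rad^2. *)
  have {S} S : \sum_(t < T) 2 * eta * (b t.+1 - fs) <= rad ^+ 2 + 2 * rad ^+ 2.
    apply: S => [|t|t tT|t tT].
    - by rewrite mulr_ge0// sqr_ge0.
    - exact: sqr_ge0.
    - exact: bound.
    - have [_ [a [aE _]]] := step t tT (bound t (ltnW tT)).
      by rewrite /b aE /= mulr0 subr0.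
  have [cX _ [_ _ conv]] := GX.
  have TT : (0 < T <= T)%N by rewrite T0 leqnn.
  have J : (f (gavg z T) <= (T%:R^-1 * \sum_(t < T) b t.+1)%:E)%E.
    apply: (gavg_jensen UG (T := T) (b := b) cX conv _ TT) => [[//|t] tT].
    have [Xz [a [aE _ _]]] := step t tT (bound t (ltnW tT)).
    by split; [exact: Xz|rewrite /b aE].
  rewrite /eps_minimizer fsE leeBlDr// -EFinD; apply: le_trans J _; rewrite lee_fin.
  have Tp : 0 < T%:R :> R by rewrite ltr0n.
  rewrite mulrC ler_pdivrMr//.
  have E : \sum_(t < T) 2 * eta * (b t.+1 - fs) = 2 * eta * (\sum_(t < T) b t.+1 - T%:R * fs).
    exact: sum_affine.
  rewrite E in S.
  have HT' : 50 * rad ^+ 2 <= T%:R * (eta * eps).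
    by move: HT; rewrite mulrA ler_pdivrMr ?mulr_gt0.
  have h : 2 * eta * (\sum_(t < T) b t.+1 - T%:R * fs) <= 2 * eta * (eps * T%:R).
    have := sqr_ge0 rad; lra.
  rewrite ler_pM2l ?mulr_gt0// in h; lra.
move=> mu mu0 str rip.
have em0 : 0 < eta * mu / 2 by rewrite !mulr_gt0 ?invr_gt0.
have contr t : (t < T)%N -> dist (z t) zs ^+ 2 <= rad ^+ 2 ->
    B (z t.+1) /\ (1 + eta * mu / 2) * dist (z t.+1) zs ^+ 2 <= dist (z t) zs ^+ 2.
  move=> tT dt; have [zp [v [prox dz' sv]]] := rip t tT.
  rewrite /Delta gt_eqF// => dr.
  have Bz := strong_ball UG sec r0 okL GX minf eta0 mu0 str dt prox dz' sv dr.
  split; first exact: Bz.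
  have Bzs : B zs by rewrite /B/cball/= (d_self UG) mulr_ge0// sqrtr_ge0.
  have dt2 : dist (z t) zs ^+ 2 <= 2 * rad ^+ 2 by have := sqr_ge0 rad; lra.
  have [a [_ afs H]] := min_step UG sec r0 okL GX minf eta0 em0 fsE dt2 prox dz' dr (str _ _ _ Bz Bzs sv).
  have : 0 <= 2 * eta * (a - fs) by rewrite !mulr_ge0 ?(ltW eta0)// subr_ge0.
  lra.
have a1 : 0 < 1 + eta * mu / 2 by rewrite addr_gt0.
have inrad t : (t <= T)%N -> dist (z t) zs ^+ 2 <= rad ^+ 2.
  elim: t => [_|t IH tT]; first exact: lexx.
  have [_ H] := contr t tT (IH (ltnW tT)); apply: le_trans (IH (ltnW tT)); apply: le_trans H.
  by rewrite ler_peMl ?sqr_ge0// lerDl ltW.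
have rate t : (t < T)%N -> dist (z t.+1) zs ^+ 2 <= (1 + eta * mu / 2)^-1 * dist (z t) zs ^+ 2.
  move=> tT; rewrite mulrC ler_pdivlMr// mulrC.
  by have [_] := contr t tT (inrad t (ltnW tT)).
split=> [t tT|//|eps eps0 HT].
  rewrite /B/cball/= sqrt2_ball ?(dist_ge0 UG)//; have := inrad t tT; have := sqr_ge0 rad; lra.
exact: (rate_conclusion (d := fun t => dist (z t) zs ^+ 2) eta0 mu0 eps0 erefl (fun=> sqr_ge0 _) rate HT).
Qed.

End minimization_theorem.

Section plane.
Context {R : realType}.

Lemma minkowski2 (p1 p2 q1 q2 r1 r2 : R) : 0 <= p1 -> 0 <= p2 -> p1 <= q1 + r1 -> p2 <= q2 + r2 ->
  Num.sqrt (p1 ^+ 2 + p2 ^+ 2) <= Num.sqrt (q1 ^+ 2 + q2 ^+ 2) + Num.sqrt (r1 ^+ 2 + r2 ^+ 2).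
Proof.
move=> p10 p20 h1 h2.
have sq (x y : R) : 0 <= x ^+ 2 + y ^+ 2 by rewrite addr_ge0 ?sqr_ge0.
set A := Num.sqrt (q1 ^+ 2 + _); set B := Num.sqrt (r1 ^+ 2 + _).
have A0 : 0 <= A by exact: sqrtr_ge0.
have B0 : 0 <= B by exact: sqrtr_ge0.
have A2 : A ^+ 2 = q1 ^+ 2 + q2 ^+ 2 by rewrite sqr_sqrtr.
have B2 : B ^+ 2 = r1 ^+ 2 + r2 ^+ 2 by rewrite sqr_sqrtr.
rewrite -(@ger0_norm _ (A + B)) ?addr_ge0// -sqrtr_sqr ler_wsqrtr//.
have CS : q1 * r1 + q2 * r2 <= A * B.
  apply: le_trans (ler_norm _) _; rewrite -(@ger0_norm _ (A * B)) ?mulr_ge0//.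
  rewrite -ler_sqr ?nnegrE// !real_normK ?num_real// exprMn A2 B2.
  have := sqr_ge0 (q1 * r2 - q2 * r1); lra.
have s1 : p1 ^+ 2 <= (q1 + r1) ^+ 2 by rewrite ler_sqr ?nnegrE// (le_trans p10).
have s2 : p2 ^+ 2 <= (q2 + r2) ^+ 2 by rewrite ler_sqr ?nnegrE// (le_trans p20).
move: s1 s2 A2 B2 CS; clear; lra.
Qed.

Lemma five_rad (r a b : R) : 0 <= r -> a <= 3 / 2 * r -> b <= 9 / 4 * r -> a + b <= 5 * r.
Proof. by move=> *; lra. Qed.

Lemma three_halves_rad (r a : R) : 0 <= r -> a <= 3 / 2 * r -> a <= 5 * r.
Proof. by move=> *; lra. Qed.

End plane.

(** * One step of the algorithm for min-max problems *)

Section product.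
Context {R : realType} (M N : riemannian_manifold R).
Variables (kmin kmax rad : R).
Hypothesis UGM : uniquely_geodesic M.
Hypothesis secM : sectional_in M kmin kmax.
Hypothesis UGN : uniquely_geodesic N.
Hypothesis secN : sectional_in N kmin kmax.
Hypothesis r0 : 0 <= rad.
Hypothesis okL : okr kmax (5 * rad).
Implicit Types (z w p q : M * N) (Y : set (M * N)).

Let L0 : 0 <= 5 * rad. Proof. exact: mulr_ge0. Qed.

Lemma dist2_ge0 z w : 0 <= dist2 z w. Proof. exact: sqrtr_ge0. Qed.

Lemma dist2_sq z w : dist2 z w ^+ 2 = dist z.1 w.1 ^+ 2 + dist z.2 w.2 ^+ 2.
Proof. by rewrite sqr_sqrtr// addr_ge0 ?sqr_ge0. Qed.

Lemma dist_le1 z w : dist z.1 w.1 <= dist2 z w.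
Proof.
rewrite -ler_sqr ?nnegrE ?dist2_ge0 ?(dist_ge0 UGM)// dist2_sq lerDl; exact: sqr_ge0.
Qed.

Lemma dist_le2 z w : dist z.2 w.2 <= dist2 z w.
Proof.
rewrite -ler_sqr ?nnegrE ?dist2_ge0 ?(dist_ge0 UGN)// dist2_sq lerDr; exact: sqr_ge0.
Qed.

Lemma dist2_sym z w : dist2 z w <= 5 * rad -> dist2 w z = dist2 z w.
Proof.
move=> h; rewrite /dist2 (d_sym UGM secM okL (le_trans (dist_le1 z w) h)).
by rewrite (d_sym UGN secN okL (le_trans (dist_le2 z w) h)).
Qed.

Lemma dist2_tri p z w : dist2 p z + dist2 z w <= 5 * rad -> dist2 p w <= dist2 p z + dist2 z w.
Proof.
move=> h; apply: minkowski2; [exact: dist_ge0|exact: dist_ge0|..].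
  by apply: (d_tri UGM secM okL); apply: le_trans h; apply: lerD; exact: dist_le1.
by apply: (d_tri UGN secN okL); apply: le_trans h; apply: lerD; exact: dist_le2.
Qed.

Lemma cball2P z w (r : R) : 0 <= r -> cball2 z r w <-> dist2 w z ^+ 2 <= r ^+ 2.
Proof. by move=> r_ge0; rewrite /cball2/= ler_sqr ?nnegrE// dist2_ge0. Qed.

(** The second component of the product geodesic joins y to itself, so it is constant by
    uniqueness. *)
Lemma ysection_gconvex Y y : gconvex_set2 Y -> gconvex_set (ysection Y y).
Proof.
move=> cY x x' /ysectionP Yx /ysectionP Yx'.
have [c [d [gc gd H]]] := cY _ _ Yx Yx'; exists c => // t t01; apply/ysectionP.
have [_ E] := UGN y y; rewrite -[y](E d _ gd (geodesic_const UGN y) t t01).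
exact: H.
Qed.

Lemma xsection_gconvex Y x : gconvex_set2 Y -> gconvex_set (xsection Y x).
Proof.
move=> cY y y' /xsectionP Yy /xsectionP Yy'.
have [c [d [gc gd H]]] := cY _ _ Yy Yy'; exists d => // t t01; apply/xsectionP.
have [_ E] := UGM x x; rewrite -[x](E c _ gc (geodesic_const UGM x) t t01).
exact: H.
Qed.

Variables (f : M -> N -> \bar R) (zs : M * N).

(** Properness in the first variable excludes -oo, and properness of the opposite in the second
    excludes +oo. *)
Lemma Gamma_sp_fin Y x y : Gamma_sp Y f -> Y (x, y) -> exists a, f x y = a%:E.
Proof.
move=> [_ H] Yxy; have [[[n1 _] _ _] [[n2 _] _ _]] := H x y Yxy.
have := n1 x; have := n2 y; case: (f x y) => [a||]; first by exists a.
  by move=> /(_ _)/negP H1; exfalso; apply: H1 => //; apply/xsectionP.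
by move=> _ /(_ _)/negP H1; exfalso; apply: H1 => //; apply/ysectionP.
Qed.

Local Notation X := (cball2 zs (5 * rad)).
Local Notation B := (cball2 zs (Num.sqrt 2 * rad)).
Hypothesis GX : Gamma_sp X f.
Hypothesis sp : saddle_point f zs.

Lemma dist2_self z : dist2 z z = 0.
Proof. by rewrite /dist2 (d_self UGM) (d_self UGN) expr0n/= addr0 sqrtr0. Qed.

Lemma X_zs2 : X zs.
Proof. by rewrite /cball2/= dist2_self. Qed.

Lemma f_zs2 : exists fs, f zs.1 zs.2 = fs%:E.
Proof. by apply: (Gamma_sp_fin GX); have := X_zs2; case: (zs). Qed.

(** A ball of the product is not a product set, but it is stable under replacing one coordinate by
    that of its centre. *)
Lemma X_fst x y : X (x, y) -> X (x, zs.2).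
Proof.
rewrite !cball2P// !dist2_sq/= (d_self UGN) => h; apply: le_trans h.
by rewrite lerD2l expr0n/= sqr_ge0.
Qed.

Lemma X_snd x y : X (x, y) -> X (zs.1, y).
Proof.
rewrite !cball2P// !dist2_sq/= (d_self UGM) => h; apply: le_trans h.
by rewrite lerD2r expr0n/= sqr_ge0.
Qed.

(** The saddle property of w is tested against [zs], and that of [zs] against w; the values of f
    drop out thanks to their order. *)
Lemma prox_near2 (eta : R) z w : 0 < eta -> is_prox_sp eta f z w ->
  dist2 w z ^+ 2 <= dist2 zs z ^+ 2.
Proof.
move=> eta0 prox; have [fs E] := f_zs2.
have [h1 _] := prox zs.1 zs.2; have [_ h2] := prox zs.1 zs.2.
have := le_trans h1 h2; have [_ s1] := sp w.1 w.2; have [s2 _] := sp w.1 w.2.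
rewrite E in s1 s2; move: s1 s2; case: (f w.1 zs.2) => [A||]; case: (f zs.1 w.2) => [A'||] //=.
rewrite -!EFinD !lee_fin => s1 s2 H.
have q : 0 < (2 * eta)^-1 by rewrite invr_gt0 mulr_gt0.
rewrite !dist2_sq -(ler_pM2l q); lra.
Qed.

Lemma iterate_distances2 (eta : R) z w z' : 0 < eta -> dist2 z zs ^+ 2 <= 2 * rad ^+ 2 ->
  is_prox_sp eta f z w -> dist2 z' w ^+ 2 <= 4^-1 * dist2 z w ^+ 2 ->
  [/\ dist2 z zs <= 3 / 2 * rad, dist2 w z <= dist2 z zs, dist2 z' w <= dist2 w z / 2 & X z'].
Proof.
move=> eta0 d2 prox dz'.
have zd := sq_le2 r0 d2.
have zL : dist2 z zs <= 5 * rad by apply: le_trans zd _; rewrite ler_wpM2r//; lra.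
have wz : dist2 w z <= dist2 z zs.
  by rewrite -(dist2_sym zL) -ler_sqr ?nnegrE ?dist2_ge0//; exact: prox_near2 prox.
have e : dist2 z' w <= dist2 z w / 2 by apply: half_of_sq dz'; exact: dist2_ge0.
have wL := le_trans wz zL; rewrite (dist2_sym wL) in e.
have dw := dist2_ge0 w z.
have t1 : dist2 w z + dist2 z zs <= 5 * rad by lra.
have t2 : dist2 z' w + dist2 w zs <= 5 * rad by have := dist2_tri t1; lra.
split=> //; rewrite /cball2/=; have := dist2_tri t2; have := dist2_tri t1; lra.
Qed.

Lemma component_distances (eta : R) z w z' : 0 < eta -> dist2 z zs ^+ 2 <= 2 * rad ^+ 2 ->
  is_prox_sp eta f z w -> dist2 z' w ^+ 2 <= 4^-1 * dist2 z w ^+ 2 ->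
  [/\ dist zs.1 z.1 <= 3 / 2 * rad, dist zs.2 z.2 <= 3 / 2 * rad,
      dist z.1 z'.1 <= 9 / 4 * rad & dist z.2 z'.2 <= 9 / 4 * rad].
Proof.
move=> eta0 d2 prox dz'.
have [zd wz e _] := iterate_distances2 eta0 d2 prox dz'.
have dw := dist2_ge0 w z.
have sm : dist2 z zs + dist2 w z + dist2 z' w <= 5 * rad by lra.
have [a1 b1 _ _ _] := step_distances UGM secM okL (dist_le1 z zs) (dist_le1 w z) (dist_le1 z' w) sm.
have [a2 b2 _ _ _] := step_distances UGN secN okL (dist_le2 z zs) (dist_le2 w z) (dist_le2 z' w) sm.
split; lra.
Qed.

Lemma component_sums (eta : R) z w z' : 0 < eta -> dist2 z zs ^+ 2 <= 2 * rad ^+ 2 ->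
  is_prox_sp eta f z w -> dist2 z' w ^+ 2 <= 4^-1 * dist2 z w ^+ 2 ->
  [/\ dist2 z zs <= 5 * rad, dist zs.1 z.1 + dist z.1 z'.1 <= 5 * rad
    & dist zs.2 z.2 + dist z.2 z'.2 <= 5 * rad].
Proof.
move=> eta0 d2 prox dz'; have [a1 a2 b1 b2] := component_distances eta0 d2 prox dz'.
have [zd _ _ _] := iterate_distances2 eta0 d2 prox dz'.
by split; [exact: three_halves_rad zd|exact: five_rad a1 b1|exact: five_rad a2 b2].
Qed.

(** The residual is bounded for both factors jointly, so the estimates of the two factors are added
    before that bound is used. *)
Lemma sp_step (eta D m1 m2 p q s : R) (u z z' : M * N) (v : 'rV[R]_(mdim M)) (w : 'rV[R]_(mdim N)) : 0 < eta -> 0 < D ->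
  dist u.1 z.1 + dist z.1 z'.1 <= 5 * rad -> dist u.2 z.2 + dist z.2 z'.2 <= 5 * rad ->
  ginner z'.1 (eta *: v - Exp_inv z'.1 z.1) (eta *: v - Exp_inv z'.1 z.1)
    + ginner z'.2 (eta *: w - Exp_inv z'.2 z.2) (eta *: w - Exp_inv z'.2 z.2)
    <= D * delta kmax (5 * rad) * dist2 z' z ^+ 2 ->
  p + (ginner z'.1 v (Exp_inv z'.1 u.1) + m1) <= q ->
  - p + (ginner z'.2 w (Exp_inv z'.2 u.2) + m2) <= - s ->
  2 * eta * (s - q) <= dist2 u z ^+ 2 - (1 - D) * dist2 u z' ^+ 2 - 2 * eta * (m1 + m2).
Proof.
move=> eta0 D0 h1 h2 dr s1 s2.
have P1 := prox_step UGM secM L0 okL h1 D0 (erefl (eta *: v - Exp_inv z'.1 z.1)).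
have P2 := prox_step UGN secN L0 okL h2 D0 (erefl (eta *: w - Exp_inv z'.2 z.2)).
have dr' : ginner z'.1 (eta *: v - Exp_inv z'.1 z.1) (eta *: v - Exp_inv z'.1 z.1) / D
    + ginner z'.2 (eta *: w - Exp_inv z'.2 z.2) (eta *: w - Exp_inv z'.2 z.2) / D
    <= delta kmax (5 * rad) * dist z'.1 z.1 ^+ 2 + delta kmax (5 * rad) * dist z'.2 z.2 ^+ 2.
  by rewrite -mulrDl -mulrDr -dist2_sq ler_pdivrMr// mulrC mulrA.
have S : 2 * eta * (s - q) <= 2 * eta * (- (ginner z'.1 v (Exp_inv z'.1 u.1) + m1) - (ginner z'.2 w (Exp_inv z'.2 u.2) + m2)).
  by rewrite ler_wpM2l ?mulr_ge0 ?(ltW eta0)//; lra.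
rewrite !dist2_sq; move: P1 P2 dr' S; clear.
lra.
Qed.

Lemma saddle_sub z' (v : 'rV[R]_(mdim M)) (w : 'rV[R]_(mdim N)) (p : R) : X z' -> f z'.1 z'.2 = p%:E ->
  subdiff (ysection X z'.2) (f ^~ z'.2) z'.1 v ->
  subdiff (xsection X z'.1) (fun y => - f z'.1 y)%E z'.2 w ->
  forall u : M * N, X (u.1, z'.2) -> X (z'.1, u.2) -> exists q s : R,
   [/\ f u.1 z'.2 = q%:E, f z'.1 u.2 = s%:E,
       p + (ginner z'.1 v (Exp_inv z'.1 u.1) + 0) <= q &
       - p + (ginner z'.2 w (Exp_inv z'.2 u.2) + 0) <= - s].
Proof.
move=> Xz' fp sv sw u X1 X2.
have [q qE] := Gamma_sp_fin GX X1; have [s sE] := Gamma_sp_fin GX X2.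
exists q, s; split=> //.
  have := sv u.1 ((ysectionP _ _ _).2 X1); rewrite /= fp qE -EFinD lee_fin; lra.
have := sw u.2 ((xsectionP _ _ _).2 X2); rewrite /= fp sE -EFinN -EFinD lee_fin; lra.
Qed.

Lemma saddle_values z' (p q s fs : R) : f zs.1 zs.2 = fs%:E -> f zs.1 z'.2 = q%:E -> f z'.1 zs.2 = s%:E ->
  q <= fs <= s.
Proof. by move=> fE qE sE; have [] := sp z'.1 z'.2; rewrite fE qE sE !lee_fin => -> ->. Qed.

Lemma gap_ge0 z' (q s : R) : f zs.1 z'.2 = q%:E -> f z'.1 zs.2 = s%:E -> 0 <= s - q.
Proof.
move=> qE sE; have [fs fE] := f_zs2.
by have /andP[h1 h2] := saddle_values 0 fE qE sE; rewrite subr_ge0 (le_trans h1).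
Qed.

Lemma X_pair z : X z -> X (z.1, z.2). Proof. by case: z. Qed.

Lemma sp_step_zs (eta D : R) z w z' v v' : 0 < eta -> 0 < D -> dist2 z zs ^+ 2 <= 2 * rad ^+ 2 ->
  is_prox_sp eta f z w -> dist2 z' w ^+ 2 <= 4^-1 * dist2 z w ^+ 2 ->
  subdiff (ysection X z'.2) (f ^~ z'.2) z'.1 v ->
  subdiff (xsection X z'.1) (fun y => - f z'.1 y)%E z'.2 v' ->
  ginner z'.1 (eta *: v - Exp_inv z'.1 z.1) (eta *: v - Exp_inv z'.1 z.1)
    + ginner z'.2 (eta *: v' - Exp_inv z'.2 z.2) (eta *: v' - Exp_inv z'.2 z.2)
    <= D * delta kmax (5 * rad) * dist2 z' z ^+ 2 ->
  (1 - D) * dist2 z' zs ^+ 2 <= dist2 z zs ^+ 2.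
Proof.
move=> eta0 D0 d2 prox dz' sv sv' dr.
have [zd wz e Xz'] := iterate_distances2 eta0 d2 prox dz'.
have [zL d1 d1'] := component_sums eta0 d2 prox dz'.
have [p pE] := Gamma_sp_fin GX (X_pair Xz').
have [q [s [qE sE h1 h2]]] := saddle_sub Xz' pE sv sv' (X_snd (X_pair Xz')) (X_fst (X_pair Xz')).
have gap : 0 <= 2 * eta * (s - q) by rewrite !mulr_ge0 ?(ltW eta0)// (gap_ge0 qE sE).
have := sp_step eta0 D0 d1 d1' dr h1 h2.
rewrite (dist2_sym zL) (dist2_sym Xz') addr0 mulr0 subr0 => H.
by rewrite -subr_ge0; exact: le_trans gap H.
Qed.

Lemma strong_sub (mu : R) z' (v : 'rV[R]_(mdim M)) (w : 'rV[R]_(mdim N)) (p : R) : strongly_gconvex_concave mu X B f -> B z' -> X z' ->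
  f z'.1 z'.2 = p%:E ->
  subdiff (ysection X z'.2) (f ^~ z'.2) z'.1 v ->
  subdiff (xsection X z'.1) (fun y => - f z'.1 y)%E z'.2 w ->
  exists q s : R,
   [/\ f zs.1 z'.2 = q%:E, f z'.1 zs.2 = s%:E,
       p + (ginner z'.1 v (Exp_inv z'.1 zs.1) + mu / 2 * dist z'.1 zs.1 ^+ 2) <= q &
       - p + (ginner z'.2 w (Exp_inv z'.2 zs.2) + mu / 2 * dist z'.2 zs.2 ^+ 2) <= - s].
Proof.
move=> str Bz' Xz' fp sv sw.
have Bp : B (z'.1, z'.2) by move: Bz'; case: (z').
have s0 : 0 <= Num.sqrt 2 * rad by rewrite mulr_ge0 ?sqrtr_ge0.
have B1 : B (zs.1, z'.2).
  apply/cball2P => //; move/cball2P : Bz' => /(_ s0); apply: le_trans.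
  by rewrite !dist2_sq/= (d_self UGM) expr0n/= lerD2r sqr_ge0.
have B2 : B (z'.1, zs.2).
  apply/cball2P => //; move/cball2P : Bz' => /(_ s0); apply: le_trans.
  by rewrite !dist2_sq/= (d_self UGN) expr0n/= lerD2l sqr_ge0.
have [q qE] := Gamma_sp_fin GX (X_snd (X_pair Xz')); have [s sE] := Gamma_sp_fin GX (X_fst (X_pair Xz')).
have [S1 S2] := str _ _ Bp.
exists q, s; split=> //.
  have := S1 z'.1 zs.1 v ((ysectionP _ _ _).2 Bp) ((ysectionP _ _ _).2 B1) sv.
  by rewrite /= fp qE -EFinD lee_fin.
have := S2 z'.2 zs.2 w ((xsectionP _ _ _).2 Bp) ((xsectionP _ _ _).2 B2) sw.
by rewrite /= fp sE -EFinN -EFinD lee_fin.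
Qed.

Lemma sp_step_strong (eta mu D : R) z w z' v v' : 0 < eta -> 0 < D -> dist2 z zs ^+ 2 <= 2 * rad ^+ 2 ->
  strongly_gconvex_concave mu X B f -> B z' ->
  is_prox_sp eta f z w -> dist2 z' w ^+ 2 <= 4^-1 * dist2 z w ^+ 2 ->
  subdiff (ysection X z'.2) (f ^~ z'.2) z'.1 v ->
  subdiff (xsection X z'.1) (fun y => - f z'.1 y)%E z'.2 v' ->
  ginner z'.1 (eta *: v - Exp_inv z'.1 z.1) (eta *: v - Exp_inv z'.1 z.1)
    + ginner z'.2 (eta *: v' - Exp_inv z'.2 z.2) (eta *: v' - Exp_inv z'.2 z.2)
    <= D * delta kmax (5 * rad) * dist2 z' z ^+ 2 ->
  (1 - D + eta * mu) * dist2 z' zs ^+ 2 <= dist2 z zs ^+ 2.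
Proof.
move=> eta0 D0 d2 str Bz' prox dz' sv sv' dr.
have [zd wz e Xz'] := iterate_distances2 eta0 d2 prox dz'.
have [zL d1 d1'] := component_sums eta0 d2 prox dz'.
have [p pE] := Gamma_sp_fin GX (X_pair Xz').
have [q [s [qE sE h1 h2]]] := strong_sub str Bz' Xz' pE sv sv'.
have gap : 0 <= 2 * eta * (s - q) by rewrite !mulr_ge0 ?(ltW eta0)// (gap_ge0 qE sE).
have := sp_step eta0 D0 d1 d1' dr h1 h2.
rewrite (dist2_sym zL) (dist2_sym Xz') -mulrDr -dist2_sq.
move: gap; clear; move: (2 * eta * (s - q)) (dist2 z zs ^+ 2) (dist2 z' zs ^+ 2) => *; lra.
Qed.

Lemma prox_subgrads (eta : R) z w : 0 < eta -> is_prox_sp eta f z w -> X w -> dist2 w z <= 5 * rad ->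
  subdiff (ysection X w.2) (f ^~ w.2) w.1 (eta^-1 *: Exp_inv w.1 z.1) /\
  subdiff (xsection X w.1) (fun y => - f w.1 y)%E w.2 (eta^-1 *: Exp_inv w.2 z.2).
Proof.
move=> eta0 prox Xw wL; have [p pE] := Gamma_sp_fin GX (X_pair Xw).
have [cX H] := GX; have [[[n1 _] _ c1] [[n2 _] _ c2]] := H _ _ (X_pair Xw).
split.
  apply: (prox_subgrad UGM secM okL eta0 c1 _ n1 pE (le_trans (dist_le1 w z) wL)).
    by move=> y Xy; apply: (ysection_gconvex cX) => //; apply/ysectionP; exact: X_pair.
  move=> y; have [_] := prox y w.2; rewrite /= pE; case: (f y w.2) => [q||]//.
    by rewrite -!EFinD !lee_fin; lra.
  by rewrite !addye// !leey.
have pE' : (- f w.1 w.2)%E = (- p)%:E by rewrite pE.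
apply: (prox_subgrad UGN secN okL eta0 c2 _ n2 pE' (le_trans (dist_le2 w z) wL)).
  by move=> y Xy; apply: (xsection_gconvex cX) => //; apply/xsectionP; exact: X_pair.
move=> y; have [+ _] := prox w.1 y; rewrite /= pE; case: (f w.1 y) => [q||]//.
  by rewrite -!EFinN -!EFinD !lee_fin; lra.
by rewrite !addye// !leey.
Qed.

(** Same dichotomy as in [strong_ball], with the factors summed; [gap_ge0] takes over the role of
    minimality. *)
Lemma strong_ball2 (eta mu : R) z w z' v v' : 0 < eta -> 0 < mu -> strongly_gconvex_concave mu X B f ->
  dist2 z zs ^+ 2 <= rad ^+ 2 -> is_prox_sp eta f z w ->
  dist2 z' w ^+ 2 <= 4^-1 * dist2 z w ^+ 2 ->
  subdiff (ysection X z'.2) (f ^~ z'.2) z'.1 v ->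
  subdiff (xsection X z'.1) (fun y => - f z'.1 y)%E z'.2 v' ->
  ginner z'.1 (eta *: v - Exp_inv z'.1 z.1) (eta *: v - Exp_inv z'.1 z.1)
    + ginner z'.2 (eta *: v' - Exp_inv z'.2 z.2) (eta *: v' - Exp_inv z'.2 z.2)
    <= eta * mu / 2 * delta kmax (5 * rad) * dist2 z' z ^+ 2 -> B z'.
Proof.
move=> eta0 mu0 str d2 prox dz' sv sv' dr.
have d22 : dist2 z zs ^+ 2 <= 2 * rad ^+ 2 by have := sqr_ge0 rad; lra.
have em0 : 0 < eta * mu / 2 by rewrite !mulr_gt0 ?invr_gt0.
have s0 : 0 <= Num.sqrt 2 * rad by rewrite mulr_ge0 ?sqrtr_ge0.
have BP p : dist2 p zs ^+ 2 <= 2 * rad ^+ 2 -> B p.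
  by move=> h; rewrite /cball2/= sqrt2_ball ?dist2_ge0.
have [small|big] := leP (eta * mu / 2) (1 / 2).
  apply: BP; have H := sp_step_zs eta0 em0 d22 prox dz' sv sv' dr.
  have : (1 / 2) * dist2 z' zs ^+ 2 <= (1 - eta * mu / 2) * dist2 z' zs ^+ 2.
    by rewrite ler_wpM2r ?sqr_ge0//; lra.
  lra.
have [zd wz e Xz'] := iterate_distances2 eta0 d22 prox dz'.
have dw := dist2_ge0 w z.
have [dneg|dpos] := ltP (delta kmax (5 * rad)) 0.
  have : 0 <= eta * mu / 2 * delta kmax (5 * rad) * dist2 z' z ^+ 2.
    by apply: le_trans dr; rewrite addr_ge0// ginner_ge0.
  rewrite nmulr_rge0 ?pmulr_rlt0// => sq0.
  have Z : dist2 z' z = 0 by apply/eqP; rewrite -sqrf_eq0; apply/eqP/le_anti; rewrite sq0 sqr_ge0.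
  have Z1 : dist z'.1 z.1 = 0 by apply: le_anti; rewrite (dist_ge0 UGM) andbT -Z dist_le1.
  have Z2 : dist z'.2 z.2 = 0 by apply: le_anti; rewrite (dist_ge0 UGN) andbT -Z dist_le2.
  apply: BP; rewrite dist2_sq -(d_eq0 UGM secM L0 okL Z1) -(d_eq0 UGN secN L0 okL Z2) -dist2_sq.
  exact: d22.
have wL : dist2 w z <= 5 * rad by lra.
have zL : dist2 z zs <= 5 * rad by lra.
have tri : dist2 w z + dist2 z zs <= 5 * rad by lra.
have le0 := dist2_tri tri.
have Xw : X w by exact: le_trans le0 tri.
have [p pE] := Gamma_sp_fin GX (X_pair Xw).
have [sub1 sub2] := prox_subgrads eta0 prox Xw wL.
have tri1 : dist zs.1 z.1 + dist z.1 w.1 <= 5 * rad.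
  rewrite (d_sym UGM secM okL (le_trans (dist_le1 z zs) zL)) (d_sym UGM secM okL (le_trans (dist_le1 w z) wL)).
  by have := dist_le1 z zs; have := dist_le1 w z; lra.
have tri2 : dist zs.2 z.2 + dist z.2 w.2 <= 5 * rad.
  rewrite (d_sym UGN secN okL (le_trans (dist_le2 z zs) zL)) (d_sym UGN secN okL (le_trans (dist_le2 w z) wL)).
  by have := dist_le2 z zs; have := dist_le2 w z; lra.
have H1 := hinge_d UGM secM L0 okL tri1; have H2 := hinge_d UGN secN L0 okL tri2.
have db1 : 0 <= delta kmax (5 * rad) * dist w.1 z.1 ^+ 2 by rewrite mulr_ge0 ?sqr_ge0.
have db2 : 0 <= delta kmax (5 * rad) * dist w.2 z.2 ^+ 2 by rewrite mulr_ge0 ?sqr_ge0.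
rewrite (ginner_sym w.1) in H1; rewrite (ginner_sym w.2) in H2.
pose g1 := ginner w.1 (Exp_inv w.1 z.1) (Exp_inv w.1 zs.1).
pose g2 := ginner w.2 (Exp_inv w.2 z.2) (Exp_inv w.2 zs.2).
have HH : dist2 w zs ^+ 2 - 2 * (g1 + g2) <= dist2 z zs ^+ 2.
  rewrite -(dist2_sym Xw) -(dist2_sym zL) !dist2_sq -/g1 in H1 *; rewrite -/g2 in H2; lra.
have key (k : R) : eta^-1 * g1 + eta^-1 * g2 <= k -> g1 + g2 <= eta * k.
  by rewrite -mulrDr ler_pdivrMl.
have G0 : g1 + g2 <= eta * 0.
  apply: key; have [q [s [qE sE]]] := saddle_sub Xw pE sub1 sub2 (X_snd (X_pair Xw)) (X_fst (X_pair Xw)).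
  have := gap_ge0 qE sE; rewrite !ginnerZl -/g1 -/g2; lra.
have Bw : B w by apply: BP; have := sqr_ge0 rad; lra.
have G1 : g1 + g2 <= eta * (- (mu / 2 * dist2 w zs ^+ 2)).
  apply: key; have [q [s [qE sE]]] := strong_sub str Bw Xw pE sub1 sub2.
  by have := gap_ge0 qE sE; rewrite !ginnerZl -/g1 -/g2 dist2_sq; lra.
have em1 : dist2 w zs ^+ 2 <= eta * mu * dist2 w zs ^+ 2.
  by rewrite ler_peMl ?sqr_ge0//; lra.
have half : 2 * dist2 w zs ^+ 2 <= dist2 z zs ^+ 2 by lra.
have tri3 : dist2 z' w + dist2 w zs <= 5 * rad by lra.
have le1 := dist2_tri tri3.
have D1 := dist2_ge0 z' zs; have D2 := dist2_ge0 w zs; have D3 := dist2_ge0 z zs.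
apply: BP; apply: (sq_sum_le _ half d2).
by rewrite ler_sqr ?nnegrE//; lra.
Qed.

End product.

Section arith.
Context {R : realType}.

(** The expansion of (a + b)^2 gives 1 + 2 * 3/2 + 2 = 6. *)
Lemma sq_five_rad (r a b c : R) : 0 <= a -> 0 <= b -> a <= r -> b ^+ 2 <= 2 * r ^+ 2 -> 0 <= c -> c <= a + b ->
  c ^+ 2 <= 6 * r ^+ 2.
Proof.
move=> a0 b0 ar b2 c0 cab; have r0 := le_trans a0 ar.
have b1 : b <= 3 / 2 * r by exact: sq_le2.
have : c ^+ 2 <= (a + b) ^+ 2 by rewrite ler_sqr ?nnegrE ?addr_ge0.
have : a * b <= r * (3 / 2 * r) by rewrite ler_pM.
have : a ^+ 2 <= r ^+ 2 by rewrite ler_sqr ?nnegrE.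
have := sqr_ge0 r; lra.
Qed.

Lemma rad_sum (r a b c : R) : 0 <= r -> a <= r -> b <= 3 / 2 * r -> c <= 9 / 4 * r -> a + b + c <= 5 * r.
Proof. by move=> *; lra. Qed.

Lemma sq_pair (r a b : R) : a <= 2 * r ^+ 2 -> b <= r ^+ 2 -> a + b <= (5 * r) ^+ 2.
Proof. by have := sqr_ge0 r; rewrite exprMn => *; lra. Qed.

Lemma rad_sum2 (r a b : R) : 0 <= r -> a <= r -> b <= 3 / 2 * r -> a + b <= 5 * r.
Proof. by move=> *; lra. Qed.

Lemma sum_average (b : nat -> R) (eta r fs : R) (T : nat) : 0 < eta -> (0 < T)%N ->
  \sum_(t < T) 2 * eta * (b t.+1 - fs) <= 10 * r ^+ 2 ->
  T%:R^-1 * \sum_(t < T) b t.+1 <= fs + 5 * r ^+ 2 / (eta * T%:R).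
Proof.
move=> eta0 T0; rewrite sum_affine => S.
have Tp : 0 < T%:R :> R by rewrite ltr0n.
rewrite mulrC ler_pdivrMr// mulrDl.
have -> : 5 * r ^+ 2 / (eta * T%:R) * T%:R = 5 * r ^+ 2 / eta by field; rewrite !gt_eqF.
rewrite -lerBlDl ler_pdivlMr//; lra.
Qed.

End arith.

(** * Averaged iterates and the saddle gap *)

Section averages.
Context {R : realType} (M N : riemannian_manifold R).
Variables (kmin kmax rad : R).
Hypothesis UGM : uniquely_geodesic M.
Hypothesis secM : sectional_in M kmin kmax.
Hypothesis UGN : uniquely_geodesic N.
Hypothesis secN : sectional_in N kmin kmax.
Hypothesis r0 : 0 <= rad.
Hypothesis okL : okr kmax (5 * rad).
Variables (f : M -> N -> \bar R) (zs : M * N).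
Local Notation X := (cball2 zs (5 * rad)).
Local Notation B := (cball2 zs (Num.sqrt 2 * rad)).
Hypothesis GX : Gamma_sp X f.
Hypothesis sp : saddle_point f zs.
Variables (eta : R) (z : nat -> M * N) (T : nat).
Hypothesis eta0 : 0 < eta.
Hypothesis rip : rippa_sp X f kmax rad eta 0 T z.
Hypothesis z0 : dist2 (z 0%N) zs <= rad.

Let D0 t : 0 < (t.+2%:R ^+ 2)^-1 :> R. Proof. by rewrite invr_gt0 exprn_gt0. Qed.

Lemma iterates_bound t : (t <= T)%N -> dist2 (z t) zs ^+ 2 <= 2 * rad ^+ 2.
Proof.
apply: (inexact_bound (d := fun t => dist2 (z t) zs ^+ 2)) => [||s sT ds]; first exact: sqr_ge0.
  by rewrite ler_sqr ?nnegrE// dist2_ge0.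
have [w [v [v' [prox dz' sv sv']]]] := rip sT.
rewrite /Delta eqxx => dr.
exact: (sp_step_zs UGM secM UGN secN r0 okL GX sp eta0 (D0 s) ds prox dz' sv sv' dr).
Qed.

Lemma iterates_in t : (0 < t <= T)%N -> X (z t).
Proof.
case: t => // t tT; have [w [v [v' [prox dz' _ _ _]]]] := rip tT.
have [_ _ _ H] := iterate_distances2 UGM secM UGN secN r0 okL GX sp eta0 (iterates_bound (ltnW tT)) prox dz'.
exact: H.
Qed.

(** The reference point is within rad of [zs], so that the hinge triangles fit in 5 rad. The
    constant 10 is 4 for the initial squared distance to u plus 6 for the bound on all later
    ones. *)
Lemma sp_sum (u : M * N) : dist2 u zs <= rad ->
  (forall t, (0 < t <= T)%N -> X (u.1, (z t).2) /\ X ((z t).1, u.2)) ->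
  \sum_(t < T) 2 * eta * (fine (f (z t.+1).1 u.2) - fine (f u.1 (z t.+1).2)) <= 10 * rad ^+ 2.
Proof.
move=> hu Xu.
have rr0 := sqr_ge0 rad.
have uL : dist2 u zs <= 5 * rad by rewrite (le_trans hu)// ler_peMl// ler1n.
have u0 := dist2_ge0 u zs.
have zL t : (t <= T)%N -> dist2 (z t) zs <= 5 * rad.
  by move=> tT; exact: three_halves_rad r0 (sq_le2 r0 (iterates_bound tT)).
have tri t : (t <= T)%N -> dist2 u (z t) <= dist2 u zs + dist2 (z t) zs.
  move=> tT; rewrite -(dist2_sym UGM secM UGN secN okL (zL t tT)).
  apply: (dist2_tri UGM secM UGN secN okL).
  rewrite (dist2_sym UGM secM UGN secN okL (zL t tT)).
  exact: rad_sum2 r0 hu (sq_le2 r0 (iterates_bound tT)).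
have six t : (t <= T)%N -> dist2 u (z t) ^+ 2 <= 6 * rad ^+ 2.
  move=> tT.
  exact: sq_five_rad u0 (dist2_ge0 _ _) hu (iterates_bound tT) (dist2_ge0 _ _) (tri t tT).
have four : dist2 u (z 0%N) ^+ 2 <= 4 * rad ^+ 2.
  have h : dist2 u (z 0%N) <= 2 * rad.
    by apply: le_trans (tri 0%N (leq0n T)) _; rewrite mulr_natl mulr2n lerD.
  have -> : 4 * rad ^+ 2 = (2 * rad) ^+ 2 by ring.
  by rewrite ler_sqr ?nnegrE ?dist2_ge0// mulr_ge0.
have S := inexact_sum (g := fun t => 2 * eta * (fine (f (z t.+1).1 u.2) - fine (f u.1 (z t.+1).2)))
  (e := fun t => dist2 u (z t) ^+ 2) (K := 6 * rad ^+ 2) (T := T).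
have -> : 10 * rad ^+ 2 = 4 * rad ^+ 2 + 6 * rad ^+ 2 by ring.
apply: (@le_trans _ _ (dist2 u (z 0%N) ^+ 2 + 6 * rad ^+ 2)); last by rewrite lerD2r.
apply: S => [|t|t tT|t tT]; [by rewrite mulr_ge0|exact: sqr_ge0|exact: six|].
have [w [v [v' [prox dz' sv sv']]]] := rip tT.
rewrite /Delta eqxx => dr.
have bt := iterates_bound (ltnW tT).
have [d1 d2 d1' d2'] := component_distances UGM secM UGN secN r0 okL GX sp eta0 bt prox dz'.
have Xz : X (z t.+1) by apply: iterates_in; rewrite ltnS tT.
have [p pE] := Gamma_sp_fin GX (X_pair Xz).
have [Xu1 Xu2] := Xu t.+1 tT.
have [q [s [qE sE h1 h2]]] := saddle_sub GX Xz pE sv sv' Xu1 Xu2.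
have ua := le_trans (dist_le1 UGM u zs) hu; have ub := le_trans (dist_le2 UGN u zs) hu.
have e1 : dist u.1 (z t).1 + dist (z t).1 (z t.+1).1 <= 5 * rad.
  have h := rad_sum r0 ua d1 d1'; apply: le_trans h; rewrite lerD2r.
  exact: (d_tri UGM secM okL (rad_sum2 r0 ua d1)).
have e2 : dist u.2 (z t).2 + dist (z t).2 (z t.+1).2 <= 5 * rad.
  have h := rad_sum r0 ub d2 d2'; apply: le_trans h; rewrite lerD2r.
  exact: (d_tri UGN secN okL (rad_sum2 r0 ub d2)).
have := sp_step UGM secM UGN secN r0 okL eta0 (D0 t) e1 e2 dr h1 h2.
by rewrite qE sE /= addr0 mulr0 subr0.
Qed.

Local Notation xbar := (gavg (fst \o z) T).
Local Notation ybar := (gavg (snd \o z) T).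
Variable fs : R.
Hypothesis fsE : f zs.1 zs.2 = fs%:E.
Hypothesis T0 : (0 < T)%N.
Let TT : (0 < T <= T)%N. Proof. by rewrite T0 leqnn. Qed.
Let K := 5 * rad ^+ 2 / (eta * T%:R).

Lemma X_zs_pair : X (zs.1, zs.2).
Proof. by apply: X_pair; exact: X_zs2. Qed.

Lemma near_pair p q : dist p zs.1 ^+ 2 <= 2 * rad ^+ 2 -> dist q zs.2 <= rad -> X (p, q).
Proof.
move=> hp hq; apply/cball2P => //; first exact: mulr_ge0.
have h : dist q zs.2 ^+ 2 <= rad ^+ 2 by rewrite ler_sqr ?nnegrE ?(dist_ge0 UGN).
by rewrite dist2_sq; exact: sq_pair hp h.
Qed.

Lemma near_pair' p q : dist p zs.1 <= rad -> dist q zs.2 ^+ 2 <= 2 * rad ^+ 2 -> X (p, q).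
Proof.
move=> hp hq; apply/cball2P => //; first exact: mulr_ge0.
have h : dist p zs.1 ^+ 2 <= rad ^+ 2 by rewrite ler_sqr ?nnegrE ?(dist_ge0 UGM).
by rewrite dist2_sq addrC; exact: sq_pair hq h.
Qed.

Lemma iterates_bound1 t : (0 < t <= T)%N -> dist (z t).1 zs.1 ^+ 2 <= 2 * rad ^+ 2.
Proof.
case/andP=> _ tT; apply: le_trans (iterates_bound tT); rewrite dist2_sq lerDl; exact: sqr_ge0.
Qed.

Lemma iterates_bound2 t : (0 < t <= T)%N -> dist (z t).2 zs.2 ^+ 2 <= 2 * rad ^+ 2.
Proof.
case/andP=> _ tT; apply: le_trans (iterates_bound tT); rewrite dist2_sq lerDr; exact: sqr_ge0.
Qed.

(** Take [(zs.1, q)] as reference point: the saddle property bounds its other value f(zs.1, y_t) by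
    fs, so the summed gaps bound the average of f(x_t, q), and Jensen passes to f(xbar, q). *)
Lemma average_x q : dist q zs.2 <= rad -> exists a, f xbar q = a%:E /\ a <= fs + K.
Proof.
move=> hq; have Xq t : (0 < t <= T)%N -> X ((z t).1, q).
  by move=> tT; exact: near_pair (iterates_bound1 tT) hq.
have [cX _] := GX; have cS := ysection_gconvex (y := q) UGN cX.
have XT := Xq T TT; have [_ HX] := GX; have [[_ _ conv] _] := HX _ _ XT.
have Xbar : X (xbar, q).
  have /ysectionP H := gavg_in UGM (z := fst \o z) cS (fun t tT => (ysectionP _ _ _).2 (Xq t tT)) TT.
  exact: H.
have [a aE] := Gamma_sp_fin GX Xbar; exists a; split=> //.
pose b t := fine (f (z t).1 q).
have J : (f xbar q <= (T%:R^-1 * \sum_(t < T) b t.+1)%:E)%E.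
  apply: (gavg_jensen UGM (T := T) (b := b) (h := f ^~ q) cS conv _ TT) => t tT.
  have [c cE] := Gamma_sp_fin GX (Xq t tT).
  by split; [apply/ysectionP; exact: Xq|rewrite /b /= cE].
rewrite aE lee_fin in J; apply: le_trans J _; apply: sum_average => //.
have hu : dist2 (zs.1, q) zs <= rad.
  by rewrite /dist2/= (d_self UGM) expr0n/= add0r sqrtr_sqr ger0_norm// (dist_ge0 UGN).
apply: le_trans (sp_sum hu _); last first.
  by move=> t tT; split; [exact: X_snd (X_pair (iterates_in tT))|exact: Xq].
apply: ler_sum => t _; apply: ler_wpM2l; first by rewrite mulr_ge0 ?(ltW eta0).
rewrite lerD2l lerN2.
have tT : (0 < t.+1 <= T)%N by rewrite ltnS ltn_ord.
have [c cE] := Gamma_sp_fin GX (X_snd UGM r0 (X_pair (iterates_in tT))).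
by have [+ _] := sp zs.1 (z t.+1).2; rewrite fsE cE lee_fin.
Qed.

Lemma average_y p : dist p zs.1 <= rad -> exists a, f p ybar = a%:E /\ fs - K <= a.
Proof.
move=> hp; have Xp t : (0 < t <= T)%N -> X (p, (z t).2).
  by move=> tT; exact: near_pair' hp (iterates_bound2 tT).
have [cX _] := GX; have cS := xsection_gconvex (x := p) UGM cX.
have XT := Xp T TT; have [_ HX] := GX; have [_ [_ _ conv]] := HX _ _ XT.
have Xbar : X (p, ybar).
  have /xsectionP H := gavg_in UGN (z := snd \o z) cS (fun t tT => (xsectionP _ _ _).2 (Xp t tT)) TT.
  exact: H.
have [a aE] := Gamma_sp_fin GX Xbar; exists a; split=> //.
pose b t := - fine (f p (z t).2).
have J : (- f p ybar <= (T%:R^-1 * \sum_(t < T) b t.+1)%:E)%E.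
  have vals t : (0 < t <= T)%N -> xsection X p ((snd \o z) t) /\ (- f p ((snd \o z) t) <= (b t)%:E)%E.
    move=> tT; have [c cE] := Gamma_sp_fin GX (Xp t tT).
    by split; [apply/xsectionP; exact: Xp|rewrite /b /= cE].
  exact: (gavg_jensen UGN cS conv vals TT).
rewrite aE -EFinN lee_fin in J.
rewrite -lerN2 opprB addrC; apply: le_trans J _.
apply: sum_average => //.
have hu : dist2 (p, zs.2) zs <= rad.
  by rewrite /dist2/= (d_self UGN) expr0n/= addr0 sqrtr_sqr ger0_norm// (dist_ge0 UGM).
apply: le_trans (sp_sum hu _); last first.
  by move=> t tT; split; [exact: Xp|exact: X_fst (X_pair (iterates_in tT))].
apply: ler_sum => t _; apply: ler_wpM2l; first by rewrite mulr_ge0 ?(ltW eta0).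
rewrite opprK addrC lerD2r.
have tT : (0 < t.+1 <= T)%N by rewrite ltnS ltn_ord.
have [c cE] := Gamma_sp_fin GX (X_fst UGN r0 (X_pair (iterates_in tT))).
by have [_] := sp (z t.+1).1 zs.2; rewrite fsE cE lee_fin.
Qed.

(* The averages are only compared with points at distance [rad] from [zs]; one fifth of the way
   to a point of [X] is that close, and concavity along the way extrapolates the bound. *)
Lemma upper_value (Y : set (M * N)) y c : Gamma_sp Y f -> geodesic zs.2 y c -> dist y zs.2 <= 5 * rad ->
  (forall s, 0 <= s <= 1 -> Y (xbar, c s)) -> exists b, f xbar y = b%:E /\ b <= fs + 5 * K.
Proof.
move=> GY g hy Yc; have [c0 c1 _] := g.
have s01 : 0 <= (5^-1 : R) <= 1 by lra.
have i0 : 0 <= (0 : R) <= 1 by rewrite lexx ler01.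
have i1 : 0 <= (1 : R) <= 1 by rewrite lexx ler01.
have near : dist (c 5^-1) zs.2 <= rad.
  have h : dist zs.2 (c 5^-1) <= rad.
    apply: le_trans (dist_le_rr UGN _ _) _; rewrite (rr_sub UGN g s01) ler_pdivrMl//.
    by rewrite (rr_sym UGN) (d_rr UGN secN okL hy).
  by rewrite (d_sym UGN secN okL)// (le_trans h)// ler_peMl// ler1n.
have [m [mE mK]] := average_x near.
have [a aE] := Gamma_sp_fin GY (Yc 0 i0); have [b bE] := Gamma_sp_fin GY (Yc 1 i1).
have [_ H] := GY; have [_ [_ _ conv]] := H _ _ (Yc 0 i0).
(* Concavity gives 4/5 f(xbar, zs.2) + 1/5 f(xbar, y) <= fs + K, and f(xbar, zs.2) >= fs by the
   saddle property. *)
have := conv _ _ _ g (fun s hs => (xsectionP _ _ _).2 (Yc s hs)) _ s01.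
have := (sp xbar zs.2).2; rewrite -{2}c0 fsE mE.
rewrite c0 in aE; rewrite c1 in bE; rewrite c0 aE bE -!EFinN -!EFinM -EFinD !lee_fin => h1 h2.
by exists b; split=> //; lra.
Qed.

Lemma lower_value (Y : set (M * N)) x c : Gamma_sp Y f -> geodesic zs.1 x c -> dist x zs.1 <= 5 * rad ->
  (forall s, 0 <= s <= 1 -> Y (c s, ybar)) -> exists b, f x ybar = b%:E /\ fs - 5 * K <= b.
Proof.
move=> GY g hx Yc; have [c0 c1 _] := g.
have s01 : 0 <= (5^-1 : R) <= 1 by lra.
have i0 : 0 <= (0 : R) <= 1 by rewrite lexx ler01.
have i1 : 0 <= (1 : R) <= 1 by rewrite lexx ler01.
have near : dist (c 5^-1) zs.1 <= rad.
  have h : dist zs.1 (c 5^-1) <= rad.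
    apply: le_trans (dist_le_rr UGM _ _) _; rewrite (rr_sub UGM g s01) ler_pdivrMl//.
    by rewrite (rr_sym UGM) (d_rr UGM secM okL hx).
  by rewrite (d_sym UGM secM okL)// (le_trans h)// ler_peMl// ler1n.
have [m [mE mK]] := average_y near.
have [a aE] := Gamma_sp_fin GY (Yc 0 i0); have [b bE] := Gamma_sp_fin GY (Yc 1 i1).
have [_ H] := GY; have [[_ _ conv] _] := H _ _ (Yc 0 i0).
have := conv _ _ _ g (fun s hs => (ysectionP _ _ _).2 (Yc s hs)) _ s01.
have := (sp zs.1 ybar).1; rewrite fsE /= mE.
rewrite c0 in aE; rewrite c1 in bE; rewrite aE bE -!EFinM -EFinD !lee_fin => h1 h2.
by exists b; split=> //; lra.
Qed.

(** Each player loses 5 K with K = 5 rad^2 / (eta T): this is where 50 comes from. *)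
Lemma gap_bound eps x y : 0 < eps -> 50 * (rad ^+ 2 / (eta * eps)) <= T%:R ->
  (exists b, f xbar y = b%:E /\ b <= fs + 5 * K) -> (exists b, f x ybar = b%:E /\ fs - 5 * K <= b) ->
  (f xbar y - f x ybar <= eps%:E)%E.
Proof.
move=> eps0 HT [b [-> hb]] [b' [-> hb']]; rewrite -EFinB lee_fin.
have Tp : 0 < T%:R :> R by rewrite ltr0n.
have HT' : 50 * rad ^+ 2 <= T%:R * (eta * eps).
  by move: HT; rewrite mulrA ler_pdivrMr ?mulr_gt0.
suff : 10 * K <= eps by lra.
rewrite /K mulrA ler_pdivrMr ?mulr_gt0//; lra.
Qed.

(** The segment from [zs] to the competitor, paired with the average of the other player, must lie
    where f is convex-concave. In X this follows from g-convexity of sections once its far end is in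
    X; in the box it is automatic, as both coordinates are projections of points of X. *)
Lemma average_eps_saddle eps : 0 < eps -> 50 * (rad ^+ 2 / (eta * eps)) <= T%:R ->
  eps_saddle_within X f eps (gavg2 z T) /\ (Gamma_sp (box X) f -> eps_saddle X f eps (gavg2 z T)).
Proof.
move=> eps0 HT; have [cX _] := GX; split.
  move=> x y Xxy Xy Xx; apply: gap_bound => //.
    have [c g] := geodesic_exists UGN zs.2 y.
    apply: (upper_value GX g (le_trans (dist_le2 UGN (x, y) zs) Xxy)) => s s01; apply/xsectionP.
    apply: (segment_unique UGN (S := xsection X xbar) (xsection_gconvex UGM cX) _ _ g s01); apply/xsectionP; last exact: Xy.
    exact: X_fst Xy.
  have [c g] := geodesic_exists UGM zs.1 x.
  apply: (lower_value GX g (le_trans (dist_le1 UGM (x, y) zs) Xxy)) => s s01; apply/ysectionP.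
  apply: (segment_unique UGM (ysection_gconvex UGN cX) _ _ g s01); apply/ysectionP; last exact: Xx.
  exact: X_snd Xx.
move=> GB x y Xxy; apply: gap_bound => //.
  have [c g] := geodesic_exists UGN zs.2 y.
  apply: (upper_value GB g (le_trans (dist_le2 UGN (x, y) zs) Xxy)) => s s01; split=> /=.
    exists (xbar, zs.2) => //.
    have H := gavg_in UGM (z := fst \o z) (ysection_gconvex (y := zs.2) UGN cX)
      (fun t tT => (ysectionP _ _ _).2 (X_fst UGN r0 (X_pair (iterates_in tT)))) TT.
    by move/ysectionP : H; apply.
  exists (zs.1, c s) => //; apply/xsectionP.
  apply: (segment_unique UGN (xsection_gconvex UGM cX) _ _ g s01); apply/xsectionP; first exact: X_zs_pair.
  exact: X_snd Xxy.
have [c g] := geodesic_exists UGM zs.1 x.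
apply: (lower_value GB g (le_trans (dist_le1 UGM (x, y) zs) Xxy)) => s s01; split=> /=.
  exists (c s, zs.2) => //; apply/ysectionP.
  apply: (segment_unique UGM (ysection_gconvex UGN cX) _ _ g s01); apply/ysectionP; first exact: X_zs_pair.
  exact: X_fst Xxy.
exists (zs.1, ybar) => //.
have H := gavg_in UGN (z := snd \o z) (xsection_gconvex (x := zs.1) UGM cX)
  (fun t tT => (xsectionP _ _ _).2 (X_snd UGM r0 (X_pair (iterates_in tT)))) TT.
by move/xsectionP : H; apply.
Qed.

End averages.

Lemma rippa_minmax (R : realType) (M N : riemannian_manifold R) (kmin kmax eta : R)
    (f : M -> N -> \bar R) (zs : M * N) (z : nat -> M * N) (T : nat) :
  let rad := dist2 (z 0%N) zs in
  let X := cball2 zs (5 * rad) in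
  let B := cball2 zs (Num.sqrt 2 * rad) in
  uniquely_geodesic M -> sectional_in M kmin kmax ->
  uniquely_geodesic N -> sectional_in N kmin kmax ->
  (0 < kmax -> 5 * rad * Num.sqrt kmax < pi) ->
  0 < eta -> saddle_point f zs -> Gamma_sp X f ->
  (rippa_sp X f kmax rad eta 0 T z ->
    (forall t, (t <= T)%N -> B (z t)) /\
    (forall eps, 0 < eps -> (0 < T)%N ->
      50 * (rad ^+ 2 / (eta * eps)) <= T%:R ->
      eps_saddle_within X f eps (gavg2 z T) /\
      (Gamma_sp (box X) f -> eps_saddle X f eps (gavg2 z T)))) /\
  (forall mu, 0 < mu -> strongly_gconvex_concave mu X B f ->
    rippa_sp X f kmax rad eta mu T z ->
    [/\ forall t, (t <= T)%N -> B (z t),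
        forall t, (t < T)%N ->
          dist2 (z t.+1) zs ^+ 2
            <= (1 + eta * mu / 2)^-1 * dist2 (z t) zs ^+ 2 &
        forall eps_d, 0 < eps_d ->
          50 * ((1 + (mu * eta)^-1) * ln (rad ^+ 2 / eps_d)) <= T%:R ->
          dist2 (z T) zs ^+ 2 <= eps_d]).
Proof.
move=> rad X B UGM secM UGN secN hk eta0 sp GX.
have r0 : 0 <= rad := dist2_ge0 _ _.
have okL := ok_rad r0 hk.
have inB p : dist2 p zs ^+ 2 <= 2 * rad ^+ 2 -> B p.
  by move=> h; rewrite /B/cball2/= sqrt2_ball ?dist2_ge0.
split.
  move=> rip; split.
    by move=> t tT; exact: inB (iterates_bound UGM secM UGN secN r0 okL GX sp eta0 rip (lexx _) tT).
  move=> eps eps0 T0 HT; have [fs fsE] := f_zs2 UGM UGN r0 GX.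
  exact: (average_eps_saddle UGM secM UGN secN r0 okL GX sp eta0 rip (lexx _) fsE T0 eps0 HT).
move=> mu mu0 str rip.
have em0 : 0 < eta * mu / 2 by rewrite !mulr_gt0 ?invr_gt0.
have contr t : (t < T)%N -> dist2 (z t) zs ^+ 2 <= rad ^+ 2 ->
    (1 + eta * mu / 2) * dist2 (z t.+1) zs ^+ 2 <= dist2 (z t) zs ^+ 2.
  move=> tT dt; have [w [v [v' [prox dz' sv sv']]]] := rip t tT.
  rewrite /Delta gt_eqF// => dr.
  have Bz := strong_ball2 UGM secM UGN secN r0 okL GX sp eta0 mu0 str dt prox dz' sv sv' dr.
  have dt2 : dist2 (z t) zs ^+ 2 <= 2 * rad ^+ 2 by have := sqr_ge0 rad; lra.
  have := sp_step_strong UGM secM UGN secN r0 okL GX sp eta0 em0 dt2 str Bz prox dz' sv sv' dr.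
  have -> : 1 - eta * mu / 2 + eta * mu = 1 + eta * mu / 2 by field.
  by [].
have a1 : 0 < 1 + eta * mu / 2 by rewrite addr_gt0.
have inrad t : (t <= T)%N -> dist2 (z t) zs ^+ 2 <= rad ^+ 2.
  elim: t => [_|t IH tT]; first exact: lexx.
  apply: le_trans (IH (ltnW tT)); apply: le_trans (contr t tT (IH (ltnW tT))).
  by rewrite ler_peMl ?sqr_ge0// lerDl ltW.
have rate t : (t < T)%N -> dist2 (z t.+1) zs ^+ 2 <= (1 + eta * mu / 2)^-1 * dist2 (z t) zs ^+ 2.
  by move=> tT; rewrite mulrC ler_pdivlMr// mulrC; exact: contr t tT (inrad t (ltnW tT)).
split=> [t tT|//|eps eps0 HT].
  by apply: inB; have := inrad t tT; have := sqr_ge0 rad; lra.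
exact: (rate_conclusion (d := fun t => dist2 (z t) zs ^+ 2) eta0 mu0 eps0 erefl (fun=> sqr_ge0 _) rate HT).
Qed.

Theorem theorem7 (R : realType) :
  exists2 C : R, 0 < C &
  (forall (M : riemannian_manifold R) (kmin kmax eta : R)
      (f : M -> \bar R) (zs : M) (z : nat -> M) (T : nat),
    let rad := dist (z 0%N) zs in
    let X := cball zs (5 * rad) in
    let B := cball zs (Num.sqrt 2 * rad) in
    uniquely_geodesic M -> sectional_in M kmin kmax ->
    (0 < kmax -> 5 * rad * Num.sqrt kmax < pi) ->
    0 < eta -> minimizer f zs -> Gamma X f ->
    (rippa X f kmax rad eta 0 T z ->
      (forall t, (t <= T)%N -> B (z t)) /\
      (forall eps, 0 < eps -> (0 < T)%N ->
        C * (rad ^+ 2 / (eta * eps)) <= T%:R ->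
        eps_minimizer f zs eps (gavg z T))) /\
    (forall mu, 0 < mu -> strongly_gconvex mu X B f ->
      rippa X f kmax rad eta mu T z ->
      [/\ forall t, (t <= T)%N -> B (z t),
          forall t, (t < T)%N ->
            dist (z t.+1) zs ^+ 2
              <= (1 + eta * mu / 2)^-1 * dist (z t) zs ^+ 2 &
          forall eps_d, 0 < eps_d ->
            C * ((1 + (mu * eta)^-1) * ln (rad ^+ 2 / eps_d)) <= T%:R ->
            dist (z T) zs ^+ 2 <= eps_d])) /\
  (forall (M N : riemannian_manifold R) (kmin kmax eta : R)
      (f : M -> N -> \bar R) (zs : M * N) (z : nat -> M * N) (T : nat),
    let rad := dist2 (z 0%N) zs in
    let X := cball2 zs (5 * rad) in
    let B := cball2 zs (Num.sqrt 2 * rad) in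
    uniquely_geodesic M -> sectional_in M kmin kmax ->
    uniquely_geodesic N -> sectional_in N kmin kmax ->
    (0 < kmax -> 5 * rad * Num.sqrt kmax < pi) ->
    0 < eta -> saddle_point f zs -> Gamma_sp X f ->
    (rippa_sp X f kmax rad eta 0 T z ->
      (forall t, (t <= T)%N -> B (z t)) /\
      (forall eps, 0 < eps -> (0 < T)%N ->
        C * (rad ^+ 2 / (eta * eps)) <= T%:R ->
        eps_saddle_within X f eps (gavg2 z T) /\
        (Gamma_sp (box X) f -> eps_saddle X f eps (gavg2 z T)))) /\
    (forall mu, 0 < mu -> strongly_gconvex_concave mu X B f ->
      rippa_sp X f kmax rad eta mu T z ->
      [/\ forall t, (t <= T)%N -> B (z t),
          forall t, (t < T)%N ->
            dist2 (z t.+1) zs ^+ 2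
              <= (1 + eta * mu / 2)^-1 * dist2 (z t) zs ^+ 2 &
          forall eps_d, 0 < eps_d ->
            C * ((1 + (mu * eta)^-1) * ln (rad ^+ 2 / eps_d)) <= T%:R ->
            dist2 (z T) zs ^+ 2 <= eps_d])).
Proof.
(* The min-max average is the most demanding of the four rates, through [gap_bound]. *)
exists 50 => //; split=> [M kmin kmax eta f zs z T | M N kmin kmax eta f zs z T] rad X B.
  exact: rippa_minimization.
exact: rippa_minmax.
Qed.
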